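(* Let $G$ be the simply connected simple complex algebraic group of type $G_2$ and let $H$ be any maximal reductive subgroup of $G$ other than the one of type $A_2$. Then neither $G/P_1$ nor $G/P_2$ is a spherical $H$-variety.
   Context: The ground field is $\mathbb{C}$. A maximal reductive subgroup of $G$ means a subgroup maximal among the proper closed connected reductive subgroups of $G$. The subgroup of type $A_2$ is (up to conjugacy) the one containing a maximal torus whose roots are the long roots of $G$. Fix a Borel subgroup $B$ of $G$; with Bourbaki numbering, $P_i\supset B$ is the maximal parabolic subgroup of $G$ associated to the fundamental weight $\omega_i$ (the stabilizer of the highest weight line in the irreducible $G$-module of highest weight $\omega_i$). $H$ acts on $G/P_i$ by left multiplication. $G/P_i$ is a spherical $H$-variety if a Borel subgroup of $H$ has an open orbit in it. *)

(* Defs.v *)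
From HB Require Import structures.
From mathcomp Require Import all_boot all_order all_algebra.
From mathcomp Require Import all_classical reals topology connected.
From mathcomp Require Import complex.
From mathcomp Require Import -(notations) mpoly.

Set Implicit Arguments.
Unset Strict Implicit.
Unset Printing Implicit Defensive.

Import Order.TTheory GRing.Theory Num.Theory.

Local Open Scope classical_set_scope.
Local Open Scope ring_scope.

Section ZariskiTopology.
Variables (K : fieldType) (n : nat).

(* Polynomials in the n * n matrix entries; the entry A i j is the value of the
   variable of index [mxvec_index i j]. *)
Definition mxeval (p : mpoly (n * n) K) (A : 'M[K]_n) : K :=
  meval (fun k => mxvec A 0 k) p.

Definition zeros (S : set (mpoly (n * n) K)) : set 'M[K]_n :=
  [set A | forall p, S p -> mxeval p A = 0].

Definition zariski : Type := 'M[K]_n.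

HB.instance Definition _ := Choice.on zariski.

Definition zariski_open (U : set zariski) : Prop :=
  exists S : set (mpoly (n * n) K), ~` U = zeros S.

Lemma zariski_openT : zariski_open setT.
Proof.
exists setT; rewrite setCT; apply/seteqP; split=> // A /(_ 1 I) /eqP.
by rewrite /mxeval meval1 oner_eq0.
Qed.

Lemma zariski_openI : setI_closed zariski_open.
Proof.
move=> U V [S eS] [S' eS']; rewrite /zariski_open.
exists [set r | exists p q, [/\ S p, S' q & r = p * q]].
rewrite setCI eS eS'; apply/seteqP; split=> A.
  by case=> zA _ [p [q [Sp Sq ->]]]; rewrite /mxeval mevalM;
     [rewrite [meval _ p]zA // mul0r | rewrite [meval _ q]zA // mulr0].
move=> zA; have [zSA|/existsNP[p /not_implyP[Sp /eqP np]]] :=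
  pselect (zeros S A); [by left | right => q S'q].
have /eqP : mxeval (p * q) A = 0 by apply: zA; exists p, q.
by rewrite /mxeval mevalM mulf_eq0 (negbTE np) /= => /eqP.
Qed.

Lemma zariski_open_bigU (I : Type) (f : I -> set zariski) :
  (forall i, zariski_open (f i)) -> zariski_open (\bigcup_i f i).
Proof.
move=> openf; exists [set p | exists i, forall A, (~` f i) A -> mxeval p A = 0].
rewrite setC_bigcup; apply/seteqP; split=> A.
  by move=> nA p [i fi]; apply: fi; apply: nA.
move=> zA i _; have [S eS] := openf i; rewrite eS => p Sp.
by apply: zA; exists i => B; rewrite eS => zB; apply: zB.
Qed.

HB.instance Definition _ := isOpenTopological.Build zariski
  zariski_openT zariski_openI zariski_open_bigU.

End ZariskiTopology.

Section LinearAlgebraicGroups.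
Variables (K : fieldType) (n : nat).
Implicit Types (G H P : set 'M[K]_n) (g X : 'M[K]_n).

Definition subgroup_GL H : Prop :=
  [/\ H `<=` [set g | g \in unitmx], H 1%:M,
      (forall g h, H g -> H h -> H (g *m h)) &
      (forall g, H g -> H (invmx g))].

Definition gen_subgroup (S : set 'M[K]_n) : set 'M[K]_n :=
  smallest subgroup_GL S.

Definition closed_subgroup H : Prop :=
  subgroup_GL H /\ exists2 Z : set (zariski K n),
    closed Z & H = [set g | g \in unitmx] `&` Z.

Definition zconnected H : Prop := connected (H : set (zariski K n)).

Definition derived_subgroup H : set 'M[K]_n :=
  gen_subgroup [set g *m h *m invmx g *m invmx h | g in H & h in H].

Definition solvable_group H : Prop :=
  exists k, iter k derived_subgroup H = [set 1%:M].

Definition unipotent_group H : Prop :=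
  forall g, H g -> exists k, (g - 1%:M) ^+ k = 0.

Definition normal_in G H : Prop :=
  H `<=` G /\ forall g h, G g -> H h -> H (g *m h *m invmx g).

(* Triviality of the unipotent radical. *)
Definition reductive G : Prop :=
  closed_subgroup G /\
  forall U, closed_subgroup U -> zconnected U -> unipotent_group U ->
    normal_in G U -> U = [set 1%:M].

Definition proper_conn_reductive G H : Prop :=
  [/\ H `<=` G, H <> G, zconnected H & reductive H].

Definition maximal_reductive G H : Prop :=
  proper_conn_reductive G H /\
  forall M, proper_conn_reductive G M -> H `<=` M -> M = H.

Definition conn_solvable_in H B : Prop :=
  [/\ B `<=` H, closed_subgroup B, zconnected B & solvable_group B].

Definition borel_subgroup H B : Prop :=
  conn_solvable_in H B /\
  forall B', conn_solvable_in H B' -> B `<=` B' -> B' = B.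

Definition left_translate g (X : set 'M[K]_n) : set 'M[K]_n :=
  [set g *m x | x in X].

Definition coset_space G P : set (set 'M[K]_n) :=
  [set left_translate g P | g in G].

(* The topology of the variety G/P is the quotient of the Zariski topology
   of G. *)
Definition open_in_coset_space G P (U : set (set 'M[K]_n)) : Prop :=
  U `<=` coset_space G P /\
  exists2 O : set (zariski K n), open O &
    G `&` [set g | U (left_translate g P)] = G `&` O.

Definition orbit_of B (x : set 'M[K]_n) : set (set 'M[K]_n) :=
  [set left_translate b x | b in B].

Definition spherical G P H : Prop :=
  exists B, borel_subgroup H B /\
    exists2 x, coset_space G P x & open_in_coset_space G P (orbit_of B x).

(* The tangent space of H at the identity: the differential at 1 of every
   polynomial vanishing on H kills X. *)
Definition lie_algebra H : set 'M[K]_n :=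
  [set X | forall p, (forall g, H g -> mxeval p g = 0) ->
     \sum_(k < n * n) mxeval (mderiv k p) 1%:M * mxvec X 0 k = 0].

Definition conj_subgroup g H : set 'M[K]_n :=
  [set g *m h *m invmx g | h in H].

Definition line_stabilizer (G : set 'M[K]_n) (V : lmodType K)
    (act : 'M[K]_n -> V -> V) (v : V) : set 'M[K]_n :=
  G `&` [set g | exists c, act g v = c *: v].

(* The exponential of a nilpotent matrix. *)
Definition nilexp X : 'M[K]_n := \sum_(k < n) (k`!%:R)^-1 *: X ^+ k.

Definition bracket X Y : 'M[K]_n := X *m Y - Y *m X.

End LinearAlgebraicGroups.

(* The simply connected group of type G2, realized as the Chevalley group of the
   7-dimensional irreducible representation of the Lie algebra of type G2 (the
   weights of this representation generate the weight lattice).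
   Simple roots are numbered as in Bourbaki with indices shifted to start at 0:
   [alpha 0] is short and [alpha 1] is long. *)
Section TypeG2.
Variable K : fieldType.

(* A pair c stands for the weight c.1 * omega_1 + c.2 * omega_2, where omega_1
   and omega_2 are the fundamental weights. *)
Definition omega (i : 'I_2) : int * int := if i == 0 then (1, 0) else (0, 1).

Definition alpha (i : 'I_2) : int * int := if i == 0 then (2, -1) else (-3, 2).

Definition weights7 : seq (int * int) :=
  [:: (1, 0); (-1, 1); (2, -1); (0, 0); (-2, 1); (1, -1); (-1, 0)].

Definition E (i j : nat) : 'M[K]_7 :=
  \matrix_(r, c) ((r == i :> nat) && (c == j :> nat))%:R.

(* Chevalley generators; the k-th basis vector has weight [weights7] k. *)
Definition che (i : 'I_2) : 'M[K]_7 :=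
  if i == 0 then E 0 1 + E 2 3 *+ 2 + E 3 4 + E 5 6 else E 1 2 + E 4 5.

Definition chf (i : 'I_2) : 'M[K]_7 :=
  if i == 0 then E 1 0 + E 3 2 + E 4 3 *+ 2 + E 6 5 else E 2 1 + E 5 4.

Definition coord (c : int * int) (i : 'I_2) : int := if i == 0 then c.1 else c.2.

Definition chh (i : 'I_2) : 'M[K]_7 :=
  diag_mx (\row_(k < 7) (coord (nth (0, 0) weights7 k) i)%:~R).

Definition G2 : set 'M[K]_7 :=
  gen_subgroup ([set nilexp (t *: che i) | t in setT & i in setT] `|`
                [set nilexp (t *: chf i) | t in setT & i in setT]).

Definition character (c : int * int) (a b : K) : K := a ^ c.1 * b ^ c.2.

(* The product of the values at a and b of the two simple coroots. *)
Definition torus_elt (a b : K) : 'M[K]_7 :=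
  diag_mx (\row_(k < 7) character (nth (0, 0) weights7 k) a b).

Definition G2_torus : set 'M[K]_7 :=
  [set torus_elt a b | a in [set a | a != 0] & b in [set b | b != 0]].

(* Root vector of the highest root 3 alpha_1 + 2 alpha_2 = omega_2. *)
Definition e_theta : 'M[K]_7 := E 0 5 + E 1 6.

Definition int_mx (f : nat -> nat -> int) : 'M[K]_7 :=
  \matrix_(r, c) (f r c)%:~R.

Lemma eq_int_mx f g :
  all (fun r => all (fun c => f r c == g r c) (iota 0 7)) (iota 0 7) ->
  int_mx f = int_mx g.
Proof.
move=> fg; apply/matrixP => r c; rewrite !mxE; congr _%:~R; apply/eqP.
have i7 (k : 'I_7) : (k : nat) \in iota 0 7 by rewrite mem_iota ltn_ord.
exact: (allP (allP fg _ (i7 r)) _ (i7 c)).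
Qed.

Lemma mul_int_mx f g : int_mx f *m int_mx g =
  int_mx (fun r c => foldr (fun k s => f r k * g k c + s) 0 (iota 0 7)).
Proof.
apply/matrixP => r c; rewrite !mxE.
under eq_bigr do rewrite !mxE -intrM.
by rewrite -rmorph_sum -(big_mkord xpredT (fun k => f r k * g k c)) unlock.
Qed.

Lemma add_int_mx f g : int_mx f + int_mx g = int_mx (fun r c => f r c + g r c).
Proof. by apply/matrixP => r c; rewrite !mxE intrD. Qed.

Lemma opp_int_mx f : - int_mx f = int_mx (fun r c => - f r c).
Proof. by apply/matrixP => r c; rewrite !mxE mulrNz. Qed.

Lemma scale_int_mx k f : k%:~R *: int_mx f = int_mx (fun r c => k * f r c).
Proof. by apply/matrixP => r c; rewrite !mxE intrM. Qed.

Lemma E_int_mx i j : E i j = int_mx (fun r c => ((r == i) && (c == j) : nat)%:Z).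
Proof. by apply/matrixP => r c; rewrite !mxE. Qed.

Lemma chh_int_mx i : chh i = int_mx (fun r c =>
  if r == c then coord (nth (0, 0) weights7 c) i else 0).
Proof.
apply/matrixP => r c; rewrite !mxE -val_eqE /=.
by case: eqP => [->|].
Qed.

Definition int_mx_simp :=
  (mulr2n, E_int_mx, chh_int_mx, mul_int_mx, scale_int_mx, opp_int_mx, add_int_mx).

(* The Chevalley relations for the Cartan matrix [coord (alpha j) i];
   the Serre relations follow, the representation being finite-dimensional. *)
Lemma chh_che i j : bracket (chh i) (che j) = (coord (alpha j) i)%:~R *: che j.
Proof.
rewrite /bracket /che /coord /alpha.
by case: (j == 0); rewrite !int_mx_simp; apply: eq_int_mx; rewrite /coord;
  case: (i == 0).
Qed.

Lemma chh_chf i j : bracket (chh i) (chf j) = (- coord (alpha j) i)%:~R *: chf j.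
Proof.
rewrite /bracket /chf /coord /alpha.
by case: (j == 0); rewrite !int_mx_simp; apply: eq_int_mx; rewrite /coord;
  case: (i == 0).
Qed.

Lemma che_chf i j : bracket (che i) (chf j) = (i == j)%:R *: chh i.
Proof.
have -> : (i == j)%:R = ((i == j) : int)%:~R :> K by [].
rewrite /bracket /che /chf; case: i j => [[|[|//]] hi] [[|[|//]] hj];
  rewrite -!val_eqE /= !int_mx_simp; exact: eq_int_mx.
Qed.

(* [delta_mx 0 0] and [e_theta] are highest weight vectors, of weights omega_1
   and omega_2. *)
Lemma hw_natural i (v := delta_mx 0 0 : 'cV[K]_7) :
  che i *m v = 0 /\ chh i *m v = (coord (omega 0) i)%:~R *: v.
Proof.
split; last first.
  rewrite mul_diag_mx; apply/matrixP => r c; rewrite !mxE -val_eqE /=.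
  by case: (r : nat) => [|k] //=; rewrite !mulr0.
apply/matrixP => r c; rewrite -colE.
rewrite /che; case: (i == 0); rewrite !mxE ?mulr2n ?mxE /= ?andbF ?addr0 //.
Qed.

Lemma hw_adjoint i : bracket (che i) e_theta = 0 /\
  bracket (chh i) e_theta = (coord (omega 1) i)%:~R *: e_theta.
Proof.
rewrite /e_theta /bracket /che /coord /omega; split.
  have -> : 0 = int_mx (fun _ _ => 0) by apply/matrixP => r c; rewrite !mxE.
  by case: (i == 0); rewrite !int_mx_simp; apply: eq_int_mx.
by rewrite !int_mx_simp; apply: eq_int_mx; rewrite /coord; case: (i == 0).
Qed.

Definition natural_act (g : 'M[K]_7) (v : 'cV[K]_7) : 'cV[K]_7 := g *m v.

Definition adjoint_act (g X : 'M[K]_7) : 'M[K]_7 := g *m X *m invmx g.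

(* The highest weight lines of the irreducible modules of highest weights
   omega_1 (the natural one) and omega_2 (the adjoint one); both stabilizers
   contain the Borel subgroup attached to the positive roots. *)
Definition P1 : set 'M[K]_7 := line_stabilizer G2 natural_act (delta_mx 0 0).

Definition P2 : set 'M[K]_7 := line_stabilizer G2 adjoint_act e_theta.

(* Roots, relative to [G2_torus], of a group containing it: the nonzero weights
   of the adjoint action on the Lie algebra. *)
Definition is_root (H : set 'M[K]_7) (c : int * int) : Prop :=
  c != 0 /\ exists X, [/\ lie_algebra H X, X != 0 &
    forall a b, a != 0 -> b != 0 ->
      adjoint_act (torus_elt a b) X = character c a b *: X].

(* The long roots of type G2: with alpha_1 short and alpha_2 long, these are
   +- alpha_2, +- (3 alpha_1 + alpha_2) and +- (3 alpha_1 + 2 alpha_2). *)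
Definition long_roots : seq (int * int) :=
  let a := alpha 0 in let b := alpha 1 in
  [:: b; a *+ 3 + b; a *+ 3 + b *+ 2; - b; - (a *+ 3 + b); - (a *+ 3 + b *+ 2)].

(* Maximal tori of G2 being conjugate, the torus may be taken to be
   [G2_torus]. *)
Definition type_A2 (H : set 'M[K]_7) : Prop :=
  exists2 g, G2 g & G2_torus `<=` conj_subgroup g H /\
    forall c, is_root (conj_subgroup g H) c <-> c \in long_roots.

End TypeG2.

Arguments G2 K : clear implicits.
Arguments G2_torus K : clear implicits.
Arguments P1 K : clear implicits.
Arguments P2 K : clear implicits.

(* Main.v *)
(* Let B be a Borel subgroup of H, with Lie algebra b. Two facts exclude an open
   orbit of B in the fivefolds G2/P1 and G2/P2.

   First, dim b <= 4. By reductivity the trace form is nondegenerate on the Lie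
   algebra h of H. If a semisimple element of h has no other semisimple elements
   in its centralizer, then dim h <= 3. Otherwise h contains, up to conjugacy, the
   Cartan subalgebra, so that h is given by a closed symmetric set of roots: it
   has at most two roots, or two orthogonal pairs of roots (and then b projects to
   proper subspaces of both ideals of type A1), or all the long roots (type A2),
   or all the roots (H = G2).

   Second, polynomials of degree at most N in the matrix entries restrict on B to
   a space of dimension O(N ^ dim b): on the connected group B the vanishing of a
   polynomial can be tested on its iterated invariant derivatives at 1, by Krull's
   intersection theorem. If B had an open orbit, the n ^ 5 forms of degree 5n in
   six homogeneous coordinates of the fivefold would stay independent on B. *)
From HB Require Import structures.
Require Import Defs.
From mathcomp Require Import all_boot all_order all_algebra.
From mathcomp Require Import all_classical reals topology connected.
From mathcomp Require Import falgebra complex ring zify.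
From mathcomp Require Import -(notations) mpoly.

Set Implicit Arguments.
Unset Strict Implicit.
Unset Printing Implicit Defensive.

Import Order.TTheory GRing.Theory Num.Theory.

Local Open Scope classical_set_scope.
Local Open Scope ring_scope.

(** * Derivations of polynomial functions and Lie algebras *)

(** Group and Lie algebra communicate along two routes: polynomial identities on the group are
    differentiated at 1, and nilpotent elements, whose exponentials are polynomial, are put back
    into the group. The obstacle is that semisimple elements have no such exponential. Chevalley's
    replicas take over: the eigenvalues of X are written with integral coefficients in numbers c_j
    independent over Z, so that the semisimple part of X is the sum of the c_j Y_j with Y_j
    integral, and every Y_j lies in any algebraic Lie algebra containing X. They serve three times.
    The trace form is integral and definite on them, so its radical consists of nilpotents; Engel's
    theorem and exponentials then turn the radical into a normal unipotent subgroup. They provide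
    the commuting semisimple elements that separate rank one from rank two. And they give a basis of
    b whose members have only O(N) distinct eigenvalues on polynomials of degree N; an arbitrary
    semisimple element can have more, which would spoil the exponent dim b in the growth
    estimate. *)

Lemma mpoly_ring_ind (k : nat) (K : fieldType) (P : mpoly k K -> Prop) :
  (forall c, P (mpolyC k c)) -> (forall i, P (mpolyX K (mnm1 i))) ->
  (forall p q, P p -> P q -> P (p + q)) ->
  (forall p q, P p -> P q -> P (p * q)) -> forall p, P p.
Proof.
move=> PC PX PD PM; elim/mpolyind => [|c m p _ _ Pp]; first by rewrite -(mpolyC0 k K).
apply/PD => //; rewrite -mul_mpolyC; apply/PM => //; rewrite mpolyXE_id.
apply: (big_ind P) => [|p1 p2|i _]; [by rewrite -(mpolyC1 k K)|exact: PM|].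
by elim: (m i) => [|e IHe]; rewrite ?expr0 -?(mpolyC1 k K) // exprS; apply/PM.
Qed.

Lemma mnm_subnn (k : nat) (m : multinom k) : mnm_sub m m = mnm0.
Proof. by apply/mnmP => i; rewrite mnmBE mnm0E subnn. Qed.

Section Jets.
Variables (K : fieldType) (n : nat).
Local Notation P := (mpoly (n * n) K).
Implicit Types (p q : P) (A B X Y : 'M[K]_n).

Definition xvar i j : P := mpolyX K (mnm1 (mxvec_index i j)).

Lemma mxevalD p q A : mxeval (p + q) A = mxeval p A + mxeval q A.
Proof. exact: mevalD. Qed.

Lemma mxevalB p q A : mxeval (p - q) A = mxeval p A - mxeval q A.
Proof. exact: mevalB. Qed.

Lemma mxevalM p q A : mxeval (p * q) A = mxeval p A * mxeval q A.
Proof. exact: mevalM. Qed.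

Lemma mxevalC c A : mxeval (mpolyC _ c) A = c.
Proof. exact: mevalC. Qed.

Lemma mxevalZ c p A : mxeval (c *: p) A = c * mxeval p A.
Proof. exact: mevalZ. Qed.

Lemma mxeval0 A : mxeval (0 : P) A = 0.
Proof. exact: meval0. Qed.

Lemma mxeval1 A : mxeval (1 : P) A = 1.
Proof. exact: meval1. Qed.

Lemma mxeval_sum (I : Type) (r : seq I) (Q : pred I) (F : I -> P) A :
  mxeval (\sum_(i <- r | Q i) F i) A = \sum_(i <- r | Q i) mxeval (F i) A.
Proof.
by apply: (big_morph (fun p => mxeval p A)) => [p q|]; rewrite (mxevalD, mxeval0).
Qed.

Lemma mxeval_var i j A : mxeval (xvar i j) A = A i j.
Proof. by rewrite /mxeval /xvar mevalXU mxvecE. Qed.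

Lemma mpoly_xvar_ind (Q : P -> Prop) :
  (forall c, Q (mpolyC _ c)) -> (forall i j, Q (xvar i j)) ->
  (forall p q, Q p -> Q q -> Q (p + q)) ->
  (forall p q, Q p -> Q q -> Q (p * q)) -> forall p, Q p.
Proof.
move=> QC QX QD QM; apply: mpoly_ring_ind => // k.
by case/mxvec_indexP: k => i j; apply: QX.
Qed.

Definition tderiv A X p : K :=
  \sum_(k < n * n) mxeval (mderiv k p) A * mxvec X 0 k.

Lemma tderivD A X p q : tderiv A X (p + q) = tderiv A X p + tderiv A X q.
Proof.
by rewrite -big_split; apply: eq_bigr => k _; rewrite mderivD mxevalD mulrDl.
Qed.

Lemma tderivM A X p q :
  tderiv A X (p * q) = tderiv A X p * mxeval q A + mxeval p A * tderiv A X q.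
Proof.
rewrite /tderiv mulr_suml mulr_sumr -big_split; apply: eq_bigr => k _ /=.
by rewrite mderivM mxevalD !mxevalM mulrDl mulrAC mulrA.
Qed.

Lemma tderivC A X c : tderiv A X (mpolyC _ c) = 0.
Proof. by apply: big1 => k _; rewrite mderivC mxeval0 mul0r. Qed.

Lemma tderiv_var A X i j : tderiv A X (xvar i j) = X i j.
Proof.
rewrite /tderiv (bigD1 (mxvec_index i j)) //= big1 => [|k nk].
  rewrite addr0 mxvecE /xvar mderivX mnmE eqxx scale1r.
  by rewrite mnm_subnn mpolyX0 mxeval1 mul1r.
by rewrite /xvar mderivX mnmE eq_sym (negbTE nk) scale0r mxeval0 mul0r.
Qed.

Lemma tderiv_linear A p (a : K) X Y :
  tderiv A (a *: X + Y) p = a * tderiv A X p + tderiv A Y p.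
Proof.
rewrite /tderiv mulr_sumr -big_split; apply: eq_bigr => k _ /=.
by rewrite linearP /= !mxE mulrDr mulrCA.
Qed.

(** The witness polynomial stays existential, so that matrix expressions in the variable can be
    differentiated by the product rule without being expanded into explicit polynomials. *)
Definition has_jet (f : 'M[K]_n -> K) A X (v : K) : Prop :=
  exists p, (forall B, f B = mxeval p B) /\ tderiv A X p = v.

Definition has_mxjet (m1 m2 : nat) (F : 'M[K]_n -> 'M[K]_(m1, m2)) A X
    (V : 'M[K]_(m1, m2)) : Prop :=
  forall i j, has_jet (fun B => F B i j) A X (V i j).

Lemma jet_cst c A X : has_jet (fun=> c) A X 0.
Proof. by exists (mpolyC _ c); split=> [B|]; rewrite (mxevalC, tderivC). Qed.

Lemma jetD f g A X v w : has_jet f A X v -> has_jet g A X w ->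
  has_jet (fun B => f B + g B) A X (v + w).
Proof.
move=> [p [fp <-]] [q [gq <-]]; exists (p + q); split=> [B|].
  by rewrite fp gq mxevalD.
exact: tderivD.
Qed.

Lemma jetM f g A X v w : has_jet f A X v -> has_jet g A X w ->
  has_jet (fun B => f B * g B) A X (v * g A + f A * w).
Proof.
move=> [p [fp <-]] [q [gq <-]]; exists (p * q); split=> [B|].
  by rewrite fp gq mxevalM.
by rewrite fp gq tderivM.
Qed.

Lemma jet_sum (I : Type) (r : seq I) f A X v :
  (forall i : I, has_jet (f i) A X (v i)) ->
  has_jet (fun B => \sum_(i <- r) f i B) A X (\sum_(i <- r) v i).
Proof.
move=> jf; elim: r => [|i r IHr].
  under [X in has_jet X]functional_extensionality_dep do rewrite big_nil.
  by rewrite big_nil; apply: jet_cst.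
under [X in has_jet X]functional_extensionality_dep do rewrite big_cons.
by rewrite big_cons; apply: jetD.
Qed.

Lemma mxjet_cst m1 m2 (C : 'M[K]_(m1, m2)) A X : has_mxjet (fun=> C) A X 0.
Proof. by move=> i j; rewrite mxE; apply: jet_cst. Qed.

Lemma mxjet_id A X : has_mxjet id A X X.
Proof.
by move=> i j; exists (xvar i j); split=> [B|]; rewrite (mxeval_var, tderiv_var).
Qed.

Lemma mxjetM m1 m2 m3 (F : 'M[K]_n -> 'M[K]_(m1, m2)) (G : 'M[K]_n -> 'M[K]_(m2, m3)) A X V W :
  has_mxjet F A X V -> has_mxjet G A X W ->
  has_mxjet (fun B => F B *m G B) A X (V *m G A + F A *m W).
Proof.
move=> jF jG i j; rewrite !mxE -big_split.
have -> : (fun B => (F B *m G B) i j) = (fun B => \sum_k F B i k * G B k j).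
  by apply/funext => B; rewrite mxE.
by apply: jet_sum => k; apply: jetM.
Qed.

Lemma mxjet_tr m1 m2 (F : 'M[K]_n -> 'M[K]_(m1, m2)) A X V :
  has_mxjet F A X V -> has_mxjet (fun B => (F B)^T) A X V^T.
Proof.
move=> jF i j; rewrite mxE.
have -> : (fun B => (F B)^T i j) = (fun B => F B j i).
  by apply/funext => B; rewrite mxE.
exact: jF.
Qed.

Lemma mxjetD m1 m2 (F G : 'M[K]_n -> 'M[K]_(m1, m2)) A X V W :
  has_mxjet F A X V -> has_mxjet G A X W ->
  has_mxjet (fun B => F B + G B) A X (V + W).
Proof.
move=> jF jG i j; rewrite mxE.
have -> : (fun B => (F B + G B) i j) = (fun B => F B i j + G B i j).
  by apply/funext => B; rewrite mxE.
exact: jetD.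
Qed.

Lemma jet_comp p (F : 'M[K]_n -> 'M[K]_n) A X V : has_mxjet F A X V ->
  has_jet (fun B => mxeval p (F B)) A X (tderiv (F A) V p).
Proof.
move=> jF; elim/mpoly_xvar_ind: p => [c|i j|p q|p q].
- rewrite tderivC; have -> : (fun B => mxeval (mpolyC (n * n) c) (F B)) = fun=> c.
    by apply/funext => B; rewrite mxevalC.
  exact: jet_cst.
- rewrite tderiv_var; have -> : (fun B => mxeval (xvar i j) (F B)) = (fun B => F B i j).
    by apply/funext => B; rewrite mxeval_var.
  exact: jF.
- move=> jp jq; rewrite tderivD.
  have -> : (fun B => mxeval (p + q) (F B)) =
     (fun B => mxeval p (F B) + mxeval q (F B)).
    by apply/funext => B; rewrite mxevalD.
  exact: jetD.
- move=> jp jq; rewrite tderivM.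
  have -> : (fun B => mxeval (p * q) (F B)) =
     (fun B => mxeval p (F B) * mxeval q (F B)).
    by apply/funext => B; rewrite mxevalM.
  exact: (jetM jp jq).
Qed.

(* The derivation of the coordinate ring of matrices, invariant under left
   translations, whose value at 1 is X: it maps the generic matrix x to x X. *)
Definition invder X p : P :=
  \sum_i \sum_j mderiv (mxvec_index i j) p * \sum_l X l j *: xvar i l.

Lemma invderD X p q : invder X (p + q) = invder X p + invder X q.
Proof.
rewrite /invder -big_split; apply: eq_bigr => i _; rewrite -big_split.
by apply: eq_bigr => j _ /=; rewrite mderivD mulrDl.
Qed.

Lemma invderM X p q : invder X (p * q) = invder X p * q + p * invder X q.
Proof.
rewrite /invder mulr_suml mulr_sumr -big_split; apply: eq_bigr => i _ /=.
rewrite mulr_suml mulr_sumr -big_split; apply: eq_bigr => j _ /=.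
by rewrite mderivM mulrDl mulrAC mulrA.
Qed.

Lemma invderC X c : invder X (mpolyC _ c) = 0.
Proof. by apply: big1 => i _; apply: big1 => j _; rewrite mderivC mul0r. Qed.

Lemma invderZ X c p : invder X (c *: p) = c *: invder X p.
Proof. by rewrite -!mul_mpolyC invderM invderC mul0r add0r. Qed.

Lemma invder_is_linear X : linear (invder X).
Proof. by move=> c p q; rewrite invderD invderZ. Qed.

HB.instance Definition _ X :=
  GRing.isLinear.Build K P P _ (invder X) (invder_is_linear X).

Lemma invder_sum X (I : Type) (r : seq I) (Q : pred I) (F : I -> P) :
  invder X (\sum_(i <- r | Q i) F i) = \sum_(i <- r | Q i) invder X (F i).
Proof. exact: linear_sum. Qed.

Lemma mxeval_invder X p A : mxeval (invder X p) A = tderiv A (A *m X) p.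
Proof.
rewrite /tderiv (reindex _ (curry_mxvec_bij _ _)) /= /invder pair_bigA mxeval_sum.
apply: eq_bigr => -[i j] _ /=.
rewrite mxevalM; congr (_ * _); rewrite mxvecE !mxE mxeval_sum.
by apply: eq_bigr => l _; rewrite mxevalZ mxeval_var mulrC.
Qed.

Lemma mderiv_xvar i j i' j' :
  mderiv (mxvec_index i' j') (xvar i j) = ((i' == i) && (j' == j))%:R.
Proof.
rewrite /xvar mderivX mnmE.
have -> : (mxvec_index i j == mxvec_index i' j') = (i' == i) && (j' == j).
  apply/eqP/andP => [e|[/eqP-> /eqP->]//].
  have := congr1 (fun k => mxvec (delta_mx i j : 'M[K]_n) 0 k) e.
  rewrite !mxvecE !mxE !eqxx /=; case: (i' == i) => /= [|/eqP]; last by rewrite oner_eq0.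
  by case: (j' == j) => // /eqP; rewrite oner_eq0.
case: andP => [[/eqP-> /eqP->]|_]; last by rewrite scale0r.
by rewrite mnm_subnn mpolyX0 scale1r.
Qed.

Lemma invder_var X i j : invder X (xvar i j) = \sum_l X l j *: xvar i l.
Proof.
rewrite /invder (bigD1 i) //= (bigD1 j) //= mderiv_xvar !eqxx mul1r.
rewrite [X in _ + X + _]big1 ?addr0 => [|j' nj]; last by rewrite mderiv_xvar (negbTE nj) andbF mul0r.
rewrite [X in _ + X]big1 ?addr0 // => i' ni.
by apply: big1 => j' _; rewrite mderiv_xvar (negbTE ni) mul0r.
Qed.

Lemma invder_linear a X Y p : invder (a *: X + Y) p = a *: invder X p + invder Y p.
Proof.
rewrite scaler_sumr -big_split; apply: eq_bigr => i _ /=.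
rewrite scaler_sumr -big_split; apply: eq_bigr => j _ /=.
rewrite scalerAr -mulrDr; congr (_ * _); rewrite scaler_sumr -big_split.
by apply: eq_bigr => l _ /=; rewrite !mxE scalerDl scalerA.
Qed.

(** Both sides are derivations in p, which reduces the identity to the variables; there [invder X]
    multiplies the generic matrix by X on the right, and composition follows the order of the
    product. *)
Lemma invder_bracket X Y p :
  invder (bracket X Y) p = invder X (invder Y p) - invder Y (invder X p).
Proof.
elim/mpoly_xvar_ind: p => [c|i j|p q ep eq|p q ep eq].
- by rewrite !invderC !linear0 addr0.
- rewrite !invder_var !invder_sum -sumrB.
  transitivity (\sum_k \sum_l (Y k j * X l k - X k j * Y l k) *: xvar i l).
    rewrite exchange_big; apply: eq_bigr => l _ /=.
    rewrite /bracket !mxE -scaler_suml -sumrB; congr (_ *: _).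
    by apply: eq_bigr => k _; rewrite mulrC [X in _ - X]mulrC.
  have E Z (W : 'M[K]_n) k : invder Z (W k j *: xvar i k) = \sum_l (W k j * Z l k) *: xvar i l.
    by rewrite invderZ invder_var scaler_sumr; apply: eq_bigr => l _; rewrite scalerA.
  apply: eq_bigr => k _; rewrite !E.
  by under eq_bigr do rewrite scalerBl; rewrite sumrB.
- by rewrite !invderD ep eq opprD addrACA.
- by rewrite !invderM !(invderD _ _) !invderM ep eq; ring.
Qed.

Definition vanishing (S : set 'M[K]_n) : set P :=
  [set p | forall g, S g -> mxeval p g = 0].

Lemma lieE S X :
  lie_algebra S X <-> forall p, vanishing S p -> tderiv 1%:M X p = 0.
Proof. by []. Qed.

Lemma lie_jet S X f v : lie_algebra S X -> has_jet f 1%:M X v ->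
  (forall g, S g -> f g = 0) -> v = 0.
Proof. by move=> LX [p [fp <-]] f0; apply: LX => g Sg; rewrite -fp f0. Qed.

End Jets.

Lemma invmxM (K : fieldType) (n : nat) (A B : 'M[K]_n) :
  A \in unitmx -> B \in unitmx -> invmx (A *m B) = invmx B *m invmx A.
Proof.
move=> uA uB; have uAB : A *m B \in unitmx by rewrite unitmx_mul uA.
by rewrite -[RHS](mulKmx uAB) -mulmxA [B *m _]mulmxA mulmxV // mul1mx mulmxV // mulmx1.
Qed.

(** * Lie algebras of matrix groups: brackets, conjugation, derived subgroups *)

Section ClosedSubgroups.
Variables (K : fieldType) (n : nat).
Local Notation P := (mpoly (n * n) K).
Implicit Types (p q : P) (A B g h X Y : 'M[K]_n) (H S T : set 'M[K]_n).

(** The value of [invder X p] at g is the derivative at 1 along X of y -> p (g y), and this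
    translate of p vanishes on H again. Iterating, all invariant derivatives of p vanish on H. *)
Lemma lie_invder H X p : subgroup_GL H -> lie_algebra H X ->
  vanishing H p -> vanishing H (invder X p).
Proof.
move=> [_ _ HM _] LX Ip g Hg; rewrite mxeval_invder.
have jF := mxjetM (mxjet_cst g 1%:M X) (mxjet_id 1%:M X).
have := lie_jet LX (jet_comp p jF); rewrite mulmx1 mul0mx add0r; apply=> y Hy.
by apply: Ip; apply: HM.
Qed.

Lemma invder_lie S X :
  (forall p, vanishing S p -> mxeval (invder X p) 1%:M = 0) -> lie_algebra S X.
Proof. by move=> D0 p /D0; rewrite mxeval_invder mul1mx. Qed.

Lemma lie_linear S a X Y :
  lie_algebra S X -> lie_algebra S Y -> lie_algebra S (a *: X + Y).
Proof.
move=> LX LY p Ip; have := tderiv_linear 1%:M p a X Y; rewrite /tderiv => ->.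
by rewrite [X in a * X]LX // [X in _ + X]LY // mulr0 addr0.
Qed.

Lemma lie0 S : lie_algebra S 0.
Proof. by move=> p _; apply: big1 => k _; rewrite linear0 mxE mulr0. Qed.

Lemma lie_sub S T X : S `<=` T -> lie_algebra S X -> lie_algebra T X.
Proof. by move=> ST LX p Ip; apply: LX => g Sg; apply: Ip; apply: ST. Qed.

Lemma lie_bracket H X Y : subgroup_GL H ->
  lie_algebra H X -> lie_algebra H Y -> lie_algebra H (bracket X Y).
Proof.
move=> sH LX LY; apply: invder_lie => p Ip.
have [_ H1 _ _] := sH.
by rewrite invder_bracket mxevalB !(lie_invder sH) ?subr0 //;
  do ?exact: lie_invder.
Qed.

Lemma lie_conj S g X : lie_algebra S X -> g \in unitmx ->
  lie_algebra (conj_subgroup g S) (g *m X *m invmx g).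
Proof.
move=> LX gu; apply/lieE => p Ip.
have jF := mxjetM (mxjetM (mxjet_cst g 1%:M X) (mxjet_id 1%:M X))
             (mxjet_cst (invmx g) 1%:M X).
have := lie_jet LX (jet_comp p jF).
rewrite mulmx1 mul0mx add0r mulmx0 addr0 mulmxV //; apply=> y Sy.
by apply: Ip; exists y.
Qed.

Lemma conj_subgroup_id H g : subgroup_GL H -> H g -> conj_subgroup g H = H.
Proof.
move=> [HU H1 HM HV] Hg; apply/seteqP; split=> [_ [h Hh <-]|h Hh].
  exact: (HM _ _ (HM _ _ Hg Hh) (HV _ Hg)).
exists (invmx g *m h *m g); first exact: (HM _ _ (HM _ _ (HV _ Hg) Hh) Hg).
have gu : g \in unitmx by apply: HU.
by rewrite !mulmxA mulmxV // mul1mx -mulmxA mulmxV // mulmx1.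
Qed.

Lemma conj_subgroupM H g h : g \in unitmx -> h \in unitmx ->
  conj_subgroup g (conj_subgroup h H) = conj_subgroup (g *m h) H.
Proof.
move=> gu hu; rewrite /conj_subgroup; apply/seteqP; split=> [_ [_ [x Hx <-] <-]|_ [x Hx <-]].
  by exists x => //; rewrite invmxM // !mulmxA.
by exists (h *m x *m invmx h); [exists x | rewrite invmxM // !mulmxA].
Qed.

Lemma conj_subgroup1 H : conj_subgroup 1%:M H = H.
Proof.
apply/seteqP; split=> [_ [x Hx <-]|x Hx]; first by rewrite invmx1 mulmx1 mul1mx.
by exists x => //; rewrite invmx1 mulmx1 mul1mx.
Qed.

Lemma lie_Ad H g X : subgroup_GL H -> H g -> lie_algebra H X ->
  lie_algebra H (g *m X *m invmx g).
Proof.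
move=> sH Hg LX; rewrite -(conj_subgroup_id sH Hg); apply: lie_conj => //.
by case: sH => HU _ _ _; apply: HU.
Qed.

Lemma lie_conjE H g X : g \in unitmx ->
  lie_algebra (conj_subgroup g H) X <-> lie_algebra H (invmx g *m X *m g).
Proof.
move=> gu; split=> LX; last first.
  have := lie_conj LX gu; rewrite !mulmxA mulmxV // mul1mx -mulmxA mulmxV //.
  by rewrite mulmx1.
have := @lie_conj _ (invmx g) _ LX; rewrite unitmx_inv invmxK conj_subgroupM ?unitmx_inv //.
by rewrite mulVmx // conj_subgroup1; apply.
Qed.

Lemma lie_trivial X : lie_algebra [set 1%:M] X -> X = 0.
Proof.
move=> LX; apply/matrixP => i j; rewrite mxE.
have jF : has_jet (fun y => y i j + - (1%:M : 'M[K]_n) i j) 1%:M X (X i j + 0).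
  by apply: jetD; [exact: mxjet_id | exact: jet_cst].
by have := lie_jet LX jF; rewrite addr0; apply=> g ->; rewrite subrr.
Qed.

Lemma subgroup_gen S : S `<=` [set g | g \in unitmx] -> subgroup_GL (gen_subgroup S).
Proof.
move=> SU; have sGL : subgroup_GL [set g : 'M[K]_n | g \in unitmx].
  split=> //= [|g h gu hu|g gu]; first exact: unitmx1.
    by rewrite unitmx_mul gu.
  by rewrite unitmx_inv.
split=> [g Sg|T [[] //]|g h Sg Sh T sT|g Sg T sT].
- exact: (Sg _ (conj sGL SU)).
- have [[_ _ TM _] _] := sT; by apply: TM; [apply: Sg|apply: Sh].
- have [[_ _ _ TV] _] := sT; by apply: TV; apply: Sg.
Qed.

Lemma sub_gen_subgroup S : S `<=` gen_subgroup S.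
Proof. by move=> g Sg T [_]; apply. Qed.

Lemma gen_subgroup_sub S T : subgroup_GL T -> S `<=` T -> gen_subgroup S `<=` T.
Proof. by move=> sT ST g; apply. Qed.

Lemma derived_subgroup_sub H : subgroup_GL H -> derived_subgroup H `<=` H.
Proof.
move=> sH; have [_ _ HM HV] := sH; apply: gen_subgroup_sub => // _ [g Hg [h Hh <-]].
exact: (HM _ _ (HM _ _ (HM _ _ Hg Hh) (HV _ Hg)) (HV _ Hh)).
Qed.

Lemma subgroup_derived H : subgroup_GL H -> subgroup_GL (derived_subgroup H).
Proof.
move=> sH; apply: subgroup_gen => _ [g Hg [h Hh <-]].
have [HU _ HM HV] := sH; apply: HU.
exact: (HM _ _ (HM _ _ (HM _ _ Hg Hh) (HV _ Hg)) (HV _ Hh)).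
Qed.

Lemma closed_memP H g : closed_subgroup H -> g \in unitmx ->
  (forall p, vanishing H p -> mxeval p g = 0) -> H g.
Proof.
move=> [_ [Z /closed_openC[S eS] eH]] gu pg; rewrite eH; split=> //.
have {eS} eZ : Z = zeros S by rewrite -eS setCK.
rewrite eZ => p Sp; apply: pg => h; rewrite eH => -[_].
by rewrite eZ; apply.
Qed.

Section Orthogonal.
(* On a group preserving a bilinear form, inversion is a polynomial map. *)
Variables J J' : 'M[K]_n.

Lemma lie_orthogonal S X : (forall g, S g -> g *m (J' *m g^T *m J) = 1%:M) ->
  J' *m J = 1%:M -> lie_algebra S X -> J' *m X^T *m J = - X.
Proof.
move=> SJ JJ LX; apply/eqP; rewrite -addr_eq0 addrC; apply/eqP/matrixP => i j.
have jI := mxjet_id 1%:M X.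
have jF := mxjetM jI (mxjetM (mxjetM (mxjet_cst J' 1%:M X) (mxjet_tr jI))
              (mxjet_cst J 1%:M X)).
have := lie_jet LX (jetD (jF i j) (jet_cst (- (1%:M : 'M[K]_n) i j) 1%:M X)).
rewrite !(trmx1, mulmx1, mul1mx, mul0mx, mulmx0, add0r, addr0) JJ mulmx1.
have -> : (0 : 'M[K]_n) i j = 0 by rewrite mxE.
by apply=> g Sg; rewrite SJ // subrr.
Qed.

(** The commutator g h g^-1 h^-1 is differentiated at 1 twice, first in h along Y and then in g
    along X; the polynomial formula for inversion makes both maps polynomial. The derived subgroup
    is the abstract one, so this [lie_algebra] is that of its Zariski closure. *)
Lemma lie_derived H X Y : subgroup_GL H ->
  (forall g, H g -> invmx g = J' *m g^T *m J) -> J' *m J = 1%:M ->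
  lie_algebra H X -> lie_algebra H Y ->
  lie_algebra (derived_subgroup H) (bracket X Y).
Proof.
move=> sH HJ JJ LX LY; have [HU H1 HM HV] := sH.
have oJ g : H g -> g *m (J' *m g^T *m J) = 1%:M.
  by move=> Hg; rewrite -HJ // mulmxV //; apply: HU.
have JX := lie_orthogonal oJ JJ LX; have JY := lie_orthogonal oJ JJ LY.
apply/lieE => p Ip.
have AdY g : H g -> tderiv 1%:M (g *m Y *m invmx g - Y) p = 0.
  move=> Hg; have jI := mxjet_id 1%:M Y.
  have jF := mxjetM (mxjetM (mxjetM (mxjet_cst g 1%:M Y) jI) (mxjet_cst (invmx g) 1%:M Y))
    (mxjetM (mxjetM (mxjet_cst J' 1%:M Y) (mxjet_tr jI)) (mxjet_cst J 1%:M Y)).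
  have := lie_jet LY (jet_comp p jF).
  rewrite !(trmx1, mulmx1, mul1mx, mul0mx, mulmx0, add0r, addr0) mulmxV ?HU // JJ !(mulmx1, mul1mx) JY.
  apply=> h Hh; apply: Ip; rewrite -HJ //; apply: sub_gen_subgroup.
  by exists g => //; exists h.
have jI := mxjet_id 1%:M X.
have jF := mxjetD (mxjetM (mxjetM jI (mxjet_cst Y 1%:M X))
   (mxjetM (mxjetM (mxjet_cst J' 1%:M X) (mxjet_tr jI)) (mxjet_cst J 1%:M X)))
   (mxjet_cst (- Y) 1%:M X).
have jG : has_jet (fun g => tderiv 1%:M (g *m Y *m (J' *m g^T *m J) - Y) p) 1%:M X
    (tderiv 1%:M (bracket X Y) p).
  rewrite /tderiv; apply: jet_sum => k; case/mxvec_indexP: k => i j; rewrite mxvecE.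
  have -> : (fun B => mxeval (mderiv (mxvec_index i j) p) 1%:M *
     mxvec (B *m Y *m (J' *m B^T *m J) - Y) 0 (mxvec_index i j)) =
     (fun B => mxeval (mderiv (mxvec_index i j) p) 1%:M *
       (B *m Y *m (J' *m B^T *m J) - Y) i j).
    by apply/funext => B; rewrite mxvecE.
  have := jetM (jet_cst (mxeval (mderiv (mxvec_index i j) p) 1%:M) 1%:M X) (jF i j).
  rewrite mul0r !(trmx1, mulmx1, mul1mx, mul0mx, mulmx0, add0r, addr0) JJ !(mulmx1, mul1mx) JX.
  by rewrite mulmxN.
apply: (lie_jet LX jG) => g Hg; rewrite -HJ //; exact: AdY.
Qed.

End Orthogonal.

End ClosedSubgroups.

(** * Exponentials and Jordan decomposition *)

Lemma poly_nat_ext (K : numFieldType) (q r : {poly K}) :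
  (forall m, q.[m%:R] = r.[m%:R]) -> q = r.
Proof.
move=> qr; apply/eqP; rewrite -subr_eq0; apply/negPn/negP => nz.
have := max_poly_roots nz (rs := [seq i%:R | i <- iota 0 (size (q - r))]).
rewrite size_map size_iota ltnn => /(_ _ _)/notF; apply.
  by apply/allP => _ /mapP[i _ ->]; rewrite /root hornerD hornerN qr subrr.
by rewrite map_inj_uniq ?iota_uniq // => i j /eqP; rewrite eqr_nat => /eqP.
Qed.

Lemma poly_ext (K : numFieldType) (q r : {poly K}) :
  (forall t, q.[t] = r.[t]) -> q = r.
Proof. by move=> qr; apply: poly_nat_ext. Qed.

Section LocalExp.
Variables (K : numClosedFieldType) (n : nat).
Local Notation M := 'M[K]_n.+1.
Local Notation P := (mpoly (n.+1 * n.+1) K).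
Implicit Types (p q : P) (A B g h X Y Z : M) (H S T : set M).

Lemma unitmx_nilp A k : A ^+ k = 0 -> 1%:M + A \in unitmx.
Proof.
move=> Ak; have := subrX1 (- A) k; rewrite exprNn Ak mulr0 sub0r.
rewrite -opprD mulNr => /oppr_inj e; rewrite addrC.
by case: (mulmx1_unit (esym e)).
Qed.

Lemma nilexpE X : exists2 W : M, GRing.comm X W & nilexp X = 1%:M + X * W.
Proof.
exists (\sum_(k < n) (k.+1`!%:R)^-1 *: X ^+ k).
  by apply: commr_sum => k _; rewrite /GRing.comm -scalerAr -scalerAl -exprS -exprSr.
rewrite /nilexp big_ord_recl expr0 invr1 scale1r; congr (_ + _).
by rewrite mulr_sumr; apply: eq_bigr => k _; rewrite -scalerAr -exprS.
Qed.

Lemma nilexp_unit X k : X ^+ k = 0 -> nilexp X \in unitmx.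
Proof.
case: (nilexpE X) => W cW -> Xk; apply: (@unitmx_nilp _ k).
by rewrite exprMn_comm // Xk mul0r.
Qed.

(** Along the one-parameter group of X the derivation [invder X] is d/dt, and polynomial functions
    restrict to polynomials in t because X is nilpotent. *)
Lemma nilexp_curve X p : X ^+ n.+1 = 0 -> exists q : {poly K},
  (forall t, mxeval p (nilexp (t *: X)) = q.[t]) /\
  (forall t, mxeval (invder X p) (nilexp (t *: X)) = q^`().[t]).
Proof.
move=> Xn; elim/mpoly_xvar_ind: p => [c|i j|p1 p2 [q1 [e1 d1]] [q2 [e2 d2]]|
  p1 p2 [q1 [e1 d1]] [q2 [e2 d2]]].
- exists c%:P; split=> t; first by rewrite mxevalC hornerC.
  by rewrite invderC mxeval0 derivC horner0.
- exists (\sum_(k < n.+1) ((k`!%:R)^-1 * (X ^+ k) i j) *: 'X^k); split=> t.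
    rewrite mxeval_var horner_sum summxE; apply: eq_bigr => k _.
    by rewrite hornerZ hornerXn exprZn !mxE -mulrA [t ^+ k * _]mulrC.
  have -> : mxeval (invder X (xvar _ i j)) (nilexp (t *: X)) =
      (nilexp (t *: X) * X) i j.
    rewrite invder_var mxeval_sum mxE; apply: eq_bigr => l _.
    by rewrite mxevalZ mxeval_var mulrC.
  rewrite mulr_suml big_ord_recr /= -scalerAl exprZn -scalerAl -exprSr Xn !scaler0 addr0.
  rewrite raddf_sum horner_sum big_ord_recl /= derivZ derivXn hornerZ mulr0n horner0 mulr0 add0r.
  rewrite summxE; apply: eq_bigr => k _.
  rewrite -scalerAl exprZn -scalerAl -exprSr derivZ derivXn hornerZ hornerMn hornerXn !mxE.
  rewrite /= /bump /= add1n add0n factS natrM invfM -[t ^+ k *+ _]mulr_natr.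
  have w0 : (k.+1%:R : K) != 0 by rewrite pnatr_eq0.
  set w := k.+1%:R in w0 *; set u := (k`!%:R)^-1; set x := (X ^+ _) i j.
  transitivity ((w^-1 * w) * (u * (t ^+ k * x))); first by rewrite mulVf ?mul1r.
  ring.
- exists (q1 + q2); split=> t; first by rewrite mxevalD hornerD e1 e2.
  by rewrite invderD mxevalD derivD hornerD d1 d2.
- exists (q1 * q2); split=> t; first by rewrite mxevalM hornerM e1 e2.
  by rewrite invderM mxevalD !mxevalM derivM hornerD !hornerM e1 e2 d1 d2.
Qed.

Lemma poly_deriv0 (q : {poly K}) : (forall k, q^`(k).[0] = 0) -> q = 0.
Proof.
move=> q0; apply/polyP => k; have := q0 k; rewrite horner_coef0 coef_derivn addn0 ffactnn.
by rewrite coef0 => /eqP; rewrite mulrn_eq0 eqn0Ngt fact_gt0 => /eqP.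
Qed.

(** If p vanishes on H, so do its iterated derivatives along X; hence all derivatives at t = 0 of
    the polynomial p (exp (t X)) are zero. *)
Lemma nilexp_mem H X t : closed_subgroup H -> lie_algebra H X -> X ^+ n.+1 = 0 ->
  H (nilexp (t *: X)).
Proof.
move=> cH LX Xn; have sH := cH.1.
have tXn s : (s *: X) ^+ n.+1 = 0 by rewrite exprZn Xn scaler0.
apply: (closed_memP cH) => [|p Ip]; first exact: nilexp_unit (tXn _).
have [q [eq _]] := nilexp_curve p Xn; rewrite eq.
suff -> : q = 0 by rewrite horner0.
apply: poly_deriv0 => k; elim: k p Ip q eq => [|k IHk] p Ip q eq.
  rewrite derivn0 -eq scale0r; apply: Ip; have [W _ ->] := nilexpE 0.
  by rewrite mul0r addr0; case: sH.
have [q' [e' d']] := nilexp_curve p Xn.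
have {e'} eqq : q = q' by apply: poly_ext => s; rewrite -eq e'.
by rewrite derivSn; apply: (IHk _ (lie_invder sH LX Ip)) => s; rewrite d' eqq.
Qed.

End LocalExp.

(** * Generalized eigencomponents in subspaces stable under an operator *)

Section EigenComponents.
Variables (K : fieldType) (V : lmodType K) (D : V -> V).
Hypothesis D_lin : forall a u v, D (a *: u + v) = a *: D u + D v.

Definition eigop a (v : V) : V := D v - a *: v.

Lemma eigop_linear a c u v : eigop a (c *: u + v) = c *: eigop a u + eigop a v.
Proof.
rewrite /eigop D_lin scalerBr scalerDr !scalerA [a * c]mulrC.
by rewrite opprD addrACA.
Qed.

Lemma eigop0 a : eigop a 0 = 0.
Proof.
have := eigop_linear a 1 0 0; rewrite !scale1r addr0 => /esym/eqP.
by rewrite -subr_eq0 addrK => /eqP.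
Qed.

Lemma eigopD a u v : eigop a (u + v) = eigop a u + eigop a v.
Proof. by rewrite -[u]scale1r eigop_linear !scale1r. Qed.

Lemma eigopZ a c u : eigop a (c *: u) = c *: eigop a u.
Proof. by rewrite -[_ *: u]addr0 eigop_linear eigop0 addr0. Qed.

Lemma eigopB a u v : eigop a (u - v) = eigop a u - eigop a v.
Proof. by rewrite -scaleN1r addrC eigop_linear scaleN1r addrC. Qed.

Lemma eigop_shift a b v : eigop b v = eigop a v + (a - b) *: v.
Proof. by rewrite /eigop scalerBl addrA subrK. Qed.

Lemma eigop_comm a b v : eigop a (eigop b v) = eigop b (eigop a v).
Proof.
by rewrite [eigop b v](eigop_shift a) [in RHS](eigop_shift a) eigopD eigopZ.
Qed.

Lemma iter_eigop_comm a b k l v :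
  iter k (eigop a) (iter l (eigop b) v) = iter l (eigop b) (iter k (eigop a) v).
Proof.
have E w i : eigop a (iter i (eigop b) w) = iter i (eigop b) (eigop a w).
  by elim: i => //= i <-; rewrite eigop_comm.
by elim: k => //= k ->; rewrite E.
Qed.

Lemma iter_eigop0 a k : iter k (eigop a) 0 = 0.
Proof. by elim: k => //= k ->; rewrite eigop0. Qed.

Lemma iter_eigopD a k u v :
  iter k (eigop a) (u + v) = iter k (eigop a) u + iter k (eigop a) v.
Proof. by elim: k => //= k ->; rewrite eigopD. Qed.

Lemma iter_eigop_sum a k (I : Type) (r : seq I) (Q : pred I) (F : I -> V) :
  iter k (eigop a) (\sum_(i <- r | Q i) F i) = \sum_(i <- r | Q i) iter k (eigop a) (F i).
Proof. exact: (big_morph _ (iter_eigopD a k) (iter_eigop0 a k)). Qed.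

Variable S : V -> Prop.
Hypotheses (S0 : S 0) (SP : forall a u v, S u -> S v -> S (a *: u + v))
  (SD : forall v, S v -> S (D v)).

Lemma stableZ a v : S v -> S (a *: v).
Proof. by move=> Sv; rewrite -[_ *: _]addr0; apply: SP. Qed.

Lemma stableD u v : S u -> S v -> S (u + v).
Proof. by move=> Su Sv; rewrite -[u]scale1r; apply: SP. Qed.

Lemma stableB u v : S u -> S v -> S (u - v).
Proof. by move=> Su Sv; rewrite addrC -scaleN1r; apply: SP. Qed.

Lemma stable_sum (I : eqType) (r : seq I) (F : I -> V) :
  (forall i, i \in r -> S (F i)) -> S (\sum_(i <- r) F i).
Proof.
elim: r => [|i r IHr] Fr; first by rewrite big_nil.
rewrite big_cons; apply: stableD; first by apply: Fr; rewrite mem_head.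
by apply: IHr => j jr; apply: Fr; rewrite in_cons jr orbT.
Qed.

Lemma stable_eigop a k v : S v -> S (iter k (eigop a) v).
Proof.
by move=> Sv; elim: k => //= k IHk; apply: stableB; [apply: SD|apply: stableZ].
Qed.

(** Induction on k reduces to the case where D - a sends v into S. Then D - b acts on v modulo S as
    the scalar a - b, and [(a - b) ^+ l *: v] lies in S. *)
Lemma eigop_coprime a b k l v : a != b ->
  S (iter k (eigop a) v) -> S (iter l (eigop b) v) -> S v.
Proof.
move=> ab; elim: k v => [|k IHk] v //; rewrite iterSr => Sav Sbv.
have Sw : S (eigop a v).
  apply: IHk => //; rewrite -[eigop a v]/(iter 1 (eigop a) v) -iter_eigop_comm.
  exact: (@stable_eigop a 1).
have Eb m : S (iter m (eigop b) v - (a - b) ^+ m *: v).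
  elim: m => [|m IHm]; first by rewrite expr0 scale1r subrr.
  have -> : iter m.+1 (eigop b) v - (a - b) ^+ m.+1 *: v =
      eigop b (iter m (eigop b) v - (a - b) ^+ m *: v) + (a - b) ^+ m *: eigop a v.
    rewrite iterS eigopB eigopZ [eigop b v](eigop_shift a) scalerDr scalerA -exprSr.
    by rewrite opprD addrA addrAC subrK.
  by apply: stableD; [exact: (@stable_eigop b 1)|exact: stableZ].
have : S ((a - b) ^- l *: ((a - b) ^+ l *: v)).
  by apply: stableZ; have := stableB Sbv (Eb l); rewrite opprB addrC subrK.
by rewrite scalerA mulVf ?scale1r // expf_neq0 // subr_eq0.
Qed.

(** Applying (D - a)^k to the sum removes one component; the others are recovered by coprimality. *)
Lemma eigen_components (r : seq K) (F : K -> V) k : uniq r ->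
  (forall a, a \in r -> iter k (eigop a) (F a) = 0) ->
  S (\sum_(a <- r) F a) -> forall a, a \in r -> S (F a).
Proof.
elim: r F => // a r IHr F /= /andP[ar ur] F0; rewrite big_cons => SF.
have Fr : forall b, b \in r -> S (F b).
  move=> b br; have ab : a != b by apply: contraNneq ar => ->.
  apply: (@eigop_coprime a b k k) => //; last first.
    by rewrite F0 ?in_cons ?br ?orbT.
  apply: (IHr (fun b => iter k (eigop a) (F b))) => // [c cr|].
    by rewrite -iter_eigop_comm F0 ?iter_eigop0 // in_cons cr orbT.
  have := @stable_eigop a k _ SF.
  by rewrite iter_eigopD F0 ?mem_head // add0r iter_eigop_sum.
move=> b; rewrite in_cons => /predU1P[->|]; last exact: Fr.
by have := stableB SF (stable_sum Fr); rewrite addrK.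
Qed.

(** An operator that is scalar on each generalized eigenspace of D, with scalar a function of the
    eigenvalue, preserves all D-stable subspaces. Applied to polynomials and the ideal of a group,
    this puts replicas into the Lie algebra. *)
Lemma eigen_operator (I : eqType) (r : seq I) (mu nu : I -> K) (v : I -> V) k :
  (forall i, i \in r -> iter k (eigop (mu i)) (v i) = 0) ->
  (forall i j, i \in r -> j \in r -> mu i = mu j -> nu i = nu j) ->
  S (\sum_(i <- r) v i) -> S (\sum_(i <- r) nu i *: v i).
Proof.
move=> v0 munu Sv; set rs := undup (map mu r).
have split_sum (w : I -> V) :
    \sum_(i <- r) w i = \sum_(a <- rs) \sum_(i <- r | mu i == a) w i.
  rewrite (exchange_big_dep xpredT) //= !big_seq; apply: eq_bigr => i ir.
  rewrite (eq_bigl (pred1 (mu i))) => [|a]; last by rewrite eq_sym.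
  by rewrite -big_filter filter_pred1_uniq ?undup_uniq ?mem_undup ?map_f // big_seq1.
have Sw : forall a, a \in rs -> S (\sum_(i <- r | mu i == a) v i).
  apply: (@eigen_components rs _ k) => [|a _|]; first exact: undup_uniq.
    rewrite iter_eigop_sum big_seq_cond big1 // => i /andP[ir /eqP<-].
    exact: v0.
  by rewrite -split_sum.
rewrite split_sum; apply: stable_sum => a ars; have := ars.
rewrite mem_undup => /mapP[i ir ea].
have -> : \sum_(j <- r | mu j == a) nu j *: v j = nu i *: \sum_(j <- r | mu j == a) v j.
  rewrite scaler_sumr big_seq_cond [RHS]big_seq_cond; apply: eq_bigr => j.
  by case/andP=> jr /eqP muj; rewrite (munu j i) // muj.
by apply: stableZ; apply: Sw.
Qed.

End EigenComponents.

(** * Jordan decomposition with integral semisimple components *)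

Section Spectral.
Variables (K : numClosedFieldType) (n : nat).
Local Notation M := 'M[K]_n.+1.
Implicit Types (A B X Y Z : M).

Lemma nilp_char_poly A k : A ^+ k = 0 -> char_poly A = 'X^(n.+1).
Proof.
move=> Ak; have [r er] := closed_field_poly_normal (char_poly A).
have /monicP lc := char_poly_monic A; rewrite lc scale1r in er.
have r0 z : z \in r -> z = 0.
  move=> zr; have : eigenvalue A z.
    by rewrite eigenvalue_root_char er root_prod_XsubC.
  case/eigenvalueP=> v vA nzv.
  have vAk j : v *m (A ^+ j) = z ^+ j *: v.
    elim: j => [|j IHj]; first by rewrite !expr0 mulmx1 scale1r.
    by rewrite exprSr mulmxA IHj -scalemxAl vA scalerA -exprSr.
  have := vAk k; rewrite Ak mulmx0 => /esym/eqP.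
  by rewrite scaler_eq0 (negbTE nzv) orbF expf_eq0 => /andP[_ /eqP].
have er' : char_poly A = 'X^(size r).
  rewrite er (eq_big_seq (fun=> 'X)) => [|z /r0->]; last by rewrite subr0.
  by rewrite big_const_seq count_predT iter_mulr_1.
have := size_char_poly A; rewrite er' size_polyXn => -[->] //.
Qed.

Lemma nilp_tr A k : A ^+ k = 0 -> \tr A = 0.
Proof.
move=> /nilp_char_poly chA; have := char_poly_trace A (ltn0Sn n).
rewrite chA coefXn /= eqn_leq ltnn andbF => /esym/eqP.
by rewrite oppr_eq0 => /eqP.
Qed.

Lemma nilp_dim A k : A ^+ k = 0 -> A ^+ n.+1 = 0.
Proof.
move=> /nilp_char_poly chA; have := Cayley_Hamilton A; rewrite chA.
by rewrite rmorphXn /= horner_mx_X.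
Qed.

(** A rank factorization A = C R of an idempotent satisfies R C = 1, of size the rank. *)
Lemma idem_tr A : A * A = A -> \tr A = (\rank A)%:R.
Proof.
move=> AA; have e := mulmx_base A.
have rc : row_base A *m col_base A = 1%:M.
  have cf : row_full (col_base A) := col_base_full A.
  have rf : row_free (row_base A) := row_base_free A.
  apply: (row_free_inj rf); rewrite mul1mx; apply: (row_full_inj cf).
  have -> : col_base A *m (row_base A *m col_base A *m row_base A) =
    (col_base A *m row_base A) *m (col_base A *m row_base A) by rewrite !mulmxA.
  by rewrite e; exact: AA.
by rewrite -{1}e mxtrace_mulC rc mxtrace1.
Qed.

Lemma dvdp_prod_count (r : seq K) :
  \prod_(z <- r) ('X - z%:P) %| \prod_(a <- undup r) ('X - a%:P) ^+ size r.
Proof.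
rewrite -prodr_undup_exp_count; elim: (undup r) => [|a s IHs]; first by rewrite !big_nil dvdpp.
by rewrite !big_cons dvdp_mul // dvdp_exp2l // count_size.
Qed.

(** The projectors are polynomials in X, obtained from Bezout relations between the powers of the
    linear factors of the characteristic polynomial, and so commute with whatever commutes with
    X. *)
Lemma spectral X : exists (rs : seq K) (Pi : K -> M) (N : nat),
  [/\ uniq rs, \sum_(a <- rs) Pi a = 1,
     forall a, a \in rs -> (X - a%:M) ^+ N * Pi a = 0,
     forall a b, a \in rs -> b \in rs -> a != b -> Pi a * Pi b = 0 &
     forall Z a, GRing.comm Z X -> GRing.comm Z (Pi a)].
Proof.
have [r er] := closed_field_poly_normal (char_poly X).
have /monicP lc := char_poly_monic X; rewrite lc scale1r in er.
(* The total number of roots bounds each multiplicity, so one exponent N serves for all of them. *)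
set rs := undup r; set N := size r; pose Q s := \prod_(a <- s) ('X - a%:P : {poly K}) ^+ N.
have [e [e1 eQ]] : exists e : K -> {poly K}, \sum_(a <- rs) e a = 1 /\
    forall a, a \in rs -> Q rs %| ('X - a%:P) ^+ N * e a.
  have : uniq rs := undup_uniq r.
  have : (0 < size rs)%N.
    case: (r) er @rs => [|z r' _ rs]; last first.
      by rewrite /rs -has_predT; apply/hasP; exists z; rewrite // mem_undup mem_head.
    by rewrite big_nil => e; have := size_char_poly X; rewrite e size_poly1.
  elim: rs => // a s IHs _ /= /andP[as_ us].
  have cop : coprimep (('X - a%:P) ^+ N) (Q s).
    apply: coprimep_expl; rewrite /Q; elim: s as_ {IHs us} => [|b s IHs].
      by rewrite big_nil coprimep1.
    rewrite in_cons negb_or => /andP[ab as_]; rewrite big_cons coprimepMr IHs // andbT.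
    by apply/coprimep_expr/coprimep_XsubC2; rewrite subr_eq0 eq_sym.
  have [[u v] /= uv] := Bezout_eq1_coprimepP _ _ cop.
  case: s IHs as_ us cop uv => [_ _ _ _|b s IHs as_ us _ uv].
    exists (fun=> 1); rewrite big_seq1; split=> // c; rewrite inE => /eqP->.
    by rewrite mulr1 /Q big_seq1 dvdpp.
  have [e [e1 eQ]] := IHs isT us.
  exists (fun c => if c == a then v * Q (b :: s) else u * ('X - a%:P) ^+ N * e c); split.
    rewrite big_cons eqxx -[RHS]uv addrC; congr (_ + _).
    rewrite -[RHS]mulr1 -e1 mulr_sumr; apply: eq_big_seq => c cs.
    by case: eqP => // ca; rewrite -ca cs in as_.
  move=> c; have -> : Q [:: a, b & s] = ('X - a%:P) ^+ N * Q (b :: s) by rewrite /Q big_cons.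
  case: eqP => [-> _|ca].
    by rewrite mulrA [_ ^+ N * v]mulrC -mulrA dvdp_mull // dvdpp.
  rewrite in_cons => /predU1P[//|cs].
  have -> : ('X - c%:P) ^+ N * (u * ('X - a%:P) ^+ N * e c) =
    u * (('X - a%:P) ^+ N * (('X - c%:P) ^+ N * e c)) by ring.
  by rewrite dvdp_mull // dvdp_mul // eQ.
have QX p : Q rs %| p -> horner_mx X p = 0.
  move=> dQ; have /dvdpP[q ->] : char_poly X %| p.
    by rewrite er (dvdp_trans (dvdp_prod_count r)).
  by rewrite rmorphM /= Cayley_Hamilton mulr0.
have cX p Z : GRing.comm Z X -> GRing.comm Z (horner_mx X p).
  by move=> cZ; apply: comm_mx_horner.
pose Pi a := horner_mx X (e a).
have PiN a : a \in rs -> (X - a%:M) ^+ N * Pi a = 0.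
  move=> ars; have := QX _ (eQ a ars).
  by rewrite rmorphM /= rmorphXn /= rmorphB /= horner_mx_X horner_mx_C.
exists rs, Pi, N; split=> // [|||Z a cZ].
- exact: undup_uniq.
- by rewrite -rmorph_sum e1 rmorph1.
(* [Pi a * Pi b] is killed by powers of X - a and of X - b, so coprimality applies with the zero
   subspace. *)
- move=> a b ars brs ab.
  have Dl (c : K) A B : X * (c *: A + B) = c *: (X * A) + X * B.
    by rewrite mulrDr scalerAr.
  have iterE c k A : iter k (eigop (fun A => X * A) c) A = (X - c%:M) ^+ k * A.
    elim: k => [|k IHk] /=; first by rewrite expr0 mul1r.
    by rewrite IHk /eigop exprS -mulrA mulrBl -mul_scalar_mx.
  apply: (@eigop_coprime _ _ _ Dl (fun A => A = 0) _ _ _ a b N N) => //.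
  + by move=> c A B -> ->; rewrite scaler0 addr0.
  + by move=> A ->; rewrite mulr0.
  + by rewrite iterE mulrA PiN // mul0r.
  + rewrite iterE; have cb : GRing.comm (Pi a) (Pi b).
      exact: comm_horner_mx2.
    by rewrite cb mulrA PiN // mul0r.
- exact: cX.
Qed.

(** A new element rationally dependent on the family is absorbed by dividing the whole family by its
    denominator N; an independent one is added to the family. *)
Lemma int_basis (rs : seq K) : exists (r : nat) (c : 'I_r -> K) (m : K -> 'I_r -> int),
  (forall z : 'I_r -> int, \sum_j (z j)%:~R * c j = 0 -> forall j, z j = 0) /\
  forall a, a \in rs -> a = \sum_j (m a j)%:~R * c j.
Proof.
elim: rs => [|a rs [r [c [m [ci cm]]]]].
  by exists 0%N, (fun=> 0), (fun _ _ => 0); split=> // z _ [].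
have [[N [z [N0 Na]]]|indep] := pselect (exists N (z : 'I_r -> int),
    N != 0 /\ N%:~R * a = \sum_j (z j)%:~R * c j).
  have NK : (N%:~R : K) != 0 by rewrite intr_eq0.
  exists r, (fun j => c j / N%:~R), (fun b j => if b == a then z j else N * m b j).
  split=> [y|b].
    under eq_bigr do rewrite mulrA; rewrite -mulr_suml => /eqP.
    by rewrite mulf_eq0 invr_eq0 (negbTE NK) orbF => /eqP /ci.
  rewrite in_cons; case: eqP => [-> _|_ /= brs].
    by under eq_bigr do rewrite mulrA; rewrite -mulr_suml -Na mulrAC mulfV ?mul1r.
  rewrite {1}(cm _ brs); apply: eq_bigr => j _; rewrite intrM.
  have -> : N%:~R * (m b j)%:~R * (c j / N%:~R) =
    (N%:~R / N%:~R) * ((m b j)%:~R * c j) by ring.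
  by rewrite mulfV // mul1r.
exists r.+1, (fun j => oapp c a (unlift ord0 j)).
exists (fun b j => if b == a then (j == ord0)%:Z
  else oapp (m b) 0 (unlift ord0 j)); split=> [z|b].
  rewrite big_ord_recl unlift_none /=; under eq_bigr do rewrite liftK /=.
  have [z0|z0] := eqVneq (z ord0) 0; last first.
    move/eqP; rewrite addr_eq0 => /eqP e; case: indep.
    exists (z ord0), (fun j => - z (lift ord0 j)); split=> //.
    by rewrite e -sumrN; apply: eq_bigr => j _; rewrite mulrNz mulNr.
  rewrite z0 mul0r add0r => /ci zl j; case: (unliftP ord0 j) => [j'|] -> //.
rewrite in_cons; case: eqP => [-> _|_ /= brs].
  rewrite big_ord_recl unlift_none /= mul1r big1 ?addr0 // => j _.
  by rewrite mul0r.
rewrite big_ord_recl unlift_none /= mul0r add0r {1}(cm _ brs).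
by apply: eq_bigr => j _; rewrite liftK.
Qed.

(* Diagonalizable with integer eigenvalues. *)
Definition int_semisimple Y : Prop := exists (s : seq int) (Pi : int -> M),
  [/\ uniq s, \sum_(k <- s) Pi k = 1 &
     forall k, k \in s -> Y * Pi k = k%:~R *: Pi k /\ Pi k * Y = k%:~R *: Pi k].

Lemma int_semisimple_comm Y s (Pi : int -> M) Z : uniq s -> \sum_(k <- s) Pi k = 1 ->
  (forall k, k \in s -> Y * Pi k = k%:~R *: Pi k /\ Pi k * Y = k%:~R *: Pi k) ->
  GRing.comm Z Y -> forall k, k \in s -> GRing.comm Z (Pi k).
Proof.
move=> us s1 sY cZ; have offd k l : k \in s -> l \in s -> k != l -> Pi k * Z * Pi l = 0.
  move=> ks ls kl; have e : k%:~R *: (Pi k * Z * Pi l) = l%:~R *: (Pi k * Z * Pi l).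
    rewrite !scalerAl -(sY k ks).2 -!mulrA [Y * _]mulrA -cZ -mulrA (sY l ls).1.
    by rewrite -!scalerAr -scalerAl.
  move/eqP: e; rewrite -subr_eq0 -scalerBl scaler_eq0 subr_eq0 eqr_int (negbTE kl) /=.
  by move/eqP.
have diagr k : k \in s -> Pi k * Z = Pi k * Z * Pi k.
  move=> ks; rewrite -[LHS]mulr1 -s1 mulr_sumr (bigD1_seq k) //=.
  by rewrite big1_seq ?addr0 // => l /andP[lk ls]; rewrite offd // eq_sym.
have diagl k : k \in s -> Z * Pi k = Pi k * Z * Pi k.
  move=> ks; rewrite -[LHS]mul1r -s1 mulr_suml (bigD1_seq k) //= mulrA.
  by rewrite big1_seq ?addr0 // => l /andP[lk ls]; rewrite mulrA offd.
by move=> k ks; rewrite /GRing.comm diagl // -diagr.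
Qed.

(* The Jordan decomposition, with the semisimple part written as a combination
   of integral semisimple matrices, its coefficients being independent over Z. *)
Definition jordan_data X rs (Pi : K -> M) N r (c : 'I_r -> K) (m : K -> 'I_r -> int) :=
  [/\ [/\ uniq rs, \sum_(a <- rs) Pi a = 1,
     forall a, a \in rs -> (X - a%:M) ^+ N * Pi a = 0,
     forall a b, a \in rs -> b \in rs -> a != b -> Pi a * Pi b = 0 &
     forall Z a, GRing.comm Z X -> GRing.comm Z (Pi a)],
   (forall z : 'I_r -> int, \sum_j (z j)%:~R * c j = 0 -> forall j, z j = 0) &
   (forall a, a \in rs -> a = \sum_j (m a j)%:~R * c j)].

Lemma jordan_dataP X : exists rs Pi N r c m, @jordan_data X rs Pi N r c m.
Proof.
have [rs [Pi [N h]]] := spectral X; have [r [c [m [ci cm]]]] := int_basis rs.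
by exists rs, Pi, N, r, c, m.
Qed.

Section Replicas.
Variables (X : M) (rs : seq K) (Pi : K -> M) (N r : nat) (c : 'I_r -> K)
  (m : K -> 'I_r -> int).
Hypothesis J : @jordan_data X rs Pi N r c m.

(** A replica in the sense of Chevalley: it acts on the generalized eigenspace of a by the j-th
    integral coordinate of a. *)
Definition replica j : M := \sum_(a <- rs) (m a j)%:~R *: Pi a.
Definition nilpart : M := X - \sum_j c j *: replica j.

Lemma replica_Pi j a : a \in rs ->
  replica j * Pi a = (m a j)%:~R *: Pi a /\ Pi a * replica j = (m a j)%:~R *: Pi a.
Proof.
case: J => -[us s1 _ sO _] _ _ ars.
have PiPi : Pi a * Pi a = Pi a.
  rewrite -[RHS]mulr1 -s1 mulr_sumr (bigD1_seq a) //= big1_seq ?addr0 //.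
  by move=> b /andP[ba brs]; rewrite sO // eq_sym.
rewrite /replica mulr_suml mulr_sumr !(bigD1_seq a) //= !big1_seq ?addr0 //.
- by rewrite -scalerAl -scalerAr PiPi.
- by move=> b /andP[ba brs]; rewrite -scalerAr sO ?scaler0 // eq_sym.
- by move=> b /andP[ba brs]; rewrite -scalerAl sO ?scaler0.
Qed.

Lemma replica_comm j Z : GRing.comm Z X -> GRing.comm Z (replica j).
Proof.
case: J => -[us s1 _ sO sc] _ _ cZ; apply: commr_sum => a _.
by rewrite /GRing.comm -scalerAr -scalerAl (sc _ a cZ).
Qed.

Lemma nilpart_comm Z : GRing.comm Z X -> GRing.comm Z nilpart.
Proof.
move=> cZ; apply: commrB => //; apply: commr_sum => j _.
by rewrite /GRing.comm -scalerAr -scalerAl (replica_comm j cZ).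
Qed.

Lemma replica_decomp : X = nilpart + \sum_j c j *: replica j.
Proof. by rewrite subrK. Qed.

Lemma replica_int_semisimple j : int_semisimple (replica j).
Proof.
have [[us s1 _ sO sc] _ _] := J.
exists (undup [seq m a j | a <- rs]), (fun k => \sum_(a <- rs | m a j == k) Pi a).
split=> [||k _]; first exact: undup_uniq.
  rewrite -s1 (exchange_big_dep xpredT) //= !big_seq; apply: eq_bigr => a ars.
  rewrite (eq_bigl (pred1 (m a j))) => [|k]; last by rewrite eq_sym.
  by rewrite -big_filter filter_pred1_uniq ?undup_uniq ?mem_undup ?map_f // big_seq1.
rewrite mulr_sumr mulr_suml scaler_sumr; split.
  rewrite big_seq_cond [RHS]big_seq_cond; apply: eq_bigr => a /andP[ars /eqP<-].
  by case: (replica_Pi j ars).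
rewrite big_seq_cond [RHS]big_seq_cond; apply: eq_bigr => a /andP[ars /eqP<-].
by case: (replica_Pi j ars).
Qed.

Lemma nilpart_nilp : nilpart ^+ n.+1 = 0.
Proof.
have [[us s1 sN sO sc] _ cm] := J; apply: (@nilp_dim _ N).
have nP a : a \in rs -> nilpart * Pi a = (X - a%:M) * Pi a.
  move=> ars; rewrite /nilpart !mulrBl; congr (_ - _).
  have -> : a%:M * Pi a = a *: Pi a by exact: mul_scalar_mx.
  rewrite mulr_suml {2}(cm a ars) scaler_suml.
  by apply: eq_bigr => j _; rewrite -scalerAl (replica_Pi j ars).1 scalerA mulrC.
have nPk a k : a \in rs -> nilpart ^+ k * Pi a = (X - a%:M) ^+ k * Pi a.
  move=> ars; have cP : GRing.comm nilpart (Pi a).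
    by apply: (sc); apply/esym; apply: nilpart_comm.
  have cXP : GRing.comm (X - a%:M) (Pi a).
    apply: (sc); apply/esym; apply: commrB => //; exact: scalar_mxC.
  elim: k => [|k IHk]; first by rewrite !expr0.
  rewrite exprSr -mulrA nP // cXP mulrA IHk -mulrA -cXP mulrA -exprSr //.
by rewrite -[LHS]mulr1 -s1 mulr_sumr big1_seq // => a /= ars; rewrite nPk // sN.
Qed.

Lemma replica_tr_int i j : exists z : int, \tr (replica i * replica j) = z%:~R.
Proof.
have [[us s1 sN sO sc] _ cm] := J.
exists (\sum_(a <- rs) m a i * m a j * (\rank (Pi a))%:Z).
have -> : replica i * replica j = \sum_(a <- rs) (m a i * m a j)%:~R *: Pi a.
  rewrite {1}/replica mulr_suml !big_seq; apply: eq_bigr => a ars.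
  by rewrite -scalerAl (replica_Pi j ars).2 scalerA intrM.
rewrite raddf_sum rmorph_sum /= !big_seq; apply: eq_bigr => a ars.
have PiPi : Pi a * Pi a = Pi a.
  rewrite -[RHS]mulr1 -s1 mulr_sumr (bigD1_seq a) //= big1_seq ?addr0 //.
  by move=> b /andP[ba brs]; rewrite sO // eq_sym.
by rewrite mxtraceZ idem_tr // [RHS]intrM.
Qed.

End Replicas.

Lemma int_semisimple_idem Y s (Pi : int -> M) : uniq s -> \sum_(k <- s) Pi k = 1 ->
  (forall k, k \in s -> Y * Pi k = k%:~R *: Pi k /\ Pi k * Y = k%:~R *: Pi k) ->
  forall k, k \in s -> Pi k * Pi k = Pi k.
Proof.
move=> us s1 sY k ks; rewrite -[RHS]mulr1 -s1 mulr_sumr (bigD1_seq k) //=.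
rewrite big1_seq ?addr0 // => l /andP[lk ls].
have e : k%:~R *: (Pi k * Pi l) = l%:~R *: (Pi k * Pi l).
  by rewrite scalerAl -(sY k ks).2 -mulrA (sY l ls).1 scalerAr.
move/eqP: e; rewrite -subr_eq0 -scalerBl scaler_eq0 subr_eq0 eqr_int eq_sym (negbTE lk) /=.
by move/eqP.
Qed.

(** The trace of Y^2 is the sum of k^2 times the rank of the k-th projector, a sum of nonnegative
    terms. *)
Lemma int_semisimple_tr Y : int_semisimple Y -> \tr (Y * Y) = 0 -> Y = 0.
Proof.
move=> [s [Pi [us s1 sY]]].
have idP := int_semisimple_idem us s1 sY.
have eY : Y = \sum_(k <- s) k%:~R *: Pi k.
  rewrite -[LHS]mulr1 -s1 mulr_sumr !big_seq; apply: eq_bigr => k ks.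
  by rewrite (sY k ks).1.
have eYY : Y * Y = \sum_(k <- s) (k ^+ 2)%:~R *: Pi k.
  rewrite {1}eY mulr_suml !big_seq; apply: eq_bigr => k ks.
  by rewrite -scalerAl (sY k ks).2 scalerA expr2 intrM.
rewrite eYY raddf_sum /= big_seq => /eqP; rewrite psumr_eq0 => [|k ks].
  move=> /allP h; rewrite eY big1_seq // => k /= ks.
  have := h k ks; rewrite ks /= mxtraceZ mulf_eq0 intr_eq0 sqrf_eq0 => /orP[/eqP->|].
    by rewrite scale0r.
  by rewrite idem_tr ?idP // pnatr_eq0 mxrank_eq0 => /eqP->; rewrite scaler0.
by rewrite mxtraceZ idem_tr ?idP // mulr_ge0 ?ler0n // ler0z sqr_ge0.
Qed.

Lemma comm_nilp_tr A B : GRing.comm A B -> A ^+ n.+1 = 0 -> \tr (A * B) = 0.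
Proof.
by move=> cAB An; apply: (@nilp_tr _ n.+1); rewrite exprMn_comm // An mul0r.
Qed.

End Spectral.

Section EigenDerivations.
Variables (K : fieldType) (n : nat).
Local Notation P := (mpoly (n * n) K).
Implicit Types (p q : P) (X Y Z W : 'M[K]_n).

Lemma invder_lin X a p q : invder X (a *: p + q) = a *: invder X p + invder X q.
Proof. by rewrite invderD invderZ. Qed.

Lemma eigop_invderM X a b p q : eigop (invder X) (a + b) (p * q) =
  eigop (invder X) a p * q + p * eigop (invder X) b q.
Proof.
rewrite /eigop invderM scalerDl mulrBl mulrBr -scalerAl -scalerAr.
by rewrite opprD addrACA.
Qed.

(** By the Leibniz rule each application lowers the nilpotency order of one factor. *)
Lemma iter_eigop_invderM X a b k l p q :
  iter k (eigop (invder X) a) p = 0 -> iter l (eigop (invder X) b) q = 0 ->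
  iter (k + l) (eigop (invder X) (a + b)) (p * q) = 0.
Proof.
have Dl := invder_lin X.
suff E m : forall k l p q, (k + l <= m)%N -> iter k (eigop (invder X) a) p = 0 ->
    iter l (eigop (invder X) b) q = 0 ->
    iter m (eigop (invder X) (a + b)) (p * q) = 0 by exact: E.
elim: m => [|m IHm] {}k {}l {}p {}q.
  by rewrite leqn0 addn_eq0 => /andP[/eqP-> _] /= ->; rewrite mul0r.
case: k => [_ /= -> _|k]; first by rewrite mul0r -iterS (iter_eigop0 Dl).
case: l => [_ _ /= ->|l klm pk ql]; first by rewrite mulr0 -iterS (iter_eigop0 Dl).
rewrite iterSr eigop_invderM (iter_eigopD Dl).
have -> : iter m (eigop (invder X) (a + b)) (eigop (invder X) a p * q) = 0.
  by apply: (IHm k l.+1) ; rewrite -?iterSr //; lia.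
have -> : iter m (eigop (invder X) (a + b)) (p * eigop (invder X) b q) = 0.
  by apply: (IHm k.+1 l) ; rewrite -?iterSr //; lia.
exact: addr0.
Qed.

Lemma invder_invder_var Z W i j :
  invder Z (invder W (xvar K i j)) = invder (Z *m W) (xvar K i j).
Proof.
rewrite invder_var invder_sum [RHS]invder_var.
have E l : invder Z (W l j *: xvar K i l) = \sum_k (Z k l * W l j) *: xvar K i k.
  rewrite invderZ invder_var scaler_sumr; apply: eq_bigr => k _.
  by rewrite scalerA mulrC.
rewrite (eq_bigr _ (fun l _ => E l)) exchange_big; apply: eq_bigr => k _ /=.
by rewrite mxE scaler_suml.
Qed.

Lemma invder_id i j : invder 1%:M (xvar K i j) = xvar K i j :> P.
Proof.
rewrite invder_var (bigD1 j) //= mxE eqxx scale1r big1 ?addr0 // => l lj.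
by rewrite mxE (negbTE lj) scale0r.
Qed.

Lemma invder0l p : invder (0 : 'M[K]_n) p = 0.
Proof.
have := invder_linear 1 0 0 p; rewrite !scale1r addr0 => /esym/eqP.
by rewrite -subr_eq0 addrK => /eqP.
Qed.

Lemma invderDl X Y p : invder (X + Y) p = invder X p + invder Y p.
Proof. by rewrite -[X]scale1r invder_linear !scale1r. Qed.

Lemma invderZl a X p : invder (a *: X) p = a *: invder X p.
Proof. by rewrite -[a *: X]addr0 invder_linear invder0l addr0. Qed.

Lemma invder_suml (I : Type) (r : seq I) (F : I -> 'M[K]_n) p :
  invder (\sum_(i <- r) F i) p = \sum_(i <- r) invder (F i) p.
Proof.
exact: (big_morph (fun X => invder X p) (fun X Y => invderDl X Y p) (invder0l p)).
Qed.

Lemma iter_eigop_invder_var X W a k i j :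
  iter k (eigop (invder X) a) (invder W (xvar K i j)) =
  invder (iter k (fun V => X *m V - a *: V) W) (xvar K i j).
Proof.
elim: k => //= k ->; rewrite /eigop invder_invder_var.
by rewrite -scaleNr [in RHS]addrC -[in RHS]scaleNr invder_linear addrC.
Qed.

End EigenDerivations.

(** * Replicas in algebraic Lie algebras *)

Section LieReplicas.
Variables (K : numClosedFieldType) (n : nat).
Local Notation M := 'M[K]_n.+1.
Local Notation P := (mpoly (n.+1 * n.+1) K).
Implicit Types (p q : P) (X Y Z : M) (H : set M).

Lemma iter_mul_eigop X W a k :
  iter k (fun V : M => X *m V - a *: V) W = (X - a%:M) ^+ k * W.
Proof.
elim: k => [|k IHk] /=; first by rewrite expr0 mul1r.
rewrite IHk exprS -mulrA mulrBl; congr (_ - _).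
by rewrite -mul_scalar_mx.
Qed.

Section Data.
Variables (X : M) (rs : seq K) (Pi : K -> M) (N r : nat) (c : 'I_r -> K)
  (m : K -> 'I_r -> int).
Hypothesis J : @jordan_data _ _ X rs Pi N r c m.

Let weight (f : {ffun 'I_r -> int}) : K := \sum_j (f j)%:~R * c j.

Let weightD f g : weight (f + g) = weight f + weight g.
Proof.
rewrite /weight -big_split; apply: eq_bigr => j _ /=.
by rewrite ffunE intrD mulrDl.
Qed.

Let elementary k (x : {ffun 'I_r -> int} * P) :=
  iter k (eigop (invder X) (weight x.1)) x.2 = 0 /\
  forall j, invder (replica rs Pi m j) x.2 = (x.1 j)%:~R *: x.2.

(** Each variable splits along the projectors, with weight the coordinates of the eigenvalue, and
    weights add under products. Weights are kept in Z^r, where the replicas read them, rather than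
    in K, where [invder X] does. *)
Lemma invder_decomp p : exists (L : seq ({ffun 'I_r -> int} * P)) k,
  (forall x, x \in L -> elementary k x) /\ p = \sum_(x <- L) x.2.
Proof.
have [[us s1 sN sO sc] ci cm] := J.
have Dl := invder_lin X.
have elW k l x : elementary k x -> elementary (l + k) x.
  by case=> e1 e2; split=> //; rewrite iterD e1 (iter_eigop0 Dl).
elim/mpoly_xvar_ind: p => [a|i j|p q [L1 [k1 [e1 ->]]] [L2 [k2 [e2 ->]]]|
    p q [L1 [k1 [e1 ->]]] [L2 [k2 [e2 ->]]]].
- exists [:: (0, mpolyC _ a)], 1%N; split; last by rewrite big_seq1.
  move=> x; rewrite inE => /eqP ->; split=> [|j] /=.
    rewrite /eigop invderC /weight big1 ?scale0r ?subr0 // => j _.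
    by rewrite ffunE mul0r.
  by rewrite invderC ffunE scale0r.
- exists [seq ([ffun l => m a l], invder (Pi a) (xvar K i j)) | a <- rs], N.
  split=> [x|]; last by rewrite big_map -invder_suml s1 invder_id.
  case/mapP=> a ars ->; split=> [|l] /=.
    rewrite iter_eigop_invder_var iter_mul_eigop.
    have -> : weight [ffun l => m a l] = a.
      by rewrite [RHS](cm a ars); apply: eq_bigr => l _; rewrite ffunE.
    by rewrite sN // invder0l.
  rewrite ffunE invder_invder_var -invderZl; congr (invder _ _).
  exact: (replica_Pi J l ars).1.
- exists (L1 ++ L2), (k1 + k2)%N; split; last by rewrite big_cat.
  move=> x; rewrite mem_cat => /orP[/e1 ex|/e2 ex]; last exact: elW.
  by rewrite addnC; apply: elW.
- exists [seq (x.1 + y.1, x.2 * y.2) | x <- L1, y <- L2], (k1 + k2)%N.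
  split=> [z /allpairsP[[x y] [/= /e1[x1 x2] /e2[y1 y2] ->]]|]; last first.
    rewrite big_allpairs_dep mulr_suml; apply: eq_bigr => x _.
    by rewrite mulr_sumr.
  split=> [|j] /=; first by rewrite weightD; apply: iter_eigop_invderM.
  rewrite invderM x2 y2 ffunE intrD scalerDl.
  by rewrite -scalerAl -scalerAr.
Qed.

Lemma weight_inj : injective weight.
Proof.
have [_ ci _] := J => f g e; apply/ffunP => j; apply/eqP; rewrite -subr_eq0.
apply/eqP; apply: (ci (fun l => f l - g l)).
under eq_bigr do rewrite intrB mulrBl.
by rewrite sumrB; apply/eqP; rewrite subr_eq0; apply/eqP.
Qed.

(** By independence of the c j an eigenvalue of [invder X] determines its integral weight
    ([weight_inj]), so the replica acts on generalized eigencomponents by a function of the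
    eigenvalue and preserves the ideal of H as [invder X] does. *)
Lemma lie_replica H j : subgroup_GL H -> lie_algebra H X ->
  lie_algebra H (replica rs Pi m j).
Proof.
move=> sH LX; have [_ H1 _ _] := sH; apply: invder_lie => p Ip.
suff : vanishing H (invder (replica rs Pi m j) p) by apply.
have [L [k [eL ep]]] := invder_decomp p.
have -> : invder (replica rs Pi m j) p = \sum_(x <- L) (x.1 j)%:~R *: x.2.
  rewrite ep invder_sum !big_seq; apply: eq_bigr => x /eL[_]; exact.
apply: (@eigen_operator _ _ _ (invder_lin X) (vanishing H) _ _ _ _ L
  (fun x => weight x.1) (fun x => (x.1 j)%:~R) (fun x => x.2) k).
- by move=> g _; rewrite mxeval0.
- by move=> a u v Iu Iv g Hg; rewrite mxevalD mxevalZ Iu ?Iv // mulr0 addr0.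
- by move=> v Iv; apply: lie_invder.
- by move=> x /eL[].
- by move=> x y _ _ /weight_inj ->.
- by rewrite -ep.
Qed.

Lemma lie_nilpart H : subgroup_GL H -> lie_algebra H X ->
  lie_algebra H (nilpart X rs Pi c m).
Proof.
move=> sH LX; rewrite /nilpart.
suff LS (s : seq 'I_r) : lie_algebra H (\sum_(j <- s) c j *: replica rs Pi m j).
  by rewrite addrC -scaleN1r; apply: lie_linear.
elim: s => [|j s IHs]; first by rewrite big_nil; apply: lie0.
by rewrite big_cons; apply: lie_linear => //; apply: lie_replica.
Qed.

End Data.

(* An element of an algebraic Lie algebra is trace-orthogonal to it only if it
   is nilpotent: its replicas lie in the algebra, and the trace form is
   integral and definite on them. *)
Lemma lie_orthogonal_nilp H X : subgroup_GL H -> lie_algebra H X ->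
  (forall Y, lie_algebra H Y -> \tr (X *m Y) = 0) -> X ^+ n.+1 = 0.
Proof.
move=> sH LX orth; have [rs [Pi [N [r [c [m J]]]]]] := jordan_dataP X.
pose Y := replica rs Pi m.
have Ynil j : \tr (nilpart X rs Pi c m *m Y j) = 0.
  apply: (comm_nilp_tr _ (nilpart_nilp J)).
  by apply: (replica_comm J); apply/esym/(nilpart_comm J).
have YY i j : \tr (Y i *m Y j) = 0.
  have [z ez] : exists z : 'I_r -> int, forall i, \tr (Y i *m Y j) = (z i)%:~R.
    have [z ez] := choice (fun i => replica_tr_int J i j); by exists z.
  rewrite ez; suff -> : z i = 0 by [].
  (* The traces of products of replicas are integers, so orthogonality of X to [Y j] is an integral
     relation between the c k and must be trivial. *)
  have [_ ci _] := J; apply: ci.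
  have := orth _ (lie_replica J j sH LX).
  rewrite {1}(replica_decomp X rs Pi c m) mulmxDl raddfD /= Ynil add0r.
  rewrite mulmx_suml raddf_sum /= => e0; rewrite -[RHS]e0; apply: eq_bigr => k _.
  by rewrite -scalemxAl mxtraceZ ez mulrC.
have Y0 j : Y j = 0 := int_semisimple_tr (replica_int_semisimple J j) (YY j j).
have eX : X = nilpart X rs Pi c m.
  by rewrite [LHS](replica_decomp X rs Pi c m) big1 ?addr0 // => j _; rewrite [replica _ _ _ _]Y0 scaler0.
by rewrite eX (nilpart_nilp J).
Qed.

End LieReplicas.

(** * Trace form of reductive groups *)

Lemma vspace_of (K : fieldType) (V : vectType K) (S : V -> Prop) :
  S 0 -> (forall a u v, S u -> S v -> S (a *: u + v)) ->
  exists U : {vspace V}, forall v, (v \in U) <-> S v.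
Proof.
move=> S0 SP.
have grow d : exists U : {vspace V}, (forall v, v \in U -> S v) /\
    ((d <= \dim U)%N \/ forall v, S v -> v \in U).
  elim: d => [|d [U [US [dU|SU]]]]; last by exists U; split=> //; right.
    by exists 0%VS; split=> [v|]; [rewrite memv0 => /eqP->|left].
  have [SU|] := pselect (forall v, S v -> v \in U); first by exists U; split=> //; right.
  case/existsNP=> v /not_implyP[Sv /negP vU].
  exists (<[v]> + U)%VS; split=> [w /memv_addP[_ /vlineP[a ->] [u uU ->]]|].
    by apply: SP => //; apply: US.
  left; apply: (leq_ltn_trans dU); rewrite ltn_neqAle dimvS ?addvSr // andbT.
  apply: contraNneq vU => e; have : (U == <[v]> + U)%VS.
    by rewrite eqEdim addvSr e /=.
  by move/eqP->; apply: (subvP (addvSl _ _)); apply: memv_line.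
have [U [US [|SU]]] := grow (\dim (fullv : {vspace V})).+1.
  by rewrite ltnNge dimvS ?subvf.
by exists U => v; split; [exact: US | exact: SU].
Qed.

(** * Nilpotent spaces of operators *)

Section Engel.
Variables (K : fieldType) (A : falgType K).
Implicit Types (L U Z : {vspace A}) (x y u : A).

Definition bracket_closed L := forall x y, x \in L -> y \in L -> x * y - y * x \in L.

(** Since Z U is contained in U Z, factors from U can be moved to the left. A product of m factors
    from U + <x> is then either x^m = 0 or in U Z^m; k such blocks lie in U^k Z^(m k) = 0. *)
Lemma nilpotent_extension U x m k : bracket_closed U ->
  (forall u, u \in U -> x * u - u * x \in U) -> x ^+ m = 0 -> (U ^+ k = 0)%VS ->
  ((U + <[x]>) ^+ (m * k) = 0)%VS.
Proof.
move=> UU xU xm Uk; set U' := (U + <[x]>)%VS; pose Z := (1 + U')%VS.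
have ZU : (Z * U <= U * Z)%VS.
  have UUZ : (U <= U * Z)%VS by rewrite -{1}[U]prodv1 prodvSr // addvSl.
  have UZ : (U <= Z)%VS by rewrite (subv_trans _ (addvSr _ _)) // addvSl.
  rewrite /Z !prodvDl prod1v !subv_add UUZ prodvSr //=.
  apply/prodvP => _ u /vlineP[a ->] uU.
  have -> : a *: x * u = u * (a *: x) + a *: (x * u - u * x).
    by rewrite scalerBr -scalerAl -scalerAr addrC subrK.
  apply: rpredD; last by apply: rpredZ; apply: (subvP UUZ); apply: xU.
  apply: memv_mul => //; apply: (subvP (addvSr _ _)); apply: (subvP (addvSr _ _)).
  by apply: rpredZ; apply: memv_line.
have ZiU i : (Z ^+ i * U <= U * Z ^+ i)%VS.
  elim: i => [|i IHi]; first by rewrite expv0 prod1v prodv1.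
  rewrite expvSl -prodvA (subv_trans (prodvSr _ IHi)) // prodvA.
  by rewrite (subv_trans (prodvSl _ ZU)) // -prodvA.
have ZiUj i j : (Z ^+ i * U ^+ j <= U ^+ j * Z ^+ i)%VS.
  elim: j => [|j IHj]; first by rewrite expv0 prod1v prodv1.
  rewrite expvSl prodvA (subv_trans (prodvSl _ (ZiU i))) // -!prodvA.
  exact: prodvSr.
have Z1 : (1 <= Z)%VS by exact: addvSl.
have Zi i : (Z ^+ i <= Z ^+ i.+1)%VS by rewrite expvSl -{1}[(Z ^+ i)%VS]prod1v prodvSl.
have xZ i : (<[x ^+ i]> <= Z ^+ i)%VS.
  rewrite -expv_line expvS // (subv_trans _ (addvSr _ _)) //; exact: addvSr.
have U'j j : (U' ^+ j <= U * Z ^+ j + <[x ^+ j]>)%VS.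
  { elim: j => [|j IHj]; first by rewrite expv0 expr0 addvSr.
  rewrite expvSl (subv_trans (prodvSr _ IHj)) // /U' prodvDl !prodvDr !subv_add.
  apply/andP; split; apply/andP; split.
  - apply: (subv_trans _ (addvSl _ _)); rewrite prodvSr // expvSl prodvSl //.
    by rewrite (subv_trans _ (addvSr _ _)) // addvSl.
  - apply: (subv_trans _ (addvSl _ _)); rewrite prodvSr //.
    exact: subv_trans (xZ j) (Zi j).
  - apply: (subv_trans _ (addvSl _ _)); rewrite prodvA.
    have xZ1 : (<[x]> <= Z)%VS by rewrite (subv_trans _ (addvSr _ _)) // addvSr.
    rewrite (subv_trans (prodvSl _ (prodvSl _ xZ1))) //.
    by rewrite (subv_trans (prodvSl _ ZU)) // -prodvA expvSl.
  - by rewrite prodv_line -exprS addvSr. }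
have U'm : (U' ^+ m <= U * Z ^+ m)%VS.
  by rewrite (subv_trans (U'j m)) // xm subv_add subvv sub0v.
have UZk i : ((U * Z ^+ m) ^+ i <= U ^+ i * Z ^+ (m * i))%VS.
  elim: i => [|i IHi]; first by rewrite muln0 !expv0 prodv1.
  rewrite expvSl (subv_trans (prodvSr _ IHi)) // -prodvA (prodvA (Z ^+ m)%VS).
  rewrite (subv_trans (prodvSr _ (prodvSl _ (ZiUj m i)))) //.
  by rewrite -prodvA !prodvA -expvSl -prodvA -expvD mulnS.
apply/eqP; rewrite -subv0 expvM (subv_trans (expvS _ U'm)) //.
by rewrite (subv_trans (UZk k)) // Uk prod0v.
Qed.

(* Engel's theorem, by Jacobson's argument on maximal nilpotent subalgebras. *)
Lemma engel L : bracket_closed L -> (forall x, x \in L -> exists k, x ^+ k = 0) ->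
  exists k, (L ^+ k = 0)%VS.
Proof.
move=> LL Lnil.
have grow d : (d <= \dim L)%N -> exists U, [/\ (U <= L)%VS, bracket_closed U,
    exists k, (U ^+ k = 0)%VS & (d <= \dim U)%N].
  elim: d => [|d IHd] dL.
    exists 0%VS; split=> //; [exact: sub0v| |by exists 1%N; rewrite expv1].
    by move=> x y /[!memv0] /eqP-> /eqP->; rewrite mul0r subrr.
  have [U [UL UU [k Uk] dU]] := IHd (ltnW dL).
  have [dU'|] := ltnP d (\dim U); first by exists U; split=> //; exists k.
  move=> Ud; have /subvPn[x0 x0L x0U] : ~~ (L <= U)%VS.
    by apply/negP => /dimvS; rewrite leqNgt (leq_ltn_trans Ud).
  have [x xL [xU xad]] : exists2 x, x \in L & (x \notin U) /\
      forall u, u \in U -> x * u - u * x \in U.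
    apply: contrapT => none.
    (* Repeated bracketing of x0 with elements of U stays in these sums, and [S (k + k)] is 0
       because U^k = 0. A walk that never enters U is therefore impossible, so some element outside
       U normalizes U. *)
    pose S j := (\sum_(i < j.+1) U ^+ i * <[x0]> * U ^+ (j - i))%VS.
    have walk j : exists y, [/\ y \in L, y \notin U & y \in S j].
      elim: j => [|j [y [yL yU yS]]].
        exists x0; split=> //; rewrite /S big_ord1 expv0 prod1v prodv1.
        exact: memv_line.
      have [u uU yu] : exists2 u, u \in U & y * u - u * y \notin U.
        apply: contrapT => no; apply: none; exists y => //; split=> // u uU.
        by apply: contrapT => /negP yu; apply: no; exists u.
      exists (y * u - u * y); split=> //; first by apply: LL => //; apply: (subvP UL).
      apply: rpredB.
        have : (S j * U <= S j.+1)%VS; last by move/subvP; apply; apply: memv_mul.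
        rewrite /S big_distrl /=; apply/subv_sumP => i _.
        rewrite -prodvA -expvSr -subSn ?leq_ord //.
        exact: (sumv_sup (widen_ord (leqnSn _) i)).
      have : (U * S j <= S j.+1)%VS; last by move/subvP; apply; apply: memv_mul.
      rewrite /S big_distrr /=; apply/subv_sumP => i _; rewrite !prodvA -expvSl.
      by apply: (sumv_sup (lift ord0 i)); rewrite // subSS.
    have [y [_ /negP yU yS]] := walk (k + k)%N; apply: yU.
    suff S0 : (S (k + k)%N <= 0)%VS by move: (subvP S0 _ yS); rewrite memv0 => /eqP->; rewrite mem0v.
    apply/subv_sumP => i _; have [ki|ik] := leqP k i.
      by rewrite -(subnK ki) expvD Uk prodv0 !prod0v.
    have kj : (k <= k + k - i)%N by lia.
    by rewrite -[(k + k - i)%N](subnK kj) expvD Uk !prodv0.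
  have [m xm] := Lnil x xL.
  exists (U + <[x]>)%VS; split.
  { by rewrite subv_add UL -memvE. }
  { move=> _ _ /memv_addP[u uU [_ /vlineP[a ->] ->]] /memv_addP[v vU [_ /vlineP[b ->] ->]].
    apply: (subvP (addvSl _ _)).
    have brDl (p q z : A) : (p + q) * z - z * (p + q) = (p * z - z * p) + (q * z - z * q).
      by rewrite mulrDl mulrDr opprD addrACA.
    have brDr (z p q : A) : z * (p + q) - (p + q) * z = (z * p - p * z) + (z * q - q * z).
      by rewrite mulrDl mulrDr opprD addrACA.
    have brZl c (p z : A) : c *: p * z - z * (c *: p) = c *: (p * z - z * p).
      by rewrite -scalerAl -scalerAr scalerBr.
    rewrite brDl !brDr !brZl; apply: rpredD; apply: rpredD.
    + exact: UU.
    + by rewrite -opprB brZl rpredN rpredZ // xad.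
    + by rewrite rpredZ // xad.
    + by rewrite -scalerAl -scalerAr subrr scaler0 mem0v. }
  { by exists (m * k)%N; apply: nilpotent_extension. }
  { apply: (leq_ltn_trans dU); rewrite ltn_neqAle dimvS ?addvSl // andbT.
    apply: contraNneq xU => e; have : (U == U + <[x]>)%VS by rewrite eqEdim addvSl e /=.
    by move/eqP->; apply: (subvP (addvSr _ _)); apply: memv_line. }
have [U [UL _ Uk dU]] := grow _ (leqnn _).
by have /eqP <- : U == L by rewrite eqEdim UL dU.
Qed.

End Engel.

(** * Unipotent groups and nondegeneracy of the trace form *)

Section Unipotent.
Variables (K : numClosedFieldType) (n : nat).
Local Notation M := 'M[K]_n.+1.
Local Notation P := (mpoly (n.+1 * n.+1) K).
Implicit Types (p q : P) (X Y Z g h : M) (H S : set M).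

Lemma closed_subgroupI S : subgroup_GL S ->
  (forall g, g \in unitmx -> (forall p, vanishing S p -> mxeval p g = 0) -> S g) ->
  closed_subgroup S.
Proof.
move=> sS mS; split=> //; exists (zeros (vanishing S)).
  rewrite -[zeros _]setCK; apply: open_closedC.
  by exists (vanishing S); rewrite setCK.
apply/seteqP; split=> [g Sg|g [gu zg]]; last by apply: mS.
by split; [case: sS => SU _ _ _; apply: SU | move=> p; apply].
Qed.

Lemma mxeval_curve (c : K -> M) : (forall i j, exists q : {poly K}, forall t, c t i j = q.[t]) ->
  forall p, exists q : {poly K}, forall t, mxeval p (c t) = q.[t].
Proof.
move=> cq; apply: mpoly_xvar_ind => [a|i j|p1 p2 [q1 e1] [q2 e2]|p1 p2 [q1 e1] [q2 e2]].
- by exists a%:P => t; rewrite mxevalC hornerC.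
- by have [q e] := cq i j; exists q => t; rewrite mxeval_var.
- by exists (q1 + q2) => t; rewrite mxevalD hornerD e1 e2.
- by exists (q1 * q2) => t; rewrite mxevalM hornerM e1 e2.
Qed.

Lemma bin_poly j : exists q : {poly K}, forall m, q.[m%:R] = 'C(m, j)%:R.
Proof.
elim: j => [|j [q eq]]; first by exists 1 => m; rewrite hornerC bin0.
exists (j.+1%:R^-1 *: (q * ('X - j%:R%:P))) => m.
have jK : (j.+1%:R : K) != 0 by rewrite pnatr_eq0.
rewrite hornerZ hornerM eq hornerXsubC; apply: (mulfI jK); rewrite mulrA mulfV // mul1r.
have [jm|mj] := leqP j m; first by rewrite -natrB // -!natrM mul_bin_left mulnC.
by rewrite !bin_small ?mul0r ?mulr0 // ltnW.
Qed.

(** With g = 1 + N, the curve is the sum of the binomial(t, j) N^j, which interpolates the powers of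
    g at the natural numbers. *)
Lemma unipotent_curve g k : (g - 1%:M) ^+ k = 0 -> exists c : K -> M,
  [/\ forall i j, exists q : {poly K}, forall t, c t i j = q.[t],
     forall m : nat, c m%:R = g ^+ m & forall t, c t \in unitmx].
Proof.
have [b eb] := choice bin_poly; move=> gk; set N := g - 1%:M in gk.
exists (fun t => \sum_(j < k.+1) (b j).[t] *: N ^+ j); split=> [i j|m|t].
- exists (\sum_(l < k.+1) (N ^+ l) i j *: b l) => t.
  rewrite summxE horner_sum; apply: eq_bigr => l _.
  by rewrite mxE hornerZ mulrC.
- have -> : g = 1 + N by rewrite addrC subrK.
  rewrite (addrC 1) exprD1n.
  have E l : (k < l)%N -> \sum_(i < l) (b i).[m%:R] *: N ^+ i =
      \sum_(i < k.+1) (b i).[m%:R] *: N ^+ i.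
    move=> kl; rewrite -(big_mkord xpredT (fun i => (b i).[m%:R] *: N ^+ i)).
    rewrite -[RHS](big_mkord xpredT (fun i => (b i).[m%:R] *: N ^+ i)).
    rewrite (big_cat_nat (n := k.+1)) //= [X in _ + X]big1_seq ?addr0 // => i.
    rewrite mem_index_iota => /andP[_ /andP[ki _]].
    by rewrite -(subnK (ltnW ki)) exprD gk mulr0 scaler0.
  rewrite -(E (m + k).+1); last by lia.
  rewrite -(big_mkord xpredT (fun i => (b i).[m%:R] *: N ^+ i)).
  rewrite (big_cat_nat (n := m.+1)) //=; last by lia.
  rewrite [X in _ + X]big1_seq ?addr0 => [|i].
    rewrite big_mkord; apply: eq_bigr => i _.
    by rewrite eb scaler_nat.
  rewrite mem_index_iota => /andP[_ /andP[mi _]].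
  by rewrite eb bin_small // scale0r.
- rewrite big_ord_recl expr0 /=.
  have -> : b 0%N = 1 by apply: poly_nat_ext => m; rewrite eb bin0 hornerC.
  rewrite hornerC scale1r.
  set W := \sum_(l < k) (b (lift ord0 l)).[t] *: N ^+ l.
  have -> : \sum_(l < k) (b (lift ord0 l)).[t] *: N ^+ (lift ord0 l) = N * W.
    by rewrite mulr_sumr; apply: eq_bigr => l _; rewrite -scalerAr -exprS.
  apply: (@unitmx_nilp _ _ _ k); rewrite exprMn_comm ?gk ?mul0r //.
  by apply: commr_sum => l _; rewrite /GRing.comm -scalerAr -scalerAl -exprS -exprSr.
Qed.

(** A point b and any g of H are joined by the polynomial curve t -> b (b^-1 g)^t, which stays in H
    as it does at natural t. A polynomial vanishing off the open part but not at b, and an equation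
    of the closed part, have product zero along the curve; K[t] being a domain, the second vanishes
    at g. *)
Lemma unipotent_connected H : closed_subgroup H -> unipotent_group H -> zconnected H.
Proof.
move=> cH uH; have [[HU H1 HM HV] _] := cH => B [b Bb] [O oO eO] [F cF eF].
have [Hb Ob] : (H `&` O) b by rewrite -eO.
apply/seteqP; split=> [g|g Hg]; first by rewrite eO => -[].
have Hh : H (invmx b *m g) by apply: HM => //; apply: HV.
have [k hk] := uH _ Hh; have [c [cq cn cu]] := unipotent_curve hk.
have bcq i j : exists q : {poly K}, forall t, (b *m c t) i j = q.[t].
  have [f ef] := choice (fun l => cq l j).
  exists (\sum_l b i l *: f l) => t; rewrite mxE horner_sum.
  by apply: eq_bigr => l _; rewrite hornerZ ef.
have Hc t : H (c t).
  apply: (closed_memP cH) => // p Ip; have [q eq] := mxeval_curve cq p.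
  rewrite eq; suff -> : q = 0 by rewrite horner0.
  apply: poly_nat_ext => m; rewrite -eq cn horner0; apply: Ip.
  by elim: m => [|m IHm]; rewrite ?expr0 // exprS; apply: HM.
have bu : b \in unitmx := HU _ Hb.
have Fg : F g.
  case/closed_openC: cF => S' eS'; case: oO => S eS.
  have {eS'} eF' : F = zeros S' by rewrite -eS' setCK.
  rewrite eF' => q' Sq'; have /existsNP[q /not_implyP[Sq /eqP qb]] : ~ zeros S b.
    by rewrite -eS => /(_ Ob).
  have [Q eQ] := mxeval_curve bcq q; have [Q' eQ'] := mxeval_curve bcq q'.
  have QQ : Q * Q' = 0.
    apply: poly_ext => t; rewrite hornerM horner0 -eQ -eQ'.
    have Hbc : H (b *m c t) by apply: HM.
    have [Obc|nO] := pselect (O (b *m c t)).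
      have [_] : (H `&` F) (b *m c t) by rewrite -eF eO.
      by rewrite eF' => /(_ _ Sq')->; rewrite mulr0.
    have : (~` O) (b *m c t) by [].
    by rewrite eS => /(_ _ Sq)->; rewrite mul0r.
  have Q0 : Q != 0.
    apply: contraNneq qb => Q0; have := eQ 0; rewrite Q0 horner0.
    by rewrite (cn 0%N) expr0 mulmx1 => ->.
  move/eqP: QQ; rewrite mulf_eq0 (negbTE Q0) /= => /eqP Q'0.
  have := eQ' 1; rewrite Q'0 horner0 (cn 1%N) expr1 mulmxA mulmxV // mul1mx.
  exact.
by rewrite eF.
Qed.

(** Multiplying exp X - 1 by X^j isolates X^(j+1) once X^(j+2) = 0, so the nilpotency order
    descends. *)
Lemma nilexp_inj X : X ^+ n.+1 = 0 -> nilexp X = 1%:M -> X = 0.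
Proof.
move=> Xn eX; have Xpow j : X ^+ j.+1 = 0 -> X = 0.
  elim: j => [|j IHj] Xj; first by rewrite expr1 in Xj.
  apply: IHj; case: (n) X Xn eX Xj => [|n'] Y; first by rewrite expr1 => -> _ _; rewrite expr0n.
  move=> _ eY Yj; have : Y ^+ j * (nilexp Y - 1) = 0 by rewrite eY subrr mulr0.
  rewrite /nilexp big_ord_recl expr0 invr1 scale1r addrAC subrr add0r big_ord_recl.
  rewrite invr1 scale1r /= mulrDr -exprSr mulr_sumr big1 ?addr0 // => i _.
  by rewrite -scalerAr -exprD /bump /= !add1n !addnS -!addSn exprD Yj mul0r scaler0.
exact: (Xpow n).
Qed.

(* An ideal of nilpotent matrices of the Lie algebra, stable under H, acts
   trivially on the graded pieces of an H-stable flag; the elements of H with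
   the same property form a connected unipotent normal subgroup. *)
Lemma reductive_nil_ideal H (L : {vspace M}) k : reductive H ->
  (forall x, x \in L -> lie_algebra H x) ->
  (forall g x, H g -> x \in L -> g *m x *m invmx g \in L) ->
  (L ^+ k = 0)%VS -> L = 0%VS.
Proof.
move=> [cH rH] LH AdL Lk; have [[HU H1 HM HV] _] := cH.
(* The flag consists of left ideals of the matrix algebra, on which L and H act by right
   multiplication; it ends with [T k] = 0. *)
pose T i : {vspace M} := (fullv * L ^+ i)%VS.
have TL i y x : y \in T i -> x \in L -> y * x \in T i.+1.
  by move=> yT xL; rewrite /T expvSr prodvA memv_mul.
have Tdec i y : y \in T i.+1 -> y \in T i.
  by apply/subvP; rewrite /T expvSl prodvA prodvSl // subvf.
have Lg g : H g -> (L * <[g]> <= <[g]> * L)%VS.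
  move=> Hg; have gu := HU _ Hg; apply/prodvP => x _ xL /vlineP[a ->].
  have -> : x * (a *: g) = (a *: g) * (invmx g *m x *m g).
    by rewrite -scalerAr -scalerAl; congr (_ *: _); rewrite -!mulmxE !mulmxA mulmxV // mul1mx.
  rewrite memv_mul ?rpredZ ?memv_line //.
  by have := AdL (invmx g) x (HV _ Hg) xL; rewrite invmxK.
have Tg g i y : H g -> y \in T i -> y * g \in T i.
  move=> Hg yT; have : (T i * <[g]> <= T i)%VS; last first.
    by move/subvP; apply; rewrite memv_mul ?memv_line.
  have Lig j : (L ^+ j * <[g]> <= <[g]> * L ^+ j)%VS.
    elim: j => [|j IHj]; first by rewrite expv0 prod1v prodv1.
    rewrite expvSl -prodvA (subv_trans (prodvSr _ IHj)) // !prodvA.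
    by rewrite prodvSl // Lg.
  rewrite /T -prodvA (subv_trans (prodvSr _ (Lig i))) // prodvA prodvSl //.
  exact: subvf.
have T0 y : y \in T 0%N by rewrite /T expv0 prodv1 memvf.
have Tk y : y \in T k -> y = 0 by rewrite /T Lk prodv0 memv0 => /eqP.
pose U : set M := [set g | H g /\ forall i y, y \in T i -> y * (g - 1) \in T i.+1].
have sU : subgroup_GL U.
  split=> [g [/HU]//||g h [Hg Tg1] [Hh Th1]|g [Hg Tg1]].
  { by split=> // i y _; rewrite subrr mulr0 mem0v. }
  { split=> [|i y yT]; first exact: HM.
    have -> : y * (g *m h - 1) = y * (g - 1) * h + y * (h - 1).
      by rewrite !mulrBr !mulr1 mulrBl addrA subrK -mulmxE mulmxA.
    by apply: rpredD; [apply: Tg => //; apply: Tg1|apply: Th1]. }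
  split=> [|i y yT]; first exact: HV.
  have -> : y * (invmx g - 1) = - (y * (g - 1) * invmx g).
    rewrite !mulrBr !mulr1 mulrBl opprB; congr (_ - _).
    by rewrite -!mulmxE -mulmxA mulmxV ?mulmx1 //; apply: HU.
  by rewrite rpredN; apply: Tg; [apply: HV|apply: Tg1].
have cU : closed_subgroup U.
  apply: closed_subgroupI => // g gu Ig; split.
    by apply: (closed_memP cH) => // p Ip; apply: Ig => h [Hh _]; apply: Ip.
  move=> i y yT; pose f A := y * A - projv (T i.+1) (y * A).
  have fD A B : f (A + B) = f A + f B.
    by rewrite /f mulrDr linearD /= opprD addrACA.
  have fZ a A : f (a *: A) = a *: f A by rewrite /f -scalerAr linearZ /= scalerBr.
  have f0 : f 0 = 0 by rewrite /f mulr0 linear0 subr0.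
  suff : f (g - 1) = 0 by move/eqP; rewrite subr_eq0 => /eqP->; apply: memv_proj.
  apply/matrixP => a b; rewrite [RHS]mxE.
  (* Lying in U imposes affine linear equations on g: p reads off an entry of the residue of y (g -
     1) modulo [T i.+1]. *)
  pose p : P := \sum_r \sum_s f (delta_mx r s) a b *: (xvar K r s - mpolyC _ ((1%:M : M) r s)).
  have ep h : mxeval p h = f (h - 1) a b.
    rewrite [in RHS](matrix_sum_delta (h - 1)) mxeval_sum.
    have -> : f (\sum_(r < n.+1) \sum_(s < n.+1) (h - 1) r s *: delta_mx r s) =
        \sum_r \sum_s (h - 1) r s *: f (delta_mx r s).
      rewrite (big_morph f fD f0); apply: eq_bigr => r _.
      by rewrite (big_morph f fD f0); apply: eq_bigr => s _; rewrite fZ.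
    rewrite summxE; apply: eq_bigr => r _; rewrite mxeval_sum summxE.
    apply: eq_bigr => s _.
    by rewrite mxevalZ mxevalB mxeval_var mxevalC !mxE mulrC.
  rewrite -ep; apply: Ig => h [Hh Th]; rewrite ep /f projv_id ?subrr ?mxE //.
  exact: Th.
have uU : unipotent_group U.
  move=> g [_ Tg1]; exists k; apply: Tk.
  by elim: (k) => [|j IHj]; rewrite ?expr0 ?T0 // exprSr; apply: Tg1.
have nU : normal_in H U.
  split=> [g []//|g h Hg [Hh Th]]; have gu := HU _ Hg; split.
    by apply: (HM) (HV _ Hg); apply: HM.
  move=> i y yT.
  have -> : y * (g *m h *m invmx g - 1) = y * g * (h - 1) * invmx g.
    rewrite !mulrBr !mulr1 mulrBl; congr (_ - _); rewrite -!mulmxE ?mulmxA //.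
    by rewrite -mulmxA mulmxV // mulmx1.
  exact: (Tg _ _ _ (HV _ Hg) (Th _ _ (Tg _ _ _ Hg yT))).
have eU := rH U cU (unipotent_connected cU uU) uU nU.
apply/eqP; rewrite -subv0; apply/subvP => x xL; rewrite memv0; apply/eqP.
have xk : x ^+ k = 0.
  apply: Tk; elim: (k) => [|j IHj]; rewrite ?expr0 ?T0 // exprSr.
  exact: TL.
have xn := nilp_dim xk; apply: (nilexp_inj xn).
suff : U (nilexp x) by rewrite eU.
split; first by have := nilexp_mem 1 cH (LH x xL) xn; rewrite scale1r.
move=> i y yT; rewrite /nilexp big_ord_recl expr0 invr1 scale1r addrAC subrr add0r.
rewrite mulr_sumr; apply: rpred_sum => j _; rewrite -scalerAr rpredZ //.
rewrite /= /bump /= add1n exprSr mulrA; apply: (TL _ _ _ _ xL).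
by elim: (j : nat) => [|l IHl]; rewrite ?expr0 ?mulr1 // exprSr mulrA; exact: (Tdec _ _ (TL _ _ _ IHl xL)).
Qed.

(** The radical of the trace form is an ideal, stable under conjugation by H and made of nilpotents;
    Engel's theorem makes some power of it vanish, and reductivity then makes it zero. *)
Lemma reductive_trace_form H X : reductive H -> lie_algebra H X ->
  (forall Y, lie_algebra H Y -> \tr (X *m Y) = 0) -> X = 0.
Proof.
move=> rH LX orth; have [cH _] := rH; have sH := cH.1; have [HU _ _ HV] := sH.
pose S Z := lie_algebra H Z /\ forall Y, lie_algebra H Y -> \tr (Z *m Y) = 0.
have S0 : S 0 by split=> [|Y _]; [apply: lie0 | rewrite mul0mx mxtrace0].
have SP a Z W : S Z -> S W -> S (a *: Z + W).
  move=> [LZ Z0] [LW W0]; split=> [|Y LY]; first exact: lie_linear.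
  by rewrite mulmxDl -scalemxAl mxtraceD mxtraceZ Z0 // W0 // mulr0 addr0.
have [L SL] := vspace_of S0 SP.
have LL : bracket_closed L.
  move=> Z W /SL[LZ Z0] /SL[LW W0]; apply/SL; split=> [|Y LY].
    exact: (lie_bracket sH LZ LW).
  have := Z0 _ (lie_bracket sH LW LY); rewrite /bracket mulmxBr mulmxBl !raddfB /=.
  by rewrite !mulmxA [\tr (Z *m Y *m W)]mxtrace_mulC mulmxA.
have Lnil x : x \in L -> exists k, x ^+ k = 0.
  by move=> /SL[LZ Z0]; exists n.+1; apply: (lie_orthogonal_nilp sH).
have [k Lk] := engel LL Lnil.
have L0 : L = 0%VS.
  apply: (reductive_nil_ideal rH _ _ Lk) => [x /SL[]//|g x Hg /SL[Lx x0]].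
  have gu := HU _ Hg; apply/SL; split; first exact: lie_Ad.
  move=> Y LY; rewrite -!mulmxA mxtrace_mulC -!mulmxA.
  have := x0 _ (lie_Ad sH (HV _ Hg) LY); rewrite invmxK !mulmxA.
  by rewrite -!mulmxA.
by have /SL : S X by []; rewrite L0 memv0 => /eqP.
Qed.

End Unipotent.

(** * Krull's intersection theorem *)

Lemma nat_monotone_subseq (u : nat -> nat) : exists phi : nat -> nat,
  {homo phi : i j / (i < j)%N} /\ {homo u \o phi : i j / (i <= j)%N}.
Proof.
have minu N : exists m, (N <= m)%N /\ forall j, (N <= j)%N -> (u m <= u j)%N.
  suff E v : forall m, (N <= m)%N -> (u m <= v)%N ->
      exists m, (N <= m)%N /\ forall j, (N <= j)%N -> (u m <= u j)%N.
    exact: (E (u N) N).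
  elim: v => [|v IHv] m Nm umv.
    by exists m; split=> // j _; move: umv; rewrite leqn0 => /eqP->.
  have [mu|/existsNP[j /not_implyP[Nj /negP]]] :=
    pselect (forall j, (N <= j)%N -> (u m <= u j)%N); first by exists m.
  by rewrite -ltnNge => uj; apply: (IHv j Nj); rewrite -ltnS (leq_trans uj).
have [f fP] := choice minu.
pose phi := fix phi i := if i is j.+1 then f (phi j).+1 else f 0%N.
have phiS i : (phi i < phi i.+1)%N by have [] := fP (phi i).+1.
exists phi; split; first by apply: homo_ltn => // ? ? ?; apply: ltn_trans.
apply: homo_leq => // [? ? ?|i]; first exact: leq_trans.
have [N eN] : exists N, phi i = f N by case: i => [|i] /=; eexists.
rewrite /comp eN; apply: (fP N).2.
by apply: (leq_trans _ (ltnW (phiS i))); rewrite eN; case: (fP N).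
Qed.

(** Monotone subsequences are extracted one coordinate after the other. *)
Lemma dickson (k : nat) (u : nat -> multinom k) : exists i j, (i < j)%N /\ lem (u i) (u j).
Proof.
suff E (s : seq 'I_k) : exists phi : nat -> nat, {homo phi : i j / (i < j)%N} /\
    forall c, c \in s -> {homo (fun i => u (phi i) c) : i j / (i <= j)%N}.
  have [phi [phil phim]] := E (enum 'I_k).
  exists (phi 0%N), (phi 1%N); split; first exact: phil.
  by apply/mnm_lepP => c; apply: (phim c (mem_enum _ c) 0%N 1%N).
elim: s => [|c s [phi [phil phim]]]; first by exists id; split.
have [psi [psil psim]] := nat_monotone_subseq (fun i => u (phi i) c).
exists (phi \o psi); split=> [i j ij|b]; first by apply/phil/psil.
rewrite in_cons => /predU1P[->|bs] i j ij; first exact: (psim i j ij).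
by apply: phim => //; apply: (ltnW_homo psil).
Qed.

(* Hilbert's basis theorem, in the form that no sequence of polynomials is
   "bad", i.e. has all its terms outside of the ideal of the preceding ones:
   reduce each term of a bad sequence to one of minimal leading monomial, and
   apply Dickson's lemma. *)
Lemma hilbert_basis (K : fieldType) (k : nat) (p : nat -> mpoly k K) :
  exists n (q : nat -> mpoly k K), p n = \sum_(i < n) q i * p i.
Proof.
apply: contrapT => bad.
pose ideal n r := exists q : nat -> mpoly k K, r = \sum_(i < n) q i * p i.
have id0 n : ideal n 0 by exists (fun=> 0); rewrite big1 // => i _; rewrite mul0r.
have idD n r s : ideal n r -> ideal n s -> ideal n (r + s).
  move=> [q ->] [q' ->]; exists (fun i => q i + q' i); rewrite -big_split.
  by apply: eq_bigr => i _ /=; rewrite mulrDl.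
have idM n r s : ideal n r -> ideal n (s * r).
  move=> [q ->]; exists (fun i => s * q i); rewrite mulr_sumr.
  by apply: eq_bigr => i _; rewrite mulrA.
have idN n r : ideal n r -> ideal n (- r) by rewrite -mulN1r; apply: idM.
have idp i n : (i < n)%N -> ideal n (p i).
  move=> ltin; exists (fun j => (j == i)%:R); rewrite (bigD1 (Ordinal ltin)) //= eqxx mul1r.
  by rewrite big1 ?addr0 // => j; rewrite -val_eqE /= => /negbTE->; rewrite mul0r.
have idS i n r : (i <= n)%N -> ideal i r -> ideal n r.
  move=> lein [q ->]; have : forall j : 'I_i, ideal n (q j * p j).
    by move=> j; apply/idM/idp/(leq_trans (ltn_ord j)).
  by move=> h; apply: (big_ind (ideal n)) => // r1 r2; apply: idD.
pose C n r := ideal n (r - p n).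
have minC n : exists r, C n r /\ forall s, C n s -> ~ (mlead s < mlead r)%O.
  suff E m : forall r, C n r -> mlead r = m ->
      exists r, C n r /\ forall s, C n s -> ~ (mlead s < mlead r)%O.
    by apply: (E _ (p n)) => //; rewrite /C subrr.
  elim/(well_founded_ind (@ltom_wf k)): m => m IHm r Cr er.
  have [mr|/existsNP[s /not_implyP[Cs /contrapT sr]]] :=
    pselect (forall s, C n s -> ~ (mlead s < mlead r)%O); first by exists r.
  by apply: (IHm (mlead s) _ s) => //; rewrite -er.
have [r rP] := choice minC.
have rnz n : r n != 0.
  apply/eqP => r0; have [] := rP n; rewrite r0 /C sub0r => /idN; rewrite opprK => -[q pq] _.
  by apply: bad; exists n, q.
have [i [j [ij uij]]] := dickson (fun n => mlead (r n)).
pose m := mnm_sub (mlead (r j)) (mlead (r i)).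
pose c := mleadc (r j) / mleadc (r i).
have ci : mleadc (r i) != 0 by rewrite mleadc_eq0.
have c0 : c != 0 by rewrite mulf_neq0 ?invr_eq0 // mleadc_eq0.
pose t := c *: mpolyX K m * r i.
have tz : c *: mpolyX K m != 0.
  rewrite scaler_eq0 (negbTE c0) /= -mleadc_eq0 mleadXm mcoeffX eqxx; exact: oner_neq0.
have leadt : mlead t = mlead (r j).
  rewrite /t mleadM // mleadZ // mleadXm /m; exact: submK.
have Xz : mpolyX K m != 0 by rewrite -mleadc_eq0 mleadXm mcoeffX eqxx oner_neq0.
have leadX : mlead (mpolyX K m * r i) = mlead (r j).
  by rewrite mleadM // mleadXm /m; apply: submK.
have coefX : mcoeff (mlead (r j)) (mpolyX K m * r i) = mleadc (r i).
  by rewrite -leadX mleadM // mleadcM mleadXm mcoeffX eqxx mul1r.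
have coeft : mcoeff (mlead (r j)) t = mleadc (r j).
  by rewrite /t -scalerAl mcoeffZ coefX /c divfK.
pose s := r j - t.
have Cs : C j s.
  rewrite /C /s addrAC; apply: (idD); first by case: (rP j).
  apply: (idN); rewrite /t; apply: (idM).
  have -> : r i = (r i - p i) + p i by rewrite subrK.
  by apply: (idD); [apply: (idS i j) (ltnW ij) _; case: (rP i)|apply: idp].
have snz : s != 0.
  apply/eqP => s0; move: Cs; rewrite s0 /C sub0r => /idN; rewrite opprK => -[q pq].
  by apply: bad; exists j, q.
apply: (rP j).2 Cs _; rewrite lt_neqAle; apply/andP; split; last first.
  by rewrite (le_trans (mleadB_le _ _)) // leadt joinxx.
apply/eqP => e; have := mleadc_eq0 s; rewrite (negbTE snz) e /s mcoeffB coeft subrr.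
by rewrite eqxx.
Qed.

Section Krull.
Variables (K : fieldType) (m : nat) (I : mpoly m K -> Prop) (v : 'I_m -> K).
Local Notation P := (mpoly m K).
Hypotheses (I0 : I 0) (ID : forall f g, I f -> I g -> I (f + g))
  (IM : forall f g, I g -> I (f * g)).
Implicit Types (f g : P).

Definition mvar j : P := mpolyX K (mnm1 j) - mpolyC m (v j).

Lemma meval_mvar j : meval v (mvar j) = 0.
Proof. by rewrite mevalB mevalXU mevalC subrr. Qed.

(* Membership in I + m ^ k, where m is the maximal ideal of the point v. *)
Fixpoint mpow k f : Prop := if k is k'.+1 then
    exists g : 'I_m -> P, (forall j, mpow k' (g j)) /\ I (f - \sum_j mvar j * g j)
  else True.

Lemma ideal_sum (J : Type) (r : seq J) (Q : pred J) (F : J -> P) :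
  (forall j, Q j -> I (F j)) -> I (\sum_(j <- r | Q j) F j).
Proof. by move=> IF; apply: (big_ind I) => // f g; apply: ID. Qed.

Lemma ideal_mpow k f : I f -> mpow k f.
Proof.
elim: k f => //= k IHk f If; exists (fun=> 0); split=> [j|]; first exact: IHk.
by rewrite big1 ?subr0 // => j _; rewrite mulr0.
Qed.

Lemma mpowD k f g : mpow k f -> mpow k g -> mpow k (f + g).
Proof.
elim: k f g => //= k IHk f g [F [kF IF]] [G [kG IG]].
exists (fun j => F j + G j); split=> [j|]; first exact: IHk.
under eq_bigr do rewrite mulrDr; rewrite big_split /= opprD addrACA.
exact: ID.
Qed.

Lemma mpowM k f g : mpow k g -> mpow k (f * g).
Proof.
elim: k f g => //= k IHk f g [G [kG IG]].
exists (fun j => f * G j); split=> [j|]; first exact: IHk.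
under eq_bigr do rewrite mulrCA; rewrite -mulr_sumr -mulrBr.
exact: IM.
Qed.

Lemma mpow_mvar k j g : mpow k g -> mpow k.+1 (mvar j * g).
Proof.
move=> kg; exists (fun l => if l == j then g else 0); split=> [l|].
  by case: (l == j) => //; apply: ideal_mpow.
rewrite (bigD1 j) //= eqxx big1 ?addr0 ?subrr // => l /negbTE->.
by rewrite mulr0.
Qed.

Lemma mpow_sum k (J : Type) (r : seq J) (F : J -> P) :
  (forall j, mpow k (F j)) -> mpow k (\sum_(j <- r) F j).
Proof.
move=> kF; elim: r => [|j r IHr]; first by rewrite big_nil; apply: ideal_mpow.
by rewrite big_cons; apply: mpowD.
Qed.

Lemma mpow_leq k l f : (k <= l)%N -> mpow l f -> mpow k f.
Proof.
elim: l k f => [|l IHl] [|k] f //= kl [F [lF IF]].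
by exists F; split=> // j; apply: IHl.
Qed.

Lemma mpow_mul k l f g : mpow k f -> mpow l g -> mpow (k + l) (f * g).
Proof.
elim: k f g => [|k IHk] f g /=; first by move=> _; apply: mpowM.
move=> [F [kF IF]] lg.
have -> : f * g = g * (f - \sum_j mvar j * F j) + \sum_j mvar j * (F j * g).
  rewrite mulrBr [g * f]mulrC mulr_sumr -addrA [X in _ + X]addrC.
  rewrite -sumrB big1 ?addr0 // => j _; rewrite mulrA [g * _]mulrC [_ * g]mulrC.
  by rewrite mulrA subrr.
apply: (@mpowD (k + l).+1); first by apply/ideal_mpow/IM.
by apply: mpow_sum => j; apply: mpow_mvar; apply: IHk.
Qed.

Definition linpart f : P := \sum_k meval v (mderiv k f) *: mvar k.

Lemma mpow1_mvar j : mpow 1 (mvar j).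
Proof. by rewrite -[mvar j]mulr1; apply: mpow_mvar. Qed.

Lemma mpow_linpart f : mpow 1 (linpart f).
Proof.
by apply: mpow_sum => j; rewrite -mul_mpolyC; apply: mpowM; apply: mpow1_mvar.
Qed.

Lemma taylor2 f : mpow 2 (f - mpolyC m (meval v f) - linpart f).
Proof.
elim/mpoly_ring_ind: f => [c|i|f g Tf Tg|f g Tf Tg].
- apply: ideal_mpow; rewrite mevalC subrr /linpart big1 ?subr0 // => k _.
  by rewrite mderivC meval0 scale0r.
- apply: ideal_mpow; rewrite mevalXU /linpart (bigD1 i) //= big1 => [|k ki].
    by rewrite mderivX mnmE eqxx mnm_subnn mpolyX0 scale1r meval1 scale1r addr0 subrr.
  by rewrite mderivX mnmE eq_sym (negbTE ki) scale0r meval0 scale0r.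
- have -> : linpart (f + g) = linpart f + linpart g.
    by rewrite /linpart -big_split; apply: eq_bigr => k _; rewrite mderivD mevalD scalerDl.
  rewrite mevalD mpolyCD.
  have -> : f + g - (mpolyC m (meval v f) + mpolyC m (meval v g)) - (linpart f + linpart g)
    = (f - mpolyC m (meval v f) - linpart f) + (g - mpolyC m (meval v g) - linpart g) by ring.
  exact: mpowD.
- have -> : linpart (f * g) =
      mpolyC m (meval v g) * linpart f + mpolyC m (meval v f) * linpart g.
    rewrite /linpart !mulr_sumr -big_split; apply: eq_bigr => k _ /=.
    rewrite mderivM mevalD !mevalM scalerDl -!mul_mpolyC !mpolyCM; ring.
  rewrite mevalM mpolyCM.
  have m1 h : mpow 2 (h - mpolyC m (meval v h) - linpart h) -> mpow 1 (h - mpolyC m (meval v h)).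
    move=> m2; rewrite -[_ - _](subrK (linpart h)).
    by apply: mpowD; [apply: mpow_leq m2|apply: mpow_linpart].
  have -> : f * g - mpolyC m (meval v f) * mpolyC m (meval v g) -
      (mpolyC m (meval v g) * linpart f + mpolyC m (meval v f) * linpart g) =
      (f - mpolyC m (meval v f)) * (g - mpolyC m (meval v g)) +
      (mpolyC m (meval v g) * (f - mpolyC m (meval v f) - linpart f) +
       mpolyC m (meval v f) * (g - mpolyC m (meval v g) - linpart g)) by ring.
  apply: mpowD; first by apply: (@mpow_mul 1 1); apply: m1.
  by apply: mpowD; apply: mpowM.
Qed.

(** The Rees algebra of the maximal ideal of v is the subring of P[T] generated by P and the T (x_j
    - v_j). Presenting it as the image of a polynomial ring in 2m variables makes the basis theorem
    applicable to it. *)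
Let Rees := {poly P}.
Let rees_var (j : 'I_(m + m)) : Rees :=
  match fintype.split j with inl i => (mpolyX K (mnm1 i))%:P | inr i => 'X * (mvar i)%:P end.
Lemma rees_morphism : exists Psi : mpoly (m + m) K -> Rees,
  [/\ forall c, Psi (mpolyC _ c) = (mpolyC m c)%:P,
     forall j, Psi (mpolyX K (mnm1 j)) = rees_var j,
     {morph Psi : p q / p + q} & {morph Psi : p q / p * q}].
Proof.
exists (mmap (polyC \o @mpolyC m K) rees_var); split.
- by move=> c; exact: mmapC.
- by move=> j; rewrite mmapX mmap1U.
- exact: mmapD.
- exact: rmorphM.
Qed.

Section Rees.
Variable Psi : mpoly (m + m) K -> Rees.
Hypotheses (PsiC : forall c, Psi (mpolyC _ c) = (mpolyC m c)%:P)
  (PsiX : forall j, Psi (mpolyX K (mnm1 j)) = rees_var j)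
  (PsiD : {morph Psi : p q / p + q}) (PsiM : {morph Psi : p q / p * q}).

Lemma Psi_sum n (F : 'I_n -> mpoly (m + m) K) : Psi (\sum_i F i) = \sum_i Psi (F i).
Proof.
have Psi0 : Psi 0 = 0 by have := PsiC 0; rewrite !mpolyC0.
exact: (big_morph Psi PsiD Psi0).
Qed.

Lemma rees_lift f : exists p, Psi p = f%:P.
Proof.
elim/mpoly_ring_ind: f => [c|i|f g [p ep] [q eq]|f g [p ep] [q eq]].
- by exists (mpolyC _ c).
- exists (mpolyX K (mnm1 (lshift m i))); rewrite PsiX /rees_var.
  by have := unsplitK (inl i : 'I_m + 'I_m); rewrite /unsplit => ->.
- by exists (p + q); rewrite PsiD ep eq polyCD.
- by exists (p * q); rewrite PsiM ep eq polyCM.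
Qed.

Lemma rees_mpow k f : mpow k f ->
  exists p f', Psi p = f'%:P * 'X^k /\ I (f - f').
Proof.
elim: k f => [|k IHk] f /=.
  by move=> _; have [p ep] := rees_lift f; exists p, f; rewrite expr0 mulr1 subrr.
move=> [F [kF IF]].
have [p pP] := choice (fun j => IHk _ (kF j)); have [g gP] := choice pP.
exists (\sum_j mpolyX K (mnm1 (rshift m j)) * p j), (\sum_j mvar j * g j); split.
  rewrite Psi_sum (big_morph polyC (@polyCD _) (polyC0 _)) mulr_suml.
  apply: eq_bigr => j _; rewrite PsiM (gP j).1 PsiX /rees_var.
  have := unsplitK (inr j : 'I_m + 'I_m); rewrite /unsplit => ->.
  rewrite polyCM exprS; ring.
have -> : f - \sum_j mvar j * g j =
    (f - \sum_j mvar j * F j) + \sum_j mvar j * (F j - g j).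
  under [X in _ = _ + X]eq_bigr do rewrite mulrBr.
  by rewrite sumrB addrA subrK.
by apply: ID => //; apply: ideal_sum => j _; apply: IM; case: (gP j).
Qed.

Lemma rees_coef p r : meval v (Psi p)`_r.+1 = 0.
Proof.
elim/mpoly_ring_ind: p r => [c|i|f g ef eg|f g ef eg] r.
- by rewrite PsiC coefC meval0.
- rewrite PsiX /rees_var; case: fintype.split => j; first by rewrite coefC meval0.
  rewrite coefXM /= coefC; case: eqP => _; last by rewrite meval0.
  exact: meval_mvar.
- by rewrite PsiD coefD mevalD (ef r) (eg r) addr0.
- rewrite PsiM coefM (big_morph _ (mevalD v) (meval0 v)) big1 // => -[[|i] ltir] _ /=.
    by rewrite subn0 mevalM eg mulr0.
  by rewrite mevalM ef mul0r.
Qed.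

End Rees.

(** Modulo I, f T^k lies in the Rees algebra for all k. A relation p_n = sum q_i p_i between lifts
    gives, in degree n, coefficients r_i of positive degree n - i, which vanish at v; then u = 1 -
    sum r_i. *)
Lemma krull f : (forall k, mpow k f) -> exists u, meval v u = 1 /\ I (u * f).
Proof.
have [Psi [PsiC PsiX PsiD PsiM]] := rees_morphism.
move=> kf; have [p pP] := choice (fun k => rees_mpow PsiC PsiX PsiD PsiM (kf k)); have [g gP] := choice pP.
have [n [q eq]] := hilbert_basis p.
pose r i := (Psi (q i))`_(n - i).
have gn : g n = \sum_(i < n) r i * g i.
  have := congr1 (fun w => (Psi w)`_n) eq.
  rewrite (gP n).1 coefMXn ltnn subnn coefC /= => ->.
  rewrite (Psi_sum PsiC PsiD) coef_sum; apply: eq_bigr => i _.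
  by rewrite PsiM (gP i).1 mulrA coefMXn ltnNge (ltnW (ltn_ord i)) /= coefMC.
exists (1 - \sum_(i < n) r i); split.
  rewrite mevalB meval1 (big_morph _ (mevalD v) (meval0 v)) big1 ?subr0 // => i _.
  by rewrite /r -(subnSK (ltn_ord i)) (rees_coef PsiC PsiX PsiD PsiM).
have -> : (1 - \sum_(i < n) r i) * f = (f - g n) + \sum_(i < n) r i * (- (f - g i)).
  rewrite mulrBl mul1r mulr_suml {1}gn -addrA; congr (_ + _).
  rewrite -sumrN -[in RHS]sumrN -big_split; apply: eq_bigr => i _ /=; ring.
apply: ID; first by case: (gP n).
by apply: ideal_sum => i _; apply: IM; rewrite -mulN1r; apply: IM; case: (gP i).
Qed.

End Krull.

(** * Growth of the coordinate ring of a connected group *)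

Section ConnectedGroups.
Variables (K : numFieldType) (n : nat).
Local Notation M := 'M[K]_n.
Local Notation P := (mpoly (n * n) K).
Implicit Types (p q u : P) (X Y g : M) (B : set M).

Let one : 'I_(n * n) -> K := fun k => mxvec (1%:M : M) 0 k.
Let y k : P := mvar one k.

Lemma translation_ex g : exists tau : P -> P,
  [/\ forall c, tau (mpolyC _ c) = mpolyC _ c,
     forall i j, tau (xvar K i j) = \sum_l g i l *: xvar K l j,
     {morph tau : p q / p + q} & {morph tau : p q / p * q}].
Proof.
pose h k : P := mxvec (\matrix_(i, j) \sum_l g i l *: xvar K l j) 0 k.
exists (mmap (@mpolyC (n * n) K) h); split.
- by move=> c; exact: mmapC.
- by move=> i j; rewrite /xvar mmapX mmap1U /h mxvecE mxE.
- exact: mmapD.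
- exact: rmorphM.
Qed.

Lemma translation_eval g tau x p :
  (forall c, tau (mpolyC _ c) = mpolyC _ c) ->
  (forall i j, tau (xvar K i j) = \sum_l g i l *: xvar K l j) ->
  {morph tau : p q / p + q} -> {morph tau : p q / p * q} ->
  mxeval (tau p) x = mxeval p (g *m x).
Proof.
move=> tC tX tD tM; elim/mpoly_xvar_ind: p => [c|i j|p q ep eq|p q ep eq].
- by rewrite tC !mxevalC.
- rewrite tX mxeval_var mxeval_sum mxE; apply: eq_bigr => l _.
  by rewrite mxevalZ mxeval_var.
- by rewrite tD !mxevalD ep eq.
- by rewrite tM !mxevalM ep eq.
Qed.

Lemma translation_invder g tau X p :
  (forall c, tau (mpolyC _ c) = mpolyC _ c) ->
  (forall i j, tau (xvar K i j) = \sum_l g i l *: xvar K l j) ->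
  {morph tau : p q / p + q} -> {morph tau : p q / p * q} ->
  invder X (tau p) = tau (invder X p).
Proof.
move=> tC tX tD tM; have tZ c q : tau (c *: q) = c *: tau q.
  by rewrite -mul_mpolyC tM tC mul_mpolyC.
have t0 : tau 0 = 0 by have := tC 0; rewrite mpolyC0.
elim/mpoly_xvar_ind: p => [c|i j|p q ep eq|p q ep eq].
- by rewrite tC !invderC t0.
- rewrite tX invder_sum invder_var (big_morph tau tD t0).
  transitivity (\sum_l \sum_k (g i l * X k j) *: xvar K l k).
    apply: eq_bigr => l _; rewrite invderZ invder_var scaler_sumr.
    by apply: eq_bigr => k _; rewrite scalerA.
  rewrite exchange_big; apply: eq_bigr => k _ /=.
  by rewrite tZ tX scaler_sumr; apply: eq_bigr => l _; rewrite scalerA mulrC.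
- by rewrite tD !invderD tD ep eq.
- by rewrite tM !invderM tD !tM ep eq.
Qed.

Variable B : set M.
Hypothesis sB : subgroup_GL B.
Let I := vanishing B.

Let I0 : I 0. Proof. by move=> g _; rewrite mxeval0. Qed.
Let ID p q : I p -> I q -> I (p + q).
Proof. by move=> Ip Iq g Bg; rewrite mxevalD Ip // Iq // addr0. Qed.
Let IM p q : I q -> I (p * q).
Proof. by move=> Iq g Bg; rewrite mxevalM Iq // mulr0. Qed.

(** Duality in finite dimension: the Lie algebra is the annihilator of the space of differentials at
    1 of the ideal, so that space is the annihilator of the Lie algebra. *)
Lemma lie_annihilator (a : 'I_(n * n) -> K) :
  (forall X, lie_algebra B X -> \sum_k a k * mxvec X 0 k = 0) ->
  exists p, I p /\ forall k, mxeval (mderiv k p) 1%:M = a k.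
Proof.
move=> a0; pose S (w : 'rV[K]_(n * n)) := exists p, I p /\
  forall k, mxeval (mderiv k p) 1%:M = w 0 k.
have S0 : S 0 by exists 0; split=> // k; rewrite mderiv0 mxeval0 mxE.
have SP c (u w : 'rV[K]_(n * n)) : S u -> S w -> S (c *: u + w).
  move=> [p [Ip pu]] [q [Iq qw]]; exists (c *: p + q); split.
    by apply: ID => //; rewrite -mul_mpolyC; apply: IM.
  by move=> k; rewrite mderivD mderivZ mxevalD mxevalZ pu qw !mxE.
have [W SW] := vspace_of S0 SP.
pose A : 'M[K]_(\dim W, n * n) := \matrix_(i < \dim W) (vbasis W)`_i.
have memW w : (w <= A)%MS -> w \in W.
  move=> /submxP[D ->]; rewrite mulmx_sum_row; apply: rpred_sum => i _.
  by rewrite rpredZ // rowK vbasis_mem // mem_nth // size_tuple.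
pose w : 'rV[K]_(n * n) := \row_k a k.
have [wA|nwA] := boolP (w <= A)%MS.
  have /SW[p [Ip pw]] := memW _ wA; exists p; split=> // k.
  by rewrite pw mxE.
have [j wj] : exists j, (w *m cokermx A) 0 j != 0.
  apply/existsP; apply: contraR nwA; rewrite negb_exists submxE => /forallP h.
  by apply/eqP/rowP => j; have := h j; rewrite negbK => /eqP->; rewrite mxE.
(* A column of the cokernel is a vector killed by all these differentials, hence in the Lie algebra,
   but not by a. *)
pose X : M := vec_mx (row j (cokermx A)^T).
have eX (u : 'rV[K]_(n * n)) : (u *m cokermx A) 0 j = \sum_k u 0 k * mxvec X 0 k.
  rewrite mxE; apply: eq_bigr => k _; congr (_ * _).
  by rewrite vec_mxK !mxE.
case/eqP: wj; rewrite eX -[RHS](a0 X); first by apply: eq_bigr => k _; rewrite mxE.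
move=> p Ip; rewrite -[LHS]/(\sum_k _) /=.
pose dp : 'rV[K]_(n * n) := \row_k mxeval (mderiv k p) 1%:M.
have dpW : dp \in W by apply/SW; exists p; split=> // k; rewrite mxE.
have dpA : (dp <= A)%MS.
  rewrite (coord_vbasis dpW); apply: summx_sub => i _; apply: scalemx_sub.
  by rewrite -(rowK (fun i : 'I_(\dim W) => (vbasis W)`_i) i) row_sub.
move: dpA; rewrite submxE => /eqP/matrixP/(_ 0 j); rewrite eX mxE => h.
by rewrite -[RHS]h; apply: eq_bigr => k _; rewrite mxE.
Qed.

(** Such a linear form is the linear part of some p in the ideal, and Taylor's formula puts their
    difference into m^2: the cotangent space of B at 1 is dual to its Lie algebra. *)
Lemma linear_mpow2 (a : 'I_(n * n) -> K) :
  (forall X, lie_algebra B X -> \sum_k a k * mxvec X 0 k = 0) ->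
  mpow I one 2 (\sum_k a k *: y k).
Proof.
move=> /lie_annihilator[p [Ip pa]].
have -> : \sum_k a k *: y k = linpart one p.
  by apply: eq_bigr => k _; rewrite -pa.
have -> : linpart one p = p - (p - mpolyC _ (meval one p) - linpart one p).
  have [_ B1 _ _] := sB; have : mxeval p 1%:M = 0 by apply: Ip.
  by rewrite /mxeval -/one => ->; rewrite mpolyC0 subr0 opprB addrC subrK.
rewrite -[X in _ - X]opprK; apply: mpowD => //; first exact: ideal_mpow.
by rewrite opprK -mulN1r; apply: mpowM => //; apply: taylor2.
Qed.

Variables (d : nat) (b : d.-tuple M).
Hypotheses (b_free : free b) (b_span : forall X, lie_algebra B X <-> X \in <<b>>%VS).

Let LieX (i : 'I_d) : lie_algebra B b`_i.
Proof. by apply/b_span/memv_span; rewrite mem_nth ?size_tuple. Qed.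

Definition lie_word (s : seq 'I_d) p : P := foldr (fun (i : 'I_d) q => invder b`_i q) p s.

(** The t i are linear coordinates at 1 dual to the basis b, and [theta] is the Euler vector field
    that they define along the invariant derivations. *)
Let t (i : 'I_d) : P := \sum_k coord b i (vec_mx (delta_mx 0 k)) *: y k.
Let theta p : P := \sum_i t i * invder b`_i p.

Let coordE i X : \sum_k coord b i (vec_mx (delta_mx 0 k)) * mxvec X 0 k = coord b i X.
Proof.
rewrite -{2}[X]mxvecK {2}(row_sum_delta (mxvec X)) !linear_sum.
by apply: eq_bigr => k _; rewrite !linearZ /= mulrC.
Qed.

Let t1 i : mpow I one 1 (t i).
Proof.
apply: mpow_sum => // k; rewrite -mul_mpolyC; apply: mpowM => //.
exact: mpow1_mvar.
Qed.

Let thetaM p q : theta (p * q) = theta p * q + p * theta q.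
Proof.
rewrite /theta mulr_suml mulr_sumr -big_split; apply: eq_bigr => i _ /=.
rewrite invderM; ring.
Qed.

Let thetaD p q : theta (p + q) = theta p + theta q.
Proof.
rewrite /theta -big_split; apply: eq_bigr => i _ /=.
by rewrite invderD mulrDr.
Qed.

Let theta_sum (J : Type) (r : seq J) (F : J -> P) :
  theta (\sum_(j <- r) F j) = \sum_(j <- r) theta (F j).
Proof.
apply: (big_morph theta thetaD); apply: big1 => i _.
by rewrite /invder big1 ?mulr0 // => l _; rewrite big1 // => l' _; rewrite mderiv0 mul0r.
Qed.

Let theta_ideal p : I p -> I (theta p).
Proof.
move=> Ip; apply: ideal_sum => // i _; apply: IM.
exact: lie_invder.
Qed.

Let invder_y X i j : invder X (y (mxvec_index i j)) =
  mpolyC _ (X i j) + \sum_l X l j *: y (mxvec_index i l).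
Proof.
have yE i' j' : y (mxvec_index i' j') = xvar K i' j' - mpolyC _ ((1%:M : M) i' j').
  by rewrite /y /mvar /one mxvecE.
rewrite yE -[- mpolyC _ _]mulN1r -(mpolyC1 (n * n) K) -mpolyCN -mpolyCM invderD invderC addr0.
rewrite invder_var; under [in RHS]eq_bigr do rewrite yE scalerBr.
rewrite sumrB addrC -addrA -[LHS]addr0; congr (_ + _).
apply/esym/eqP; rewrite addrC subr_eq0; apply/eqP.
rewrite (bigD1 i) //= big1 ?addr0 => [|l li].
  by rewrite mxE eqxx -mul_mpolyC mulr1.
by rewrite mxE eq_sym (negbTE li) mpolyC0 scaler0.
Qed.

(** To first order [theta] replaces the linear form [y k] by one with the same values on the Lie
    algebra, and [linear_mpow2] absorbs the difference. *)
Let theta_y k : mpow I one 2 (theta (y k) - y k).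
Proof.
case/mxvec_indexP: k => i j; set k := mxvec_index i j.
have -> : theta (y k) - y k =
    (\sum_(l < d) b`_l i j *: t l - y k) +
    \sum_(r < d) t r * \sum_l b`_r l j *: y (mxvec_index i l).
  rewrite addrAC; congr (_ - _); rewrite /theta -big_split; apply: eq_bigr => l _ /=.
  by rewrite invder_y mulrDr -mul_mpolyC [mpolyC _ _ * _]mulrC.
apply: mpowD => //; last first.
  apply: mpow_sum => // r; apply: (@mpow_mul _ _ _ _ I0 ID IM 1 1) => //.
  apply: mpow_sum => // l; rewrite -mul_mpolyC; apply: mpowM => //.
  exact: mpow1_mvar.
have -> : \sum_(l < d) b`_l i j *: t l - y k = \sum_k'
    (\sum_(l < d) b`_l i j * coord b l (vec_mx (delta_mx 0 k')) - (k' == k)%:R) *: y k'.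
  under [RHS]eq_bigr do rewrite scalerBl scaler_suml.
  rewrite sumrB exchange_big /=; congr (_ - _).
    apply: eq_bigr => l _; rewrite scaler_sumr; apply: eq_bigr => k' _.
    by rewrite scalerA.
  rewrite (bigD1 k) //= eqxx scale1r big1 ?addr0 // => k' /negbTE->.
  by rewrite scale0r.
apply: linear_mpow2 => X /b_span bX.
under eq_bigr do rewrite mulrBl mulr_suml.
rewrite sumrB exchange_big /= [X in _ - X](bigD1 k) //= eqxx mul1r.
rewrite [X in _ - (_ + X)]big1 ?addr0 => [|k' /negbTE->]; last by rewrite mul0r.
rewrite /k mxvecE {2}(coord_span bX) summxE; apply/eqP; rewrite subr_eq0; apply/eqP.
apply: eq_bigr => l _; rewrite mxE -coordE mulr_suml.
by apply: eq_bigr => k' _; rewrite -mulrA [RHS]mulrC.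
Qed.

(* Euler's identity: [theta] acts on the k-th graded piece of the local ring at 1
   as multiplication by k. *)
Let euler k p : mpow I one k p -> mpow I one k.+1 (theta p - k%:R *: p).
Proof.
elim: k p => [|k IHk] p.
  rewrite scale0r subr0 => _; apply: mpow_sum => // i; rewrite mulrC.
  by apply: mpowM.
move=> [F [kF IF]]; set r := p - _ in IF.
have ep : p = r + \sum_k y k * F k by rewrite /r subrK.
have -> : theta p - k.+1%:R *: p = (theta r - k.+1%:R *: r) +
    \sum_j ((theta (y j) - y j) * F j + y j * (theta (F j) - k%:R *: F j)).
  have e1 : theta p = theta r + \sum_j theta (y j * F j) by rewrite {1}ep thetaD theta_sum.
  have e2 : k.+1%:R *: p = k.+1%:R *: r + \sum_j k.+1%:R *: (y j * F j).
    by rewrite {1}ep scalerDr scaler_sumr.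
  rewrite e1 e2 opprD addrACA.
  congr (_ + _); rewrite -sumrB; apply: eq_bigr => j _.
  rewrite thetaM -!mul_mpolyC -(addn1 k) natrD mpolyCD mpolyC1; ring.
apply: mpowD => //.
  apply: ideal_mpow => //; apply: ID; first exact: theta_ideal.
  by rewrite -scaleNr -mul_mpolyC; apply: IM.
apply: mpow_sum => // j; apply: mpowD => //.
  by apply: (@mpow_mul _ _ _ _ I0 ID IM 2 k); [apply: theta_y|apply: kF].
by apply: (mpow_mvar I0); apply: IHk; apply: kF.
Qed.

(** The hypothesis passes to the derivatives of p, and induction puts [theta p] one step deeper in
    the filtration. By Euler's identity this is k p up to deeper terms, and k is invertible; order
    one, where k would be 0, comes from Taylor's formula instead. *)
Lemma words_mpow k p : (forall s, mxeval (lie_word s p) 1%:M = 0) -> mpow I one k p.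
Proof.
elim: k p => [|k IHk] p p0 //.
have tk : mpow I one k.+1 (theta p).
  apply: mpow_sum => // i; rewrite -add1n; apply: mpow_mul => //; apply: IHk => s.
  by have := p0 (rcons s i); rewrite /lie_word foldr_rcons.
case: k IHk tk => [_ _|k IHk tk].
  have -> : p = (p - mpolyC _ (meval one p) - linpart one p) + linpart one p.
    have := p0 [::]; rewrite /= /mxeval -/one => ->.
    by rewrite mpolyC0 subr0 subrK.
  by apply: mpowD => //; [apply: (@mpow_leq _ _ I one 1 2) => //; apply: taylor2|apply: mpow_linpart].
have k0 : (k.+1%:R : K) != 0 by rewrite pnatr_eq0.
have -> : p = mpolyC _ k.+1%:R^-1 * (theta p + mpolyC _ (-1) * (theta p - k.+1%:R *: p)).
  rewrite mpolyCN mpolyC1 mulN1r opprB addrC subrK -mul_mpolyC mulrA -mpolyCM.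
  by rewrite mulVf // mpolyC1 mul1r.
apply: mpowM => //; apply: mpowD => //; apply: mpowM => //.
by apply: euler; apply: IHk.
Qed.

Lemma vanishing_near_one p : (forall s, mxeval (lie_word s p) 1%:M = 0) ->
  exists u, mxeval u 1%:M = 1 /\ I (u * p).
Proof. by move=> p0; apply: (krull I0 ID IM) => k; apply: words_mpow. Qed.

(** Every derivation costs one power of u: u^(k+1) D q equals u D (u^k q) up to a multiple of u^k
    q. *)
Lemma vanishing_words u p s x : I (u * p) -> B x -> mxeval u x != 0 ->
  mxeval (lie_word s p) x = 0.
Proof.
move=> Iup Bx ux; suff [k Ik] : exists k, I (u ^+ k * lie_word s p).
  have /eqP := Ik x Bx; rewrite mxevalM mulf_eq0 => /orP[|/eqP//].
  suff -> : mxeval (u ^+ k) x = mxeval u x ^+ k by rewrite expf_eq0 (negbTE ux) andbF.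
  by elim: k {Ik} => [|k IHk]; rewrite ?expr0 ?mxeval1 // !exprS mxevalM IHk.
elim: s => [|i s [k IHs]] /=; first by exists 1%N; rewrite expr1.
exists k.+1; set q := lie_word s p in IHs *.
have Du : exists w, invder b`_i (u ^+ k) * u = w * u ^+ k.
  elim: (k) => [|l [w ew]].
    by exists 0; rewrite expr0 -(mpolyC1 (n * n) K) invderC !mul0r.
  exists (invder b`_i u + w); rewrite exprS invderM mulrDl mulrDl.
  congr (_ + _); first by rewrite -mulrA [_ ^+ l * _]mulrC.
  by rewrite -mulrA ew; ring.
have [w ew] := Du.
have -> : u ^+ k.+1 * invder b`_i q = u * invder b`_i (u ^+ k * q) - w * (u ^+ k * q).
  by rewrite invderM mulrA -ew exprS; ring.
rewrite -mulN1r; apply: ID; apply: (IM); last exact: (IM).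
exact: lie_invder.
Qed.

(* The points of B at which all the invariant derivatives of p vanish form a
   closed subset, and an open one by translation to 1. *)
Lemma connected_words_vanishing p : closed_subgroup B -> zconnected B ->
  (forall s, mxeval (lie_word s p) 1%:M = 0) -> I p.
Proof.
move=> cB coB p0; have [BU B1 BM BV] := sB.
pose Z : set (zariski K n) := [set g | B g /\ forall s, mxeval (lie_word s p) g = 0].
suff eZ : Z = B by move=> g; rewrite -[B]eZ => -[_ /(_ [::])].
apply: coB; first by exists 1%:M.
  pose Rs := [set r : P | forall x, B x -> mxeval r x != 0 -> Z x].
  exists (~` zeros Rs); first by exists Rs; rewrite setCK.
  apply/seteqP; split=> [g [Bg gp]|g [Bg]]; last first.
    by move=> /existsNP[r /not_implyP[Rr /eqP rg]]; apply: Rr.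
  split=> // zg.
  have [tau [tC tX tD tM]] := translation_ex g.
  have tW s : lie_word s (tau p) = tau (lie_word s p).
    elim: s => //= i s ->; exact: translation_invder.
  have [u [u1 Iu]] : exists u, mxeval u 1%:M = 1 /\ I (u * tau p).
    apply: vanishing_near_one => s; rewrite tW (translation_eval _ _ tC tX tD tM).
    by rewrite mulmx1.
  have gu : g \in unitmx := BU _ Bg.
  have [sig [sC sX sD sM]] := translation_ex (invmx g).
  have : mxeval (sig u) g = 0.
    apply: zg => x Bx; rewrite (translation_eval _ _ sC sX sD sM) => ux.
    split=> // s; have := vanishing_words s Iu (BM _ _ (BV _ Bg) Bx) ux.
    by rewrite tW (translation_eval _ _ tC tX tD tM) mulmxA mulmxV // mul1mx.
  rewrite (translation_eval _ _ sC sX sD sM) mulVmx // u1 => /eqP.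
  by rewrite oner_eq0.
have [_ [Y cY eY]] := cB.
exists (Y `&` zeros [set lie_word s p | s in setT]).
  apply: closedI => //; rewrite -[zeros _]setCK; apply: open_closedC.
  by exists [set lie_word s p | s in setT]; rewrite setCK.
apply/seteqP; split=> [g [Bg gp]|g [Bg [_ zg]]]; last first.
  by split=> // s; apply: zg; exists s.
split=> //; split; last by move=> _ [s _ <-].
by move: Bg; rewrite eY => -[].
Qed.

End ConnectedGroups.

(** * Reordering words in a Lie algebra of operators *)

Lemma perm_swap_invariant (T : eqType) (R : Type) (f : seq T -> R) (m : nat) :
  (forall u i j w, size (u ++ [:: i, j & w]) = m ->
     f (u ++ [:: i, j & w]) = f (u ++ [:: j, i & w])) ->
  forall s t, size s = m -> perm_eq s t -> f s = f t.
Proof.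
move=> fsw; have move_right u i t1 t2 : size (u ++ i :: t1 ++ t2) = m ->
    f (u ++ i :: t1 ++ t2) = f (u ++ t1 ++ i :: t2).
  elim: t1 u => //= j t1 IHt u sz; rewrite fsw //.
  have := IHt (rcons u j); rewrite !cat_rcons; apply.
  by rewrite -sz !size_cat.
suff E s : forall u t, size (u ++ s) = m -> perm_eq s t -> f (u ++ s) = f (u ++ t).
  by move=> s t; apply: (E s [::]).
elim: s => [|i s IHs] u t sz pst.
  by have /eqP := perm_size pst; rewrite eq_sym size_eq0 => /eqP->.
have it : i \in t by rewrite -(perm_mem pst) mem_head.
case/splitPr: it pst => t1 t2 pst.
have pst' : perm_eq s (t1 ++ t2).
  rewrite -(perm_cons i) (perm_trans pst) // -[i :: t2]cat1s -[i :: _ ++ _]cat1s.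
  by rewrite perm_catCA.
rewrite -cat_rcons (IHs (rcons u i) (t1 ++ t2)) ?cat_rcons // move_right //.
by rewrite -sz !size_cat /= (perm_size pst').
Qed.

Section Words.
Variables (K : fieldType) (V : lmodType K) (d : nat) (D : 'I_d -> V -> V).
Hypothesis D_lin : forall i a u v, D i (a *: u + v) = a *: D i u + D i v.
Variable c : 'I_d -> 'I_d -> 'I_d -> K.
Hypothesis D_br : forall i j v, D i (D j v) = D j (D i v) + \sum_k c i j k *: D k v.

Definition op_word (s : seq 'I_d) v := foldr D v s.

Lemma op_word_cat s t v : op_word (s ++ t) v = op_word s (op_word t v).
Proof. exact: foldr_cat. Qed.

Lemma op_word_linear s a u v : op_word s (a *: u + v) = a *: op_word s u + op_word s v.
Proof. by elim: s => //= i s ->; rewrite D_lin. Qed.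

Lemma op_word0 s : op_word s 0 = 0.
Proof.
have := op_word_linear s 1 0 0; rewrite !scale1r addr0 => /esym/eqP.
by rewrite -subr_eq0 addrK => /eqP.
Qed.

Lemma op_word_sum s (I : Type) (r : seq I) (a : I -> K) (F : I -> V) :
  op_word s (\sum_(i <- r) a i *: F i) = \sum_(i <- r) a i *: op_word s (F i).
Proof.
elim: r => [|i r IHr]; first by rewrite !big_nil op_word0.
by rewrite !big_cons op_word_linear IHr.
Qed.

Definition canonical_word (s : seq 'I_d) : seq 'I_d :=
  flatten [seq nseq (count_mem i s) i | i <- enum 'I_d].

Lemma perm_canonical_word s : perm_eq s (canonical_word s).
Proof.
apply/allP => j _ /=; apply/eqP; rewrite /canonical_word count_flatten -map_comp.
rewrite (eq_map (g := fun i => if i == j then count_mem j s else 0%N)) => [|i /=]; last first.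
  by rewrite count_nseq /=; case: eqP => [->|_]; rewrite ?mul1n ?mul0n.
rewrite sumnE big_map big_enum /= (bigD1 j) //= eqxx big1 ?addn0 // => i /negbTE->.
by [].
Qed.

Variable lam : V -> K.
Hypothesis lam_lin : forall a u v, lam (a *: u + v) = a * lam u + lam v.

Let lam0 : lam 0 = 0.
Proof.
have := lam_lin 1 0 0; rewrite scale1r addr0 mul1r => /esym/eqP.
by rewrite -subr_eq0 addrK => /eqP.
Qed.

Let lam_sum (I : Type) (r : seq I) (a : I -> K) (F : I -> V) :
  lam (\sum_(i <- r) a i *: F i) = \sum_(i <- r) a i * lam (F i).
Proof.
elim: r => [|i r IHr]; first by rewrite !big_nil lam0.
by rewrite !big_cons lam_lin IHr.
Qed.

(* The easy half of the Poincare-Birkhoff-Witt theorem: modulo shorter words the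
   letters commute. *)
Lemma words_vanishing v : (forall s, lam (op_word (canonical_word s) v) = 0) ->
  forall s, lam (op_word s v) = 0.
Proof.
move=> cw0; suff E m : forall s, size s = m -> lam (op_word s v) = 0.
  by move=> s; exact: E.
elim/ltn_ind: m => m IHm s sz.
rewrite -(cw0 s).
apply: (@perm_swap_invariant _ _ (fun s => lam (op_word s v)) m) => //; last first.
  exact: perm_canonical_word.
move=> u i j w {}sz; rewrite !op_word_cat /= D_br -[X in X + _]scale1r op_word_linear lam_lin mul1r.
rewrite op_word_sum lam_sum big1 ?addr0 // => k _.
rewrite -[D k _]/(op_word (k :: w) v) -op_word_cat (IHm (size (u ++ k :: w))) ?mulr0 //.
by rewrite -sz !size_cat /= !addnS.
Qed.

Fixpoint exp_word (l : seq 'I_d) (es : seq nat) v :=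
  match l, es with i :: l', e :: es' => iter e (D i) (exp_word l' es' v) | _, _ => v end.

Lemma canonical_exp_word s v :
  op_word (canonical_word s) v = exp_word (enum 'I_d) [seq count_mem i s | i <- enum 'I_d] v.
Proof.
rewrite /canonical_word; elim: (enum 'I_d) => //= i l IHl.
rewrite op_word_cat IHl; by elim: (count_mem i s) => //= k ->.
Qed.

End Words.

Section Recurrence.
Variables (K : fieldType) (V : lmodType K) (D : V -> V).
Hypothesis D_lin : forall a u v, D (a *: u + v) = a *: D u + D v.
Variable lam : V -> K.
Hypothesis lam_lin : forall a u v, lam (a *: u + v) = a * lam u + lam v.

Definition kill (rs : seq K) v := foldr (fun a w => eigop D a w) v rs.

Lemma kill_expand rs : exists r : nat -> K, forall v,
  kill rs v = iter (size rs) D v + \sum_(a < size rs) r a *: iter a D v.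
Proof.
have D0 : D 0 = 0.
  have := D_lin 1 0 0; rewrite !scale1r addr0 => /esym/eqP.
  by rewrite -subr_eq0 addrK => /eqP.
have DD u v : D (u + v) = D u + D v by rewrite -[u]scale1r D_lin !scale1r.
have DZ a u : D (a *: u) = a *: D u by rewrite -[_ *: u]addr0 D_lin D0 addr0.
elim: rs => [|b rs [r IHr]]; first by exists (fun=> 0) => v; rewrite big_ord0 addr0.
exists (fun a => (if a is a'.+1 then r a' else 0) - b * (if a == size rs then 1 else r a)).
move=> v; rewrite /= IHr /eigop DD (big_morph D DD D0) -addrA; congr (_ + _).
transitivity (\sum_(i < size rs) r i *: iter i.+1 D v -
    (b *: iter (size rs) D v + \sum_(a < size rs) (b * r a) *: iter a D v)).
  congr (_ - _); first by apply: eq_bigr => i _; rewrite DZ.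
  rewrite scalerDr scaler_sumr; congr (_ + _).
  by apply: eq_bigr => a _; rewrite scalerA.
transitivity (\sum_(a < (size rs).+1) ((if (a : nat) is a'.+1 then r a' else 0) *: iter a D v) -
    \sum_(a < (size rs).+1) (b * (if a == size rs :> nat then 1 else r a)) *: iter a D v).
  congr (_ - _).
    by rewrite big_ord_recl /= scale0r add0r.
  rewrite big_ord_recr /= eqxx mulr1 addrC; congr (_ + _).
  by apply: eq_bigr => a _; rewrite /= ltn_eqF.
by rewrite -sumrB; apply: eq_bigr => a _; rewrite scalerBl.
Qed.

(** The vanishing of [kill rs v] is a monic linear recurrence of order [size rs] for the sequence
    lam (D^a v), which is thus determined by its first terms. *)
Lemma kill_recurrence rs v : kill rs v = 0 ->
  (forall a, (a < size rs)%N -> lam (iter a D v) = 0) -> forall a, lam (iter a D v) = 0.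
Proof.
have [r er] := kill_expand rs; move=> rv bnd.
have lam0 : lam 0 = 0.
  have := lam_lin 1 0 0; rewrite scale1r addr0 mul1r => /esym/eqP.
  by rewrite -subr_eq0 addrK => /eqP.
have D0 : D 0 = 0.
  have := D_lin 1 0 0; rewrite !scale1r addr0 => /esym/eqP.
  by rewrite -subr_eq0 addrK => /eqP.
have lam_sum m (F : 'I_m -> K) (G : 'I_m -> V) :
    lam (\sum_i F i *: G i) = \sum_i F i * lam (G i).
  elim: m F G => [|m IHm] F G; first by rewrite !big_ord0 lam0.
  by rewrite !big_ord_recl lam_lin IHm.
elim/ltn_ind => a IHa; have [/bnd//|sa] := ltnP a (size rs).
have killD j : kill rs (iter j D v) = 0.
  have comm b w : eigop D b (D w) = D (eigop D b w).
    by have := eigop_comm D_lin b 0 w; rewrite /eigop !scale0r !subr0 => ->.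
  have killC l w : kill l (D w) = D (kill l w).
    by elim: l => //= b l ->; rewrite comm.
  by elim: j => //= j IHj; rewrite killC IHj D0.
have := er (iter (a - size rs) D v); rewrite killD -iterD subnKC // => /esym/eqP.
rewrite addr_eq0 => /eqP ->; rewrite -scaleN1r -[_ *: _]addr0 lam_lin lam0 addr0.
rewrite lam_sum big1 ?mulr0 // => i _; rewrite -iterD IHa ?mulr0 //.
by have := ltn_ord i; lia.
Qed.

End Recurrence.

(** * Invariant derivations on polynomials of bounded degree *)

Section BoundedDegree.
Variables (K : numClosedFieldType) (n : nat).
Local Notation M := 'M[K]_n.+1.
Local Notation P := (mpoly (n.+1 * n.+1) K).
Implicit Types (p q : P) (X Y g : M) (B : set M).

(** Splitting off one variable at a time is the form in which the degree is used: products of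
    variables are treated by induction on N through the Leibniz rule. *)
Fixpoint deg_le N p : Prop := if N is N'.+1 then
  exists (c : K) (g : 'I_n.+1 -> 'I_n.+1 -> P), (forall i j, deg_le N' (g i j)) /\
    p = mpolyC _ c + \sum_i \sum_j xvar K i j * g i j
  else exists c, p = mpolyC _ c.

Lemma deg_leC N c : deg_le N (mpolyC _ c).
Proof.
elim: N c => [|N IHN] c; first by exists c.
exists c, (fun _ _ => mpolyC _ 0); split=> [i j|]; first exact: IHN.
rewrite big1 ?addr0 // => i _; rewrite big1 // => j _.
by rewrite mpolyC0 mulr0.
Qed.

Lemma deg_leD N p q : deg_le N p -> deg_le N q -> deg_le N (p + q).
Proof.
elim: N p q => [|N IHN] p q.
  by move=> [c ->] [c' ->]; exists (c + c'); rewrite mpolyCD.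
move=> [c [g [gN ->]]] [c' [g' [g'N ->]]].
exists (c + c'), (fun i j => g i j + g' i j); split=> [i j|]; first by apply: IHN; [apply: gN|apply: g'N].
rewrite mpolyCD addrACA; congr (_ + _); rewrite -big_split; apply: eq_bigr => i _ /=.
by rewrite -big_split; apply: eq_bigr => j _ /=; rewrite mulrDr.
Qed.

Lemma deg_leZ N a p : deg_le N p -> deg_le N (a *: p).
Proof.
elim: N p => [|N IHN] p; first by move=> [c ->]; exists (a * c); rewrite mpolyCM mul_mpolyC.
move=> [c [g [gN ->]]]; exists (a * c), (fun i j => a *: g i j); split=> [i j|]; first exact: (IHN _ (gN i j)).
rewrite scalerDr mpolyCM mul_mpolyC scaler_sumr; congr (_ + _); apply: eq_bigr => i _.
by rewrite scaler_sumr; apply: eq_bigr => j _; rewrite scalerAr.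
Qed.

Lemma deg_leS N p : deg_le N p -> deg_le N.+1 p.
Proof.
elim: N p => [|N IHN] p; first by move=> [c ->]; apply: deg_leC.
by move=> [c [g [gN ->]]]; exists c, g; split=> // i j; apply: IHN; apply: gN.
Qed.

Lemma deg_le_leq N N' p : (N <= N')%N -> deg_le N p -> deg_le N' p.
Proof. by move=> /subnK<- pN; elim: (N' - N)%N => //= k; apply: deg_leS. Qed.

Lemma deg_le_sum N (I : Type) (r : seq I) (F : I -> P) :
  (forall i, deg_le N (F i)) -> deg_le N (\sum_(i <- r) F i).
Proof.
move=> FN; elim: r => [|i r IHr]; first by rewrite big_nil -(mpolyC0 (n.+1 * n.+1) K); apply: deg_leC.
by rewrite big_cons; apply: deg_leD.
Qed.

Lemma deg_leM N N' p q : deg_le N p -> deg_le N' q -> deg_le (N + N') (p * q).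
Proof.
elim: N p => [|N IHN] p.
  by move=> [c ->] qN; rewrite mul_mpolyC; apply: deg_leZ.
move=> [c [g [gN ->]]] qN; rewrite mulrDl; apply: deg_leD.
  by rewrite mul_mpolyC; apply: deg_leZ; apply: deg_le_leq qN; rewrite leq_addl.
exists 0, (fun i j => g i j * q); split=> [i j|]; first exact: (IHN _ (gN i j)).
rewrite mpolyC0 add0r mulr_suml; apply: eq_bigr => i _.
by rewrite mulr_suml; apply: eq_bigr => j _; rewrite mulrA.
Qed.

Lemma deg_leX N p e : deg_le N p -> deg_le (N * e) (p ^+ e).
Proof.
move=> pN; elim: e => [|e IHe]; first by rewrite muln0 expr0 -mpolyC1; apply: deg_leC.
by rewrite exprS mulnS; apply: deg_leM.
Qed.

Lemma deg_le_var i j : deg_le 1 (xvar K i j).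
Proof.
exists 0, (fun i' j' => mpolyC _ ((i' == i) && (j' == j))%:R); split=> [i' j'|].
  by eexists.
rewrite mpolyC0 add0r (bigD1 i) //= (bigD1 j) //= !eqxx mpolyC1 mulr1.
rewrite [X in _ + X + _]big1 => [|j' /negbTE->]; last by rewrite andbF mpolyC0 mulr0.
rewrite [X in _ + X]big1 ?addr0 // => i' /negbTE->.
by rewrite big1 // => j' _; rewrite mpolyC0 mulr0.
Qed.

Lemma deg_le_invder N X p : deg_le N p -> deg_le N (invder X p).
Proof.
elim: N p => [|N IHN] p.
  by move=> [c ->]; rewrite invderC -(mpolyC0 (n.+1 * n.+1) K); exists 0.
move=> [c [g [gN ->]]]; rewrite invderD invderC add0r invder_sum.
apply: deg_le_sum => i; rewrite invder_sum; apply: deg_le_sum => j.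
rewrite invderM invder_var; apply: deg_leD; rewrite -add1n; apply: deg_leM.
- by apply: deg_le_sum => l; apply/deg_leZ/deg_le_var.
- exact: gN.
- exact: deg_le_var.
- exact: (IHN _ (gN i j)).
Qed.

(** Each variable is killed by the power n + 1 of the derivation, and these orders add along
    products of at most N variables; the extra 1 kills the constants. *)
Lemma nilp_kill X N p : X ^+ n.+1 = 0 -> deg_le N p ->
  iter (n.+1 * N).+1 (eigop (invder X) 0) p = 0.
Proof.
move=> Xn; have Dl := invder_lin X.
have varX i j : iter n.+1 (eigop (invder X) 0) (xvar K i j) = 0.
  rewrite -[xvar K i j]invder_id iter_eigop_invder_var iter_mul_eigop.
  by rewrite raddf0 subr0 Xn mul0r invder0l.
elim: N p => [|N IHN] p.
  by move=> [c ->]; rewrite muln0 /= /eigop invderC scale0r subr0.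
move=> [c [g [gN ->]]]; rewrite iter_eigopD // !iter_eigop_sum // big1 ?addr0 => [|i _].
  by rewrite iterSr /eigop invderC scale0r subr0 (iter_eigop0 Dl).
rewrite iter_eigop_sum // big1 // => j _.
have -> : (n.+1 * N.+1).+1 = (n.+1 + (n.+1 * N).+1)%N by rewrite mulnS addnS.
by rewrite -[0]addr0; apply: iter_eigop_invderM; [apply: varX|apply: IHN; apply: gN].
Qed.

Lemma int_semisimple_eigen Y : int_semisimple Y -> exists c : nat, forall N p,
  deg_le N p -> exists L : seq (int * P),
    (forall x, x \in L -> (absz (x.1 : int) <= c * N)%N /\ invder Y x.2 = x.1%:~R *: x.2) /\
    p = \sum_(x <- L) x.2.
Proof.
move=> [s [Pi [us s1 sY]]]; pose c := \max_(k <- s) `|k|%N.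
have cs k : k \in s -> (`|k| <= c)%N by move=> ks; apply: leq_bigmax_seq.
exists c; elim=> [|N IHN] p.
  move=> [a ->]; exists [:: (0, mpolyC _ a)]; split; last by rewrite big_seq1.
  by move=> x; rewrite inE => /eqP->; rewrite /= invderC scale0r.
move=> [a [g [gN ->]]].
have [L LP] := choice (fun ij : 'I_n.+1 * 'I_n.+1 => IHN _ (gN ij.1 ij.2)).
exists ((0, mpolyC _ a) :: flatten [seq [seq (k + x.1, invder (Pi k) (xvar K ij.1 ij.2) * x.2) |
   k <- s, x <- L ij] | ij <- enum {: 'I_n.+1 * 'I_n.+1}]); split=> [x|].
  rewrite in_cons => /predU1P[->|]; first by rewrite /= invderC scale0r.
  case/flattenP=> _ /mapP[[i j] _ ->] /allpairsP[[k y] /= [ks yL ->]] /=.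
  have [yc yY] := (LP (i, j)).1 y yL; split.
    have eN : (c * N.+1 = c + c * N)%N by rewrite mulnS.
    by rewrite eN (leq_trans _ (leq_add (cs k ks) yc)) //; move: (y.1) => z; lia.
  rewrite invderM yY invder_invder_var.
  have -> : Y *m Pi k = k%:~R *: Pi k := (sY k ks).1.
  by rewrite invderZl intrD scalerDl -scalerAl -scalerAr.
rewrite big_cons; congr (_ + _); rewrite big_flatten big_map big_enum /=.
rewrite pair_bigA; apply: eq_bigr => -[i j] _ /=.
rewrite big_allpairs_dep /= [X in _ * X](LP (i, j)).2.
rewrite [X in X * _](_ : _ = \sum_(k <- s) invder (Pi k) (xvar K i j)); last first.
  by rewrite -invder_suml s1 invder_id.
rewrite mulr_suml.
by apply: eq_bigr => k _; rewrite mulr_sumr.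
Qed.

(** The roots are 0 with multiplicity (n+1) N + 1 for nilpotent X, and the integers between -cN and
    cN for integral X. Integrality keeps their number linear in N: for a semisimple matrix with
    eigenvalues of higher rank over Z it can grow faster. *)
Lemma bounded_kill X : X ^+ n.+1 = 0 \/ int_semisimple X -> exists C : nat, forall N,
  exists rs : seq K, (size rs <= C * N.+1)%N /\
    forall p, deg_le N p -> kill (invder X) rs p = 0.
Proof.
have Dl := invder_lin X; case=> [Xn|/int_semisimple_eigen[c cP]].
  exists n.+1 => N; exists (nseq (n.+1 * N).+1 0); split.
    by rewrite size_nseq mulnS addnC -addn1 leq_add2l.
  move=> p pN; rewrite -[RHS](nilp_kill Xn pN).
  by elim: (n.+1 * N).+1 => //= k ->.
exists (2 * c).+1 => N.
exists [seq (i%:Z - (c * N)%:Z)%:~R | i <- iota 0 (2 * c * N).+1]; split.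
  by rewrite size_map size_iota; lia.
move=> p /cP[L [LP ->]]; set rs := [seq _ | i <- _].
have killD u v : kill (invder X) rs (u + v) = kill (invder X) rs u + kill (invder X) rs v.
  by elim: (rs) => //= a l ->; rewrite eigopD.
have kill0 : kill (invder X) rs 0 = 0 by elim: (rs) => //= a l ->; rewrite eigop0.
rewrite (big_morph _ killD kill0) big1_seq // => x /= /LP[xN xX].
have xrs : x.1%:~R \in rs.
  apply/mapP; exists (absz (x.1 + (c * N)%:Z)).
    by move: (x.1) xN => y; rewrite mem_iota; lia.
  by move: (x.1) xN => y yN; congr _%:~R; lia.
have Ek l : kill (invder X) l x.2 = (\prod_(a <- l) (x.1%:~R - a)) *: x.2.
  elim: l => [|a l IHl] /=; first by rewrite big_nil scale1r.
  by rewrite IHl eigopZ // /eigop xX -scalerBl scalerA big_cons mulrC.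
rewrite [LHS](Ek rs); have -> : \prod_(a <- rs) (x.1%:~R - a) = 0; last exact: scale0r.
apply/eqP; rewrite prodf_seq_eq0; apply/hasP; exists x.1%:~R => //.
by rewrite /= subrr eqxx.
Qed.

(* The invariant derivations along b preserve the polynomials of degree at most
   N, where each is killed by a polynomial of degree O(N) in it; hence O(N ^ d)
   ordered words suffice to test the vanishing on B of such polynomials. *)
Lemma connected_growth B d (b : d.-tuple M) : closed_subgroup B -> zconnected B ->
  free b -> (forall X, lie_algebra B X <-> X \in <<b>>%VS) ->
  (forall X, X \in b -> X ^+ n.+1 = 0 \/ int_semisimple X) ->
  exists C : nat, forall N (J : finType) (F : J -> P), (forall j, deg_le N (F j)) ->
    ((C * N.+1) ^ d < #|J|)%N ->
    exists c : J -> K, (exists j, c j != 0) /\ vanishing B (\sum_j c j *: F j).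
Proof.
move=> cB coB bf bs bX; have sB := cB.1.
pose D (i : 'I_d) := invder (b`_i : M).
have Dl i a u v : D i (a *: u + v) = a *: D i u + D i v by exact: invder_lin.
have bk (i : 'I_d) : exists C : nat, forall N, exists rs : seq K,
    (size rs <= C * N.+1)%N /\ forall p, deg_le N p -> kill (D i) rs p = 0.
  by apply: bounded_kill; apply: bX; rewrite mem_nth ?size_tuple.
have [Cf CfP] := choice bk.
pose C := (\max_i Cf i).+1; exists C => N J F FN Jbig; set e := (C * N.+1)%N in Jbig.
have br_in (i j : 'I_d) : bracket (b`_i : M) (b`_j) \in <<b>>%VS.
  by apply/bs; apply: lie_bracket => //; apply/bs/memv_span; rewrite mem_nth ?size_tuple.
pose cc (i j k : 'I_d) := coord b k (bracket (b`_i : M) b`_j).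
have Dbr i j v : D i (D j v) = D j (D i v) + \sum_k cc i j k *: D k v.
  have -> : D i (D j v) = D j (D i v) + invder (bracket (b`_i : M) b`_j) v.
    by rewrite invder_bracket addrC subrK.
  congr (_ + _); rewrite {1}(coord_span (br_in i j)) invder_suml.
  by apply: eq_bigr => k _; rewrite invderZl.
(* The exponents of ordered words are taken below e. There are more polynomials than such words, so
   some nontrivial combination has value 0 at 1 under all of them. *)
pose es (k : {ffun 'I_d -> 'I_e}) := [seq (k i : nat) | i <- enum 'I_d].
pose A : 'M[K]_(#|J|, #|{ffun 'I_d -> 'I_e}|) :=
  \matrix_(j, k) mxeval (exp_word D (enum 'I_d) (es (enum_val k)) (F (enum_val j))) 1%:M.
have rA : (\rank A < #|J|)%N.
  by rewrite (leq_ltn_trans (rank_leq_col A)) // card_ffun !card_ord.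
have /rowV0Pn[w wA wn0] : kermx A != 0.
  by rewrite -mxrank_eq0 mxrank_ker subn_eq0 -ltnNge.
have wA0 : w *m A = 0 by apply/sub_kermxP.
exists (fun j => w 0 (enum_rank j)); split.
  have /rV0Pn[k wk] := wn0; exists (enum_val k); by rewrite enum_valK.
set p := \sum_j _.
have pN : deg_le N p by apply: deg_le_sum => j; apply: deg_leZ.
have expN l es' q : deg_le N q -> deg_le N (exp_word D l es' q).
  move=> qN; elim: l es' => [|i l IHl] [|k es'] //=.
  by elim: k => [|k IHk] //=; apply: deg_le_invder.
have exp_lin l es' a u v :
    exp_word D l es' (a *: u + v) = a *: exp_word D l es' u + exp_word D l es' v.
  elim: l es' => [|i l IHl] [|k es'] //=; rewrite IHl.
  by elim: k => [|k IHk] //=; rewrite IHk Dl.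
have box k : mxeval (exp_word D (enum 'I_d) (es k) p) 1%:M = 0.
  have := congr1 (fun B' : 'rV[K]_#|{ffun 'I_d -> 'I_e}| => B' 0 (enum_rank k)) wA0.
  rewrite [RHS]mxE mxE => <-.
  have -> : p = \sum_(i < #|J|) w 0 i *: F (enum_val i).
    rewrite /p (reindex_onto (enum_val : 'I_#|J| -> J) enum_rank) /=; last by move=> j _; apply: enum_rankK.
    rewrite big_mkcond; apply: eq_bigr => i _; by rewrite enum_valK eqxx.
  have sumE (r : seq 'I_#|J|) (G : 'I_#|J| -> P) :
      mxeval (exp_word D (enum 'I_d) (es k) (\sum_(i <- r) w 0 i *: G i)) 1%:M =
      \sum_(i <- r) w 0 i * mxeval (exp_word D (enum 'I_d) (es k) (G i)) 1%:M.
    elim: r => [|i r IHr]; last by rewrite !big_cons exp_lin mxevalD mxevalZ IHr.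
    rewrite !big_nil; have := exp_lin (enum 'I_d) (es k) (-1) 0 0.
    by rewrite scaler0 addr0 scaleN1r addNr => ->; rewrite mxeval0.
  by rewrite sumE; apply: eq_bigr => i _; rewrite !mxE enum_rankK.
(* Next, large exponents are reduced to those below e letter by letter, each by the recurrence of
   its derivation, after composing the functional with the letters further left. *)
have lam_lin a u v : mxeval (a *: u + v) (1%:M : M) = a * mxeval u 1%:M + mxeval v 1%:M.
  by rewrite mxevalD mxevalZ.
have allexp (l : seq 'I_d) (lam : P -> K) : uniq l ->
    (forall a u v, lam (a *: u + v) = a * lam u + lam v) ->
    (forall k : 'I_d -> nat, (forall i, (k i < e)%N) ->
       lam (exp_word D l [seq k i | i <- l] p) = 0) ->
    forall k : 'I_d -> nat, lam (exp_word D l [seq k i | i <- l] p) = 0.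
  elim: l lam => [|i l IHl] lam /=.
    by move=> _ _ k0 k; apply: (k0 (fun=> 0%N)).
  move=> /andP[il ul] ll lam0 k.
  have [rs [srs krs]] := CfP i N.
  apply: (kill_recurrence (Dl i) ll (krs _ (expN _ _ _ pN))) => a ars.
  have ae : (a < e)%N.
    rewrite (leq_trans ars) // (leq_trans srs) // leq_mul2r ltnW ?orbT // ltnS.
    exact: (leq_bigmax i).
  apply: (IHl (fun v => lam (iter a (D i) v))) => // [b' u v|k' k'e].
    by rewrite -ll; congr (lam _); elim: (a) => //= a' ->; rewrite Dl.
  have := lam0 (fun j => if j == i then a else k' j); rewrite eqxx.
  suff -> : [seq (if j == i then a else k' j) | j <- l] = [seq k' j | j <- l].
    by apply=> j; case: eqP.
  by apply/eq_in_map => j jl; case: eqP => // ji; rewrite -ji jl in il.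
apply: (connected_words_vanishing sB bs cB coB) => s.
rewrite -[lie_word _ _ _]/(op_word D s p); move: s.
apply: (words_vanishing Dl Dbr lam_lin) => s; rewrite canonical_exp_word.
apply: (allexp _ (fun q => mxeval q 1%:M)) => //; first exact: enum_uniq.
move=> k ke; have := box [ffun i => Ordinal (ke i)]; congr (mxeval (exp_word _ _ _ _) _ = _).
by apply: eq_map => i; rewrite ffunE.
Qed.

End BoundedDegree.

(** * The group G2 and its root subgroups *)

(** Integer matrices are functions on pairs of naturals, so that the finitely many identities
    between them are checked by computation and then transported to K by [int_mx]. *)
Definition spmx (l : seq (nat * nat * int)) (r c : nat) : int :=
  foldr (fun x a => if (x.1.1 == r) && (x.1.2 == c) then x.2 else a) 0 l.

Definition imul (f g : nat -> nat -> int) (r c : nat) : int :=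
  foldr (fun k s => f r k * g k c + s) 0 (iota 0 7).

Definition ieq (f g : nat -> nat -> int) : bool :=
  all (fun r => all (fun c => f r c == g r c) (iota 0 7)) (iota 0 7).

(* Nonzero entries (row, column, value) of the root vectors. With a and b the short
   and the long simple root, the roots of indices 0, ..., 5 are a, b, a + b,
   2a + b, 3a + b, 3a + 2b, and the root of index k + 6 is opposite to that of
   index k. *)
Definition root_entries : seq (seq (nat * nat * int)) := [::
  [:: (0%N, 1%N, 1); (2%N, 3%N, 2); (3%N, 4%N, 1); (5%N, 6%N, 1)];
  [:: (1%N, 2%N, 1); (4%N, 5%N, 1)];
  [:: (0%N, 2%N, 1); (1%N, 3%N, - 2); (3%N, 5%N, 1); (4%N, 6%N, - 1)];
  [:: (0%N, 3%N, 2); (1%N, 4%N, - 1); (2%N, 5%N, - 1); (3%N, 6%N, 1)];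
  [:: (0%N, 4%N, 1); (2%N, 6%N, - 1)];
  [:: (0%N, 5%N, 1); (1%N, 6%N, 1)];
  [:: (1%N, 0%N, 1); (3%N, 2%N, 1); (4%N, 3%N, 2); (6%N, 5%N, 1)];
  [:: (2%N, 1%N, 1); (5%N, 4%N, 1)];
  [:: (2%N, 0%N, 1); (3%N, 1%N, - 1); (5%N, 3%N, 2); (6%N, 4%N, - 1)];
  [:: (3%N, 0%N, 1); (4%N, 1%N, - 1); (5%N, 2%N, - 1); (6%N, 3%N, 2)];
  [:: (4%N, 0%N, 1); (6%N, 2%N, - 1)];
  [:: (5%N, 0%N, 1); (6%N, 1%N, 1)]].

(* Halves of the squares of the root vectors, whose cubes vanish. *)
Definition square_entries : seq (seq (nat * nat * int)) := [::
  [:: (2%N, 4%N, 1)]; [::]; [:: (1%N, 5%N, - 1)]; [:: (0%N, 6%N, 1)]; [::]; [::]; [:: (4%N, 2%N, 1)]; [::]; [:: (5%N, 1%N, - 1)]; [:: (6%N, 0%N, 1)]; [::]; [::]].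

(* Multiplication by each basis vector for the cross product of trace-zero
   octonions, the invariant alternating product of the 7-dimensional module. *)
Definition cross_entries : seq (seq (nat * nat * int)) := [::
  [:: (0%N, 3%N, 2); (1%N, 4%N, 2); (2%N, 5%N, 2); (3%N, 6%N, 1)];
  [:: (0%N, 2%N, - 2); (1%N, 3%N, - 2); (3%N, 5%N, 1); (4%N, 6%N, 2)];
  [:: (0%N, 1%N, 2); (2%N, 3%N, - 2); (3%N, 4%N, - 1); (5%N, 6%N, 2)];
  [:: (0%N, 0%N, - 2); (1%N, 1%N, 2); (2%N, 2%N, 2); (4%N, 4%N, - 2); (5%N, 5%N, - 2); (6%N, 6%N, 2)];
  [:: (1%N, 0%N, - 2); (3%N, 2%N, 1); (4%N, 3%N, 2); (6%N, 5%N, - 2)];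
  [:: (2%N, 0%N, - 2); (3%N, 1%N, - 1); (5%N, 3%N, 2); (6%N, 4%N, 2)];
  [:: (3%N, 0%N, - 1); (4%N, 1%N, - 2); (5%N, 2%N, - 2); (6%N, 3%N, - 2)]].

(* For each entry (r, c), a combination of the linear equations satisfied by the
   derivations of the cross product (see [lie_coef]) that expresses this entry
   through the entries at the positions [root_pos] and two diagonal ones. *)
Definition lie_certificates : seq (nat * nat * seq (nat * nat * nat * int)) := [::
  (0, 3, [:: (0%N, 0%N, 6%N, 4)]);
  (0, 6, [:: (3%N, 0%N, 6%N, 1)]);
  (1, 3, [:: (1%N, 1%N, 5%N, 4); (0%N, 0%N, 5%N, 4)]);
  (1, 4, [:: (1%N, 1%N, 6%N, 2)]);
  (1, 5, [:: (2%N, 0%N, 5%N, - 2)]);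
  (1, 6, [:: (2%N, 0%N, 6%N, - 2)]);
  (2, 2, [:: (1%N, 0%N, 2%N, 2)]);
  (2, 3, [:: (1%N, 0%N, 3%N, 2)]);
  (2, 4, [:: (1%N, 0%N, 4%N, 2)]);
  (2, 5, [:: (1%N, 0%N, 5%N, 2); (0%N, 0%N, 6%N, - 2)]);
  (2, 6, [:: (1%N, 0%N, 6%N, 2)]);
  (3, 1, [:: (0%N, 0%N, 1%N, - 2)]);
  (3, 2, [:: (0%N, 0%N, 2%N, - 2)]);
  (3, 3, [:: (0%N, 0%N, 3%N, - 2)]);
  (3, 4, [:: (0%N, 0%N, 4%N, - 2)]);
  (3, 5, [:: (0%N, 0%N, 5%N, - 2)]);
  (4, 1, [:: (0%N, 1%N, 1%N, - 2)]);
  (4, 2, [:: (0%N, 1%N, 2%N, - 2)]);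
  (4, 3, [:: (0%N, 1%N, 3%N, - 2)]);
  (4, 4, [:: (0%N, 1%N, 4%N, - 2)]);
  (4, 5, [:: (0%N, 1%N, 5%N, - 2)]);
  (4, 6, [:: (1%N, 1%N, 5%N, 2); (0%N, 1%N, 6%N, - 2); (0%N, 0%N, 5%N, 2)]);
  (5, 1, [:: (0%N, 2%N, 1%N, - 2)]);
  (5, 2, [:: (0%N, 2%N, 2%N, - 2)]);
  (5, 3, [:: (0%N, 2%N, 3%N, - 2)]);
  (5, 4, [:: (0%N, 2%N, 4%N, - 2)]);
  (5, 5, [:: (1%N, 0%N, 2%N, 2); (0%N, 2%N, 5%N, - 2)]);
  (5, 6, [:: (1%N, 0%N, 3%N, 1); (0%N, 2%N, 6%N, - 2)]);
  (6, 0, [:: (0%N, 4%N, 1%N, 2)]);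
  (6, 1, [:: (0%N, 3%N, 1%N, - 4)]);
  (6, 2, [:: (0%N, 3%N, 2%N, - 4)]);
  (6, 3, [:: (0%N, 3%N, 3%N, - 4)]);
  (6, 4, [:: (1%N, 4%N, 4%N, - 2); (0%N, 0%N, 1%N, - 2)]);
  (6, 5, [:: (1%N, 4%N, 5%N, - 2); (0%N, 1%N, 3%N, - 1)]);
  (6, 6, [:: (0%N, 3%N, 6%N, - 4); (0%N, 0%N, 3%N, - 2)])].

Definition root_fun k := spmx (nth [::] root_entries k).
Definition square_fun k := spmx (nth [::] square_entries k).
Definition cross_fun k := spmx (nth [::] cross_entries k).
(** Gram matrix of the invariant quadratic form of the 7-dimensional module, which pairs each weight
    with its opposite. *)
Definition form_fun (r c : nat) : int :=
  if (r + c == 6)%N then nth 0 [:: 1; -1; 1; -2; 1; -1; 1] r else 0.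
Definition one_fun (r c : nat) : int := (r == c : nat)%:Z.

Lemma all_iotaP n (p : pred nat) k : all p (iota 0 n) -> (k < n)%N -> p k.
Proof. by move=> /allP pa kn; apply: pa; rewrite mem_iota. Qed.

Lemma sq_check : all (fun k => [&& ieq (imul (root_fun k) (root_fun k)) (fun r c => 2 * square_fun k r c),
  ieq (imul (root_fun k) (square_fun k)) (fun _ _ => 0),
  ieq (imul (square_fun k) (root_fun k)) (fun _ _ => 0) &
  ieq (imul (square_fun k) (square_fun k)) (fun _ _ => 0)]) (iota 0 12).
Proof. by vm_compute. Qed.

Definition itr (f : nat -> nat -> int) r c := f c r.
Definition iadd (f g : nat -> nat -> int) r c := f r c + g r c.

(** The coefficients of t, t^2, t^3 and t^4 in the invariance of the form under 1 + t e + t^2 s, for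
    the simple roots and their opposites. *)
Lemma form_check : all (fun k => let e := root_fun k in let s := square_fun k in
  [&& ieq (iadd (imul (itr e) form_fun) (imul form_fun e)) (fun _ _ => 0),
  ieq (iadd (iadd (imul (itr s) form_fun) (imul form_fun s)) (imul (imul (itr e) form_fun) e)) (fun _ _ => 0),
  ieq (iadd (imul (imul (itr e) form_fun) s) (imul (imul (itr s) form_fun) e)) (fun _ _ => 0) &
  ieq (imul (imul (itr s) form_fun) s) (fun _ _ => 0)]) [:: 0; 1; 6; 7]%N.
Proof. by vm_compute. Qed.

(* Matrix of the cross product by the j-th column of f. *)
Definition icross (f : nat -> nat -> int) j r c : int :=
  foldr (fun k s => f k j * cross_fun k r c + s) 0 (iota 0 7).

(** The coefficients of t, t^2, t^3 and t^4 in g l_j = cross (g e_j) g for g = 1 + t e + t^2 s. *)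
Lemma cross_check : all (fun k => let e := root_fun k in let s := square_fun k in
  all (fun j => let l := cross_fun j in
  [&& ieq (imul e l) (iadd (icross e j) (imul l e)),
  ieq (imul s l) (iadd (iadd (icross s j) (imul (icross e j) e)) (imul l s)),
  ieq (iadd (imul (icross s j) e) (imul (icross e j) s)) (fun _ _ => 0) &
  ieq (imul (icross s j) s) (fun _ _ => 0)]) (iota 0 7)) [:: 0; 1; 6; 7]%N.
Proof. by vm_compute. Qed.

(* The representative u_a(1) u_{-a}(-1) u_a(1) of the simple reflection a. *)
Definition weyl_fun (i : nat) : nat -> nat -> int :=
  let up := iadd one_fun (iadd (root_fun i) (square_fun i)) in
  let lo := iadd one_fun (iadd (fun r c => - root_fun (i + 6) r c) (square_fun (i + 6))) in
  imul up (imul lo up).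

Definition weyl_step (i k l : nat) (sg : int) :=
  ieq (imul (weyl_fun i) (root_fun k)) (fun r c => sg * imul (root_fun l) (weyl_fun i) r c) &&
  ieq (imul (weyl_fun i) (square_fun k)) (imul (square_fun l) (weyl_fun i)).

(** In a triple (i, k, l) the simple reflection i maps the root k to the root l. Each source is the
    root of a generator or an earlier target, and the targets are the eight remaining roots. *)
Definition weyl_steps := [:: (1, 0, 2); (0, 2, 3); (0, 1, 4); (1, 4, 5);
  (1, 6, 8); (0, 8, 9); (0, 7, 10); (1, 10, 11)]%N.

Lemma weyl_check : all (fun x => weyl_step x.1.1 x.1.2 x.2 1 || weyl_step x.1.1 x.1.2 x.2 (-1)) weyl_steps.
Proof. by vm_compute. Qed.

Section RootGroups.
Variable K : numClosedFieldType.
Local Notation M := 'M[K]_7.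
Local Notation int_mx := (@int_mx K).

Definition rmx k : M := int_mx (root_fun k).
Definition smx k : M := int_mx (square_fun k).
Definition jmx : M := int_mx form_fun.
Definition lmx k : M := int_mx (cross_fun k).
Definition umx k (t : K) : M := 1%:M + t *: rmx k + t ^+ 2 *: smx k.

Lemma int_mx_eq f g : ieq f g -> int_mx f = int_mx g.
Proof. exact: eq_int_mx. Qed.

Lemma int_mxM f g : int_mx f *m int_mx g = int_mx (imul f g).
Proof. exact: mul_int_mx. Qed.

Lemma int_mxD f g : int_mx f + int_mx g = int_mx (iadd f g).
Proof. exact: add_int_mx. Qed.

Lemma int_mx1 : int_mx one_fun = 1%:M.
Proof. by apply/matrixP => r c; rewrite !mxE /one_fun val_eqE; case: eqP. Qed.

Lemma int_mx0 : int_mx (fun _ _ => 0) = 0.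
Proof. by apply/matrixP => r c; rewrite !mxE. Qed.

Lemma int_mxT f : (int_mx f)^T = int_mx (itr f).
Proof. by apply/matrixP => r c; rewrite !mxE. Qed.

Lemma rmx_sq k : (k < 12)%N -> rmx k *m rmx k = 2 *: smx k.
Proof.
move=> /(all_iotaP sq_check)/and4P[e _ _ _].
by rewrite -[2]/(2%:~R) /rmx int_mxM scale_int_mx (int_mx_eq e).
Qed.

Lemma rmx_smx k : (k < 12)%N ->
  [/\ rmx k *m smx k = 0, smx k *m rmx k = 0 & smx k *m smx k = 0].
Proof.
move=> /(all_iotaP sq_check)/and4P[_ e1 e2 e3].
by rewrite /rmx /smx !int_mxM -int_mx0 (int_mx_eq e1) (int_mx_eq e2) (int_mx_eq e3).
Qed.

Lemma umxE k t : (k < 12)%N -> nilexp (t *: rmx k) = umx k t.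
Proof.
move=> kn; have [rs _ _] := rmx_smx kn.
have X2 : (t *: rmx k) ^+ 2 = (2 * t ^+ 2) *: smx k.
  by rewrite exprS expr1 -scalerAl -scalerAr scalerA -mulmxE rmx_sq // scalerA mulrC expr2.
have X3 j : (t *: rmx k) ^+ (j + 3) = 0.
  rewrite exprD exprS X2 -scalerAr -scalerAl -mulmxE rs scaler0.
  by rewrite scaler0 mulmx0.
rewrite /nilexp !big_ord_recl big_ord0 /= !(X3 0%N, X3 1%N, X3 2%N, X3 3%N) !scaler0 !addr0.
rewrite expr0 expr1 X2 !factS fact0 !mul1n invr1 !scale1r /umx addrA.
by rewrite scalerA mulrA mulVf ?mul1r // pnatr_eq0.
Qed.

Lemma umxM k s t : (k < 12)%N -> umx k s *m umx k t = umx k (s + t).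
Proof.
move=> kn; have [rs sr ss] := rmx_smx kn; rewrite /umx.
rewrite !mulmxDl !mulmxDr !mul1mx !mulmx1 -!scalemxAl -!scalemxAr rs sr ss !scaler0 rmx_sq //.
by apply/matrixP => r c; rewrite !mxE; ring.
Qed.

Lemma umx0 k : umx k 0 = 1%:M.
Proof. by rewrite /umx expr0n /= !scale0r !addr0. Qed.

Lemma umx_unit k t : (k < 12)%N -> umx k t \in unitmx.
Proof. by move=> kn; have /mulmx1_unit[] : umx k t *m umx k (- t) = 1%:M by rewrite umxM // subrr umx0. Qed.

Lemma invmx_umx k t : (k < 12)%N -> invmx (umx k t) = umx k (- t).
Proof.
by move=> kn; rewrite -[RHS]mul1mx -(mulVmx (umx_unit t kn)) -mulmxA umxM // subrr umx0 mulmx1.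
Qed.

Lemma weyl_fun_umx i : (i < 2)%N ->
  int_mx (weyl_fun i) = umx i 1 *m umx (i + 6) (-1) *m umx i 1.
Proof.
move=> i2; have e f g : int_mx (iadd f g) = int_mx f + int_mx g.
  by rewrite add_int_mx.
rewrite /weyl_fun /umx -mulmxA -int_mxM -int_mxM !e -opp_int_mx int_mx1.
by rewrite sqrrN !expr1n !scale1r scaleN1r !addrA.
Qed.

Lemma weyl_stepP i k l sg : sg ^+ 2 = 1 -> weyl_step i k l sg -> forall t,
  int_mx (weyl_fun i) *m umx k t = umx l (sg%:~R * t) *m int_mx (weyl_fun i).
Proof.
move=> sg1 /andP[/int_mx_eq e1 /int_mx_eq e2] t; move: e1 e2.
rewrite -scale_int_mx -!int_mxM => e1 e2.
rewrite /umx !mulmxDl !mulmxDr mulmx1 mul1mx -!scalemxAl -!scalemxAr e1 e2.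
by rewrite !scalerA exprMn -rmorphXn sg1 mul1r [_ * t]mulrC.
Qed.

Lemma addr_eq0l (A B : M) : A + B = 0 -> B = - A.
Proof. by move/eqP; rewrite addrC addr_eq0 => /eqP. Qed.

Lemma umx_form k t : k \in [:: 0; 1; 6; 7]%N -> (umx k t)^T *m jmx *m umx k t = jmx.
Proof.
move=> /(allP form_check)/and4P[f1 f2 f3 f4].
pose e := rmx k; pose s := smx k.
have e1 : e^T *m jmx + jmx *m e = 0.
  by rewrite int_mxT !int_mxM int_mxD (int_mx_eq f1) int_mx0.
have e2 : s^T *m jmx + jmx *m s + e^T *m jmx *m e = 0.
  by rewrite !int_mxT !int_mxM !int_mxD (int_mx_eq f2) int_mx0.
have e3 : e^T *m jmx *m s + s^T *m jmx *m e = 0.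
  by rewrite !int_mxT !int_mxM !int_mxD (int_mx_eq f3) int_mx0.
have e4 : s^T *m jmx *m s = 0.
  by rewrite !int_mxT !int_mxM (int_mx_eq f4) int_mx0.
move: e1 e2 e3 => /addr_eq0l e1 /addr_eq0l e2 /addr_eq0l e3; rewrite -/e -/s.
have -> : (umx k t)^T = 1%:M + t *: e^T + t ^+ 2 *: s^T.
  by apply/matrixP => r c; rewrite !mxE eq_sym.
rewrite /umx -/e -/s !mulmxDl !mulmxDr !mul1mx.
rewrite -!scalemxAl -!scalemxAr ?mulmx1 ?mul1mx e1 e2 e3 e4.
move: (e^T *m jmx *m s) (e^T *m jmx) (jmx *m s) (s^T *m jmx) => A B C D.
by apply/matrixP => r c; rewrite !mxE; ring.
Qed.

Definition cross (v : 'cV[K]_7) : M := \sum_j v j 0 *: lmx j.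

Lemma cross_is_linear a v w : cross (a *: v + w) = a *: cross v + cross w.
Proof.
rewrite /cross scaler_sumr -big_split; apply: eq_bigr => j _ /=.
by rewrite !mxE scalerDl scalerA.
Qed.

Lemma cross0 : cross 0 = 0.
Proof. by rewrite /cross big1 // => j _; rewrite mxE scale0r. Qed.

Lemma crossZ a v : cross (a *: v) = a *: cross v.
Proof. by rewrite -[a *: v]addr0 cross_is_linear cross0 addr0. Qed.

Lemma crossD v w : cross (v + w) = cross v + cross w.
Proof. by rewrite -[v]scale1r cross_is_linear !scale1r. Qed.

(** Automorphisms of the octonions, seen on their trace-zero part. [G2] is given by generators; its
    inclusion in this group provides the equations that bound its Lie algebra from above. *)
Definition aut7 (g : M) : Prop := g^T *m jmx *m g = jmx /\
  forall v, g *m cross v = cross (g *m v) *m g.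

Lemma cross_col f (j : 'I_7) : cross (int_mx f *m delta_mx j 0) = int_mx (icross f j).
Proof.
rewrite -colE /cross; apply/matrixP => r c; rewrite summxE !mxE.
under eq_bigr do rewrite !mxE -intrM.
by rewrite -rmorph_sum -(big_mkord xpredT (fun k => f k j * cross_fun k r c)) unlock.
Qed.

Lemma cross_delta (j : 'I_7) : cross (delta_mx j 0) = lmx j.
Proof.
rewrite /cross (bigD1 j) //= !mxE !eqxx scale1r big1 ?addr0 // => i /negbTE ij.
by rewrite !mxE ij scale0r.
Qed.

Lemma aut7_basis g : (forall j : 'I_7, g *m lmx j = cross (g *m delta_mx j 0) *m g) ->
  forall v, g *m cross v = cross (g *m v) *m g.
Proof.
move=> gb v; have -> : v = \sum_j v j 0 *: delta_mx j 0.
  apply/colP => i; rewrite summxE (bigD1 i) //= !mxE !eqxx mulr1 big1 ?addr0 // => j /negbTE ij.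
  by rewrite !mxE eq_sym ij mulr0.
move: (fun j => v j 0) => a; rewrite (big_morph cross crossD cross0) !mulmx_sumr (big_morph cross crossD cross0) mulmx_suml.
apply: eq_bigr => j _.
by rewrite -!scalemxAr !crossZ -scalemxAr -scalemxAl cross_delta gb.
Qed.

Definition jinv : M := 2^-1 *: int_mx (fun r c =>
  if (r + c == 6)%N then nth 0 [:: 2; -2; 2; -1; 2; -2; 2] r else 0).

Lemma jinvK : jinv *m jmx = 1%:M.
Proof.
rewrite -scalemxAl int_mxM (@int_mx_eq _ (fun r c => 2 * one_fun r c)) ?(eqxx, refl_equal) //.
by rewrite -scale_int_mx scalerA mulVf ?pnatr_eq0 // scale1r int_mx1.
Qed.

Lemma jmx_unit : jmx \in unitmx.
Proof. by have [] := mulmx1_unit jinvK. Qed.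

(** Inversion is polynomial on this group, as [lie_derived] requires. *)
Lemma aut7_inv g : aut7 g -> invmx g = jinv *m g^T *m jmx.
Proof.
move=> [gj _]; have e : (jinv *m g^T *m jmx) *m g = 1%:M.
  by rewrite -!mulmxA (mulmxA g^T) gj jinvK.
have [_ gU] := mulmx1_unit e.
by rewrite -[RHS]mulmx1 -(mulmxV gU) mulmxA e mul1mx.
Qed.

Lemma aut7_subgroup : subgroup_GL aut7.
Proof.
have aU g : aut7 g -> g \in unitmx.
  move=> [gj _]; have : \det (g^T *m jmx *m g) != 0 by rewrite gj -unitfE -unitmxE jmx_unit.
  by rewrite !det_mulmx !mulf_eq0 !negb_or => /andP[_]; rewrite unitmxE unitfE.
split=> [g /aU//||g h [gj gL] [hj hL]|g ga].
- by split=> [|v]; rewrite ?trmx1 !mul1mx !mulmx1.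
- split; first by rewrite trmx_mul !mulmxA -(mulmxA h^T) -(mulmxA h^T) gj.
  by move=> v; rewrite -mulmxA hL mulmxA gL -!mulmxA.
- have gU := aU g ga; have [gj gL] := ga; split.
    by rewrite -{1}gj !mulmxA trmx_inv mulVmx ?unitmx_tr // mul1mx mulmxK.
  move=> v; have := gL (invmx g *m v); rewrite (mulKVmx gU) => e.
  by rewrite -[LHS](mulmxK gU) -(mulmxA (invmx g)) -e mulKmx.
Qed.

Lemma umx_aut7 k t : k \in [:: 0; 1; 6; 7]%N -> aut7 (umx k t).
Proof.
move=> kn; split; first exact: umx_form.
apply: aut7_basis => j.
have /all_iotaP - /(_ j (ltn_ord j)) /and4P[c1 c2 c3 c4] := allP cross_check _ kn.
pose e := rmx k; pose s := smx k; pose a := cross (e *m delta_mx j 0).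
pose b := cross (s *m delta_mx j 0); pose l := lmx j.
have e1 : e *m l = a + l *m e.
  by rewrite /a cross_col !int_mxM (int_mx_eq c1) int_mxD.
have e2 : s *m l = b + a *m e + l *m s.
  by rewrite /a /b !cross_col !int_mxM (int_mx_eq c2) !int_mxD.
have e3 : b *m e + a *m s = 0.
  by rewrite /a /b !cross_col !int_mxM int_mxD (int_mx_eq c3) int_mx0.
have e4 : b *m s = 0 by rewrite /b cross_col int_mxM (int_mx_eq c4) int_mx0.
move: e3 => /addr_eq0l e3; rewrite /umx -/e -/s -/l !mulmxDl mul1mx -!scalemxAl.
rewrite !crossD !crossZ mul1mx cross_delta -/a -/b -/l e1 e2.
rewrite !mulmxDl !mulmxDr -!scalemxAl -!scalemxAr !mulmx1 e3 e4.
move: (a *m e) (b *m e) (l *m e) (l *m s) => A B C D.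
by apply/matrixP => r c; rewrite !mxE; ring.
Qed.

Lemma G2_aut7 g : G2 K g -> aut7 g.
Proof.
move: g; apply: gen_subgroup_sub; first exact: aut7_subgroup.
have ge i t : i \in [:: 0; 1]%N -> aut7 (nilexp (t *: rmx i)) /\ aut7 (nilexp (t *: rmx (i + 6))).
  by rewrite !inE => /orP[]/eqP->; rewrite !umxE //; split; apply: umx_aut7.
have rE i : @che K i = rmx i /\ @chf K i = rmx (i + 6).
  rewrite /che /chf /rmx; case: i => [[|[|//]] hi]; rewrite -!val_eqE /= !int_mx_simp.
    by split; apply: eq_int_mx; vm_compute.
  by split; apply: eq_int_mx; vm_compute.
have i2 (i : 'I_2) : (i : nat) \in [:: 0; 1]%N by case: i => [[|[|//]] hi].
by move=> g [[t _ [i _ <-]]|[t _ [i _ <-]]]; rewrite ((rE i).1, (rE i).2); have [] := ge i t (i2 i).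
Qed.

End RootGroups.

(* Coefficient of the (a, b) entry of X in the (r, c) entry of the derivation
   identity X *m lmx k - lmx k *m X - cross (col k X). *)
Definition lie_coef (k r c a b : nat) : int :=
  (a == r : nat)%:Z * cross_fun k b c - (b == c : nat)%:Z * cross_fun k r a
  - (b == k : nat)%:Z * cross_fun a r c.

(** At this position the root vector k has entry 1 and the other root vectors have 0 ([pos_check]),
    so that the entry of an element of the Lie algebra there is its coordinate. *)
Definition root_pos (k : nat) : nat * nat := nth (0, 0)%N
  [:: (0, 1); (1, 2); (0, 2); (3, 6); (0, 4); (0, 5);
      (1, 0); (2, 1); (2, 0); (3, 0); (4, 0); (5, 0)]%N k.

Definition cartan_fun (i r : nat) : int :=
  nth 0 (nth [::] [:: [:: 1; -1; 2; 0; -2; 1; -1]; [:: 0; 1; -1; 0; 1; -1; 0]] i) r.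

(** The linear map that rebuilds a matrix from its entries at the positions [root_pos] and its first
    two diagonal entries, as a combination of root vectors and Cartan elements. *)
Definition proj_coef (r c a b : nat) : int :=
  foldr (fun k s => (if (a, b) == root_pos k then root_fun k r c else 0) + s) 0 (iota 0 12)
  + (if r == c then (if (a == 0)%N && (b == 0)%N then cartan_fun 0 r + cartan_fun 1 r else 0)
     + (if (a == 1)%N && (b == 1)%N then cartan_fun 1 r else 0) else 0).

Definition cert_of (r c : nat) : seq (nat * nat * nat * int) :=
  flatten [seq x.2 | x <- lie_certificates & x.1 == (r, c)].

Definition cert_coef (l : seq (nat * nat * nat * int)) (a b : nat) : int :=
  foldr (fun x s => x.2 * lie_coef x.1.1.1 x.1.1.2 x.1.2 a b + s) 0 l.

(** Identity minus this map is a combination of the derivation equations; the factor 4 clears the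
    denominators of the certificates. *)
Lemma cert_check : all (fun r => all (fun c => all (fun a => all (fun b =>
  4 * (((a == r) && (b == c) : nat)%:Z - proj_coef r c a b) == cert_coef (cert_of r c) a b)
  (iota 0 7)) (iota 0 7)) (iota 0 7)) (iota 0 7).
Proof. by vm_compute. Qed.

Lemma all_flatten_filter (S T : Type) (p : pred T) (q : pred S) (l : seq (S * seq T)) :
  all (fun x => all p x.2) l -> all p (flatten [seq x.2 | x <- l & q x.1]).
Proof.
elim: l => //= x l IHl /andP[px /IHl pl]; case: (q _) => //=.
by rewrite all_cat px.
Qed.

Lemma cert_bound : all (fun x => all (fun y => [&& y.1.1.1 < 7, y.1.1.2 < 7 & y.1.2 < 7]%N) x.2)
  lie_certificates.
Proof. by vm_compute. Qed.

(** * Upper bound for the Lie algebra of G2 *)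

Section LieG2.
Variable K : numClosedFieldType.
Local Notation M := 'M[K]_7.
Implicit Types (g X Y : M).

Lemma cheE (i : 'I_2) : che K i = rmx K i.
Proof.
by rewrite /che /rmx; case: i => [[|[|//]] hi]; rewrite -!val_eqE /= !int_mx_simp;
  apply: eq_int_mx; vm_compute.
Qed.

Lemma chfE (i : 'I_2) : chf K i = rmx K (i + 6).
Proof.
by rewrite /chf /rmx; case: i => [[|[|//]] hi]; rewrite -!val_eqE /= !int_mx_simp;
  apply: eq_int_mx; vm_compute.
Qed.

Lemma G2_subgroup : subgroup_GL (G2 K).
Proof.
apply: subgroup_gen => _ [[t _ [i _ <-]]|[t _ [i _ <-]]].
  by rewrite cheE umxE /= ?umx_unit //; case: i => [[|[|//]] hi].
by rewrite chfE umxE /= ?umx_unit //; case: i => [[|[|//]] hi].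
Qed.

Lemma umx_G2 k t : (k < 12)%N -> G2 K (umx k t).
Proof.
have [GU _ GM GV] := G2_subgroup.
have g0 (i : 'I_2) s : G2 K (umx i s) /\ G2 K (umx (i + 6) s).
  have [i1 i2] : (i < 12)%N /\ (i + 6 < 12)%N by case: i => [[|[|//]] hi].
  by split; apply: sub_gen_subgroup; [left|right]; exists s => //; exists i => //;
    rewrite ?cheE ?chfE umxE.
have wG (i : 'I_2) : G2 K (int_mx K (weyl_fun i)).
  rewrite weyl_fun_umx //; apply: (GM); first by apply: GM; [apply: (g0 i 1).1|apply: (g0 i _).2].
  exact: (g0 i 1).1.
have step i k' l : (i < 2)%N -> weyl_step i k' l 1 || weyl_step i k' l (-1) ->
    (forall s, G2 K (umx k' s)) -> forall s, G2 K (umx l s).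
  move=> i2 wst Gk s; have wi := wG (Ordinal i2); have wU := GU _ wi.
  have [sg sg1 ws] : exists2 sg : int, sg ^+ 2 = 1 & weyl_step i k' l sg.
    by case/orP: wst => ws; [exists 1|exists (-1)].
  have := weyl_stepP sg1 ws (sg%:~R * s).
  rewrite mulrA -intrM -expr2 sg1 mul1r => e.
  by rewrite -[umx l s](mulmxK wU) -e; apply: (GM); [apply: GM|apply: GV].
have gen i s : i \in [:: 0; 1; 6; 7]%N -> G2 K (umx i s).
  rewrite !inE => /or4P[] /eqP->; [exact: (g0 0 s).1|exact: (g0 1 s).1|exact: (g0 0 s).2|exact: (g0 1 s).2].
have wc n := allP weyl_check n.
move: t; have s2 := step 1%N 0%N 2%N isT (wc (1, 0, 2)%N isT) (fun s => gen 0%N s isT).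
have s3 := step 0%N 2%N 3%N isT (wc (0, 2, 3)%N isT) s2.
have s4 := step 0%N 1%N 4%N isT (wc (0, 1, 4)%N isT) (fun s => gen 1%N s isT).
have s5 := step 1%N 4%N 5%N isT (wc (1, 4, 5)%N isT) s4.
have s8 := step 1%N 6%N 8%N isT (wc (1, 6, 8)%N isT) (fun s => gen 6%N s isT).
have s9 := step 0%N 8%N 9%N isT (wc (0, 8, 9)%N isT) s8.
have s10 := step 0%N 7%N 10%N isT (wc (0, 7, 10)%N isT) (fun s => gen 7%N s isT).
have s11 := step 1%N 10%N 11%N isT (wc (1, 10, 11)%N isT) s10.
by case: k => [|[|[|[|[|[|[|[|[|[|[|[|k]]]]]]]]]]]] t k12 //; [exact: (gen 0%N t isT)|exact: (gen 1%N t isT)|exact: (gen 6%N t isT)|exact: (gen 7%N t isT)].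
Qed.

Lemma weyl_G2 i : (i < 2)%N -> G2 K (int_mx K (weyl_fun i)).
Proof.
move=> i2; rewrite weyl_fun_umx //; have [_ _ GM _] := G2_subgroup.
have i6 : (i + 6 < 12)%N by move: i2; lia.
have i1 : (i < 12)%N by move: i2; lia.
by apply: (GM); [apply: GM|]; apply: umx_G2.
Qed.

Lemma lie_G2_form X : lie_algebra (G2 K) X -> jinv K *m X^T *m jmx K = - X.
Proof.
apply: lie_orthogonal; last exact: jinvK.
move=> g Gg; have [GU _ _ _] := G2_subgroup.
by rewrite -aut7_inv ?mulmxV ?GU //; apply: G2_aut7.
Qed.

Lemma lie_G2_cross X (k : 'I_7) : lie_algebra (G2 K) X ->
  X *m lmx K k = lmx K k *m X + cross (X *m delta_mx k 0).
Proof.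
move=> LX; apply/matrixP => r c.
have jI := mxjet_id (1%:M : M) X.
have jc : has_mxjet (fun g : M => cross (g *m delta_mx k 0)) 1%:M X (cross (X *m delta_mx k 0)).
  move=> i j; have -> : (fun g : M => cross (g *m delta_mx k 0) i j) =
      (fun g : M => \sum_(l < 7) g l k * lmx K l i j).
    apply/funext => g; rewrite summxE; apply: eq_bigr => l _.
    by rewrite -colE !mxE.
  have -> : cross (X *m delta_mx k 0) i j =
      \sum_(l < 7) (X l k * lmx K l i j + (1%:M : M) l k * 0).
    by rewrite summxE; apply: eq_bigr => l _; rewrite mulr0 addr0 -colE !mxE.
  by apply: jet_sum => l; apply: jetM; [apply: jI|apply: jet_cst].
have j1 := mxjetM jI (mxjet_cst (lmx K k) 1%:M X).
have j2 := mxjetM (mxjet_cst (-1%:M : M) 1%:M X) (mxjetM jc jI).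
have := lie_jet LX (jetD (j1 r c) (j2 r c)) => /(_ _)/wrap[g Gg|].
  by have [_ /(_ (delta_mx k 0))] := G2_aut7 Gg; rewrite cross_delta => ->; rewrite mulNmx mul1mx !mxE subrr.
rewrite !mulmx1 !mul1mx !mul0mx addr0 add0r cross_delta mulNmx mul1mx.
move=> e; apply/eqP; rewrite -subr_eq0 -e; apply/eqP; rewrite !mxE; ring.
Qed.

Lemma lie_G2_coef X k r c : lie_algebra (G2 K) X -> (k < 7)%N -> (r < 7)%N -> (c < 7)%N ->
  \sum_(a < 7) \sum_(b < 7) (lie_coef k r c a b)%:~R * X a b = 0.
Proof.
move=> LX k7 r7 c7; have := congr1 (fun A : M => A (Ordinal r7) (Ordinal c7)) (lie_G2_cross (Ordinal k7) LX).
rewrite [in RHS]mxE => /eqP; rewrite addrC -subr_eq0 => /eqP e; rewrite -[RHS]e {e}.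
pose k' := Ordinal k7; pose r' := Ordinal r7; pose c' := Ordinal c7.
have cE (F : 'I_7 -> K) (i : 'I_7) : \sum_a ((a : 'I_7) == i :> nat)%:R * F a = F i.
  rewrite (bigD1 i) //= eqxx mul1r big1 ?addr0 // => a /negbTE ai.
  by rewrite val_eqE ai mul0r.
transitivity (\sum_(a < 7) \sum_(b < 7) ((a : nat) == r')%:R * ((cross_fun k b c)%:~R * X a b) -
  \sum_(a < 7) \sum_(b < 7) ((b : nat) == c')%:R * ((cross_fun k r a)%:~R * X a b) -
  \sum_(a < 7) \sum_(b < 7) ((b : nat) == k')%:R * ((cross_fun a r c)%:~R * X a b)).
  rewrite -!sumrB; apply: eq_bigr => a _; rewrite -!sumrB; apply: eq_bigr => b _.
  rewrite /lie_coef !rmorphB !rmorphM /=; ring.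
have -> : \sum_(a < 7) \sum_(b < 7) ((a : nat) == r')%:R * ((cross_fun k b c)%:~R * X a b) =
    (X *m lmx K k) r' c'.
  rewrite exchange_big mxE; apply: eq_bigr => b _ /=.
  by rewrite [LHS](cE (fun a => (cross_fun k b c)%:~R * X a b) r') mxE mulrC.
have -> : \sum_(a < 7) \sum_(b < 7) ((b : nat) == c')%:R * ((cross_fun k r a)%:~R * X a b) =
    (lmx K k *m X) r' c'.
  rewrite mxE; apply: eq_bigr => a _.
  by rewrite [LHS](cE (fun b => (cross_fun k r a)%:~R * X a b) c') mxE.
have -> : \sum_(a < 7) \sum_(b < 7) ((b : nat) == k')%:R * ((cross_fun a r c)%:~R * X a b) =
    cross (X *m delta_mx k' 0) r' c'.
  rewrite summxE; apply: eq_bigr => a _.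
  by rewrite [LHS](cE (fun b => (cross_fun a r c)%:~R * X a b) k') -colE !mxE mulrC.
rewrite /= -/k' -/r' -/c'; ring.
Qed.

Lemma lie_G2_entry X (r c : 'I_7) : lie_algebra (G2 K) X ->
  X r c = \sum_(a < 7) \sum_(b < 7) (proj_coef r c a b)%:~R * X a b.
Proof.
move=> LX; have cert : \sum_(a < 7) \sum_(b < 7) (cert_coef (cert_of r c) a b)%:~R * X a b = 0.
  have : all (fun y : nat * nat * nat * int => [&& y.1.1.1 < 7, y.1.1.2 < 7 & y.1.2 < 7]%N) (cert_of r c).
    exact: (all_flatten_filter (fun x => x == (r : nat, c : nat)) cert_bound).
  elim: (cert_of r c) => [|x l IHl] /=.
    by rewrite big1 // => a _; rewrite big1 // => b _; rewrite mul0r.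
  move=> /andP[/and3P[x1 x2 x3] /IHl e]; have e1 := lie_G2_coef LX x1 x2 x3.
  transitivity (x.2%:~R * (\sum_(a < 7) \sum_(b < 7)
      (lie_coef x.1.1.1 x.1.1.2 x.1.2 a b)%:~R * X a b) +
    \sum_(a < 7) \sum_(b < 7) (cert_coef l a b)%:~R * X a b); last by rewrite e e1 mulr0 addr0.
  rewrite mulr_sumr -big_split; apply: eq_bigr => a _ /=; rewrite mulr_sumr -big_split; apply: eq_bigr => b _ /=.
  by rewrite rmorphD rmorphM mulrDl mulrA.
have n4 : (4%:R : K) != 0 by rewrite pnatr_eq0.
apply: (mulfI n4); apply/eqP; rewrite -subr_eq0; apply/eqP; rewrite -[RHS]cert.
rewrite mulr_sumr.
have -> : X r c = \sum_(a < 7) \sum_(b < 7) ((a == r) && (b == c))%:R * X a b.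
  rewrite (bigD1 r) //= (bigD1 c) //= !eqxx mul1r big1 => [|b /negbTE->]; last by rewrite andbF mul0r.
  by rewrite addr0 big1 ?addr0 // => a /negbTE->; rewrite big1 // => b _; rewrite mul0r.
rewrite mulr_sumr -sumrB; apply: eq_bigr => a _; rewrite !mulr_sumr -sumrB.
apply: eq_bigr => b _.
have /eqP <- := all_iotaP (all_iotaP (all_iotaP (all_iotaP cert_check (ltn_ord r)) (ltn_ord c)) (ltn_ord a)) (ltn_ord b).
by rewrite rmorphM rmorphB /=; ring.
Qed.

Definition root_coord k X : K := X (inord (root_pos k).1) (inord (root_pos k).2).

Lemma root_pos_bound : all (fun k => ((root_pos k).1 < 7) && ((root_pos k).2 < 7))%N (iota 0 12).
Proof. by []. Qed.

Lemma chh_entry (i : 'I_2) (r c : 'I_7) : chh K i r c = (r == c)%:R * (cartan_fun i r)%:~R.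
Proof.
rewrite chh_int_mx mxE -val_eqE /=; case: eqP => [->|_]; last by rewrite mul0r.
rewrite mul1r; congr _%:~R; rewrite /Defs.coord -val_eqE; case: i => [[|[|//]] hi] /=;
  by case: c => [[|[|[|[|[|[|[|//]]]]]]] hc].
Qed.

(** The first two diagonal entries of x [chh 0] + y [chh 1] are x and y - x, whence the coefficients
    of the Cartan part. *)
Lemma lie_G2_decomp X : lie_algebra (G2 K) X ->
  X = \sum_(k < 12) root_coord k X *: rmx K k + X 0 0 *: chh K 0 + (X 0 0 + X 1 1) *: chh K 1.
Proof.
move=> LX; apply/matrixP => r c; rewrite {1}(lie_G2_entry r c LX).
have aE (A B : M) : (A + B) r c = A r c + B r c by rewrite mxE.
have zE a (A : M) : (a *: A) r c = a * A r c by rewrite mxE.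
rewrite !aE summxE !zE.
have cE (F : 'I_7 -> 'I_7 -> K) i j : \sum_a \sum_b ((a == i) && (b == j))%:R * F a b = F i j.
  rewrite (bigD1 i) //= (bigD1 j) //= !eqxx mul1r big1 => [|b /negbTE->]; last by rewrite andbF mul0r.
  by rewrite addr0 big1 ?addr0 // => a /negbTE->; rewrite big1 // => b _; rewrite mul0r.
have -> : \sum_(k < 12) (root_coord k X *: rmx K k) r c = \sum_(a < 7) \sum_(b < 7)
    (foldr (fun k s => (if ((a : nat), (b : nat)) == root_pos k then root_fun k r c else 0) + s)
      0 (iota 0 12))%:~R * X a b.
  transitivity (\sum_(k < 12) \sum_(a < 7) \sum_(b < 7) ((if ((a : nat), (b : nat)) == root_pos k
     then root_fun k r c else 0)%:~R * X a b)).
    apply: eq_bigr => k _; have /andP[k1 k2] := all_iotaP root_pos_bound (ltn_ord k).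
    rewrite !mxE mulrC /root_coord -(cE (fun a b => (root_fun k r c)%:~R * X a b)).
    apply: eq_bigr => a _; apply: eq_bigr => b _.
    rewrite -!val_eqE /= !inordK //; case: (root_pos k) => p q /=; rewrite xpair_eqE.
    by case: ifP => _; rewrite ?mul1r ?mul0r.
  rewrite exchange_big; apply: eq_bigr => a _ /=; rewrite exchange_big; apply: eq_bigr => b _ /=.
  rewrite -mulr_suml; congr (_ * _).
  rewrite -rmorph_sum -(big_mkord xpredT (fun k => if ((a : nat), (b : nat)) == root_pos k
     then root_fun k r c else 0)); by rewrite unlock.
rewrite !chh_entry -(cE X 0 0) -(cE X 1 1) -big_split !mulr_suml -!big_split.
apply: eq_bigr => a _ /=; rewrite -big_split !mulr_suml -!big_split.
apply: eq_bigr => b _ /=; rewrite /proj_coef rmorphD mulrDl -addrA; congr (_ + _).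
rewrite (_ : (a == 0) = ((a : nat) == 0%N)) // (_ : (b == 0) = ((b : nat) == 0%N)) //.
rewrite (_ : (a == 1) = ((a : nat) == 1%N)) // (_ : (b == 1) = ((b : nat) == 1%N)) //.
rewrite modn_small // -[r == c]/((r : nat) == c).
move: ((r : nat) == c) (X a b) => e x.
case: e; last by rewrite rmorph0 /=; ring.
do 4 case: (_ == _); rewrite /= ?rmorphD ?rmorph0 /=; ring.
Qed.

End LieG2.

(** * Null vectors and triangular elements *)

Definition row_zero k r := all (fun c => (root_fun k r c == 0) && (square_fun k r c == 0)) (iota 0 7).
Definition row_unit k r d :=
  all (fun c => (root_fun k r c == (c == d : nat)%:Z) && (square_fun k r c == 0)) (iota 0 7).

Definition root_height (k : nat) : nat := nth 0%N [:: 1; 1; 2; 3; 4; 5]%N k.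
Definition below (h : nat) (f : nat -> nat -> int) :=
  all (fun r => all (fun c => (c < r + h)%N ==> (f r c == 0)) (iota 0 7)) (iota 0 7).

Lemma height_check : all (fun k => below (root_height k) (root_fun k) &&
  below (2 * root_height k) (square_fun k)) (iota 0 6).
Proof. by vm_compute. Qed.

Definition root_weight k i : int := cartan_fun i (root_pos k).1 - cartan_fun i (root_pos k).2.

Lemma weight_check : all (fun k => all (fun r => all (fun c => (root_fun k r c == 0) ||
   all (fun i => cartan_fun i r - cartan_fun i c == root_weight k i) (iota 0 2))
  (iota 0 7)) (iota 0 7)) (iota 0 12).
Proof. by vm_compute. Qed.

Lemma pos_check : all (fun k => all (fun j =>
  root_fun k (root_pos j).1 (root_pos j).2 == (j == k : nat)%:Z) (iota 0 12)) (iota 0 12).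
Proof. by vm_compute. Qed.

Section NullVectors.
Variable K : numClosedFieldType.
Local Notation M := 'M[K]_7.
Implicit Types (g X Y z : M) (v : 'cV[K]_7).

Lemma umx_row k t v (r : 'I_7) : row_zero k r -> (umx k t *m v) r 0 = v r 0.
Proof.
move=> rz; rewrite !mulmxDl mul1mx -!scalemxAl !mxE !big1 ?mulr0 ?addr0 // => c _;
  by rewrite !mxE; have /andP[/eqP e1 /eqP e2] := all_iotaP rz (ltn_ord c); rewrite ?e1 ?e2 mul0r.
Qed.

Lemma umx_row_unit k t v (r d : 'I_7) : row_unit k r d ->
  (umx k t *m v) r 0 = v r 0 + t * v d 0.
Proof.
move=> rd; rewrite !mulmxDl mul1mx -!scalemxAl !mxE.
rewrite [X in _ + _ * X]big1 => [|c _]; last first.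
  by rewrite !mxE; have /andP[_ /eqP e2] := all_iotaP rd (ltn_ord c); rewrite e2 mul0r.
rewrite (bigD1 d) //= big1 => [|c cd]; rewrite !mxE.
  have /andP[/eqP e1 _] := all_iotaP rd (ltn_ord d).
  by rewrite e1 eqxx mul1r mulr0 !addr0.
have /andP[/eqP e1 _] := all_iotaP rd (ltn_ord c).
by rewrite e1 (inj_eq val_inj) (negbTE cd) mul0r.
Qed.

Definition qform v : K := v 0 0 * v (inord 6) 0 - v 1 0 * v (inord 5) 0
  + v (inord 2) 0 * v (inord 4) 0 - v (inord 3) 0 ^+ 2.

Lemma qformE v : (v^T *m jmx K *m v) 0 0 = 2 * qform v.
Proof.
pose a i := v (inord i) 0; have aE (i : 'I_7) : v i 0 = a i by rewrite /a inord_val.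
rewrite mxE; under eq_bigr => c _.
  rewrite mxE; under eq_bigr => r _ do rewrite !mxE !aE.
  rewrite aE -(big_mkord xpredT (fun r => a r * (form_fun r c)%:~R)).
over.
rewrite -(big_mkord xpredT (fun c => (\sum_(0 <= r < 7) a r * (form_fun r c)%:~R) * a c)).
rewrite unlock /= /qform -/(a 6%N) -/(a 5%N) -/(a 2%N) -/(a 4%N) -/(a 3%N) !aE /form_fun /=.
ring.
Qed.

Lemma qform_G2 g v : G2 K g -> qform (g *m v) = qform v.
Proof.
move=> Gg; have n2 : (2 : K) != 0 by rewrite pnatr_eq0.
apply: (mulfI n2); rewrite -!qformE trmx_mul -!mulmxA (mulmxA g^T) (mulmxA (g^T *m _)).
by have [-> _] := G2_aut7 Gg; rewrite !mulmxA.
Qed.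

(* Lowering root groups clear the coordinates 1, ..., 5 one after the other. *)
Lemma clear_coords v : v 0 0 != 0 -> exists2 g, G2 K g &
  (g *m v) 0 0 = v 0 0 /\ forall i : 'I_7, (0 < i < 6)%N -> (g *m v) i 0 = 0.
Proof.
move=> v0; have [_ G1 GM _] := G2_subgroup K.
suff H n : (n < 6)%N -> exists2 g, G2 K g &
    (g *m v) 0 0 = v 0 0 /\ forall i : 'I_7, (0 < i <= n)%N -> (g *m v) i 0 = 0.
  by have [g Gg gP] := H 5%N isT; exists g.
elim: n => [_|n IHn n5].
  by exists 1%:M => //; split=> [|i]; [rewrite mul1mx|case: (i : nat)].
have [g Gg [g0 gi]] := IHn (ltnW n5).
(* Indices of the lowering root groups that fix the coordinates up to n and add a multiple of
   coordinate 0 to coordinate n + 1. *)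
pose k := nth 0%N [:: 6; 8; 9; 10; 11]%N n.
have n7 : (n.+1 < 7)%N by rewrite ltnS ltnW.
have ck : (k < 12)%N && (row_unit k n.+1 0) && all (row_zero k) (iota 0 n.+1).
  by move: n5 @k; case: n {IHn gi n7} => [|[|[|[|[|//]]]]] _; vm_compute.
have /andP[/andP[k12 ku] kz] := ck.
exists (umx k (- (g *m v) (Ordinal n7) 0 / v 0 0) *m g); first by apply: GM => //; apply: umx_G2.
rewrite -mulmxA; split=> [|i /andP[i0]].
  by rewrite umx_row // (all_iotaP kz).
rewrite leq_eqVlt => /orP[/eqP ein|ilt]; last first.
  by rewrite umx_row ?(all_iotaP kz) // gi // i0 -ltnS.
have -> : i = Ordinal n7 by apply: val_inj.
by rewrite (@umx_row_unit k _ _ (Ordinal n7) 0 ku) g0 divfK // subrr.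
Qed.

(** After coordinates 1 to 5 are cleared the quadratic form reads v_0 v_6, so nullity kills the last
    coordinate. *)
Lemma null_vector_chart v : v 0 0 != 0 -> qform v = 0 ->
  exists2 g, G2 K g & g *m v = v 0 0 *: delta_mx 0 0.
Proof.
move=> v0 qv; have [g Gg [g0 gi]] := clear_coords v0; exists g => //.
have := qform_G2 v Gg; rewrite qv /qform g0.
have gi' i : (0 < i < 6)%N -> (g *m v) (inord i) 0 = 0.
  by move=> /andP[i0 i6]; rewrite gi ?inordK ?i0 // ltnW.
rewrite (gi' 5%N) // (gi' 2%N) // (gi' 3%N) // expr0n !mul0r !mulr0 !subr0 addr0 => /eqP.
rewrite mulf_eq0 (negbTE v0) => /eqP g6.
apply/colP => i; rewrite [RHS]mxE [X in _ * X]mxE andbT.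
have [->|i0] := eqVneq i 0; first by rewrite mulr1.
rewrite mulr0; have [i6|i6] := ltnP i 6; first by rewrite gi // lt0n i0.
by rewrite -g6; congr ((g *m v) _ 0); apply: val_inj; rewrite /= inordK //; have := ltn_ord i; lia.
Qed.

Lemma null_vector v : v != 0 -> qform v = 0 ->
  exists2 g, G2 K g & exists2 c, c != 0 & g *m v = c *: delta_mx 0 0.
Proof.
move=> vn0 qv; have [_ _ GM _] := G2_subgroup K.
suff [g Gg g0] : exists2 g, G2 K g & (g *m v) 0 0 != 0.
  have [|h Gh hv] := null_vector_chart g0; first by rewrite qform_G2.
  exists (h *m g); first exact: GM.
  by exists ((g *m v) 0 0) => //; rewrite -mulmxA.
have [v0|v0] := eqVneq (v 0 0) 0; last first.
  by exists 1%:M; [case: (G2_subgroup K)|rewrite mul1mx].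
have up k (i : 'I_7) : (k < 12)%N -> row_unit k 0 i -> v i 0 != 0 ->
    exists2 g, G2 K g & (g *m v) 0 0 != 0.
  move=> k12 ku vi; exists (umx k 1); first exact: umx_G2.
  by rewrite (@umx_row_unit k _ _ 0 i ku) v0 add0r mul1r.
have [v1|/up] := eqVneq (v 1 0) 0; last by apply; [exact: (isT : (0 < 12)%N)|].
have i7 i : (i < 7)%N -> (inord i : 'I_7) = i :> nat by move=> i7; rewrite inordK.
have [v2|/(up 2%N)] := eqVneq (v (inord 2) 0) 0; last by apply; rewrite // i7.
have [v4|/(up 4%N)] := eqVneq (v (inord 4) 0) 0; last by apply; rewrite // i7.
have [v5|/(up 5%N)] := eqVneq (v (inord 5) 0) 0; last by apply; rewrite // i7.
have v3 : v (inord 3) 0 = 0.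
  move: qv; rewrite /qform v0 v1 v2 !mul0r subrr add0r sub0r => /eqP.
  by rewrite oppr_eq0 expf_eq0 => /eqP.
(* Only coordinate 6 is left, and the square part of this root group, the matrix unit (0, 6), brings
   it to coordinate 0. *)
exists (umx 3 1); first exact: umx_G2.
pose a i := v (inord i) 0; have aE (i : 'I_7) : v i 0 = a i by rewrite /a inord_val.
have a0 : a 0%N = 0 by rewrite -v0 aE.
have a1 : a 1%N = 0 by rewrite -v1 aE.
have a6 : a 6%N != 0.
  apply: contra vn0 => /eqP a6; apply/eqP/colP => i; rewrite aE mxE.
  by case: i => [[|[|[|[|[|[|[|//]]]]]]] hi].
rewrite /umx mxE; under eq_bigr => c _ do rewrite !mxE aE.
rewrite -(big_mkord xpredT (fun c => ((0%N == c)%:R + 1 * (root_fun 3 0 c)%:~R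
  + 1 ^+ 2 * (square_fun 3 0 c)%:~R) * a c)) unlock /=.
rewrite a0 a1 [a 2%N]v2 [a 3%N]v3 [a 4%N]v4 [a 5%N]v5 !mulr0 !add0r addr0.
by rewrite !(mulr0, add0r, expr1n, mul1r).
Qed.

(** Filtration by superdiagonals, compatible with the heights of the positive roots; [filt 0] means
    upper triangular. *)
Definition filt h (A : M) := forall r c : 'I_7, (c < r + h)%N -> A r c = 0.

Lemma filtM h k A B : filt h A -> filt k B -> filt (h + k) (A *m B).
Proof.
move=> Ah Bk r c rc; rewrite mxE big1 // => j _.
have [jr|jr] := ltnP j (r + h); first by rewrite Ah ?mul0r.
by rewrite Bk ?mulr0 //; rewrite (leq_trans rc) // addnA leq_add2r.
Qed.

Lemma filtD h A B : filt h A -> filt h B -> filt h (A + B).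
Proof. by move=> Ah Bh r c rc; rewrite mxE Ah // Bh // addr0. Qed.

Lemma filtZ h a A : filt h A -> filt h (a *: A).
Proof. by move=> Ah r c rc; rewrite mxE Ah // mulr0. Qed.

Lemma filt_leq h k A : (h <= k)%N -> filt k A -> filt h A.
Proof. by move=> hk Ak r c rc; apply: Ak; rewrite (leq_trans rc) // leq_add2l. Qed.

Lemma filt_height k : (k < 6)%N ->
  filt (root_height k) (rmx K k) /\ filt (2 * root_height k) (smx K k).
Proof.
move=> /(all_iotaP height_check)/andP[h1 h2]; split=> r c rc; rewrite mxE.
  by have /implyP/(_ rc)/eqP-> := all_iotaP (all_iotaP h1 (ltn_ord r)) (ltn_ord c).
by have /implyP/(_ rc)/eqP-> := all_iotaP (all_iotaP h2 (ltn_ord r)) (ltn_ord c).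
Qed.

Lemma filt_nilp A : filt 1 A -> A ^+ 7 = 0.
Proof.
move=> A1; have H k : filt k (A ^+ k).
  elim: k => [|k IHk]; last by rewrite exprS -add1n; apply: filtM.
  move=> r c rc; rewrite expr0 mxE; case: eqP rc => // ->; by rewrite addn0 ltnn.
by apply/matrixP => r c; rewrite [RHS]mxE (H 7%N) // (leq_trans (ltn_ord c)) // leq_addl.
Qed.

(** The term shown is the bracket of the root vector with the diagonal of z; all other changes lie
    strictly above the superdiagonal numbered by the height of the root. *)
Lemma conj_umx k s z : (k < 6)%N -> filt 0 z -> forall r c : 'I_7, (c <= r + root_height k)%N ->
  (umx k s *m z *m invmx (umx k s)) r c =
  z r c + s * (root_fun k r c)%:~R * (z c c - z r r).
Proof.
move=> k6 z0 r c rc; have k12 : (k < 12)%N by rewrite (leq_trans k6).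
have [e1 s1] := filt_height k6; set h := root_height k in rc e1 s1.
have h0 : (0 < h)%N by rewrite /h; case: (k) k6 => [|[|[|[|[|[|//]]]]]].
pose d : M := diag_mx (\row_i z i i); pose n := z - d.
have n1 : filt 1 n.
  move=> i j; rewrite addn1 ltnS leq_eqVlt => /orP[/eqP/val_inj->|ij].
    by rewrite !mxE eqxx mulr1n subrr.
  by rewrite !mxE (z0 i j) ?addn0 //; case: eqP ij => [->|_ _]; rewrite ?ltnn // mulr0n subrr.
have zE : z = d + n by rewrite /n addrC subrK.
have d0 : filt 0 d by move=> i j; rewrite addn0 !mxE; case: eqP => // ->; rewrite ltnn.
pose e := rmx K k; pose q := smx K k.
pose R := s *: (e *m n) + - s *: (n *m e) + s ^+ 2 *: (q *m z) + s ^+ 2 *: (z *m q)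
  + - s ^+ 2 *: (e *m (z *m e)) + - s ^+ 3 *: (q *m (z *m e)) + s ^+ 3 *: (e *m (z *m q))
  + s ^+ 4 *: (q *m (z *m q)).
have Rh : filt h.+1 R.
  repeat apply: filtD; apply: filtZ.
  - by rewrite -addn1; apply: filtM.
  - by rewrite -add1n; apply: filtM.
  - by apply: (@filt_leq _ (2 * h + 0)); [lia|apply: filtM].
  - by apply: (@filt_leq _ (0 + 2 * h)); [lia|apply: filtM].
  - by apply: (@filt_leq _ (h + (0 + h))); [lia|do 2!apply: filtM => //].
  - by apply: (@filt_leq _ (2 * h + (0 + h))); [lia|do 2!apply: filtM => //].
  - by apply: (@filt_leq _ (h + (0 + 2 * h))); [lia|do 2!apply: filtM => //].
  - by apply: (@filt_leq _ (2 * h + (0 + 2 * h))); [lia|do 2!apply: filtM => //].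
have -> : umx k s *m z *m invmx (umx k s) = z + s *: (e *m d - d *m e) + R.
  rewrite invmx_umx // /umx -/e -/q !mulmxDl !mulmxDr !mul1mx !mulmx1 -!scalemxAl -!scalemxAr.
  rewrite /R -?mulmxA.
  have -> : e *m z = e *m d + e *m n by rewrite -mulmxDr -zE.
  have -> : z *m e = d *m e + n *m e by rewrite -mulmxDl -zE.
  rewrite !mulmxDr -?mulmxA.
  move: (e *m d) (e *m n) (d *m e) (n *m e) (q *m z) (z *m q) (e *m (d *m e)) (e *m (n *m e))
    (q *m (d *m e)) (q *m (n *m e)) (e *m (z *m q)) (q *m (z *m q)) => *.
  by apply/matrixP => i j; rewrite !mxE; ring.
rewrite mxE (Rh r c) ?addr0; last by rewrite addnS ltnS.
rewrite mxE; congr (_ + _); rewrite mxE mul_diag_mx mul_mx_diag !mxE; ring.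
Qed.

Lemma chh_rmx i k : (k < 12)%N ->
  bracket (chh K i) (rmx K k) = (root_weight k i)%:~R *: rmx K k.
Proof.
move=> k12; apply/matrixP => r c; rewrite /bracket /chh mul_diag_mx mul_mx_diag !mxE.
have cE (j : 'I_7) : Defs.coord (nth (0, 0) weights7 j) i = cartan_fun i j.
  by have := chh_entry K i j j; rewrite /chh mxE eqxx mul1r mxE mulr1n => /intr_inj.
rewrite !cE; have := all_iotaP (all_iotaP (all_iotaP weight_check k12) (ltn_ord r)) (ltn_ord c).
case/orP=> [/eqP->|/all_iotaP/(_ (ltn_ord i))/eqP <-]; first by rewrite mulr0 mul0r subrr mulr0.
by rewrite rmorphB /=; ring.
Qed.

Definition cartan_diag (a b : K) : M := a *: chh K 0 + b *: chh K 1.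

Lemma cartan_diag_entry a b (r c : 'I_7) : cartan_diag a b r c =
  (r == c)%:R * (a * (cartan_fun 0 r)%:~R + b * (cartan_fun 1 r)%:~R).
Proof.
rewrite /cartan_diag; have aE (A B : M) : (A + B) r c = A r c + B r c by rewrite mxE.
have zE x (A : M) : (x *: A) r c = x * A r c by rewrite mxE.
by rewrite aE !zE !chh_entry /=; ring.
Qed.

Lemma cartan_diag_rmx a b k : (k < 12)%N -> bracket (cartan_diag a b) (rmx K k) =
  (a * (root_weight k 0)%:~R + b * (root_weight k 1)%:~R) *: rmx K k.
Proof.
move=> k12; have e0 := chh_rmx 0 k12; have e1 := chh_rmx 1 k12; move: e0 e1.
rewrite /bracket /cartan_diag !mulmxDl !mulmxDr -!scalemxAl -!scalemxAr => e0 e1.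
rewrite opprD addrACA -!scalerBr e0 e1 scalerDl -!scalerA; by [].
Qed.

Lemma root_coord_rmx j k : (j < 12)%N -> (k < 12)%N -> root_coord j (rmx K k) = (j == k)%:R.
Proof.
move=> j12 k12; have /andP[p1 p2] := all_iotaP root_pos_bound j12.
rewrite /root_coord mxE !inordK //.
by have /eqP-> := all_iotaP (all_iotaP pos_check k12) j12.
Qed.

End NullVectors.

(** * Conjugating semisimple elements into the Cartan subalgebra *)

Section Diagonalization.
Variable K : numClosedFieldType.
Local Notation M := 'M[K]_7.
Local Notation e0 := (delta_mx 0 0 : 'cV[K]_7).
Implicit Types (g X Y z : M) (v : 'cV[K]_7).

Lemma int_semisimple_conj n (g Y : 'M[K]_n.+1) : g \in unitmx -> int_semisimple Y ->
  int_semisimple (g *m Y *m invmx g).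
Proof.
move=> gU [s [Pi [us s1 sY]]]; exists s, (fun k => g *m Pi k *m invmx g); split=> //.
  by rewrite -mulmx_suml -mulmx_sumr s1 [g *m _]mulmx1 mulmxV.
move=> k /sY[e1 e2]; rewrite -!mulmxE -!mulmxA !mulKmx // !(mulmxA _ _ (invmx g)).
by rewrite [Y *m _]e1 [_ *m Y]e2 -scalemxAr -scalemxAl.
Qed.

Lemma int_semisimple_root n (Y : 'M[K]_n.+1) (a : K) m (v : 'cV_n.+1) : int_semisimple Y ->
  (Y - a%:M) ^+ m *m v = 0 -> (Y - a%:M) *m v = 0.
Proof.
move=> [s [Pi [us s1 sY]]] Yv.
have PY j k : k \in s -> Pi k * (Y - a%:M) ^+ j = (k%:~R - a) ^+ j *: Pi k.
  move=> ks; elim: j => [|j IHj]; first by rewrite !expr0 mulr1 scale1r.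
  rewrite exprSr mulrA IHj -scalerAl mulrBr (sY k ks).2 -[Pi k * _]/(Pi k *m a%:M) mul_mx_scalar.
  by rewrite -scalerBl scalerA -exprSr.
have z k : k \in s -> (k%:~R - a) *: (Pi k *m v) = 0.
  move=> ks; have := congr1 (mulmx (Pi k)) Yv; rewrite mulmx0 mulmxA mulmxE PY //.
  rewrite -scalemxAl => /eqP; rewrite scaler_eq0 expf_eq0.
  by case/orP=> [/andP[_ /eqP->]|/eqP->]; rewrite ?scale0r ?scaler0.
rewrite -[v]mul1mx -[1%:M]/(1 : 'M_n.+1) -s1 mulmx_suml mulmx_sumr.
rewrite big1_seq // => k /= ks; rewrite mulmxA mulmxBl [Y *m _](sY k ks).1 mul_scalar_mx.
by rewrite -scalerBl -scalemxAl z.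
Qed.

Lemma lie_G2_conj g z : G2 K g -> lie_algebra (G2 K) z ->
  lie_algebra (G2 K) (g *m z *m invmx g).
Proof. by move=> Gg Lz; apply: lie_Ad => //; apply: G2_subgroup. Qed.

Lemma conjM g h z : G2 K g -> G2 K h ->
  (g *m h) *m z *m invmx (g *m h) = g *m (h *m z *m invmx h) *m invmx g.
Proof.
by move=> Gg Gh; have [GU _ _ _] := G2_subgroup K; rewrite invmxM ?(GU _ Gg) ?(GU _ Gh) // !mulmxA.
Qed.

(** Elements of the Lie algebra are skew for the form, so pairing z v with v gives l q(v) = - l
    q(v). *)
Lemma eigenvector_null z v (l : K) : lie_algebra (G2 K) z -> l != 0 -> z *m v = l *: v ->
  qform v = 0.
Proof.
move=> Lz l0 zv; have n2 : (2 : K) != 0 by rewrite pnatr_eq0.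
apply: (mulfI n2); rewrite mulr0 -qformE; apply: (mulfI l0).
have jz : z^T *m jmx K = - (jmx K *m z).
  rewrite -mulmxN -(lie_G2_form Lz) !mulmxA.
  have -> : jmx K *m jinv K = 1%:M by apply: mulmx1C; apply: jinvK.
  by rewrite mul1mx.
set q := (v^T *m jmx K *m v) 0 0.
have e1 : (v^T *m jmx K *m (z *m v)) 0 0 = l * q by rewrite zv -scalemxAr mxE.
have e2 : (v^T *m jmx K *m (z *m v)) 0 0 = - (l * q).
  rewrite mulmxA -(mulmxA v^T) -[jmx K *m z]opprK -jz mulmxN mulNmx mxE mulmxA.
  by rewrite -trmx_mul zv linearZ /= -!scalemxAl mxE.
rewrite mulr0; have := addrN (l * q); rewrite -{1}e1 -e2 e1 -mulr2n => /eqP.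
by rewrite mulrn_eq0 /= => /eqP.
Qed.

(** The negative root vectors other than that of index 7 send the first basis vector to distinct
    other basis vectors, so an element preserving its line has no component along them. *)
Lemma lie_G2_upper z : lie_algebra (G2 K) z -> z *m e0 = z 0 0 *: e0 ->
  root_coord 7 z = 0 -> filt 0 z.
Proof.
move=> Lz z0 z7 r c rc; rewrite addn0 in rc.
have low k : (6 <= k < 12)%N -> root_coord k z = 0.
  move=> /andP[k6 k12]; have [->//|k7] := eqVneq k 7%N.
  have p2 : (root_pos k).2 = 0%N /\ (0 < (root_pos k).1 < 7)%N.
    by move: k6 k12 k7; do 12 (case: k => [|k] //).
  have := congr1 (fun w : 'cV_7 => w (inord (root_pos k).1) 0) z0.
  rewrite -colE !mxE /root_coord p2.1 (_ : inord 0 = 0); last by apply: val_inj; rewrite /= inordK.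
  move=> ->; rewrite -val_eqE /= inordK; last by case/andP: p2.2.
  by rewrite gtn_eqF ?mulr0 //; case/andP: p2.2.
rewrite (lie_G2_decomp Lz) -addrA -/(cartan_diag _ _) mxE cartan_diag_entry.
have -> : (r == c) = false by apply/eqP => e; rewrite e ltnn in rc.
rewrite mul0r addr0 summxE big1 // => k _; rewrite mxE.
have [k6|k6] := ltnP k 6; last by rewrite low ?mul0r // k6 /=.
by rewrite (filt_height K k6).1 ?mulr0 // (leq_trans rc) // leq_addr.
Qed.

(** Root components on which the diagonal acts nontrivially are removed in the order of the indices,
    along which heights do not decrease; by [conj_umx] a later conjugation leaves the earlier
    components alone. *)
Lemma kill_roots z : lie_algebra (G2 K) z -> filt 0 z -> exists2 g, G2 K g &
  let z' := g *m z *m invmx g in [/\ filt 0 z', lie_algebra (G2 K) z' &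
    forall k, (k < 6)%N -> root_coord k z' *
      (z' (inord (root_pos k).2) (inord (root_pos k).2) -
       z' (inord (root_pos k).1) (inord (root_pos k).1)) = 0].
Proof.
move=> Lz z0; have [GU G1 GM _] := G2_subgroup K.
suff H n : (n <= 6)%N -> exists2 g, G2 K g &
  let z' := g *m z *m invmx g in [/\ filt 0 z', lie_algebra (G2 K) z' &
    forall k, (k < n)%N -> root_coord k z' *
      (z' (inord (root_pos k).2) (inord (root_pos k).2) -
       z' (inord (root_pos k).1) (inord (root_pos k).1)) = 0] by apply: H.
elim: n => [_|n IHn n6].
  by exists 1%:M => //=; rewrite mul1mx invmx1 mulmx1.
have [g Gg /= [y0 Ly yk]] := IHn (ltnW n6); set y := _ *m invmx g in y0 Ly yk.
pose d k := y (inord (root_pos k).2) (inord (root_pos k).2) -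
  y (inord (root_pos k).1) (inord (root_pos k).1).
(* If [d n] is 0 then s is 0, and the component survives next to a zero factor. *)
pose s := - root_coord n y / d n; have n12 : (n < 12)%N by rewrite (leq_trans n6).
have Gu := umx_G2 s n12; exists (umx n s *m g); first exact: GM.
rewrite /= conjM // -/y; set x := _ *m invmx (umx n s).
have xE := conj_umx s n6 y0; rewrite -/x in xE.
have h0 : (0 < root_height n)%N by case: (n) n6 => [|[|[|[|[|[|//]]]]]].
have x0 : filt 0 x.
  have u0 (t : K) : filt 0 (umx n t).
    have [e1 s1] := filt_height K n6.
    apply: filtD; [apply: filtD|by apply: filtZ; apply: filt_leq s1].
      by move=> i j; rewrite mxE addn0; case: eqP => // ->; rewrite ltnn.
    by apply: filtZ; apply: filt_leq e1.
  by rewrite /x invmx_umx //; apply: (@filtM _ 0 0) => //; apply: (@filtM _ 0 0).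
have xd i : x i i = y i i by rewrite xE ?leq_addr // subrr mulr0 addr0.
split=> //; first exact: lie_G2_conj.
move=> k; rewrite ltnS => kn; rewrite !xd -/(d k).
have k12 : (k < 12)%N by rewrite (leq_ltn_trans kn).
have /andP[p1 p2] := all_iotaP root_pos_bound k12.
have hk : ((root_pos k).2 <= (root_pos k).1 + root_height n)%N.
  have : all (fun n => all (fun k => (root_pos k).2 <= (root_pos k).1 + root_height n)%N (iota 0 n.+1)) (iota 0 6) by [].
  by move=> hc; apply: (all_iotaP (all_iotaP hc n6)).
rewrite {1}/root_coord xE ?inordK // -/(root_coord k y) -/(d k).
have /eqP-> := all_iotaP (all_iotaP pos_check n12) k12.
move: kn; rewrite leq_eqVlt => /orP[/eqP->|kn].
  rewrite eqxx mulr1; have [->|dn] := eqVneq (d n) 0; first by rewrite mulr0.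
  by rewrite divfK // subrr mul0r.
by rewrite ltn_eqF // mulr0 mul0r addr0 yk.
Qed.

(** The block of z on coordinates 1 and 2 is made triangular inside the Levi subgroup of the long
    simple root: by a root of a quadratic equation, or by the reflection if the block is already
    triangular on the wrong side. *)
Lemma levi_step z : lie_algebra (G2 K) z -> z *m e0 = z 0 0 *: e0 ->
  exists2 g, G2 K g & let z' := g *m z *m invmx g in
    z' *m e0 = z' 0 0 *: e0 /\ root_coord 7 z' = 0.
Proof.
move=> Lz z0; have [GU G1 GM _] := G2_subgroup K.
have E0 (Y : M) (l : K) : Y *m e0 = l *: e0 ->
    Y *m e0 = Y 0 0 *: e0.
  move=> e; rewrite e; have := congr1 (fun w : 'cV_7 => w 0 0) e.
  by rewrite -colE !mxE mulr1 => <-.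
have fixE g : G2 K g -> g *m e0 = e0 ->
    let z' := g *m z *m invmx g in z' *m e0 = z' 0 0 *: e0.
  move=> Gg g0; apply: (E0 _ (z 0 0)).
  by rewrite -{1}g0 -!mulmxA mulKmx ?GU // z0 -scalemxAr g0.
have i2 : (inord 2 : 'I_7) = 2%N :> nat by rewrite inordK.
have [z12|z12] := eqVneq (z (inord 1) (inord 2)) 0; last first.
  pose a := z (inord 1) (inord 2); pose b := z (inord 1) (inord 1) - z (inord 2) (inord 2).
  pose c := z (inord 2) (inord 1).
  have [s sE] : exists s : K, c + s * b - s ^+ 2 * a = 0.
    pose D := sqrtC (b ^+ 2 + 4 * a * c); exists ((b + D) / (2 * a)).
    have D2 : D ^+ 2 = b ^+ 2 + 4 * a * c by rewrite sqrtCK.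
    have n2 : (2 : K) != 0 by rewrite pnatr_eq0.
    have e : c = (D ^+ 2 - b ^+ 2) / (4 * a) by rewrite D2; field; rewrite z12.
    by rewrite e; field; rewrite z12.
  have s7 : smx K 7 = 0 by rewrite /smx -int_mx0; apply: int_mx_eq.
  have uE t : umx 7 t = 1%:M + t *: rmx K 7 by rewrite /umx s7 scaler0 addr0.
  exists (umx 7 s); first exact: umx_G2.
  split; first (apply: fixE; first exact: umx_G2).
    rewrite uE mulmxDl mul1mx -scalemxAl -[RHS]addr0; congr (_ + _); apply/colP => i.
    by rewrite mxE -colE !mxE; case: i => [[|[|[|[|[|[|[|//]]]]]]] hi]; rewrite mulr0.
  rewrite invmx_umx // !uE !mulmxDl !mulmxDr !mul1mx !mulmx1 -!scalemxAl -!scalemxAr.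
  rewrite /root_coord.
  have row2 (A : M) j : (rmx K 7 *m A) (inord 2) j = A (inord 1) j.
    rewrite mxE (bigD1 (inord 1)) //= big1 => [|i i1]; rewrite !mxE !inordK //=.
      by rewrite mul1r addr0.
    have : (i : nat) != 1%N by apply: contra i1 => /eqP ii; apply/eqP/val_inj; rewrite /= inordK.
    by case: i {i1} => [[|[|[|[|[|[|[|//]]]]]]] hi]; rewrite ?mul0r.
  have col1 (A : M) i : (A *m rmx K 7) i (inord 1) = A i (inord 2).
    rewrite mxE (bigD1 (inord 2)) //= big1 => [|j j2]; rewrite !mxE !inordK //=.
      by rewrite mulr1 addr0.
    have : (j : nat) != 2%N by apply: contra j2 => /eqP ii; apply/eqP/val_inj; rewrite /= inordK.
    by case: j {j2} => [[|[|[|[|[|[|[|//]]]]]]] hi]; rewrite ?mulr0.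
  have aE (A B : M) i j : (A + B) i j = A i j + B i j by rewrite mxE.
  have zE x (A : M) i j : (x *: A) i j = x * A i j by rewrite mxE.
  rewrite /= !(aE, zE) !col1 !row2 -sE /a /b /c; ring.
exists (int_mx K (weyl_fun 1)); first exact: weyl_G2.
have Gw : G2 K (int_mx K (weyl_fun 1)) by apply: weyl_G2.
set w := int_mx _ _ in Gw *.
have wE i j : w i j = (weyl_fun 1 i j)%:~R by rewrite mxE.
split; first apply: fixE => //.
  have c0 : all (fun j => weyl_fun 1 j 0 == (j == 0%N : nat)%:Z) (iota 0 7) by vm_compute.
  apply/colP => i; rewrite -colE mxE [RHS]mxE wE andbT.
  by have /eqP-> := all_iotaP c0 (ltn_ord i).
set y := w *m z *m invmx w; have wc : all (fun j => (weyl_fun 1 j 2 == if j == 1%N then weyl_fun 1 1 2 else 0) &&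
  (weyl_fun 1 2 j == if j == 1%N then weyl_fun 1 2 1 else 0)) (iota 0 7) && (weyl_fun 1 1 2 != 0).
  by vm_compute.
have /andP[wa w0] := wc; have i1 : (inord 1 : 'I_7) = 1%N :> nat by rewrite inordK.
have j1 (j : 'I_7) : j != inord 1 -> ((j : nat) == 1%N) = false.
  by move=> jn; apply: contraNF jn => /eqP ji; apply/eqP/val_inj; rewrite /= i1.
have := congr1 (fun A : M => A (inord 2) (inord 2)) (mulmxKV (GU _ Gw) (w *m z)).
rewrite /= -/y mxE (bigD1 (inord 1)) //= big1 => [|j /j1 jn]; last first.
  by rewrite wE i2; have /andP[/eqP-> _] := all_iotaP wa (ltn_ord j); rewrite jn mulr0.
rewrite [RHS]mxE (bigD1 (inord 1)) //= big1 => [|j /j1 jn]; last first.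
  by rewrite wE i2; have /andP[_ /eqP->] := all_iotaP wa (ltn_ord j); rewrite jn mul0r.
rewrite z12 mulr0 !addr0 wE i1 i2 => /eqP; rewrite mulf_eq0 intr_eq0 (negbTE w0) orbF.
by move/eqP.
Qed.

(** An eigenvector with nonzero eigenvalue is null, hence conjugate into the highest weight line; a
    step in the Levi subgroup then makes z upper triangular. After [kill_roots] the strictly upper
    part commutes with the diagonal part, and semisimplicity forces it to vanish. *)
Lemma lie_G2_diagonalize z : lie_algebra (G2 K) z -> int_semisimple z ->
  exists2 g, G2 K g & exists a b, g *m z *m invmx g = cartan_diag a b.
Proof.
move=> Lz sz; have [GU G1 GM _] := G2_subgroup K.
have [->|zn0] := eqVneq z 0.
  by exists 1%:M => //; exists 0, 0; rewrite mulmx0 mul0mx /cartan_diag !scale0r addr0.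
have [v [l [vn0 l0 zv]]] : exists v l, [/\ v != 0, l != 0 & z *m v = l *: v].
  have [s [Pi [us s1 sY]]] := sz.
  have [k ks kP] : exists2 k, k \in s & k%:~R *: Pi k != 0.
    apply/hasP; apply: contraNT zn0 => /hasPn h.
    rewrite -[z]mulr1 -s1 mulr_sumr big1_seq // => k /= ks.
    by rewrite (sY k ks).1; apply/eqP; move/(_ k ks): h; rewrite negbK.
  move: kP; rewrite scaler_eq0 negb_or => /andP[k0 /matrix0Pn[i [j Pij]]].
  exists (Pi k *m delta_mx j 0), k%:~R; split=> //.
    apply: contra Pij => /eqP e; have := congr1 (fun w : 'cV_7 => w i 0) e.
    by rewrite -colE !mxE => ->.
  by rewrite mulmxA [z *m _](sY k ks).1 scalemxAl.
have [g Gg [l' l'0 gv]] := null_vector vn0 (eigenvector_null Lz l0 zv).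
set y := g *m z *m invmx g; have Ly : lie_algebra (G2 K) y by apply: lie_G2_conj.
have y0 : y *m e0 = y 0 0 *: e0.
  have e : y *m e0 = l *: e0.
    have -> : e0 = l'^-1 *: (g *m v) by rewrite gv scalerA mulVf // scale1r.
    rewrite /y -scalemxAr -!mulmxA mulKmx ?GU // zv -scalemxAr !scalerA mulrC //.
  rewrite e; have := congr1 (fun w : 'cV_7 => w 0 0) e.
  by rewrite -colE !mxE mulr1 => <-.
have [h Gh [x0 x7]] := levi_step Ly y0; set x := _ *m invmx h in x0 x7.
have Lx : lie_algebra (G2 K) x by apply: lie_G2_conj.
have [f Gf [w0 Lw wk]] := kill_roots Lx (lie_G2_upper Lx x0 x7).
set w := _ *m invmx f in w0 Lw wk.
exists (f *m (h *m g)); first by apply: (GM) => //; apply: GM.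
have Ghg : G2 K (h *m g) by apply: GM.
rewrite (conjM z Gf Ghg) (conjM z Gh Gg) -/y -/x -/w.
have sw : int_semisimple w.
  by apply: int_semisimple_conj (GU _ Gf) _; apply: int_semisimple_conj (GU _ Gh) _;
    apply: int_semisimple_conj (GU _ Gg) _.
exists (w 0 0), (w 0 0 + w 1 1); set D := cartan_diag _ _.
pose n := \sum_(k < 12) root_coord k w *: rmx K k.
have wE : w = n + D by rewrite {1}(lie_G2_decomp Lw) -addrA.
have neg k : (6 <= k < 12)%N -> root_coord k w = 0.
  move=> /andP[k6 k12]; apply: w0; have /andP[p1 p2] := all_iotaP root_pos_bound k12.
  rewrite addn0 !inordK //; move: k6 k12 {p1 p2}; by do 12 (case: k => [|k] //).
have n1 : filt 1 n.
  move=> r c rc; rewrite summxE big1 // => k _; rewrite mxE.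
  have [k6|k6] := ltnP k 6; last by rewrite neg ?mul0r // k6 /=.
  have h1 : (1 <= root_height k)%N by case: (k : nat) k6 => [|[|[|[|[|[|//]]]]]].
  by rewrite (filt_leq h1 (filt_height K k6).1) ?mulr0.
have Dii i : w i i = D i i by rewrite {1}wE mxE n1 ?add0r // addn1.
have nD : bracket D n = 0.
  rewrite /bracket mulmx_sumr mulmx_suml -sumrB big1 // => k _.
  rewrite -scalemxAr -scalemxAl -scalerBr [_ - _]cartan_diag_rmx // scalerA.
  have [k6|k6] := ltnP k 6; last by rewrite neg ?mul0r ?scale0r // k6 /=.
  have /andP[p1 p2] := all_iotaP root_pos_bound (ltn_ord k).
  have /eqP := wk k k6; rewrite (Dii (inord (root_pos k).2)) (Dii (inord (root_pos k).1)) !cartan_diag_entry !eqxx !mul1r !inordK // /root_weight.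
  rewrite !rmorphB /= => /eqP e; apply/eqP; rewrite scaler_eq0; apply/orP; left.
  rewrite -oppr_eq0 -e; apply/eqP; ring.
have nw : GRing.comm n w.
  rewrite /GRing.comm {2}wE {1}wE mulrDr mulrDl; congr (_ + _).
  by apply/esym/eqP; rewrite -subr_eq0; apply/eqP.
suff n0 : n = 0 by rewrite wE n0 add0r.
apply/matrixP => r c; rewrite [RHS]mxE.
pose v' : 'cV[K]_7 := delta_mx c 0; pose d := D c c.
have Dv : D *m v' = d *: v'.
  apply/colP => i; rewrite -colE [LHS]mxE [RHS]mxE [X in _ * X]mxE eqxx andbT /d.
  rewrite !cartan_diag_entry eqxx mul1r.
  by case: eqP => [->|_]; rewrite ?mul1r ?mulr1 ?mul0r ?mulr0.
have e1 : (w - d%:M) *m v' = n *m v'.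
  by rewrite mulmxBl mul_scalar_mx wE mulmxDl Dv addrK.
have em m : (w - d%:M) ^+ m *m v' = n ^+ m *m v'.
  elim: m => [|m IHm]; first by rewrite !expr0.
  rewrite exprS -mulmxE -mulmxA IHm exprSr -[n ^+ m * n]/(n ^+ m *m n) -mulmxA -e1 !mulmxA.
  congr (_ *m _); apply: commrX; apply: commr_sym; apply: commrB => //.
  by rewrite /GRing.comm -!mulmxE scalar_mxC.
have := @int_semisimple_root _ w d 7 v' sw; rewrite em filt_nilp // mul0mx e1 => /(_ erefl) nv.
by have := congr1 (fun u : 'cV_7 => u r 0) nv; rewrite /v' -colE !mxE.
Qed.

End Diagonalization.

(** * Lie algebras of reductive subgroups of G2 *)

Section Brackets.
Variables (K : numFieldType) (n : nat).
Local Notation M := 'M[K]_n.+1.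
Implicit Types (X Y Z : M).

Lemma bracketE X Y : bracket X Y = X * Y - Y * X.
Proof. by []. Qed.

Lemma jacobi X Y Z :
  bracket X (bracket Y Z) = bracket (bracket X Y) Z + bracket Y (bracket X Z).
Proof.
rewrite !bracketE !mulrBr !mulrBl !mulrA.
move: (X * Y * Z) (X * Z * Y) (Y * Z * X) (Z * Y * X) (Y * X * Z) (Z * X * Y) => a b c d e f.
by apply/matrixP => i j; rewrite !mxE; ring.
Qed.

Lemma bracketC X Y : bracket X Y = - bracket Y X.
Proof. by rewrite !bracketE opprB. Qed.

Lemma bracketXX X : bracket X X = 0.
Proof. exact: subrr. Qed.

Lemma bracketDr X Y Z : bracket X (Y + Z) = bracket X Y + bracket X Z.
Proof. by rewrite !bracketE mulrDr mulrDl opprD addrACA. Qed.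

Lemma bracketDl X Y Z : bracket (X + Y) Z = bracket X Z + bracket Y Z.
Proof. by rewrite bracketC bracketDr opprD -!(bracketC _ Z). Qed.

Lemma bracketZr a X Y : bracket X (a *: Y) = a *: bracket X Y.
Proof. by rewrite !bracketE -scalerAr -scalerAl scalerBr. Qed.

Lemma bracketNr X Y : bracket X (- Y) = - bracket X Y.
Proof. by rewrite -!scaleN1r bracketZr. Qed.

Lemma bracketNl X Y : bracket (- X) Y = - bracket X Y.
Proof. by rewrite bracketC bracketNr -bracketC. Qed.

Lemma bracketZl a X Y : bracket (a *: X) Y = a *: bracket X Y.
Proof. by rewrite bracketC bracketZr -scalerN -bracketC. Qed.

Lemma bracket0r X : bracket X 0 = 0.
Proof. by rewrite bracketE mulr0 mul0r subrr. Qed.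

Lemma bracket_sumr X (I : Type) (r : seq I) (Q : pred I) (F : I -> M) :
  bracket X (\sum_(i <- r | Q i) F i) = \sum_(i <- r | Q i) bracket X (F i).
Proof. exact: (big_morph (bracket X) (bracketDr X) (bracket0r X)). Qed.

Lemma bracket_comm X Y : GRing.comm X Y <-> bracket X Y = 0.
Proof. by rewrite bracketE; split=> [->|/eqP]; rewrite ?subrr // subr_eq0 => /eqP. Qed.

Lemma tr_bracket X Y Z : \tr (bracket X Y * Z) = \tr (X * bracket Y Z).
Proof.
rewrite !bracketE mulrBl mulrBr !linearB /= !mulrA; congr (_ - _).
by rewrite -[Y * X * Z]mulrA; apply: mxtrace_mulC.
Qed.

End Brackets.

(** * Weights of semisimple elements and the rank one case *)

Section SemisimpleAd.
Variables (K : numClosedFieldType) (n : nat).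
Local Notation M := 'M[K]_n.+1.
Implicit Types (X Y Z x v : M) (H : set M).

Lemma int_semisimple_ad x : int_semisimple x -> exists rs : seq int, uniq rs /\
  (forall k v, v != 0 -> bracket x v = k%:~R *: v -> k \in rs) /\
  forall Y, exists F : int -> M, Y = \sum_(k <- rs) F k /\
    forall k, bracket x (F k) = k%:~R *: F k.
Proof.
move=> [s [Pi [us s1 sY]]].
have split_sum Y : Y = \sum_(i <- s) \sum_(j <- s) Pi i * Y * Pi j.
  rewrite -{1}[Y]mul1r -[1 * Y]mulr1 -s1 mulr_suml mulr_suml.
  by apply: eq_bigr => i _; rewrite mulr_sumr.
exists (undup [seq i - j | i <- s, j <- s]); split; first exact: undup_uniq.
have memrs i j : i \in s -> j \in s -> i - j \in undup [seq i - j | i <- s, j <- s].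
  by move=> si sj; rewrite mem_undup; apply/allpairsP; exists (i, j).
split=> [k v vn0 xv|Y].
  apply: contraNT vn0 => kn; rewrite (split_sum v) big1_seq // => i /= si.
  rewrite big1_seq // => j /= sj; apply/eqP.
  have : (k%:~R - (i - j)%:~R) *: (Pi i * v * Pi j) = 0.
    have := congr1 (fun w : M => Pi i * w * Pi j) xv.
    rewrite bracketE mulrBr mulrBl !mulrA (sY i si).2 -!mulrA (sY j sj).1.
    rewrite -!scalerAl -!scalerAr -scalerBl -rmorphB => e.
    by rewrite scalerBl mulrA -mulrA e subrr.
  move=> /eqP; rewrite scaler_eq0 -rmorphB intr_eq0 subr_eq0 => /orP[/eqP kij|//].
  by rewrite kij memrs in kn.
exists (fun k => \sum_(i <- s) \sum_(j <- s) if i - j == k then Pi i * Y * Pi j else 0).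
split=> [|k].
  rewrite exchange_big /= {1}(split_sum Y); apply: eq_big_seq => i si.
  rewrite exchange_big /=; apply: eq_big_seq => j sj.
  rewrite (bigD1_seq (i - j)) ?undup_uniq ?memrs //= eqxx big1 ?addr0 // => k.
  by rewrite eq_sym => /negbTE->.
rewrite bracket_sumr scaler_sumr; apply: eq_big_seq => i si.
rewrite bracket_sumr scaler_sumr; apply: eq_big_seq => j sj.
case: eqP => [<-|_]; last by rewrite bracket0r scaler0.
rewrite bracketE !mulrA (sY i si).1 -!mulrA (sY j sj).2 -!scalerAl -!scalerAr.
by rewrite rmorphB scalerBl.
Qed.

Lemma ad_component_mem x (S : M -> Prop) (rs : seq int) (F : int -> M) : uniq rs ->
  S 0 -> (forall a u v, S u -> S v -> S (a *: u + v)) -> (forall v, S v -> S (bracket x v)) ->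
  (forall k, bracket x (F k) = k%:~R *: F k) -> S (\sum_(k <- rs) F k) ->
  forall k, k \in rs -> S (F k).
Proof.
move=> urs S0 SP Sx xF Ss k krs.
have Dl a u v : bracket x (a *: u + v) = a *: bracket x u + bracket x v.
  by rewrite bracketDr bracketZr.
pose G (a : K) := \sum_(k <- rs | k%:~R == a) F k.
have GE j : j \in rs -> G j%:~R = F j.
  move=> jrs; rewrite /G big_mkcond (bigD1_seq j) //= eqxx big1 ?addr0 // => i.
  by rewrite eqr_int => /negbTE->.
rewrite -GE //; apply: (@eigen_components _ _ (bracket x) Dl S S0 SP Sx [seq i%:~R | i <- rs] G 1).
- by rewrite map_inj_uniq // => i j /eqP; rewrite eqr_int => /eqP.
- move=> _ /mapP[j jrs ->]; rewrite GE // /= /eigop xF subrr //.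
- by rewrite big_map (eq_big_seq F) // => j; apply: GE.
- by apply: map_f.
Qed.

Lemma lie_replicas H X : subgroup_GL H -> lie_algebra H X ->
  exists (r : nat) (c : 'I_r -> K) (Y : 'I_r -> M) (N : M),
  [/\ X = N + \sum_j c j *: Y j, lie_algebra H N /\ N ^+ n.+1 = 0,
      forall j, lie_algebra H (Y j) /\ int_semisimple (Y j) &
      forall Z, GRing.comm Z X -> GRing.comm Z N /\ forall j, GRing.comm Z (Y j)].
Proof.
move=> sH LX; have [rs [Pi [N [r [c [m J]]]]]] := jordan_dataP X.
exists r, c, (replica rs Pi m), (nilpart X rs Pi c m); split.
- exact: replica_decomp.
- by split; [apply: lie_nilpart J _ sH LX|apply: nilpart_nilp J].
- by move=> j; split; [apply: lie_replica J _ j sH LX|apply: replica_int_semisimple J _].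
- by move=> Z ZX; split=> [|j]; [apply: (nilpart_comm J)|apply: (replica_comm J)].
Qed.

Variables (H : set M) (L : {vspace M}).
Hypotheses (redH : reductive H) (LP : forall X, (X \in L) <-> lie_algebra H X).

Let sH : subgroup_GL H := redH.1.1.

Lemma lie_vspace_bracket X Y : X \in L -> Y \in L -> bracket X Y \in L.
Proof. by move=> /LP LX /LP LY; apply/LP/lie_bracket. Qed.

Lemma lie_vspace_nondeg X : X \in L -> (forall Y, Y \in L -> \tr (X * Y) = 0) -> X = 0.
Proof.
move=> /LP LX XY; apply: (reductive_trace_form redH LX) => Y /LP LY; exact: XY.
Qed.

(** Polarization of the identity tr (Z^2) = 0 for nilpotent Z. *)
Lemma tr_nilp_polar (X Y : M) : (X + Y) ^+ n.+1 = 0 -> X ^+ n.+1 = 0 -> Y ^+ n.+1 = 0 ->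
  \tr (X * Y) = 0.
Proof.
have sq Z : Z ^+ n.+1 = 0 -> \tr (Z * Z) = 0.
  by move=> Zn; apply: comm_nilp_tr.
move=> /sq e /sq eX /sq eY; move: e; rewrite mulrDl !mulrDr !linearD /= eX eY.
rewrite add0r addr0 -[\tr (Y * X)]mxtrace_mulC -mulr2n => /eqP.
by rewrite mulrn_eq0 => /eqP.
Qed.

Lemma lie_nilpotent_trivial : (forall X, X \in L -> X ^+ n.+1 = 0) -> L = 0%VS.
Proof.
move=> Ln; apply/eqP; rewrite -subv0; apply/subvP => X LX; rewrite memv0; apply/eqP.
apply: (lie_vspace_nondeg LX) => Y LY.
by apply: tr_nilp_polar; apply: Ln => //; apply: memvD.
Qed.

(** A nonzero x exists as a replica of an element that is not nilpotent. If z commutes with x, so do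
    its replicas; when none of them leaves the line of x, the semisimple part of z is a multiple of
    x. *)
Lemma lie_rank_cases : L != 0%VS -> exists x, [/\ x \in L, int_semisimple x, x != 0 &
  (forall z, z \in L -> GRing.comm z x -> exists a, (z - a *: x) ^+ n.+1 = 0 /\ GRing.comm (z - a *: x) x) \/
  exists y, [/\ y \in L, int_semisimple y, GRing.comm x y & y \notin <[x]>%VS]].
Proof.
move=> Ln0; have [x [xL xs xn0]] : exists x, [/\ x \in L, int_semisimple x & x != 0].
  have [X LX Xn] : exists2 X, X \in L & X ^+ n.+1 != 0.
    have [//|nX] := pselect (exists2 X, X \in L & X ^+ n.+1 != 0).
    case/negP: Ln0; apply/eqP/lie_nilpotent_trivial => X LX.
    by apply/eqP; apply: contra_notT nX => Xn; exists X.
  have [r [c [Y [N [XE [_ Nn] YP _]]]]] := lie_replicas sH (iffLR (LP X) LX).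
  have [j Yj] : exists j, Y j != 0.
    apply/existsP; apply: contraNT Xn => /existsPn Y0.
    by rewrite XE big1 ?addr0 ?Nn // => j _; have := Y0 j; rewrite negbK => /eqP->; rewrite scaler0.
  by exists (Y j); have [/LP] := YP j.
exists x; split=> //.
have [ny|ny] := pselect (exists y, [/\ y \in L, int_semisimple y, GRing.comm x y & y \notin <[x]>%VS]).
  by right.
left=> z zL zx; have [r [c [Y [N [zE [NL Nn] YP Zc]]]]] := lie_replicas sH (iffLR (LP z) zL).
have [Nx Yx] := Zc x (commr_sym zx).
have Yx' j : Y j \in <[x]>%VS.
  apply: contra_notT ny => Yn; exists (Y j); have [/LP YL Ys] := YP j; split=> //.
have : \sum_j c j *: Y j \in <[x]>%VS by apply: memv_suml => j _; apply: memvZ.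
move=> /vlineP[a e]; exists a; have -> : z - a *: x = N by rewrite zE e addrK.
by split=> //; apply: commr_sym.
Qed.

Lemma max_witness (P : int -> Prop) (rs : seq int) k0 : k0 \in rs -> P k0 ->
  exists2 k, k \in rs & P k /\ forall j, j \in rs -> P j -> j <= k.
Proof.
elim: rs k0 => // a rs IHrs k0 k0rs Pk0.
have [[k [krs Pk]]|nP] := pselect (exists k, k \in rs /\ P k); last first.
  move: k0rs; rewrite inE => /predU1P[e|k0rs]; last by case: nP; exists k0.
  exists k0; rewrite ?inE ?e ?eqxx //; split; first by rewrite -e.
  by move=> j; rewrite inE => /predU1P[->//|jrs Pj]; case: nP; exists j.
have [m mrs [Pm mmax]] := IHrs k krs Pk.
have [[Pa am]|na] := pselect (P a /\ m <= a).
  exists a; rewrite ?mem_head //; split=> // j; rewrite inE => /predU1P[->//|jrs Pj].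
  by rewrite (le_trans (mmax j jrs Pj)).
exists m; first by rewrite inE mrs orbT.
split=> // j; rewrite inE => /predU1P[->|jrs Pj]; last exact: mmax.
by move=> Pa; rewrite leNgt; apply/negP => /ltW ma; case: na.
Qed.

Let int_arith (m k j : int) : [/\ 0 < m -> k < k + m, m < k -> - k + (- k + m) < - k,
  - m + (- m + (m + m)) = 0, 0 < m -> m < k -> (- m + k) * k + k * k != 0 &
  0 < k -> j < - k -> k < - j].
Proof. by split; lia || nia. Qed.

Let int_arith2 (m k j : int) : [/\ k + (- k + m) + m - k = m + m - k -> m - k + m = m + m - k,
  j < 0 -> 0 < - j, 0 < k -> j = - k -> - k + j < - k, 0 < k -> k < k + k & - k + m + m = m + m - k].
Proof. by split; lia. Qed.

Section RankOne.
Variable x : M.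
Hypotheses (xL : x \in L) (xs : int_semisimple x) (xn0 : x != 0).
Hypothesis x_cent : forall z, z \in L -> GRing.comm z x ->
  exists a, (z - a *: x) ^+ n.+1 = 0 /\ GRing.comm (z - a *: x) x.

Let wt (k : int) v := v \in L /\ bracket x v = k%:~R *: v.

Let trx : \tr (x * x) != 0.
Proof. by apply: contra xn0 => /eqP e; apply/eqP; apply: int_semisimple_tr. Qed.

Let wt_components Y : Y \in L -> exists (rs : seq int) (F : int -> M),
  Y = \sum_(k <- rs) F k /\ forall k, k \in rs -> wt k (F k).
Proof.
move=> YL; have [rs [urs [_ FP]]] := int_semisimple_ad xs.
have [F [YE xF]] := FP Y; exists rs, F; split=> // k krs; split=> //.
apply: (@ad_component_mem x (fun v => v \in L) rs F) => //; last by rewrite -YE.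
- exact: mem0v.
- by move=> a u v uL vL; rewrite memvD // memvZ.
- by move=> v; apply: lie_vspace_bracket.
Qed.

Let wt_bracket k j u v : wt k u -> wt j v -> wt (k + j) (bracket u v).
Proof.
move=> [uL ux] [vL vx]; split; first exact: lie_vspace_bracket.
by rewrite jacobi ux vx bracketZl bracketZr -scalerDl -rmorphD.
Qed.

Let wt_tr k j u v : wt k u -> wt j v -> k + j != 0 -> \tr (u * v) = 0.
Proof.
move=> [uL ux] [vL vx] kj; have : (k + j)%:~R * \tr (u * v) = 0.
  have e1 : k%:~R * \tr (u * v) = \tr (bracket x u * v) by rewrite ux -scalerAl linearZ.
  have e2 : j%:~R * \tr (u * v) = \tr (u * bracket x v) by rewrite vx -scalerAr linearZ.
  by rewrite rmorphD mulrDl e1 e2 -tr_bracket (bracketC u x) mulNr linearN /= addrN.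
by move=> /eqP; rewrite mulf_eq0 intr_eq0 (negbTE kj) => /eqP.
Qed.

(** On weight 0, elements of trace zero against x are nilpotent, and by polarization orthogonal to
    one another; they are orthogonal to the other weights as well, so nondegeneracy makes them
    zero. *)
Let wt0 v : wt 0 v -> exists a, v = a *: x.
Proof.
have cx u : wt 0 u <-> u \in L /\ GRing.comm u x.
  rewrite /wt rmorph0 scale0r -bracket_comm.
  by split=> -[uL c]; split=> //; apply: commr_sym.
have nil u : u \in L -> GRing.comm u x -> \tr (u * x) = 0 -> u ^+ n.+1 = 0.
  move=> uL ux; have [a [un uc]] := x_cent uL ux => tux.
  have : \tr ((u - a *: x) * x) = 0 by apply: comm_nilp_tr.
  rewrite mulrBl linearB /= tux -scalerAl linearZ /= sub0r => /eqP.
  rewrite oppr_eq0 mulf_eq0 (negbTE trx) orbF => /eqP a0.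
  by move: un; rewrite a0 scale0r subr0.
have key u : u \in L -> GRing.comm u x -> \tr (u * x) = 0 -> u = 0.
  move=> uL ux tux; apply: (lie_vspace_nondeg uL) => Y YL.
  have [rs [F [-> wF]]] := wt_components YL; rewrite mulr_sumr linear_sum big1_seq // => k /= krs.
  have [k0|k0] := eqVneq k 0; last first.
    apply: (wt_tr (k := 0) (j := k)); [by apply/cx|exact: wF|by rewrite add0r].
  have := wF k krs; rewrite k0 => /cx[FL Fx]; set f := F 0 in FL Fx *.
  pose b := \tr (f * x) / \tr (x * x).
  have fb : \tr ((f - b *: x) * x) = 0.
    by rewrite mulrBl linearB /= -scalerAl linearZ /= divfK // subrr.
  have fL' : f - b *: x \in L by rewrite memvB // memvZ.
  have fx' : GRing.comm (f - b *: x) x.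
    by apply: commr_sym; apply: commrB; [apply: commr_sym|rewrite /GRing.comm -scalerAr -scalerAl].
  have : \tr (u * (f - b *: x)) = 0.
    have un := nil u uL ux tux; have fn := nil _ fL' fx' fb; apply: tr_nilp_polar => //.
    apply: nil; [exact: memvD| |by rewrite mulrDl linearD /= tux fb addr0].
    by apply: commr_sym; apply: commrD; apply: commr_sym.
  by rewrite mulrBr linearB /= -scalerAr linearZ /= tux mulr0 subr0.
move=> /cx[vL vx]; exists (\tr (v * x) / \tr (x * x)); apply/eqP; rewrite -subr_eq0; apply/eqP.
apply: key; first by rewrite memvB // memvZ.
  by apply: commr_sym; apply: commrB; [apply: commr_sym|rewrite /GRing.comm -scalerAr -scalerAl].
by rewrite mulrBl linearB /= -scalerAl linearZ /= divfK // subrr.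
Qed.

(** Nondegeneracy pairs weight k with weight -k. The bracket of a pair with nonzero trace is a
    multiple of x by [wt0], nonzero by invariance of the trace form, and u can be rescaled. *)
Let wt_dual k v : wt k v -> v != 0 -> k != 0 -> exists2 u, wt (- k) u & bracket v u = x.
Proof.
move=> wv vn0 k0; have [Y YL vY] : exists2 Y, Y \in L & \tr (v * Y) != 0.
  have [//|nY] := pselect (exists2 Y, Y \in L & \tr (v * Y) != 0).
  case/negP: vn0; apply/eqP; apply: (lie_vspace_nondeg wv.1) => Y YL.
  by apply/eqP; apply: contra_notT nY => vY; exists Y.
have [rs [F [YE wF]]] := wt_components YL.
have [u wu vu] : exists2 u, wt (- k) u & \tr (v * u) != 0.
  have [/hasP[j jrs jk]|/hasPn nk] := boolP (has (fun j => \tr (v * F j) != 0) rs).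
    exists (F j) => //; suff -> : - k = j by apply: wF.
    apply/eqP; rewrite eq_sym -addr_eq0 addrC; apply: contraNT jk => kj.
    by apply/eqP; apply: (wt_tr wv (wF j jrs)).
  case/negP: vY; rewrite YE mulr_sumr linear_sum big1_seq // => j /= /nk.
  by rewrite negbK => /eqP.
have wb := wt_bracket wv wu; rewrite addrN in wb; have [c bc] := wt0 wb.
have c0 : c != 0.
  apply: contra vu => /eqP c0; have := congr1 (fun w => \tr (w * x)) bc.
  rewrite /= c0 scale0r mul0r linear0 tr_bracket bracketC wu.2 mulrN -scalerAr linearN linearZ /=.
  by move=> /eqP; rewrite oppr_eq0 mulf_eq0 intr_eq0 oppr_eq0 (negbTE k0).
exists (c^-1 *: u); last by rewrite bracketZr bc scalerA mulVf // scale1r.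
by split; [apply: memvZ; case: wu|rewrite bracketZr wu.2 !scalerA mulrC].
Qed.

(* Bracketing with a vector e of top weight and its dual f, normalized by
   [bracket e f = x], leaves no weight besides 0 and those of e and f. *)
Lemma lie_rank_one : (\dim L <= 3)%N.
Proof.
suff [e [f Lef]] : exists e f, (L <= <<[:: e; x; f]>>)%VS.
  by apply: leq_trans (dimvS Lef) _; apply: dim_span.
have [rs [urs [wrs FP]]] := int_semisimple_ad xs.
have [[k0 [k0n [v0 [v0n wv0]]]]|nk] :=
    pselect (exists k, k != 0 /\ exists v, v != 0 /\ wt k v); last first.
  exists 0, 0; apply/subvP => Y YL; have [ts [F [-> wF]]] := wt_components YL.
  rewrite big_seq; apply: memv_suml => j jts; have wj := wF j jts.
  have [F0|Fn] := eqVneq (F j) 0; first by rewrite F0 mem0v.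
  have [j0|jn] := eqVneq j 0; last by case: nk; exists j; split=> //; exists (F j).
  move: wj; rewrite j0 => /wt0[a ->].
  by apply: memvZ; apply: memv_span; rewrite !inE eqxx orbT.
have [u0 wu0 vu0] := wt_dual wv0 v0n k0n.
have u0n : u0 != 0 by apply: contra xn0 => /eqP e; rewrite -vu0 e bracket0r.
pose P k := exists v, v != 0 /\ wt k v.
have Prs k : P k -> k \in rs by move=> [v [vn [_ vx]]]; apply: (wrs k v).
have [k krs [[e [en we]] kmax]] : exists2 k, k \in rs & P k /\ forall j, j \in rs -> P j -> j <= k.
  by apply: (@max_witness P rs k0); [apply: Prs; exists v0|exists v0].
have top j v : wt j v -> k < j -> v = 0.
  move=> wv kj; apply/eqP; apply: contraTT kj => vn; rewrite -leNgt.
  by apply: kmax; [apply: Prs|]; exists v.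
have k_gt0 : 0 < k.
  have kk0 : k0 <= k by apply: kmax; [apply: Prs|]; exists v0.
  have kk1 : - k0 <= k by apply: kmax; [apply: Prs|]; exists u0.
  have [//|kle] := ltP 0 k; case/negP: k0n; rewrite eq_le (le_trans kk0) //=.
  by rewrite -oppr_le0 (le_trans kk1).
have bot j v : wt j v -> j < - k -> v = 0.
  move=> wv jk; apply/eqP; apply/negPn/negP => vn.
  have jn : j != 0.
    by apply/eqP => j0; move: jk; rewrite j0 oppr_gt0 ltNge ltW.
  have [u wu uv] := wt_dual wv vn jn; have ue : u = 0 by apply: top wu _; case: (int_arith 0 k j) => _ _ _ _ ->.
  by case/negP: xn0; rewrite -uv ue bracket0r.
have kn0 : k != 0 by rewrite gt_eqF.
have [f wf ef] := wt_dual we en kn0.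
have kK : (k%:~R : K) != 0 by rewrite intr_eq0.
have fe : bracket f e = - x by rewrite bracketC ef.
(* No weight lies strictly between 0 and k. The Jacobi identity for e, f and w = [f, v] leaves only
   k = 2m, as in a nonreduced root system; in that case a second identity, with the dual u of v,
   gives k (2k - m) e = 0. *)
have half m v : 0 < m -> m < k -> wt m v -> v = 0.
  move=> m0 mk wv; apply/eqP/negPn/negP => vn.
  have ev : bracket e v = 0 by apply: top (wt_bracket we wv) _; case: (int_arith m k 0) => ->.
  have wfv := wt_bracket wf wv; set w := bracket f v in wfv.
  have ew : bracket e w = m%:~R *: v by rewrite /w jacobi ef ev bracket0r addr0 wv.2.
  have fw : bracket f w = 0 by apply: bot (wt_bracket wf wfv) _; case: (int_arith m k 0) => _ ->.
  have w2 : (m + m - k)%:~R *: w = 0.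
    have := jacobi e f w; rewrite fw bracket0r ef ew bracketZr wfv.2 -/w -scalerDl -rmorphD => ->.
    by congr (_%:~R *: _); case: (int_arith2 m k 0).
  have mK : (m%:~R : K) != 0 by rewrite intr_eq0 gt_eqF.
  have wn0 : w != 0.
    apply: contra vn => /eqP w0; have := ew; rewrite w0 bracket0r => /esym/eqP.
    by rewrite scaler_eq0 (negbTE mK).
  have k2m : k = m + m.
    by move/eqP: w2; rewrite scaler_eq0 (negbTE wn0) orbF intr_eq0 subr_eq0 => /eqP.
  have [u wu vu] := wt_dual wv vn (lt0r_neq0 m0).
  have wue := wt_bracket wu we; set y := bracket u e in wue.
  have vy : bracket v y = k%:~R *: e.
    rewrite /y jacobi vu we.2 (bracketC v e) ev oppr0 bracket0r addr0 //.
  have wuy : wt 0 (bracket u y).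
    by have := wt_bracket wu wue; rewrite k2m; case: (int_arith m k 0) => _ _ ->.
  have [g uy] := wt0 wuy.
  have uv : bracket u v = - x by rewrite bracketC vu.
  have e1 : bracket v (y + g *: v) = k%:~R *: e by rewrite bracketDr bracketZr bracketXX scaler0 addr0.
  have e2 : bracket u (y + g *: v) = 0 by rewrite bracketDr bracketZr uv uy scalerN subrr.
  have := jacobi v u (y + g *: v); rewrite e2 bracket0r vu e1 bracketZr -/y.
  rewrite bracketDr bracketZr wv.2 wue.2 => e3.
  have := congr1 (bracket v) e3; rewrite bracket0r !bracketDr !bracketZr bracketXX vy !scaler0 addr0.
  rewrite !scalerA -!scalerDl => /esym/eqP; rewrite scaler_eq0 (negbTE en) orbF.
  rewrite -!intrM -rmorphD intr_eq0; apply/negP; case: (int_arith m k 0) => _ _ _ h _.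
  exact: h.
exists e, f; apply/subvP => Y YL; have [ts [F [-> wF]]] := wt_components YL.
rewrite big_seq; apply: memv_suml => j jts; have := wF j jts; move: (F j) => v wv {wF}.
have [v0'|vn] := eqVneq v 0; first by rewrite v0' mem0v.
have [j0|jn] := eqVneq j 0.
  by move: wv; rewrite j0 => /wt0[a ->]; apply: memvZ; apply: memv_span; rewrite !inE eqxx orbT.
have sup i u : wt i u -> u != 0 -> 0 < i -> i = k.
  move=> wu un i0; have ik : i <= k by apply: kmax; [apply: Prs|]; exists u.
  move: ik; rewrite le_eqVlt => /orP[/eqP//|ik].
  by rewrite (half i u i0 ik wu) eqxx in un.
have [jlt|jgt|j0] := ltgtP j 0; last by rewrite j0 eqxx in jn.
  have [u wu vu] := wt_dual wv vn jn.
  have un : u != 0 by apply: contra xn0 => /eqP e0; rewrite -vu e0 bracket0r.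
  have jk : - j = k by apply: (sup (- j) u) => //; case: (int_arith2 0 k j) => _ -> //.
  have wev : wt 0 (bracket e v) by have := wt_bracket we wv; rewrite -jk addNr.
  have [c ev] := wt0 wev.
  have fv : bracket f v = 0.
    by apply: bot (wt_bracket wf wv) _; case: (int_arith2 0 k j) => _ _ -> //; rewrite -jk opprK.
  have := jacobi f e v; rewrite ev fe fv bracket0r addr0 bracketZr bracketNl wv.2.
  rewrite (bracketC f x) wf.2 => e3.
  have vE : v = c *: f.
    apply: (scalerI kK); have := e3; rewrite -jk !rmorphN /= !scaleNr !opprK => <-.
    by rewrite scalerN !scalerA mulrC.
  by rewrite vE; apply: memvZ; apply: memv_span; rewrite !inE eqxx !orbT.
have jk := sup j v wv vn jgt; rewrite jk in wv.
have wfv : wt 0 (bracket f v) by have := wt_bracket wf wv; rewrite addNr.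
have [c fv] := wt0 wfv.
have ev : bracket e v = 0 by apply: top (wt_bracket we wv) _; case: (int_arith2 0 k 0) => _ _ _ ->.
have := jacobi e f v; rewrite fv ef ev bracket0r addr0 bracketZr wv.2 (bracketC e x) we.2 => e3.
have vE : v = - c *: e.
  by apply: (scalerI kK); rewrite -e3 scalerN !scalerA mulrN mulrC scaleNr.
by rewrite vE; apply: memvZ; apply: memv_span; rewrite !inE eqxx.
Qed.

End RankOne.

End SemisimpleAd.

(** * Solvable subalgebras of A1 + A1, and Cartan subalgebras *)

Section RankTwo.
Variable K : numClosedFieldType.
Local Notation M := 'M[K]_7.
Implicit Types (g X Y x y z : M) (H B : set M).

(* Otherwise every term of the derived series of B would have a Lie algebra
   projecting onto the perfect algebra V1. *)
Lemma sl2_sl2_solvable (B : set M) (b V1 V2 : {vspace M}) (e f h : M) :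
  subgroup_GL B -> B `<=` G2 K -> solvable_group B ->
  (forall X, (X \in b) <-> lie_algebra B X) ->
  e \in V1 -> f \in V1 -> h \in V1 -> e != 0 ->
  bracket e f = h -> bracket h e = 2 *: e -> bracket h f = - 2 *: f ->
  (forall X Y, X \in V1 -> Y \in V2 -> bracket X Y = 0) ->
  (forall X Y, X \in V2 -> Y \in V2 -> bracket X Y \in V2) ->
  (V1 <= <<[:: e; f; h]>>)%VS -> ~~ (V1 <= b + V2)%VS.
Proof.
move=> sB BG [k solB] bP eV fV hV en0 ef he hf V12 V22 V1s.
apply/negP => V1b; have n2 : (2 : K) != 0 by rewrite pnatr_eq0.
pose Q (D : set M) := exists Ye Yf Yh, [/\ Ye \in V2, Yf \in V2, Yh \in V2 &
  [/\ lie_algebra D (e + Ye), lie_algebra D (f + Yf) & lie_algebra D (h + Yh)]].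
have Q0 : Q B.
  have get X : X \in V1 -> exists2 Y, Y \in V2 & lie_algebra B (X + Y).
    move=> XV; have /memv_addP[u ub [v vV2 XE]] := subvP V1b X XV.
    by exists (- v); [rewrite memvN|rewrite XE addrK; apply/bP].
  have [Ye Ye2 Le] := get e eV; have [Yf Yf2 Lf] := get f fV; have [Yh Yh2 Lh] := get h hV.
  by exists Ye, Yf, Yh.
have brV X Y X' Y' : X \in V1 -> Y \in V1 -> X' \in V2 -> Y' \in V2 ->
    bracket (X + X') (Y + Y') = bracket X Y + bracket X' Y'.
  move=> XV YV X'V Y'V; rewrite bracketDl !bracketDr (V12 X Y') // addr0.
  by rewrite (bracketC X' Y) (V12 Y X') // oppr0 add0r.
have step D : subgroup_GL D -> D `<=` G2 K -> Q D -> Q (derived_subgroup D).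
  move=> sD DG [Ye [Yf [Yh [Ye2 Yf2 Yh2 [Le Lf Lh]]]]].
  have LD X Y : lie_algebra D X -> lie_algebra D Y -> lie_algebra (derived_subgroup D) (bracket X Y).
    apply: lie_derived (jinvK K) => // g Dg; apply: aut7_inv; apply: G2_aut7; exact: DG.
  have LZ a X : lie_algebra (derived_subgroup D) X -> lie_algebra (derived_subgroup D) (a *: X).
    by move=> LX; rewrite -[_ *: X]addr0; apply: lie_linear => //; apply: lie0.
  exists (2^-1 *: bracket Yh Ye), (- 2^-1 *: bracket Yh Yf), (bracket Ye Yf).
  split; [by apply: memvZ; apply: V22|by apply: memvZ; apply: V22|by apply: V22|].
  split.
  - have := LZ 2^-1 _ (LD _ _ Lh Le); rewrite brV // he scalerDr scalerA mulVf // scale1r; by [].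
  - have := LZ (- 2^-1) _ (LD _ _ Lh Lf).
    by rewrite brV // hf scalerDr scalerA mulrNN mulVf // scale1r.
  - by have := LD _ _ Le Lf; rewrite brV // ef.
have Qk j : subgroup_GL (iter j (@derived_subgroup K 7) B) /\
    iter j (@derived_subgroup K 7) B `<=` B /\ Q (iter j (@derived_subgroup K 7) B).
  elim: j => [|j [sj [jB Qj]]]; first by split; [|split].
  rewrite iterS; split; first exact: subgroup_derived.
  split; first by apply: subset_trans jB; apply: derived_subgroup_sub.
  by apply: step => //; apply: subset_trans jB BG.
have [_ [_ [Ye [_ [_ [Ye2 _ _ [Le _ _]]]]]]] := Qk k.
rewrite solB in Le; have /eqP := lie_trivial Le; rewrite addr_eq0 => /eqP eE.
have eV2 : e \in V2 by rewrite eE memvN.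
have h0 : h = 0 by rewrite -ef bracketC V12 ?oppr0.
have := he; rewrite h0 bracketC bracket0r oppr0 => /esym/eqP.
by rewrite scaler_eq0 (negbTE n2) (negbTE en0).
Qed.

(** In dim b = dim (b + V2) + dim (b :&: V2) - dim V2 the first term is at most 5 and the second is
    less than dim V2. *)
Lemma sl2_sl2_dim (L b V1 V2 : {vspace M}) : (b <= L)%VS -> (V2 <= L)%VS -> (L <= V1 + V2)%VS ->
  (\dim V1 <= 3)%N -> (\dim V2 <= 3)%N -> ~~ (V1 <= b + V2)%VS -> ~~ (V2 <= b + V1)%VS ->
  (\dim b <= 4)%N.
Proof.
move=> bL V2L LV d1 d2 n1 n2.
have s1 : (b + V2 <= V1 + V2)%VS by apply: subv_trans LV; rewrite subv_add bL.
have d12 : (\dim (V1 + V2) <= 6)%N by apply: leq_trans (dimv_add_leqif V1 V2) _; rewrite (leq_add d1 d2).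
have l1 : (\dim (b + V2) < \dim (V1 + V2))%N.
  rewrite ltn_neqAle (dimvS s1) andbT (dimv_leqif_sup s1); apply: contra n1 => h.
  by apply: subv_trans h; apply: addvSl.
have l2 : (\dim (b :&: V2) < \dim V2)%N.
  rewrite ltn_neqAle (dimvS (capvSr _ _)) andbT (dimv_leqif_sup (capvSr _ _)).
  apply: contra n2 => h; apply: subv_trans h _; apply: subv_trans (capvSl _ _) _.
  exact: addvSl.
by have := dimv_sum_cap b V2; move: l1 l2 d12; lia.
Qed.

Lemma int_semisimple_joint x y : int_semisimple x -> int_semisimple y -> GRing.comm x y ->
  exists (s s' : seq int) (R : int -> int -> M),
  [/\ \sum_(i <- s) \sum_(j <- s') R i j = 1, uniq s, uniq s' &
   forall i j, i \in s -> j \in s' ->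
     [/\ x *m R i j = i%:~R *: R i j, R i j *m x = i%:~R *: R i j,
         y *m R i j = j%:~R *: R i j & R i j *m y = j%:~R *: R i j]].
Proof.
move=> [s [Pi [us s1 sY]]] [s' [Pi' [us' s1' sY']]] xy.
have cPi := int_semisimple_comm us s1 sY (commr_sym xy).
exists s, s', (fun i j => Pi i * Pi' j); split=> // [|i j si sj].
  rewrite -[RHS]mulr1 -{1}s1 -{1}s1' mulr_suml; apply: eq_bigr => i _.
  by rewrite mulr_sumr.
have c1 := cPi i si.
have c2 : GRing.comm x (Pi' j) := int_semisimple_comm us' s1' sY' xy sj.
rewrite !mulmxE; split.
- by rewrite mulrA (sY i si).1 scalerAl.
- by rewrite -mulrA -c2 mulrA (sY i si).2 scalerAl.
- by rewrite mulrA c1 -mulrA (sY' j sj).1 scalerAr.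
- by rewrite -mulrA (sY' j sj).2 scalerAr.
Qed.

Lemma diag_lie_G2 X : lie_algebra (G2 K) X -> (forall r c, r != c -> X r c = 0) ->
  X = cartan_diag (X 0 0) (X 0 0 + X 1 1).
Proof.
move=> LX Xd; rewrite {1}(lie_G2_decomp LX) -addrA big1 ?add0r // => k _.
have /andP[p1 p2] := all_iotaP root_pos_bound (ltn_ord k).
rewrite /root_coord Xd ?scale0r // -val_eqE /= !inordK //.
have /all_iotaP/(_ (ltn_ord k)) // : all (fun k => (root_pos k).1 != (root_pos k).2) (iota 0 12) by [].
Qed.

Lemma cartan_diag_linear a b a' b' (s t : K) :
  s *: cartan_diag a b + t *: cartan_diag a' b' = cartan_diag (s * a + t * a') (s * b + t * b').
Proof.
rewrite /cartan_diag !scalerDr !scalerA !scalerDl.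
by rewrite addrACA.
Qed.

(** A single diagonalization handles both elements: z = x + q y with q large has distinct
    eigenvalues on the joint eigenspaces of x and y, so whatever makes z diagonal makes x and y
    diagonal. *)
Lemma torus_in_lie H x y : subgroup_GL H -> H `<=` G2 K ->
  lie_algebra H x -> lie_algebra H y -> int_semisimple x -> int_semisimple y ->
  GRing.comm x y -> x != 0 -> y \notin <[x]>%VS ->
  exists2 g, G2 K g & forall a b, lie_algebra (conj_subgroup g H) (cartan_diag a b).
Proof.
move=> sH HG Lx Ly xs ys xy xn0 yx; have [GU _ _ _] := G2_subgroup K.
have [s [s' [R [R1 us us' RP]]]] := int_semisimple_joint xs ys xy.
(* As |i| <= N, the map (i, j) -> i + q j is injective for q = 2N + 1. *)
pose N := (\max_(i <- s) `|i|)%N; pose q : int := (2 * N).+1.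
have sN i : i \in s -> (absz i <= N)%N by move=> si; apply: leq_bigmax_seq.
have inj i j i' j' : i \in s -> i' \in s -> i + q * j = i' + q * j' -> i = i' /\ j = j'.
  move=> /sN si /sN si'; rewrite /q => e.
  have jj : j = j' by nia.
  by move: e; rewrite jj => /addIr.
pose z := x + q%:~R *: y.
have zR i j : i \in s -> j \in s' -> z *m R i j = (i + q * j)%:~R *: R i j /\
    R i j *m z = (i + q * j)%:~R *: R i j.
  move=> si sj; have [e1 e2 e3 e4] := RP i j si sj; rewrite /z mulmxDl mulmxDr -scalemxAl -scalemxAr.
  by rewrite e1 e2 e3 e4 scalerA -scalerDl rmorphD rmorphM.
have zs : int_semisimple z.
  pose ks := undup [seq i + q * j | i <- s, j <- s'].
  have kin i j : i \in s -> j \in s' -> i + q * j \in ks.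
    by move=> si sj; rewrite mem_undup; apply/allpairsP; exists (i, j).
  exists ks, (fun k => \sum_(i <- s) \sum_(j <- s') if i + q * j == k then R i j else 0).
  split; first exact: undup_uniq.
    rewrite -[RHS]R1 exchange_big; apply: eq_big_seq => i si /=.
    rewrite exchange_big; apply: eq_big_seq => j sj /=.
    rewrite (bigD1_seq (i + q * j)) ?undup_uniq ?kin //= eqxx big1 ?addr0 // => k.
    by rewrite eq_sym => /negbTE->.
  move=> k _; rewrite mulr_sumr mulr_suml scaler_sumr; split; apply: eq_big_seq => i si.
    rewrite mulr_sumr scaler_sumr; apply: eq_big_seq => j sj.
    by case: eqP => [<-|_]; [apply: (zR i j si sj).1|rewrite mulr0 scaler0].
  rewrite mulr_suml scaler_sumr; apply: eq_big_seq => j sj.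
  by case: eqP => [<-|_]; [apply: (zR i j si sj).2|rewrite mul0r scaler0].
have LG X : lie_algebra H X -> lie_algebra (G2 K) X by apply: lie_sub.
have Lz : lie_algebra H z.
  by rewrite /z addrC; apply: lie_linear.
have [g Gg [a [b gz]]] := lie_G2_diagonalize (LG z Lz) zs.
have gU := GU g Gg; exists g => //.
pose c X := g *m X *m invmx g.
have cM X Y : c X *m c Y = c (X *m Y) by rewrite /c !mulmxA mulmxKV.
have cZ k X : c (k *: X) = k *: c X by rewrite /c -scalemxAr -scalemxAl.
have cR1 : \sum_(i <- s) \sum_(j <- s') c (R i j) = 1%:M.
  under eq_bigr => i _ do rewrite -mulmx_suml -mulmx_sumr.
  by rewrite -mulmx_suml -mulmx_sumr R1 [g *m _]mulmx1 mulmxV.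
pose D i : K := cartan_diag a b i i.
have cdE i j : cartan_diag a b i j = (i == j)%:R * D i by rewrite /D !cartan_diag_entry eqxx mul1r.
have cRD i j r t : i \in s -> j \in s' -> c (R i j) r t != 0 ->
    D r = (i + q * j)%:~R /\ D t = (i + q * j)%:~R.
  move=> si sj n0; have [e1 e2] := zR i j si sj.
  have f1 : cartan_diag a b *m c (R i j) = (i + q * j)%:~R *: c (R i j) by rewrite -gz cM e1 cZ.
  have f2 : c (R i j) *m cartan_diag a b = (i + q * j)%:~R *: c (R i j) by rewrite -gz cM e2 cZ.
  split; apply: (mulIf n0).
    have := congr1 (fun A : M => A r t) f1; rewrite [RHS]mxE => <-.
    rewrite [RHS]mxE (bigD1 r) //= cdE eqxx mul1r big1 ?addr0 // => l lr.
    by rewrite cdE eq_sym (negbTE lr) !mul0r.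
  have := congr1 (fun A : M => A r t) f2; rewrite [RHS]mxE => <-.
  rewrite [RHS]mxE (bigD1 t) //= cdE eqxx mul1r big1 ?addr0 1?mulrC // => l lr.
  by rewrite cdE (negbTE lr) mul0r mulr0.
have cRd i j r t : i \in s -> j \in s' -> r != t -> c (R i j) r t = 0.
  move=> si sj rt; apply/eqP/negPn/negP => n0; have [Dr Dt] := cRD i j r t si sj n0.
  have := congr1 (fun A : M => A r t) cR1; rewrite [RHS]mxE (negbTE rt) summxE.
  rewrite (bigD1_seq i) //= [X in _ + X]big1_seq => [|i' /andP[ii' si']].
    rewrite summxE (bigD1_seq j) //= big1_seq ?addr0 => [/eqP|j' /andP[jj' sj']].
      by rewrite (negbTE n0).
    apply/eqP/negPn/negP => n1; have [Dr' _] := cRD i j' r t si sj' n1.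
    move: Dr'; rewrite Dr => /intr_inj/(inj _ _ _ _ si si)[_ e].
    by rewrite e eqxx in jj'.
  rewrite summxE big1_seq // => j' /= sj'.
  apply/eqP/negPn/negP => n1; have [Dr' _] := cRD i' j' r t si' sj' n1.
  move: Dr'; rewrite Dr => /intr_inj/(inj _ _ _ _ si si')[e _].
  by rewrite e eqxx in ii'.
have cdiag X (w : int -> int -> int) : (forall i j, i \in s -> j \in s' -> X *m R i j = (w i j)%:~R *: R i j) ->
    forall r t, r != t -> c X r t = 0.
  move=> XR r t rt; have -> : c X = \sum_(i <- s) \sum_(j <- s') (w i j)%:~R *: c (R i j).
    rewrite -[c X]mulmx1 -cR1 mulmx_sumr; apply: eq_big_seq => i si.
    by rewrite mulmx_sumr; apply: eq_big_seq => j sj; rewrite cM XR // cZ.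
  rewrite summxE big1_seq // => i /= si; rewrite summxE big1_seq // => j /= sj.
  by rewrite mxE cRd ?mulr0.
have Lc X : lie_algebra H X -> lie_algebra (conj_subgroup g H) (c X).
  by move=> LX; apply: lie_conj.
have cxd := cdiag x (fun i j => i) (fun i j si sj => let: And4 e _ _ _ := RP i j si sj in e).
have cyd := cdiag y (fun i j => j) (fun i j si sj => let: And4 _ _ e _ := RP i j si sj in e).
have ex := diag_lie_G2 (lie_G2_conj Gg (LG x Lx)) cxd.
have ey := diag_lie_G2 (lie_G2_conj Gg (LG y Ly)) cyd.
rewrite -/(c x) in ex; rewrite -/(c y) in ey.
move: ex ey; set a1 := c x 0 0; set b1 := _ + _; set a2 := c y 0 0; set b2 := a2 + _ => ex ey.
have cinj X : invmx g *m c X *m g = X by rewrite /c !mulmxA mulVmx // mul1mx mulmxKV.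
(* The determinant of the conjugates of x and y in the basis of simple coroots; when it is nonzero
   they span the Cartan subalgebra. *)
pose d := a1 * b2 - a2 * b1.
have d0 : d != 0.
  apply: contra yx => /eqP d0.
  have cx0 : (a1 != 0) || (b1 != 0).
    apply: contraNT xn0; rewrite negb_or !negbK => /andP[/eqP a0 /eqP b0].
    by rewrite -(cinj x) ex a0 b0 /cartan_diag !scale0r addr0 mulmx0 mul0mx.
  suff [k e] : exists k, c y = k *: c x.
    by apply/vlineP; exists k; rewrite -(cinj y) e -cZ cinj.
  have cdZ k u v : k *: cartan_diag u v = cartan_diag (k * u) (k * v).
    by rewrite /cartan_diag scalerDr !scalerA.
  have dd : a1 * b2 = a2 * b1 by apply/eqP; rewrite -subr_eq0 -/d d0.
  case/orP: cx0 => n0.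
    exists (a2 / a1); rewrite ey ex cdZ divfK //; congr cartan_diag.
    by apply: (mulfI n0); rewrite dd; field.
  exists (b2 / b1); rewrite ey ex cdZ divfK //; congr cartan_diag.
  by apply: (mulIf n0); rewrite -dd; field.
move=> u v; have -> : cartan_diag u v =
    ((u * b2 - v * a2) / d) *: c x + ((v * a1 - u * b1) / d) *: c y.
  by rewrite ex ey cartan_diag_linear; congr cartan_diag; rewrite /d; field.
apply: lie_linear; first exact: Lc.
by rewrite -[_ *: c y]addr0; apply: lie_linear; [apply: Lc|apply: lie0].
Qed.

End RankTwo.

(* Any integral functional separating 0 and the roots would do. *)
Definition generic_weight k : int := 6 * root_weight k 0 + 11 * root_weight k 1.

Lemma generic_weight_check : uniq (0 :: [seq generic_weight k | k <- iota 0 12]).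
Proof. by vm_compute. Qed.

(** * Sets of roots of G2 *)

Definition opp_root k := if (k < 6)%N then (k + 6)%N else (k - 6)%N.

Definition itrace (f : nat -> nat -> int) : int := foldr (fun k s => f k k + s) 0 (iota 0 7).

Lemma trace_check : all (fun k => all (fun j => (j == opp_root k) ||
    (itrace (imul (root_fun k) (root_fun j)) == 0)) (iota 0 12) &&
  all (fun r => root_fun k r r == 0) (iota 0 7)) (iota 0 12).
Proof. by vm_compute. Qed.

Definition ibracket f g := iadd (imul f g) (fun r c => - imul g f r c).

(** Structure constants in type G2 are integers of absolute value at most 3; a nonzero one is
    invertible in characteristic zero. *)
Definition root_bracket i j l := has (fun m : int => ieq (ibracket (root_fun i) (root_fun j))
  (fun r c => m * root_fun l r c)) [:: 1; -1; 2; -2; 3; -3].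

Lemma bracket_check : all (fun t => [&& root_bracket t.1.1 t.1.2 t.2,
    root_bracket t.2 (t.1.1 + 6) t.1.2 & root_bracket t.2 (t.1.2 + 6) t.1.1])
  [:: (0, 1, 2); (0, 2, 3); (0, 3, 4); (1, 4, 5); (2, 3, 5)]%N.
Proof. by vm_compute. Qed.

(** Coordinates in the basis of simple coroots, for the positive roots in the order of
    [root_entries]. *)
Definition coroot k : int * int :=
  nth (0, 0) [:: (1, 0); (0, 1); (1, 3); (2, 3); (1, 1); (1, 2)] k.

Lemma coroot_check : all (fun k => ieq (ibracket (root_fun k) (root_fun (k + 6)))
    (fun r c => if r == c then (coroot k).1 * cartan_fun 0 r + (coroot k).2 * cartan_fun 1 r else 0) &&
  ((coroot k).1 * root_weight k 0 + (coroot k).2 * root_weight k 1 == 2) &&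
  all (fun i => root_weight (k + 6) i == - root_weight k i) (iota 0 2)) (iota 0 6).
Proof. by vm_compute. Qed.

Definition orthogonal_roots i j := [&& all (fun x => ieq (ibracket (root_fun x.1) (root_fun x.2)) (fun _ _ => 0))
    [:: (i, j); (i, j + 6); (i + 6, j); (i + 6, j + 6)]%N,
  (coroot i).1 * root_weight j 0 + (coroot i).2 * root_weight j 1 == 0,
  (coroot j).1 * root_weight i 0 + (coroot j).2 * root_weight i 1 == 0 &
  (coroot i).1 * (coroot j).2 - (coroot i).2 * (coroot j).1 != 0].

Lemma orthogonal_check : all (fun x => orthogonal_roots x.1 x.2) [:: (0, 5); (1, 3); (2, 4)]%N.
Proof. by vm_compute. Qed.

(** By symmetry a set of roots is recorded by its positive members, and closedness becomes three
    implications for each relation i + j = l among positive roots; the 2^6 subsets are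
    enumerated. *)
Lemma root_subsystems (p : nat -> bool) :
  (forall i j l, (i, j, l) \in [:: (0, 1, 2); (0, 2, 3); (0, 3, 4); (1, 4, 5); (2, 3, 5)]%N ->
    [/\ p i -> p j -> p l, p l -> p i -> p j & p l -> p j -> p i]) ->
  [\/ exists k, (k < 6)%N /\ forall j, (j < 6)%N -> p j -> j = k,
      exists i j, (i, j) \in [:: (0, 5); (1, 3); (2, 4)]%N /\
        forall k, (k < 6)%N -> p k = ((k == i) || (k == j)),
      forall k, (k < 6)%N -> p k = (k \in [:: 1; 4; 5]%N) |
      forall k, (k < 6)%N -> p k].
Proof.
move=> pP.
have [a1 a2 a3] := pP 0%N 1%N 2%N isT; have [b1 b2 b3] := pP 0%N 2%N 3%N isT.
have [c1 c2 c3] := pP 0%N 3%N 4%N isT; have [d1 d2 d3] := pP 1%N 4%N 5%N isT.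
have [e1 e2 e3] := pP 2%N 3%N 5%N isT.
have L6 (Q : nat -> Prop) : Q 0%N -> Q 1%N -> Q 2%N -> Q 3%N -> Q 4%N -> Q 5%N ->
  forall k, (k < 6)%N -> Q k by move=> q0 q1 q2 q3 q4 q5 [|[|[|[|[|[|k]]]]]].
have one k (k6 : (k < 6)%N) : (forall j, (j < 6)%N -> p j -> j = k) ->
    exists k, (k < 6)%N /\ forall j, (j < 6)%N -> p j -> j = k by exists k.
move: a1 a2 a3 b1 b2 b3 c1 c2 c3 d1 d2 d3 e1 e2 e3.
case p0: (p 0%N); case p1: (p 1%N); case p2: (p 2%N); case p3: (p 3%N); case p4: (p 4%N); case p5: (p 5%N);
  move=> a1 a2 a3 b1 b2 b3 c1 c2 c3 d1 d2 d3 e1 e2 e3;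
  try by [have := a1 isT isT|have := a2 isT isT|have := a3 isT isT|have := b1 isT isT|have := b2 isT isT
   |have := b3 isT isT|have := c1 isT isT|have := c2 isT isT|have := c3 isT isT|have := d1 isT isT
   |have := d2 isT isT|have := d3 isT isT|have := e1 isT isT|have := e2 isT isT|have := e3 isT isT].
all: try by (apply: Or44; apply: L6).
all: try by (apply: Or43; apply: L6; rewrite ?(p0, p1, p2, p3, p4, p5)).
all: try by (apply: Or42; exists 0%N, 5%N; split=> //; apply: L6; rewrite ?(p0, p1, p2, p3, p4, p5)).
all: try by (apply: Or42; exists 1%N, 3%N; split=> //; apply: L6; rewrite ?(p0, p1, p2, p3, p4, p5)).
all: try by (apply: Or42; exists 2%N, 4%N; split=> //; apply: L6; rewrite ?(p0, p1, p2, p3, p4, p5)).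
all: apply: Or41.
all: try by (apply: (one 0%N) => //; apply: L6; rewrite ?(p0, p1, p2, p3, p4, p5)).
all: try by (apply: (one 1%N) => //; apply: L6; rewrite ?(p0, p1, p2, p3, p4, p5)).
all: try by (apply: (one 2%N) => //; apply: L6; rewrite ?(p0, p1, p2, p3, p4, p5)).
all: try by (apply: (one 3%N) => //; apply: L6; rewrite ?(p0, p1, p2, p3, p4, p5)).
all: try by (apply: (one 4%N) => //; apply: L6; rewrite ?(p0, p1, p2, p3, p4, p5)).
all: try by (apply: (one 5%N) => //; apply: L6; rewrite ?(p0, p1, p2, p3, p4, p5)).
Qed.

Section RootSubsets.
Variable K : numClosedFieldType.
Local Notation M := 'M[K]_7.
Implicit Types (g X Y x y z : M) (H B : set M).

Lemma int_bracket f f' : bracket (int_mx K f) (int_mx K f') = int_mx K (ibracket f f').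
Proof. by rewrite /bracket !int_mxM opp_int_mx int_mxD. Qed.

Lemma root_bracketP i j l : root_bracket i j l -> exists2 m : K, m != 0 &
  bracket (rmx K i) (rmx K j) = m *: rmx K l.
Proof.
case/hasP=> m ml /int_mx_eq e; exists m%:~R.
  by rewrite intr_eq0; move: ml; rewrite !inE => /or4P[/eqP->|/eqP->|/eqP->|/or3P[]/eqP->].
by rewrite int_bracket e scale_int_mx.
Qed.

Lemma cartan_diag_int (m n : int) : cartan_diag m%:~R n%:~R = int_mx K (fun r c =>
  if r == c then m * cartan_fun 0 r + n * cartan_fun 1 r else 0).
Proof.
apply/matrixP => r c; rewrite cartan_diag_entry [RHS]mxE -val_eqE.
by case: eqP => _; rewrite ?mul1r ?mul0r ?rmorphD ?rmorphM.
Qed.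

Definition coroot_mx k : M := cartan_diag (coroot k).1%:~R (coroot k).2%:~R.

Lemma coroot_sl2 k : (k < 6)%N -> [/\ bracket (rmx K k) (rmx K (k + 6)) = coroot_mx k,
  bracket (coroot_mx k) (rmx K k) = 2 *: rmx K k &
  bracket (coroot_mx k) (rmx K (k + 6)) = - 2 *: rmx K (k + 6)].
Proof.
move=> k6; have k12 : (k < 12)%N by rewrite (leq_trans k6).
have k12' : (k + 6 < 12)%N by rewrite -[12%N]/(6 + 6)%N ltn_add2r.
have /andP[/andP[/int_mx_eq e1 /eqP e2] e3] := all_iotaP coroot_check k6.
split; first by rewrite int_bracket e1 /coroot_mx cartan_diag_int.
  by rewrite cartan_diag_rmx // -!rmorphM -rmorphD e2.
rewrite cartan_diag_rmx //; have /eqP-> := all_iotaP e3 (isT : (0 < 2)%N).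
have /eqP-> := all_iotaP e3 (isT : (1 < 2)%N).
by rewrite -!rmorphM -rmorphD !mulrN -opprD e2 rmorphN.
Qed.

Variable H : set M.
Hypotheses (sH : subgroup_GL H) (HG : H `<=` G2 K)
  (tH : forall a b, lie_algebra H (cartan_diag a b)).

(** The Cartan element t takes distinct nonzero values on the roots, so the components of X for the
    bracket with t are its Cartan part and its individual root components. *)
Lemma lie_root_component X k : lie_algebra H X -> (k < 12)%N ->
  root_coord k X != 0 -> lie_algebra H (rmx K k).
Proof.
move=> LX k12 ck; pose t := cartan_diag 6 11 : M.
have tk j : (j < 12)%N -> bracket t (rmx K j) = (generic_weight j)%:~R *: rmx K j.
  have e : (generic_weight j)%:~R = 6 * (root_weight j 0)%:~R + 11 * (root_weight j 1)%:~R :> K.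
    by rewrite /generic_weight intrD !intrM.
  by move=> j12; rewrite cartan_diag_rmx // e.
pose D := cartan_diag (X 0 0) (X 0 0 + X 1 1).
pose F (m : int) : M := if m == 0 then D else \sum_(j < 12 | generic_weight j == m) root_coord j X *: rmx K j.
have := generic_weight_check; rewrite cons_uniq => /andP[w0 wu].
have wn j : (j < 12)%N -> generic_weight j != 0.
  move=> j12; apply: contraNneq w0 => e; rewrite -{1}e.
  by apply/mapP; exists j => //; rewrite mem_iota.
have Fj j : (j < 12)%N -> F (generic_weight j) = root_coord j X *: rmx K j.
  move=> j12; rewrite /F (negbTE (wn j j12)) (bigD1 (Ordinal j12)) //= big1 ?addr0 // => i /andP[/eqP e ij].
  case/negP: ij; apply/eqP/val_inj => /=.
  have nthE m : (m < 12)%N -> generic_weight m = nth 0 [seq generic_weight k | k <- iota 0 12] m.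
    by move=> m12; rewrite (nth_map 0%N) ?size_iota // nth_iota.
  apply/eqP; rewrite -(nth_uniq 0 _ _ wu) ?size_map ?size_iota //.
  by rewrite -!nthE // e.
have XF : X = \sum_(m <- 0 :: [seq generic_weight j | j <- iota 0 12]) F m.
  rewrite big_cons {1}/F eqxx big_map {1}(lie_G2_decomp (lie_sub HG LX)) -addrA addrC; congr (_ + _).
  rewrite -[iota 0 12]/(index_iota 0 12) big_mkord; apply: eq_bigr => j _.
  by rewrite Fj.
have := @ad_component_mem K 6 t (lie_algebra H) _ F generic_weight_check (@lie0 _ _ H).
have LP a u v : lie_algebra H u -> lie_algebra H v -> lie_algebra H (a *: u + v) by apply: lie_linear.
have Lt v : lie_algebra H v -> lie_algebra H (bracket t v).
  by move=> Lv; apply: lie_bracket => //; apply: tH.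
have tF m : bracket t (F m) = m%:~R *: F m.
  rewrite /F; case: eqP => [->|_].
    rewrite scale0r /bracket; apply/eqP; rewrite subr_eq0; apply/eqP/matrixP => r c.
    rewrite !mxE; under eq_bigr do rewrite !cartan_diag_entry.
    under [RHS]eq_bigr do rewrite !cartan_diag_entry.
    apply: eq_bigr => i _; have [->|_] := eqVneq r i; have [->|_] := eqVneq i c;
      rewrite ?(mul0r, mulr0, mul1r, eqxx) //; by rewrite mulrC.
  rewrite bracket_sumr scaler_sumr; apply: eq_bigr => j /eqP <-.
  by rewrite bracketZr tk // !scalerA mulrC.
move=> /(_ LP Lt tF); rewrite -XF => /(_ LX (generic_weight k)).
rewrite inE map_f ?orbT ?mem_iota // Fj // => /(_ isT) Lk.
have -> : rmx K k = (root_coord k X)^-1 *: (root_coord k X *: rmx K k) + 0.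
  by rewrite scalerA mulVf // scale1r addr0.
by apply: lie_linear => //; apply: lie0.
Qed.

Lemma lie_root_triple i j l : root_bracket i j l -> lie_algebra H (rmx K i) ->
  lie_algebra H (rmx K j) -> lie_algebra H (rmx K l).
Proof.
move=> /root_bracketP[m m0 e] Li Lj.
have -> : rmx K l = m^-1 *: bracket (rmx K i) (rmx K j) + 0.
  by rewrite e scalerA mulVf // scale1r addr0.
by apply: lie_linear; [apply: lie_bracket|apply: lie0].
Qed.

Lemma rmx_neq0 k : (k < 12)%N -> rmx K k != 0.
Proof.
move=> k12; apply/eqP => e; have := root_coord_rmx K k12 k12.
by rewrite e /root_coord mxE eqxx => /esym/eqP; rewrite oner_eq0.
Qed.

(** A root vector is trace-orthogonal to the Cartan subalgebra and to all root vectors but the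
    opposite one, so nondegeneracy requires an element with an opposite component. *)
Lemma lie_root_opp k : (forall X, lie_algebra H X ->
    (forall Y, lie_algebra H Y -> \tr (X *m Y) = 0) -> X = 0) ->
  (k < 12)%N -> lie_algebra H (rmx K k) -> lie_algebra H (rmx K (opp_root k)).
Proof.
move=> nd k12 Lk; have [//|nL] := pselect (lie_algebra H (rmx K (opp_root k))).
have o12 : (opp_root k < 12)%N by rewrite /opp_root; case: ifP; move: k12; lia.
have /andP[t1 t2] := all_iotaP trace_check k12.
suff /eqP : rmx K k = 0 by rewrite (negbTE (rmx_neq0 k12)).
apply: nd => // Y LY; rewrite (lie_G2_decomp (lie_sub HG LY)) -addrA mulmxDr linearD /=.
rewrite mulmx_sumr linear_sum big1 ?add0r => [|j _].
  rewrite -/(cartan_diag _ _) /mxtrace big1 // => r _; rewrite mxE big1 // => c _.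
  rewrite cartan_diag_entry mxE; have [->|_] := eqVneq c r; last by rewrite mul0r mulr0.
  by have /eqP-> := all_iotaP t2 (ltn_ord r); rewrite mul0r.
rewrite -scalemxAr linearZ /=; have /orP[/eqP jo|/eqP e] := all_iotaP t1 (ltn_ord j).
  rewrite jo; have [->|n0] := eqVneq (root_coord (opp_root k) Y) 0; first by rewrite mul0r.
  by case: nL; apply: lie_root_component LY o12 n0.
rewrite int_mxM /mxtrace; under eq_bigr do rewrite mxE.
rewrite -rmorph_sum -(big_mkord xpredT (fun i => imul (root_fun k) (root_fun j) i i)).
by rewrite (_ : \sum_(0 <= i < 7) _ = itrace (imul (root_fun k) (root_fun j))) ?e ?mulr0 // unlock.
Qed.

End RootSubsets.

(** * Long root groups and type A2 *)

Lemma long_check : all (fun k => [&& ieq (imul (root_fun k) (root_fun k)) (fun _ _ => 0),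
  ieq (imul (root_fun (k + 6)) (root_fun (k + 6))) (fun _ _ => 0),
  ieq (imul (imul (root_fun k) (root_fun (k + 6))) (root_fun k)) (root_fun k),
  ieq (imul (imul (root_fun (k + 6)) (root_fun k)) (root_fun (k + 6))) (root_fun (k + 6)) &
  ieq (square_fun k) (fun _ _ => 0) && ieq (square_fun (k + 6)) (fun _ _ => 0)]) [:: 1; 4; 5]%N.
Proof. by vm_compute. Qed.

Definition weight_diff (r c : nat) : int * int :=
  nth (0, 0) weights7 r - nth (0, 0) weights7 c.

Lemma long_root_check : all (fun k => all (fun r => all (fun c => (root_fun k r c == 0) ||
    (weight_diff r c \in long_roots)) (iota 0 7)) (iota 0 7)) [:: 1; 4; 5; 7; 10; 11]%N &&
  all (fun d => has (fun k => all (fun r => all (fun c => (root_fun k r c == 0) ||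
    (weight_diff r c == d)) (iota 0 7)) (iota 0 7)) [:: 1; 4; 5; 7; 10; 11]%N) long_roots &&
  (0 \notin long_roots).
Proof. by vm_compute. Qed.

Section Conjugates.
Variable K : numClosedFieldType.
Local Notation M := 'M[K]_7.
Implicit Types (g X Y x y z : M) (H B : set M).

Lemma conj_subgroup_GL H g : g \in unitmx -> subgroup_GL H -> subgroup_GL (conj_subgroup g H).
Proof.
move=> gU [HU H1 HM HV]; have gI : invmx g \in unitmx by rewrite unitmx_inv.
split.
- by move=> _ [h Hh <-] /=; rewrite !unitmx_mul gU gI HU.
- by exists 1%:M => //; rewrite mulmx1 mulmxV.
- move=> _ _ [h Hh <-] [h' Hh' <-]; exists (h *m h'); first exact: HM.
  by rewrite !mulmxA mulmxKV.
- move=> _ [h Hh <-]; exists (invmx h); first exact: HV.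
  by rewrite !invmxM ?unitmx_mul ?gU ?gI ?HU // invmxK mulmxA.
Qed.

Lemma nilexp_conj g X : g \in unitmx -> nilexp (invmx g *m X *m g) = invmx g *m nilexp X *m g.
Proof.
move=> gU; rewrite /nilexp mulmx_sumr mulmx_suml; apply: eq_bigr => k _.
rewrite -scalemxAr -scalemxAl; congr (_ *: _).
elim: (k : nat) => [|j IHj]; first by rewrite !expr0 [_ *m 1]mulmx1 mulVmx.
by rewrite !exprS IHj -!mulmxE !mulmxA mulmxK.
Qed.

Lemma conj_umx_mem H g k t : closed_subgroup H -> g \in unitmx -> (k < 12)%N ->
  lie_algebra (conj_subgroup g H) (rmx K k) -> conj_subgroup g H (umx k t).
Proof.
move=> cH gU k12 /(lie_conjE _ _ gU) LX; exists (invmx g *m umx k t *m g); last first.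
  by rewrite !mulmxA mulmxK // mulmxV // mul1mx.
rewrite -umxE // -nilexp_conj // -scalemxAr -scalemxAl; apply: nilexp_mem => //.
have e := rmx_sq K k12; have [e1 e2 e3] := rmx_smx K k12.
have cj j : (invmx g *m rmx K k *m g) ^+ j = invmx g *m (rmx K k) ^+ j *m g.
  elim: j => [|j IHj]; first by rewrite !expr0 [_ *m 1]mulmx1 mulVmx.
  by rewrite !exprS IHj -!mulmxE !mulmxA mulmxK.
have r3 : rmx K k ^+ 3 = 0.
  rewrite 2!exprS expr1 mulrA -[LHS]/(rmx K k *m rmx K k *m rmx K k).
  by rewrite e -scalemxAl e2 scaler0.
by rewrite cj (exprD _ 3 4) r3 mul0r mulmx0 mul0mx.
Qed.

Section LongTorus.
Variable H : set M.
Hypothesis sH : subgroup_GL H.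

(* The value at a of the coroot of a long root: long root vectors square to zero,
   so the subgroup SL2 acts through its natural and its trivial modules. *)
Lemma long_torus_mem k a : k \in [:: 1; 4; 5]%N -> a != 0 ->
  (forall t, H (umx k t)) -> (forall t, H (umx (k + 6) t)) ->
  H (1 - rmx K k * rmx K (k + 6) - rmx K (k + 6) * rmx K k
     + a *: (rmx K k * rmx K (k + 6)) + a^-1 *: (rmx K (k + 6) * rmx K k)).
Proof.
move=> kl a0 Hk Hk'; have [_ _ HM _] := sH.
have /and5P[/int_mx_eq f1 /int_mx_eq f2 /int_mx_eq f3 /int_mx_eq f4 /andP[/int_mx_eq f5 /int_mx_eq f6]] :=
  allP long_check k kl.
pose A := rmx K k; pose B := rmx K (k + 6); pose P := A * B; pose Q := B * A.
have AA : A * A = 0 by rewrite -mulmxE int_mxM f1 int_mx0.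
have BB : B * B = 0 by rewrite -mulmxE int_mxM f2 int_mx0.
have PA : P * A = A by rewrite /P -!mulmxE !int_mxM f3.
have QB : Q * B = B by rewrite /Q -!mulmxE !int_mxM f4.
have uA t : umx k t = 1 + t *: A by rewrite /umx /smx f5 int_mx0 scaler0 addr0.
have uB t : umx (k + 6) t = 1 + t *: B by rewrite /umx /smx f6 int_mx0 scaler0 addr0.
have AQ : A * Q = A by rewrite mulrA PA.
have BP : B * P = B by rewrite mulrA QB.
have AP : A * P = 0 by rewrite mulrA AA mul0r.
have BQ : B * Q = 0 by rewrite mulrA BB mul0r.
have PB : P * B = 0 by rewrite -mulrA BB mulr0.
have QA : Q * A = 0 by rewrite -mulrA AA mulr0.
have PP : P * P = P by rewrite {2}/P mulrA PA.
have QQ : Q * Q = Q by rewrite {2}/Q mulrA QB.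
have PQ : P * Q = 0 by rewrite /Q mulrA PB mul0r.
have QP : Q * P = 0 by rewrite /P mulrA QA mul0r.
pose w (t : K) := umx k t *m umx (k + 6) (- t^-1) *m umx k t.
have wH t : H (w t) by apply: (HM) => //; apply: (HM).
have wE t : t != 0 -> w t = 1 + t *: A - t^-1 *: B - P - Q.
  move=> t0; rewrite /w !uA !uB !mulmxE !(mulrDl, mulrDr, mul1r, mulr1) -!scalerAl -!scalerAr.
  rewrite AA -/P -/Q -?scalerAl PA; move: (A) (B) (P) (Q) => A' B' P' Q'.
  by apply/matrixP => i j; rewrite !mxE; field.
have := HM _ _ (wH a) (wH (- 1)).
have n1 : (-1 : K) != 0 by rewrite oppr_eq0 oner_eq0.
rewrite !wE // invrN1 !scaleN1r opprK mulmxE !(mulrDl, mulrDr, mulNr, mulrN, mul1r, mulr1).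
rewrite -!scalerAl -/P -/Q AA BB PA PB PP PQ QA QB QP QQ AP AQ BP BQ -/P -/Q.
set L := (X in H X -> _); suff -> : L = 1 - P - Q + a *: P + a^-1 *: Q by [].
rewrite /L; move: (A) (B) (P) (Q) => A' B' P' Q'.
by apply/matrixP => i j; rewrite !mxE; ring.
Qed.

Lemma G2_torus_sub : (forall k t, k \in [:: 1; 4; 7; 10]%N -> H (umx k t)) -> G2_torus K `<=` H.
Proof.
move=> Hk _ [a a0 [b b0 <-]]; have [_ _ HM _] := sH.
have P1 : rmx K 1 * rmx K 7 = int_mx K (imul (root_fun 1) (root_fun 7)) by rewrite -mulmxE int_mxM.
have Q1 : rmx K 7 * rmx K 1 = int_mx K (imul (root_fun 7) (root_fun 1)) by rewrite -mulmxE int_mxM.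
have P4 : rmx K 4 * rmx K 10 = int_mx K (imul (root_fun 4) (root_fun 10)) by rewrite -mulmxE int_mxM.
have Q4 : rmx K 10 * rmx K 4 = int_mx K (imul (root_fun 10) (root_fun 4)) by rewrite -mulmxE int_mxM.
(* The coroot of the root of index 4 is the sum of the simple coroots, so its value at a times the
   value of the second simple coroot at b / a is [torus_elt a b]. *)
have ba0 : b / a != 0 by rewrite mulf_neq0 // invr_eq0.
have h4 := @long_torus_mem 4%N a isT a0 (fun t => Hk 4%N t isT) (fun t => Hk 10%N t isT).
have h1 := @long_torus_mem 1%N (b / a) isT ba0 (fun t => Hk 1%N t isT) (fun t => Hk 7%N t isT).
have := HM _ _ h4 h1; rewrite /= -![(_ + 6)%N]/(10%N) -![(1 + 6)%N]/7%N P1 Q1 P4 Q4.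
set L := (X in H X -> _); suff -> : L = torus_elt a b by [].
have dE (f f' : nat -> nat -> int) (x y : K) : (forall r c : 'I_7, r != c -> f r c = 0) ->
    (forall r c : 'I_7, r != c -> f' r c = 0) ->
    1 - int_mx K f - int_mx K f' + x *: int_mx K f + y *: int_mx K f' =
    diag_mx (\row_(r < 7) (1 - (f r r)%:~R - (f' r r)%:~R + x * (f r r)%:~R + y * (f' r r)%:~R)) :> M.
  move=> f0 f'0; apply/matrixP => r c; rewrite !mxE.
  have [->|rc] := eqVneq r c; first by rewrite mulr1n.
  by rewrite (f0 _ _ rc) (f'0 _ _ rc) mulr0n rmorph0 !mulr0 !subr0 !addr0.
have d0 k l : all (fun r => all (fun c => (r == c) || (imul (root_fun k) (root_fun l) r c == 0))
    (iota 0 7)) (iota 0 7) -> forall r c : 'I_7, r != c -> imul (root_fun k) (root_fun l) r c = 0.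
  by move=> h r c rc; have := all_iotaP (all_iotaP h (ltn_ord r)) (ltn_ord c); rewrite val_eqE (negbTE rc) => /eqP.
rewrite /L !dE; try by apply: d0; vm_compute.
rewrite mulmx_diag /torus_elt; congr diag_mx; apply/rowP => r; rewrite !mxE.
case: r => [[|[|[|[|[|[|[|//]]]]]]] hr]; rewrite /= /character /=;
  rewrite ?(expr0z, expr1z, exprN1); try by field; rewrite ?a0 ?b0.
rewrite -[a ^ _]/((a ^+ 2)^-1).
by field; rewrite ?a0 ?b0.
Qed.

End LongTorus.

Lemma character_expD (c d : int * int) (a b : K) : a != 0 -> b != 0 ->
  character (c - d) a b = character c a b / character d a b.
Proof.
move=> a0 b0; rewrite /character /= !expfzDr // -!invr_expz.
by rewrite invfM mulrACA.
Qed.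

(** Characters will be compared at the value 2, which is not a root of unity in characteristic
    zero. *)
Lemma exprz2_inj (m n : int) : (2 : K) ^ m = 2 ^ n -> m = n.
Proof.
have n2 : (2 : K) != 0 by rewrite pnatr_eq0.
wlog mn : m n / m <= n.
  by move=> w e; case/orP: (le_total m n) => h; [apply: w|apply/esym/w].
have [k ->] : exists k : nat, n = m + k%:Z by exists (absz (n - m)); lia.
rewrite expfzDr // -{1}[2 ^ m]mulr1 => /(mulfI (expfz_neq0 m n2)).
rewrite -exprnP -natrX => /esym/eqP; rewrite pnatr_eq1.
by case: k => [|k]; [rewrite addr0|rewrite expnS; move: (2 ^ k)%N => j; lia].
Qed.

Lemma character_inj (c d : int * int) :
  (forall a b : K, a != 0 -> b != 0 -> character c a b = character d a b) -> c = d.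
Proof.
have n2 : (2 : K) != 0 by rewrite pnatr_eq0.
case: c d => [c1 c2] [d1 d2] e.
have e1 := e 2 1 n2 (oner_neq0 K); have e2 := e 1 2 (oner_neq0 K) n2.
move: e1 e2; rewrite /character /= !exp1rz !mulr1 !mul1r => e1 e2.
by rewrite (exprz2_inj e1) (exprz2_inj e2).
Qed.

Lemma torus_act (a b : K) X (r c : 'I_7) : a != 0 -> b != 0 ->
  adjoint_act (torus_elt a b) X r c = character (weight_diff r c) a b * X r c.
Proof.
move=> a0 b0; pose t (k : 'I_7) := character (nth (0, 0) weights7 k) a b.
have t0 k : t k != 0 by rewrite mulf_neq0 // expfz_neq0.
pose T' : M := diag_mx (\row_k (t k)^-1).
have TT : torus_elt a b *m T' = 1%:M.
  rewrite mulmx_diag -diag_const_mx; congr diag_mx; apply/rowP => k.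
  by rewrite !mxE; apply: mulfV; apply: t0.
have [TU _] := mulmx1_unit TT.
rewrite /adjoint_act; have -> : invmx (torus_elt a b) = T'.
  by rewrite -[T']mul1mx -(mulVmx TU) -mulmxA TT mulmx1.
rewrite mul_mx_diag mul_diag_mx !mxE /weight_diff character_expD //.
by rewrite -/(t r) -/(t c) mulrAC.
Qed.

(** [type_A2] asks for the torus in the group, not only in its Lie algebra; it is recovered from the
    long root groups, which are exponentials of nilpotent elements. *)
Lemma long_type_A2 H g : closed_subgroup H -> H `<=` G2 K -> G2 K g ->
  (forall a b, lie_algebra (conj_subgroup g H) (cartan_diag a b)) ->
  (forall k, (k < 12)%N -> lie_algebra (conj_subgroup g H) (rmx K k) <-> k \in [:: 1; 4; 5; 7; 10; 11]%N) ->
  type_A2 H.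
Proof.
move=> cH HG Gg tH rH; have [GU _ GM GV] := G2_subgroup K; have gU := GU g Gg.
have sH' : subgroup_GL (conj_subgroup g H) by apply: conj_subgroup_GL => //; case: cH.
have HG' : conj_subgroup g H `<=` G2 K.
  by move=> _ [h Hh <-]; apply: (GM); [apply: (GM) => //; apply: HG|apply: GV].
have /andP[/andP[lc1 lc2] lc3] := long_root_check.
exists g => //; split.
  apply: G2_torus_sub => // k t kl.
  have k12 : (k < 12)%N by move: kl; rewrite !inE => /or4P[]/eqP->.
  apply: conj_umx_mem => //; apply/rH => //.
  by move: kl; rewrite !inE => /or4P[]/eqP->.
move=> c; split=> [[c0 [X [LX Xn Xc]]]|cl].
  have [r [t Xrt]] : exists r t, X r t != 0 by apply/matrix0Pn.
  have cE : c = weight_diff r t.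
    apply: character_inj => a b a0 b0; apply: (mulIf Xrt).
    by rewrite -torus_act // Xc // mxE.
  have [k12 [k12lt kL kr]] : exists k, [/\ (k < 12)%N, lie_algebra (conj_subgroup g H) (rmx K k) & root_fun k r t != 0].
    have [//|nk] := pselect (exists k, [/\ (k < 12)%N, lie_algebra (conj_subgroup g H) (rmx K k) & root_fun k r t != 0]).
    case/negP: Xrt; rewrite (lie_G2_decomp (lie_sub HG' LX)) -addrA -/(cartan_diag _ _) mxE summxE.
    have rt : r != t.
      by apply: contra_neq c0 => e; rewrite cE e /weight_diff subrr.
    rewrite cartan_diag_entry (negbTE rt) mul0r addr0 big1 // => k _; rewrite mxE.
    have [->|cn] := eqVneq (root_coord k X) 0; first by rewrite mul0r.
    rewrite mxE; have [->|rk] := eqVneq (root_fun k r t) 0; first by rewrite mulr0.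
    case: nk; exists k; split=> //; exact: (lie_root_component sH' HG' tH LX).
  have kl := (rH _ k12lt).1 kL; rewrite cE.
  have := all_iotaP (all_iotaP (allP lc1 _ kl) (ltn_ord r)) (ltn_ord t).
  by rewrite (negbTE kr).
have /hasP[k kl kc] := allP lc2 c cl.
split; first by apply: contraNneq lc3 => <-.
have k12 : (k < 12)%N by apply: (allP (_ : all (fun k => k < 12)%N [:: 1; 4; 5; 7; 10; 11]%N)).
exists (rmx K k); split; [by apply/rH|exact: rmx_neq0|].
move=> a b a0 b0; apply/matrixP => r t; rewrite torus_act // !mxE.
have /orP[/eqP->|/eqP->//] := all_iotaP (all_iotaP kc (ltn_ord r)) (ltn_ord t).
by rewrite !mulr0.
Qed.

Lemma conj_all_roots H g : closed_subgroup H -> H `<=` G2 K -> G2 K g ->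
  (forall k, (k < 12)%N -> lie_algebra (conj_subgroup g H) (rmx K k)) -> H = G2 K.
Proof.
move=> cH HG Gg Hk; have [GU _ GM GV] := G2_subgroup K; have gU := GU g Gg.
have sH' : subgroup_GL (conj_subgroup g H) by apply: conj_subgroup_GL => //; case: cH.
have GH : G2 K `<=` conj_subgroup g H.
  apply: gen_subgroup_sub => // _ [[t _ [i _ <-]]|[t _ [i _ <-]]].
    have i12 : (i < 12)%N by case: i => [[|[|//]] hi].
    by rewrite cheE umxE //; apply: conj_umx_mem => //; apply: Hk.
  have i12 : (i + 6 < 12)%N by case: i => [[|[|//]] hi].
  by rewrite chfE umxE //; apply: conj_umx_mem => //; apply: Hk.
apply/seteqP; split=> // x Gx.
have [h Hh e] : conj_subgroup g H (g *m x *m invmx g) by apply: GH; apply: (GM); [apply: GM|apply: GV].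
suff -> : x = h by [].
by have := congr1 (fun A => invmx g *m A *m g) e; rewrite /= !mulmxA mulVmx // !mul1mx !mulmxKV.
Qed.

End Conjugates.

(** * Lie algebras of Borel subgroups *)

Section BorelDimension.
Variable K : numClosedFieldType.
Local Notation M := 'M[K]_7.
Implicit Types (g X Y x y z : M) (H B : set M).

Lemma bracket_span (U : {vspace M}) (s t : seq M) X Y :
  (forall x y, x \in s -> y \in t -> bracket x y \in U) ->
  X \in <<s>>%VS -> Y \in <<t>>%VS -> bracket X Y \in U.
Proof.
move=> stU Xs Yt; rewrite (coord_span (X := in_tuple s) Xs) (coord_span (X := in_tuple t) Yt).
rewrite bracketC bracket_sumr -sumrN; apply: memv_suml => i _.
rewrite -bracketC bracket_sumr; apply: memv_suml => j _.
rewrite bracketZr bracketZl; do 2!apply: memvZ.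
by apply: stU; apply: mem_nth; rewrite ?size_tuple.
Qed.

Lemma root_set_symmetric H : subgroup_GL H -> H `<=` G2 K ->
  (forall a b, lie_algebra H (cartan_diag a b)) ->
  (forall X, lie_algebra H X -> (forall Y, lie_algebra H Y -> \tr (X *m Y) = 0) -> X = 0) ->
  forall k, (k < 6)%N -> lie_algebra H (rmx K (k + 6)) <-> lie_algebra H (rmx K k).
Proof.
move=> sH HG tH nd k k6; have k12 : (k < 12)%N by rewrite (leq_trans k6).
have k12' : (k + 6 < 12)%N by rewrite -[12%N]/(6 + 6)%N ltn_add2r.
split=> Lk.
  have := lie_root_opp sH HG tH nd k12' Lk; rewrite /opp_root.
  by rewrite ltnNge leq_addl /= addnK.
by have := lie_root_opp sH HG tH nd k12 Lk; rewrite /opp_root k6.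
Qed.

Lemma borel_lie_dim H B (b : {vspace M}) : reductive H -> H `<=` G2 K -> H <> G2 K ->
  ~ type_A2 H -> conn_solvable_in H B -> (forall X, (X \in b) <-> lie_algebra B X) ->
  (\dim b <= 4)%N.
Proof.
move=> redH HG HnG nA2 [BH cB coB solB] bP; have [GU _ GM GV] := G2_subgroup K.
have sH := redH.1.1; have sB := cB.1.
have [L LP] := @vspace_of _ _ (lie_algebra H) (@lie0 _ _ H) (fun a u v => @lie_linear _ _ H a u v).
have bL : (b <= L)%VS by apply/subvP => X /bP LX; apply/LP; apply: lie_sub LX.
have [L0|Ln0] := eqVneq L 0%VS.
  by move: bL; rewrite L0 subv0 => /eqP->; rewrite dimv0.
have [x [xL xs xn0 [rk1|[y [yL ys xy yx]]]]] := lie_rank_cases redH LP Ln0.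
  by rewrite (leq_trans (dimvS bL)) // ltnW // ltnS (lie_rank_one redH LP xL xs xn0 rk1).
have [g Gg tH] := torus_in_lie sH HG ((LP x).1 xL) ((LP y).1 yL) xs ys xy xn0 yx.
have gU := GU g Gg; have sH' : subgroup_GL (conj_subgroup g H) by apply: conj_subgroup_GL.
have HG' : conj_subgroup g H `<=` G2 K.
  by move=> _ [h Hh <-]; apply: (GM); [apply: (GM) => //; apply: HG|apply: GV].
have nd X : lie_algebra (conj_subgroup g H) X ->
    (forall Y, lie_algebra (conj_subgroup g H) Y -> \tr (X *m Y) = 0) -> X = 0.
  move=> /(lie_conjE _ _ gU) LX XY; suff e : invmx g *m X *m g = 0.
    by have := congr1 (fun A : M => g *m A *m invmx g) e; rewrite /= !mulmxA mulmxV // mul1mx mulmxK // mulmx0 mul0mx.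
  apply: (reductive_trace_form redH LX) => Y LY.
  have := XY _ (lie_conj LY gU); rewrite -!mulmxA mxtrace_mulC -!mulmxA => <-.
  by rewrite [RHS]mxtrace_mulC -!mulmxA [in RHS]mxtrace_mulC -!mulmxA mxtrace_mulC -!mulmxA.
have sym := root_set_symmetric sH' HG' tH nd.
pose p k := `[< lie_algebra (conj_subgroup g H) (rmx K k) >].
(* The root analysis takes place in the conjugate by g; c carries its results back to the Lie
   algebra of H, where b lives. *)
pose c X := invmx g *m X *m g.
have cD X Y : c (X + Y) = c X + c Y by rewrite /c mulmxDr mulmxDl.
have cZ a X : c (a *: X) = a *: c X by rewrite /c -scalemxAr -scalemxAl.
have c0 : c 0 = 0 by rewrite /c mulmx0 mul0mx.
have cbr X Y : bracket (c X) (c Y) = c (bracket X Y).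
  by rewrite /bracket /c mulmxBr mulmxBl !mulmxA !mulmxK.
have cg X : c (g *m X *m invmx g) = X by rewrite /c !mulmxA mulVmx // mul1mx mulmxKV.
have cn0 X : X != 0 -> c X != 0.
  apply: contra_neq => e; have := congr1 (fun A : M => g *m A *m invmx g) e.
  by rewrite /= /c !mulmxA mulmxV // mul1mx mulmxK // mulmx0 mul0mx.
have cL X : lie_algebra (conj_subgroup g H) X -> c X \in L.
  by move=> /(lie_conjE _ _ gU) LX; apply/LP.
have span (U : {vspace M}) : (forall a a', c (cartan_diag a a') \in U) ->
    (forall k, (k < 6)%N -> p k -> c (rmx K k) \in U /\ c (rmx K (k + 6)) \in U) -> (L <= U)%VS.
  move=> Uc Ur; apply/subvP => X /LP LX; have LX' := lie_conj LX gU.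
  rewrite -(cg X) (lie_G2_decomp (lie_sub HG' LX')) -addrA cD; apply: memvD; last exact: Uc.
  rewrite (big_morph c cD c0); apply: memv_suml => k _; rewrite cZ.
  set X' := g *m X *m invmx g in LX' *.
  have [->|n0] := eqVneq (root_coord k X') 0; first by rewrite scale0r mem0v.
  apply: memvZ; have Lk := lie_root_component sH' HG' tH LX' (ltn_ord k) n0.
  have [k6|k6] := ltnP k 6; first by have [] := Ur k k6 (asboolT Lk).
  have kE : (k : nat) = (k - 6 + 6)%N by rewrite subnK.
  have k6' : (k - 6 < 6)%N by have := ltn_ord k; lia.
  rewrite kE; have [] // := Ur (k - 6)%N k6'; apply/asboolP/sym => //.
  by rewrite -kE.
have triple i j l : (i, j, l) \in [:: (0, 1, 2); (0, 2, 3); (0, 3, 4); (1, 4, 5); (2, 3, 5)]%N ->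
    [/\ p i -> p j -> p l, p l -> p i -> p j & p l -> p j -> p i].
  move=> t; have /and3P[/= b1 b2 b3] := allP bracket_check _ t.
  have [i6 j6] : (i < 6)%N /\ (j < 6)%N.
    by move: t; rewrite !inE => /or4P[/eqP[-> -> _]|/eqP[-> -> _]|/eqP[-> -> _]|/orP[]/eqP[-> -> _]].
  have tr := lie_root_triple sH'.
  by split=> /asboolP La /asboolP Lb; apply/asboolP;
    [exact: tr b1 La Lb|apply: tr b2 La _; apply/sym|apply: tr b3 La _; apply/sym].
have [[k [k6 kp]]|[i [j [ij pij]]]|pl|pa] := root_subsystems triple.
(* With at most one pair of opposite roots, even the whole Lie algebra has dimension at most 2 +
   2. *)
- apply: leq_trans (dimvS bL) _.
  pose s := [:: c (chh K 0); c (chh K 1); c (rmx K k); c (rmx K (k + 6))].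
  have LU : (L <= <<s>>)%VS.
    apply: span => [a a'|j j6 pj].
      rewrite /cartan_diag cD !cZ; apply: memvD; apply: memvZ; apply: memv_span;
        by rewrite !inE eqxx ?orbT.
    by rewrite (kp j j6 pj); split; apply: memv_span; rewrite !inE eqxx ?orbT.
  by apply: leq_trans (dimvS LU) _; apply: dim_span.
- have [i6 j6] : (i < 6)%N /\ (j < 6)%N.
    by move: ij; rewrite !inE => /or3P[]/eqP[-> ->].
  have [ei1 ei2 ei3] := coroot_sl2 K i6; have [ej1 ej2 ej3] := coroot_sl2 K j6.
  have /and4P[/= /and5P[/int_mx_eq o1 /int_mx_eq o2 /int_mx_eq o3 /int_mx_eq o4 _] /eqP w1 /eqP w2 d0] :=
    allP orthogonal_check _ ij.
  have i12 : (i < 12)%N by rewrite (leq_trans i6).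
  have j12 : (j < 12)%N by rewrite (leq_trans j6).
  have i12' : (i + 6 < 12)%N by rewrite -[12%N]/(6 + 6)%N ltn_add2r.
  have j12' : (j + 6 < 12)%N by rewrite -[12%N]/(6 + 6)%N ltn_add2r.
  have wopp l : (l < 6)%N -> root_weight (l + 6) 0 = - root_weight l 0 /\
      root_weight (l + 6) 1 = - root_weight l 1.
    move=> l6; have /andP[_ e] := all_iotaP coroot_check l6.
    by split; apply/eqP; apply: (all_iotaP e).
  have cc u v u' v' : bracket (cartan_diag u v) (cartan_diag u' v') = 0 :> M.
    have cdE u0 v0 : cartan_diag u0 v0 = diag_mx (\row_(r < 7)
        (u0 * (cartan_fun 0 r)%:~R + v0 * (cartan_fun 1 r)%:~R)) :> M.
      apply/matrixP => r c'; rewrite cartan_diag_entry !mxE.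
      by case: eqP => [->|_]; rewrite ?mul1r ?mul0r.
    by rewrite !cdE /bracket !mulmx_diag; apply/eqP; rewrite subr_eq0; apply/eqP; congr diag_mx;
      apply/rowP => r; rewrite !mxE mulrC.
  have cw m l : (coroot m).1 * root_weight l 0 + (coroot m).2 * root_weight l 1 = 0 -> (l < 6)%N ->
      bracket (coroot_mx K m) (rmx K l) = 0 /\ bracket (coroot_mx K m) (rmx K (l + 6)) = 0.
    move=> e l6; have l12 : (l < 12)%N by rewrite (leq_trans l6).
    have l12' : (l + 6 < 12)%N by rewrite -[12%N]/(6 + 6)%N ltn_add2r.
    rewrite /coroot_mx !cartan_diag_rmx // (wopp l l6).1 (wopp l l6).2.
    by rewrite -!intrM -!intrD !mulrN -opprD e oppr0 !scale0r.
  have [a1 a2] := cw i j w1 j6; have [a3 a4] := cw j i w2 i6.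
  pose V l := <<[:: c (rmx K l); c (rmx K (l + 6)%N); c (coroot_mx K l)]>>%VS.
  have memV l : [/\ c (rmx K l) \in V l, c (rmx K (l + 6)) \in V l & c (coroot_mx K l) \in V l].
    by split; apply: memv_span; rewrite !inE eqxx ?orbT.
  have Vij X Y : X \in V i -> Y \in V j -> bracket X Y = 0.
    move=> Xi Yj; apply/eqP; rewrite -memv0; apply: bracket_span Xi Yj => u v.
    have z0 A A' : bracket A A' = 0 -> bracket (c A) (c A') \in 0%VS by rewrite cbr => ->; rewrite c0 mem0v.
    have b1 : bracket (rmx K i) (rmx K j) = 0 by rewrite int_bracket o1 int_mx0.
    have b2 : bracket (rmx K i) (rmx K (j + 6)) = 0 by rewrite int_bracket o2 int_mx0.
    have b3 : bracket (rmx K (i + 6)) (rmx K j) = 0 by rewrite int_bracket o3 int_mx0.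
    have b4 : bracket (rmx K (i + 6)) (rmx K (j + 6)) = 0 by rewrite int_bracket o4 int_mx0.
    have b5 : bracket (rmx K i) (coroot_mx K j) = 0 by rewrite bracketC a3 oppr0.
    have b6 : bracket (rmx K (i + 6)) (coroot_mx K j) = 0 by rewrite bracketC a4 oppr0.
    by rewrite !inE => /or3P[]/eqP-> /or3P[]/eqP->; apply: z0 => //; apply: cc.
  have Vl l : (l < 6)%N -> forall X Y, X \in V l -> Y \in V l -> bracket X Y \in V l.
    move=> l6 X Y; apply: bracket_span => u v; have [e1 e2 e3] := coroot_sl2 K l6.
    have [m1 m2 m3] := memV l.
    rewrite !inE => /or3P[]/eqP-> /or3P[]/eqP->; rewrite cbr ?bracketXX ?c0 ?mem0v // ?e1 ?e2 ?e3 //;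
      rewrite ?cZ ?memvZ //; by rewrite bracketC ?e1 ?e2 ?e3 -scaleN1r cZ memvZ // ?cZ ?memvZ.
  have LV : (L <= V i + V j)%VS.
    apply: span => [a a'|k k6].
      pose d : K := ((coroot i).1 * (coroot j).2 - (coroot i).2 * (coroot j).1)%:~R.
      have dn : d != 0 by rewrite intr_eq0.
      have -> : cartan_diag a a' = ((a * (coroot j).2%:~R - a' * (coroot j).1%:~R) / d) *: coroot_mx K i +
          ((a' * (coroot i).1%:~R - a * (coroot i).2%:~R) / d) *: coroot_mx K j.
        rewrite cartan_diag_linear; congr cartan_diag; rewrite /d rmorphB !rmorphM /= in dn *; field => //.
      rewrite cD !cZ; apply: memv_add; apply: memvZ; by have [] := memV i; have [] := memV j.
    rewrite pij // => /orP[]/eqP->.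
      by have [m1 m2 _] := memV i; split; apply: (subvP (addvSl _ _)).
    by have [m1 m2 _] := memV j; split; apply: (subvP (addvSr _ _)).
  have Lij l : (l < 6)%N -> p l -> (V l <= L)%VS.
    move=> l6 /asboolP Ll; apply/span_subvP => u; rewrite !inE => /or3P[]/eqP->; apply: cL => //.
      by apply/sym.
    exact: tH.
  have pj : p j by rewrite pij // eqxx orbT.
  have BG : B `<=` G2 K by apply: subset_trans BH HG.
  have sl l : (l < 6)%N -> [/\ bracket (c (rmx K l)) (c (rmx K (l + 6))) = c (coroot_mx K l),
      bracket (c (coroot_mx K l)) (c (rmx K l)) = 2 *: c (rmx K l) &
      bracket (c (coroot_mx K l)) (c (rmx K (l + 6))) = - 2 *: c (rmx K (l + 6))].
    by move=> /(coroot_sl2 K)[e1 e2 e3]; rewrite !cbr e1 e2 e3 !cZ.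
  have [mi1 mi2 mi3] := memV i; have [mj1 mj2 mj3] := memV j.
  have [si1 si2 si3] := sl i i6; have [sj1 sj2 sj3] := sl j j6.
  have Vji X Y : X \in V j -> Y \in V i -> bracket X Y = 0.
    by move=> Xj Yi; rewrite bracketC Vij // oppr0.
  have ni := sl2_sl2_solvable sB BG solB bP mi1 mi2 mi3 (cn0 _ (rmx_neq0 K i12)) si1 si2 si3
    Vij (Vl j j6) (subvv _).
  have nj := sl2_sl2_solvable sB BG solB bP mj1 mj2 mj3 (cn0 _ (rmx_neq0 K j12)) sj1 sj2 sj3
    Vji (Vl i i6) (subvv _).
  by apply: (sl2_sl2_dim bL (Lij j j6 pj) LV _ _ ni nj); apply: dim_span.
- case: nA2; apply: (long_type_A2 redH.1 HG Gg tH) => k k12.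
  have pE l : (l < 6)%N -> lie_algebra (conj_subgroup g H) (rmx K l) <-> l \in [:: 1; 4; 5]%N.
    by move=> l6; rewrite -pl //; split=> /asboolP.
  have [k6|k6] := ltnP k 6.
    by rewrite (pE k k6); case: k k6 {k12} => [|[|[|[|[|[|k]]]]]].
  have kE : k = (k - 6 + 6)%N by rewrite subnK.
  have k6' : (k - 6 < 6)%N by lia.
  rewrite kE sym // pE //; case: (k - 6)%N k6' => [|[|[|[|[|[|l]]]]]] //.
- case: HnG; apply: (conj_all_roots redH.1 HG Gg) => k k12.
  have pE l : (l < 6)%N -> lie_algebra (conj_subgroup g H) (rmx K l).
    by move=> /pa /asboolP.
  have [/pE//|k6] := ltnP k 6.
  by rewrite -(subnK k6) sym; [apply: pE|]; lia.
Qed.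

End BorelDimension.

(** * Density of open orbits and counting of forms *)

Lemma free_subseq (K : fieldType) (V : vectType K) (s : seq V) :
  exists t, [/\ free t, {subset t <= s} & (<<t>> = <<s>>)%VS].
Proof.
elim: s => [|x s [t [ft ts sp]]]; first by exists [::]; split=> //; apply: nil_free.
have [xt|xt] := boolP (x \in <<t>>%VS).
  exists t; split=> // [y /ts ys|]; first by rewrite inE ys orbT.
  by rewrite span_cons -sp; apply/esym/addv_idPr; rewrite -memvE.
exists (x :: t); rewrite free_cons xt ft !span_cons sp; split=> // y.
by rewrite !inE => /predU1P[->|/ts ->]; rewrite ?eqxx ?orbT.
Qed.

(** Nilpotent parts and replicas of a spanning set span as well, and a basis is extracted from them.
    These are the elements to which [bounded_kill] applies. *)
Lemma lie_rational_basis (K : numClosedFieldType) (n : nat) (H : set 'M[K]_n.+1)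
  (L : {vspace 'M[K]_n.+1}) : subgroup_GL H -> (forall X, (X \in L) <-> lie_algebra H X) ->
  exists b : (\dim L).-tuple 'M[K]_n.+1, [/\ free b, <<b>>%VS = L &
    forall X, X \in b -> X ^+ n.+1 = 0 \/ int_semisimple X].
Proof.
move=> sH LP; pose good (X : 'M[K]_n.+1) := X ^+ n.+1 = 0 \/ int_semisimple X.
have cover (s : seq 'M[K]_n.+1) : {subset s <= L} -> exists t,
    [/\ {subset t <= L}, (forall X, X \in t -> good X) & {subset s <= <<t>>%VS}].
  elim: s => [|X s IHs] sL; first by exists [::].
  have [t [tL tg st]] : exists t,
      [/\ {subset t <= L}, (forall X, X \in t -> good X) & {subset s <= <<t>>%VS}].
    by apply: IHs => Y Ys; apply: sL; rewrite inE Ys orbT.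
  have /LP LX := sL X (mem_head _ _).
  have [r [c [Y [N [XE [LN Nn] YP _]]]]] := lie_replicas sH LX.
  exists (N :: [seq Y j | j <- enum 'I_r] ++ t); split.
  - move=> Z; rewrite inE mem_cat => /orP[/eqP->|/orP[/mapP[j _ ->]|/tL//]]; apply/LP => //.
    by have [] := YP j.
  - move=> Z; rewrite inE mem_cat => /orP[/eqP->|/orP[/mapP[j _ ->]|/tg//]]; first by left.
    by right; have [] := YP j.
  - have sub Z : Z \in N :: [seq Y j | j <- enum 'I_r] ++ t ->
        Z \in <<N :: [seq Y j | j <- enum 'I_r] ++ t>>%VS by apply: memv_span.
    move=> Z; rewrite inE => /predU1P[->|/st].
      rewrite XE; apply: memvD; first by apply: sub; rewrite mem_head.
      apply: memv_suml => j _.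
      by rewrite memvZ // sub // inE mem_cat map_f ?orbT ?mem_enum.
    rewrite span_cons span_cat => Zt; by do 2!apply: (subvP (addvSr _ _)).
have [t [tL tg bt]] := cover (vbasis L) (fun X XL => vbasis_mem XL).
have [u [fu ut us]] := free_subseq t.
have uL : (<<u>> = L)%VS.
  apply: subv_anti; rewrite us; apply/andP; split; first exact/span_subvP.
  by rewrite -(span_basis (vbasisP L)); apply/span_subvP.
have su : size u == \dim L by rewrite -uL; move/eqP: fu => ->.
by exists (Tuple su); split=> // X /ut /tg.
Qed.

Section Density.
Variables (K : numClosedFieldType).
Local Notation M := 'M[K]_7.
Local Notation P := (mpoly (7 * 7) K).
Implicit Types (g h : M) (p q : P).

Definition poly_curve (c : K -> M) : Prop :=
  forall i j, exists q : {poly K}, forall t, c t i j = q.[t].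

Lemma poly_curve_cst g : poly_curve (fun=> g).
Proof. by move=> i j; exists (g i j)%:P => t; rewrite hornerC. Qed.

Lemma poly_curveM c d : poly_curve c -> poly_curve d -> poly_curve (fun t => c t *m d t).
Proof.
move=> cP dP i j; have [f fE] := choice (fun k => cP i k).
have [f' fE'] := choice (fun k => dP k j).
exists (\sum_k f k * f' k) => t; rewrite mxE horner_sum.
by apply: eq_bigr => k _; rewrite hornerM fE fE'.
Qed.

Lemma poly_curve_umx k a : poly_curve (fun t => umx k (t * a)).
Proof.
move=> i j.
exists (((1%:M : M) i j)%:P + (a * rmx K k i j) *: 'X + (a ^+ 2 * smx K k i j) *: 'X^2).
move=> t; rewrite !hornerD !hornerZ hornerC hornerX hornerXn.
rewrite /umx [LHS]mxE [X in X + _]mxE [X in _ + X]mxE [X in _ + X + _]mxE.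
by move: (1%:M i j) (rmx K k i j) (smx K k i j) => *; ring.
Qed.

Definition curve_component : set M := [set g | exists c : K -> M,
  [/\ poly_curve c, forall t, G2 K (c t), c 0 = 1%:M & c 1 = g]].

Lemma G2_curve g : G2 K g -> curve_component g.
Proof.
have [GU G1 GM GV] := G2_subgroup K.
move: g; apply: gen_subgroup_sub; first split.
- by move=> _ [c [_ cG _ <-]]; apply: GU.
- by exists (fun=> 1%:M); split=> //; apply: poly_curve_cst.
- move=> _ _ [c [cP cG c0 <-]] [d [dP dG d0 <-]]; exists (fun t => c t *m d t); split=> //.
  + exact: poly_curveM.
  + by move=> t; apply: GM.
  + by rewrite c0 d0 mulmx1.
- move=> _ [c [cP cG c0 <-]]; exists (fun t => invmx (c t)); split=> //.
  + have -> : (fun t => invmx (c t)) = fun t => jinv K *m ((c t)^T *m jmx K).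
      by apply/funext => t; rewrite mulmxA aut7_inv //; apply: G2_aut7.
    apply: poly_curveM; first exact: poly_curve_cst.
    apply: poly_curveM; last exact: poly_curve_cst.
    by move=> i j; have [q qE] := cP j i; exists q => t; rewrite mxE.
  + by move=> t; apply: GV.
  + by rewrite c0 invmx1.
have umxC k a : (k < 12)%N -> curve_component (umx k a).
  move=> k12; exists (fun t => umx k (t * a)); split; first exact: poly_curve_umx.
  - by move=> t; apply: umx_G2.
  - by rewrite mul0r umx0.
  - by rewrite mul1r.
by move=> _ [[a _ [i _ <-]]|[a _ [i _ <-]]]; rewrite ?cheE ?chfE umxE; try apply: umxC;
  case: i => [[|[|//]]].
Qed.

(* Any two points of the group lie on a curve with polynomial entries. *)
Lemma G2_dense p q g0 : G2 K g0 -> mxeval q g0 != 0 ->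
  (forall g, G2 K g -> mxeval q g != 0 -> mxeval p g = 0) ->
  forall g, G2 K g -> mxeval p g = 0.
Proof.
move=> Gg0 q0 pq g Gg; have [GU G1 GM GV] := G2_subgroup K.
have [c [cP cG c0 c1]] := G2_curve (GM _ _ Gg (GV _ Gg0)).
have dP : poly_curve (fun t => c t *m g0) by apply: poly_curveM => //; apply: poly_curve_cst.
have [r rE] := mxeval_curve dP p; have [s sE] := mxeval_curve dP q.
have /eqP : s * r = 0.
  apply: poly_ext => t; rewrite hornerM horner0 -rE -sE.
  have [->|n0] := eqVneq (mxeval q (c t *m g0)) 0; first by rewrite mul0r.
  by rewrite pq ?mulr0 //; apply: GM.
rewrite mulf_eq0 => /orP[/eqP s0|/eqP r0].
  by case/eqP: q0; rewrite -[g0]mul1mx -c0 sE s0 horner0.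
have -> : g = c 1 *m g0 by rewrite c1 mulmxKV //; apply: GU.
by rewrite rE r0 horner0.
Qed.

End Density.

Definition digit n j i : nat := ((j %/ n ^ i) %% n)%N.

Lemma digit_sum n k j : (0 < n)%N ->
  (\sum_(i < k) digit n j i * n ^ i = j %% n ^ k)%N.
Proof.
move=> n0; elim: k => [|k IHk]; first by rewrite big_ord0 modn1.
rewrite big_ord_recr /= IHk /digit.
have nk0 : (0 < n ^ k)%N by rewrite expn_gt0 n0.
rewrite [in RHS](divn_eq j (n ^ k)) [in RHS](divn_eq (j %/ n ^ k) n).
rewrite mulnDl -mulnA -expnS -addnA modnMDl [RHS]modn_small 1?addnC //.
rewrite expnS (@leq_trans (((j %/ n ^ k) %% n).+1 * n ^ k)) //.
  by rewrite mulSn ltn_add2r ltn_pmod.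
by rewrite leq_mul2r ltn_pmod ?orbT.
Qed.

Section Monomials.
Variable n : nat.
Implicit Types (j : nat).

Definition digits_total j : nat := \sum_(i < 5) digit n j i.

Lemma digits_bound j : (0 < n)%N -> (digits_total j <= 5 * n)%N.
Proof.
move=> n0; rewrite -[X in (_ <= X * _)%N](card_ord 5) -sum_nat_const.
by apply: leq_sum => i _; rewrite ltnW // ltn_pmod.
Qed.

(* The exponents are the digits of j in base n, so that the form takes the value
   z ^ j at the point (1, z, z ^ n, ..., z ^ (n ^ 4)). *)
Definition digit_form (A : comNzRingType) j (u : 'I_6 -> A) : A :=
  u ord0 ^+ (5 * n - digits_total j) * \prod_(i < 5) u (lift ord0 i) ^+ digit n j i.

Lemma digit_formZ (A : comNzRingType) j (u : 'I_6 -> A) a : (0 < n)%N ->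
  digit_form j (fun i => a * u i) = a ^+ (5 * n) * digit_form j u.
Proof.
move=> n0; rewrite /digit_form exprMn; under eq_bigr do rewrite exprMn.
by rewrite big_split /= prodrXr mulrACA -exprD subnK // digits_bound.
Qed.

Lemma digit_form_chart (A : comNzRingType) j (u : 'I_6 -> A) z : (0 < n)%N ->
  (j < n ^ 5)%N -> u ord0 = 1 -> (forall i, u (lift ord0 i) = z ^+ (n ^ i)) ->
  digit_form j u = z ^+ j.
Proof.
move=> n0 jn u0 uz; rewrite /digit_form u0 expr1n mul1r.
under eq_bigr do rewrite uz -exprM mulnC.
by rewrite prodrXr digit_sum // modn_small.
Qed.

End Monomials.

Section OrbitGrowth.
Variable K : numClosedFieldType.
Local Notation M := 'M[K]_7.
Local Notation P := (mpoly (7 * 7) K).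
Implicit Types (g : M) (p : P) (H B Q : set M).

Lemma deg_le_prod (I : Type) (r : seq I) (N : I -> nat) (F : I -> P) :
  (forall i, deg_le (N i) (F i)) -> deg_le (\sum_(i <- r) N i) (\prod_(i <- r) F i).
Proof.
move=> FN; apply: (big_ind2 (fun N p => deg_le N p)) => [|N1 p1 N2 p2|i _] //.
  by rewrite -mpolyC1; apply: deg_leC.
exact: deg_leM.
Qed.

Lemma deg_le_digit_form n j e (F : 'I_6 -> P) : (0 < n)%N -> (forall i, deg_le e (F i)) ->
  deg_le (e * (5 * n)) (digit_form n j F).
Proof.
move=> n0 Fe; rewrite -(subnK (digits_bound j n0)) mulnDr; apply: deg_leM; first exact: deg_leX.
by rewrite big_distrr; apply: deg_le_prod => i; apply: deg_leX.
Qed.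

Lemma mxeval_digit_form n j (F : 'I_6 -> P) g :
  mxeval (digit_form n j F) g = digit_form n j (fun i => mxeval (F i) g).
Proof.
rewrite /mxeval /digit_form rmorphM rmorphXn rmorph_prod.
by congr (_ * _); apply: eq_bigr => i _; rewrite rmorphXn.
Qed.

(* On the dense orbit of B the n ^ 5 forms [digit_form n j] in six homogeneous
   coordinates of G2/Q are linearly independent, whereas on B they span a space
   of dimension O(n ^ d). *)
Lemma not_spherical_growth H Q e (F : M -> 'I_6 -> K) :
  Q 1%:M ->
  (forall B, conn_solvable_in H B -> B `<=` G2 K /\ exists d C, (d <= 4)%N /\
    forall N (J : finType) (f : J -> P), (forall j, deg_le N (f j)) ->
      ((C * N.+1) ^ d < #|J|)%N ->
      exists c : J -> K, (exists j, c j != 0) /\ vanishing B (\sum_j c j *: f j)) ->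
  (forall g0 i, exists2 p, deg_le e p & forall b, mxeval p b = F (b *m g0) i) ->
  (forall h, Q h -> exists a, forall g i, F (g *m h) i = a * F g i) ->
  (forall y : 'I_5 -> K, exists2 g, G2 K g &
     F g ord0 = 1 /\ forall i, F g (lift ord0 i) = y i) ->
  ~ spherical (G2 K) Q H.
Proof.
move=> Q1 HB Fpoly Fhom Fsurj [B [[csB _] [_ [g0 Gg0 <-] [_ [O oO OE]]]]].
have [BG [d [C [d4 growth]]]] := HB B csB.
have [_ [[_ B1 _ _] _] _ _] := csB.
have [S OS] : zariski_open O by [].
have Og0 : O g0.
  suff : (G2 K `&` O) g0 by case.
  rewrite -OE; split=> //; exists 1%:M => //.
  apply/seteqP; split=> x; first by move=> [y yQ <-]; rewrite mul1mx.
  by move=> xQ; exists x; rewrite ?mul1mx.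
have [s Ss s0] : exists2 s, S s & mxeval s g0 != 0.
  have [//|nS] := pselect (exists2 s, S s & mxeval s g0 != 0).
  suff : (~` O) g0 by [].
  rewrite OS => s Ss; have [//|n0] := eqVneq (mxeval s g0) 0.
  by case: nS; exists s.
have cell g : G2 K g -> mxeval s g != 0 -> exists b h, [/\ B b, Q h & g = b *m g0 *m h].
  move=> Gg sg; have : (G2 K `&` O) g.
    split=> //; have [//|nO] := pselect (O g).
    by case/eqP: sg; have zg : zeros S g by [rewrite -OS]; apply: zg.
  rewrite -OE => -[_ [b Bb bE]].
  have : left_translate g Q g by exists 1%:M; rewrite ?mulmx1.
  by rewrite -bE => -[_ [h Qh <-] <-]; exists b, h; rewrite mulmxA.
(* With this A the bound on the number of words is at most (A n)^4 = A^4 n^4, and n > A^4 makes it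
   smaller than n^5. *)
pose A := (C * (5 * e).+1).+1; pose n := (A ^ 4).+1.
have n0 : (0 < n)%N by [].
have big : ((C * (e * (5 * n)).+1) ^ d < #|'I_(n ^ 5)|)%N.
  rewrite card_ord (@leq_ltn_trans ((A * n) ^ 4)) //.
    have le1 : (C * (e * (5 * n)).+1 <= A * n)%N.
      rewrite (@leq_trans (C * ((5 * e).+1 * n))) //.
        by rewrite leq_mul2l [((5 * e).+1 * n)%N]mulSn -mulnA [(5 * (e * n))%N]mulnCA -add1n leq_add2r n0 orbT.
      by rewrite mulnA leq_mul2r leqnSn orbT.
    rewrite (@leq_trans ((A * n) ^ d)) //; first by case: (d) => [|d'] //; rewrite leq_exp2r.
    by rewrite leq_pexp2l // muln_gt0.
  by rewrite expnMn [(n ^ 5)%N]expnS ltn_pmul2r // expn_gt0.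
(* f0 reads the coordinates of b g0 as polynomials in b, f1 those of g itself; where g = b g0 h with
   h in Q they agree up to a common factor. *)
have [f0 fE] := choice (fun i => (let: ex_intro2 p p1 p2 := Fpoly g0 i in
  ex_intro (fun p => deg_le e p /\ forall b, mxeval p b = F (b *m g0) i) p (conj p1 p2))).
have [f1 f1E] := choice (fun i => (let: ex_intro2 p p1 p2 := Fpoly 1%:M i in
  ex_intro (fun p => deg_le e p /\ forall b, mxeval p b = F (b *m 1%:M) i) p (conj p1 p2))).
have [c [[j cj] vB]] := growth _ 'I_(n ^ 5) (fun j => digit_form n j f0)
  (fun j => deg_le_digit_form j n0 (fun i => (fE i).1)) big.
have evalE (f : 'I_6 -> P) g : mxeval (\sum_j c j *: digit_form n j f) g =
    \sum_j c j * digit_form n j (fun i => mxeval (f i) g).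
  by rewrite mxeval_sum; apply: eq_bigr => k _; rewrite mxevalZ mxeval_digit_form.
have vG g : G2 K g -> mxeval (\sum_j c j *: digit_form n j f1) g = 0.
  move: g; apply: (G2_dense Gg0 s0) => g Gg /(cell g Gg)[b [h [Bb Qh gE]]].
  have [a aE] := Fhom h Qh.
  have e1 : (fun i => mxeval (f1 i) g) = fun i => a * mxeval (f0 i) b.
    by apply/funext => i; rewrite (f1E i).2 (fE i).2 mulmx1 gE aE.
  rewrite evalE; under eq_bigr => k _ do rewrite e1 digit_formZ // mulrCA.
  by rewrite -mulr_sumr -evalE vB ?mulr0.
(* At the point of the chart with coordinates z, z^n, ..., z^(n^4) the forms take the values z^k, so
   the relation becomes a polynomial in z that vanishes everywhere. *)
have : \poly_(k < n ^ 5) (if insub k is Some k' then c k' else 0) = 0.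
  apply: poly_ext => z; rewrite horner0.
  have [g Gg [g1 gz]] := Fsurj (fun i => z ^+ (n ^ i)).
  rewrite -(vG g Gg) evalE horner_poly; apply: eq_bigr => k _.
  rewrite valK (@digit_form_chart n _ _ _ z) // ?(f1E _).2 ?mulmx1 // => i.
  by rewrite (f1E _).2 mulmx1 gz.
move=> /(congr1 (fun p : {poly K} => p`_j)); rewrite coef_poly ltn_ord valK coef0 => cj0.
by rewrite cj0 eqxx in cj.
Qed.

End OrbitGrowth.

(** * Charts of the two flag varieties *)

Section FlagCoordinates.
Variable K : numClosedFieldType.
Local Notation M := 'M[K]_7.
Local Notation P := (mpoly (7 * 7) K).
Implicit Types (g : M) (p : P) (H B : set M).

(** Six of the seven homogeneous coordinates on the quadric G2/P1; the last is a function of them in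
    the chart where the first is 1. *)
Definition coord1 g (i : 'I_6) : K := g (inord i) 0.

Lemma coord1_poly g0 i : exists2 p : P, deg_le 1 p &
  forall b, mxeval p b = coord1 (b *m g0) i.
Proof.
exists (\sum_l g0 l 0 *: xvar K (inord i) l).
  by apply: deg_le_sum => l; apply/deg_leZ/deg_le_var.
move=> b; rewrite mxeval_sum /coord1 mxE; apply: eq_bigr => l _.
by rewrite mxevalZ mxeval_var mulrC.
Qed.

Lemma coord1_hom h : P1 K h -> exists a, forall g i, coord1 (g *m h) i = a * coord1 g i.
Proof.
move=> [_ [a ha]]; exists a => g i; rewrite /coord1.
have e (A : M) r : A r 0 = (A *m delta_mx 0 0 : 'cV_7) r 0 by rewrite -colE mxE.
by rewrite [LHS]e -mulmxA [h *m _]ha -scalemxAr mxE -e.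
Qed.

(** Coordinate 6 is solved from the equation of the quadric, and [null_vector_chart] supplies the
    group element. *)
Lemma coord1_surj (y : 'I_5 -> K) : exists2 g, G2 K g &
  coord1 g ord0 = 1 /\ forall i, coord1 g (lift ord0 i) = y i.
Proof.
pose u (k : nat) : K := if k is k'.+1 then y (inord k') else 1.
pose v : 'cV[K]_7 := \col_r if (r < 6)%N then u r
  else u 1 * u 5 - u 2 * u 4 + u 3 ^+ 2.
have v0 : v 0 0 = 1 by rewrite mxE.
have qv : qform v = 0 by rewrite /qform !mxE !inordK //= mulr1n; ring.
have v1 : v 0 0 != 0 by rewrite v0 oner_eq0.
have [g Gg gv] := null_vector_chart v1 qv; have [GU _ _ GV] := G2_subgroup K.
exists (invmx g); first exact: GV.
have gE r : (invmx g) r 0 = v r 0.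
  have -> : v = invmx g *m delta_mx 0 0 by rewrite -[LHS](mulKmx (GU _ Gg)) gv v0 scale1r.
  by rewrite -colE mxE.
split; first by rewrite /coord1 gE mxE inordK.
move=> i; have i5 : (i < 5)%N := ltn_ord i.
have i6 : (i.+1 < 6)%N := i5; have i7 : (i.+1 < 7)%N := ltnW i6.
rewrite /coord1 gE mxE lift0 inordK // i6 /=.
by congr y; apply: val_inj; rewrite /= inordK.
Qed.

(* Multiplying by the inverse Gram matrix turns the adjoint action on [e_theta]
   into the congruence action, which is polynomial in g. *)
Definition theta_form : M := e_theta K *m jinv K.

Lemma theta_formE : theta_form = E K 1 0 - E K 0 1.
Proof.
have -> : theta_form = 2^-1 *: (2%:~R *: (E K 1 0 - E K 0 1)).
  rewrite /theta_form /jinv -scalemxAr /e_theta; congr (_ *: _).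
  by rewrite !int_mx_simp; apply: eq_int_mx.
have -> : 2%:~R = 2 :> K by [].
by rewrite scalerA mulVf ?scale1r ?pnatr_eq0.
Qed.

Lemma theta_form_delta : theta_form = delta_mx 1 0 *m (delta_mx 0 0 : 'cV_7)^T -
  delta_mx 0 0 *m (delta_mx 1 0 : 'cV_7)^T.
Proof.
rewrite theta_formE !trmx_delta !mul_delta_mx.
by congr (_ - _); apply/matrixP => r c; rewrite !mxE -!val_eqE.
Qed.

(** Pluecker coordinates of the plane spanned by the first two columns of g. These six are chosen so
    that on the opposite unipotent radical they can be solved successively for its parameters. *)
Definition coord2_pos (i : 'I_6) : 'I_7 * 'I_7 :=
  nth (0, 0) [:: (inord 1, 0); (inord 2, 0); (inord 3, 0); (inord 4, 0);
                 (inord 4, inord 1); (inord 6, 0)] i.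

Definition coord2 g (i : 'I_6) : K :=
  (g *m theta_form *m g^T) (coord2_pos i).1 (coord2_pos i).2.

Lemma coord2_poly g0 i : exists2 p : P, deg_le 2 p &
  forall b, mxeval p b = coord2 (b *m g0) i.
Proof.
set W := g0 *m theta_form *m g0^T; rewrite /coord2; case: (coord2_pos i) => r c /=.
exists (\sum_m (\sum_l W l m *: xvar K r l) * xvar K c m).
  apply: (@deg_le_sum K 6 2) => m; apply: (@deg_leM K 6 1 1); last exact: deg_le_var.
  by apply: deg_le_sum => l; apply/deg_leZ/deg_le_var.
move=> b; have -> : b *m g0 *m theta_form *m (b *m g0)^T = b *m W *m b^T.
  by rewrite trmx_mul /W !mulmxA.
rewrite mxeval_sum mxE; apply: eq_bigr => m _; rewrite mxevalM mxeval_var mxeval_sum.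
rewrite [b^T _ _]mxE [(b *m W) _ _]mxE; congr (_ * _).
by apply: eq_bigr => l _; rewrite mxevalZ mxeval_var mulrC.
Qed.

Lemma coord2_hom h : P2 K h -> exists a, forall g i, coord2 (g *m h) i = a * coord2 g i.
Proof.
move=> [Gh [a ha]]; exists a => g i; rewrite /coord2.
suff e : h *m theta_form *m h^T = a *: theta_form.
  have -> : g *m h *m theta_form *m (g *m h)^T = a *: (g *m theta_form *m g^T).
    by rewrite trmx_mul scalemxAl scalemxAr -e !mulmxA.
  by rewrite mxE.
have jK : jmx K *m jinv K = 1%:M by apply/mulmx1C/jinvK.
rewrite /theta_form scalemxAl -ha /adjoint_act (aut7_inv (G2_aut7 Gh)) !mulmxA.
by rewrite -[RHS]mulmxA jK mulmx1.
Qed.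

Definition umx_fun k t (f : nat -> K) (r : nat) : K :=
  f r + (t * foldr (fun c s => (root_fun k r c)%:~R * f c + s) 0 (iota 0 7)
    + t ^+ 2 * foldr (fun c s => (square_fun k r c)%:~R * f c + s) 0 (iota 0 7)).

Lemma umx_col k t (f : nat -> K) :
  umx k t *m (\col_(r < 7) f r) = \col_(r < 7) umx_fun k t f r.
Proof.
rewrite !mulmxDl mul1mx -!scalemxAl -addrA; apply/colP => r; rewrite !mxE.
have colE h : \sum_j int_mx K h r j * (\col_(r0 < 7) f r0) j 0 =
    foldr (fun c s => (h r c)%:~R * f c + s) 0 (iota 0 7).
  under eq_bigr do rewrite !mxE.
  by rewrite -(big_mkord xpredT (fun c => (h r c)%:~R * f c)) unlock.
by rewrite !colE.
Qed.

Lemma umx_seq k t (l l' : seq K) :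
  (forall r, (r < 7)%N -> umx_fun k t (nth 0 l) r = nth 0 l' r) ->
  umx k t *m (\col_(r < 7) nth 0 l r) = \col_(r < 7) nth 0 l' r.
Proof. by move=> e; rewrite umx_col; apply/colP => r; rewrite !mxE e. Qed.

Ltac umx_step := move=> [|[|[|[|[|[|[|//]]]]]]] _;
  rewrite /umx_fun /root_fun /square_fun /spmx /=; ring.

(** The product of the five root groups opposite to the unipotent radical of [P2] has coordinates 1,
    a, -b, -c, -d and e + b c, which determine the parameters in turn. *)
Lemma coord2_surj (y : 'I_5 -> K) : exists2 g, G2 K g &
  coord2 g ord0 = 1 /\ forall i, coord2 g (lift ord0 i) = y i.
Proof.
have [_ _ GM _] := G2_subgroup K.
pose a := y (inord 0); pose b := - y (inord 1); pose c := - y (inord 2).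
pose d := - y (inord 3); pose e := y (inord 4) - b * c.
pose g : M := umx 7 a *m (umx 8 b *m (umx 9 c *m (umx 10 d *m umx 11 e))).
exists g; first by do 4!(apply: (GM); first by apply: umx_G2); apply: umx_G2.
pose v := nth 0 [:: 1; 0; b; c; d; e + 2 * (b * c) + a * d; c ^+ 2 - b * d].
pose w := nth 0 [:: 0; 1; a; - b; - c; - b ^+ 2 - a * c; e + b * c].
have gv : g *m delta_mx 0 0 = \col_(r < 7) v r.
  have -> : delta_mx 0 0 = \col_(r < 7) nth 0 [:: 1] r :> 'cV[K]_7.
    by apply/colP => -[[|[|r]] hr]; rewrite !mxE -val_eqE /= ?nth_nil.
  rewrite /g -!mulmxA (@umx_seq 11 e _ [:: 1; 0; 0; 0; 0; e]); last by umx_step.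
  rewrite (@umx_seq 10 d _ [:: 1; 0; 0; 0; d; e]); last by umx_step.
  rewrite (@umx_seq 9 c _ [:: 1; 0; 0; c; d; e; c ^+ 2]); last by umx_step.
  rewrite (@umx_seq 8 b _ [:: 1; 0; b; c; d; e + 2 * (b * c); c ^+ 2 - b * d]); last by umx_step.
  by apply: umx_seq; umx_step.
have gw : g *m delta_mx 1 0 = \col_(r < 7) w r.
  have -> : delta_mx 1 0 = \col_(r < 7) nth 0 [:: 0; 1] r :> 'cV[K]_7.
    by apply/colP => -[[|[|[|r]]] hr]; rewrite !mxE -val_eqE /= ?nth_nil.
  rewrite /g -!mulmxA (@umx_seq 11 e _ [:: 0; 1; 0; 0; 0; 0; e]); last by umx_step.
  rewrite (@umx_seq 10 d _ [:: 0; 1; 0; 0; 0; 0; e]); last by umx_step.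
  rewrite (@umx_seq 9 c _ [:: 0; 1; 0; 0; - c; 0; e]); last by umx_step.
  rewrite (@umx_seq 8 b _ [:: 0; 1; 0; - b; - c; - b ^+ 2; e + b * c]); last by umx_step.
  by apply: umx_seq; umx_step.
have WE (r s : 'I_7) : (g *m theta_form *m g^T) r s = w r * v s - v r * w s.
  rewrite theta_form_delta mulmxBr mulmxBl !mulmxA -[_ *m _^T *m g^T]mulmxA -trmx_mul.
  by rewrite -[X in _ - X]mulmxA -trmx_mul gv gw !mxE !big_ord1 !mxE.
split; first by rewrite /coord2 WE /= !inordK //= /v /w /=; ring.
by move=> [[|[|[|[|[|//]]]]] hi]; rewrite /coord2 WE /= !inordK //= /v /w /=
  -[Ordinal hi]inord_val /= /e /b /c /d /a; ring.
Qed.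

End FlagCoordinates.

Lemma not_spherical (K : numClosedFieldType) (H Q : set 'M[K]_7) e (F : 'M[K]_7 -> 'I_6 -> K) :
  reductive H -> H `<=` G2 K -> H <> G2 K -> ~ type_A2 H -> Q 1%:M ->
  (forall g0 i, exists2 p : mpoly (7 * 7) K, deg_le (n := 6) e p &
     forall b, mxeval p b = F (b *m g0) i) ->
  (forall h, Q h -> exists a, forall g i, F (g *m h) i = a * F g i) ->
  (forall y : 'I_5 -> K, exists2 g, G2 K g &
     F g ord0 = 1 /\ forall i, F g (lift ord0 i) = y i) ->
  ~ spherical (G2 K) Q H.
Proof.
move=> redH HG HnG nA2 Q1; apply: not_spherical_growth Q1 _ => B csB.
have [BH cB coB _] := csB; split; first exact: subset_trans HG.
have [L LP] := @vspace_of _ _ (lie_algebra B) (@lie0 _ _ B) (fun a u v => @lie_linear _ _ B a u v).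
have [b [bf bL bX]] := lie_rational_basis cB.1 LP.
have LP' X : lie_algebra B X <-> X \in <<b>>%VS by rewrite bL; split=> /LP.
have [C CP] := connected_growth cB coB bf LP' bX.
by exists (\dim L), C; split=> //; apply: (borel_lie_dim redH HG HnG nA2 csB LP).
Qed.

Theorem proposition9 (R : realType) (H : set 'M[R[i]]_7)
  (H_max : maximal_reductive (G2 R[i]) H) (H_A2 : ~ type_A2 H) :
  ~ spherical (G2 R[i]) (P1 R[i]) H /\ ~ spherical (G2 R[i]) (P2 R[i]) H.
Proof.
have [[HG HnG _ redH] _] := H_max; have [_ G1 _ _] := G2_subgroup R[i].
split.
- apply: (not_spherical redH HG HnG H_A2 _ (@coord1_poly _) (@coord1_hom _) (@coord1_surj _)).
  by split=> //; exists 1; rewrite /natural_act mul1mx scale1r.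
- apply: (not_spherical redH HG HnG H_A2 _ (@coord2_poly _) (@coord2_hom _) (@coord2_surj _)).
  by split=> //; exists 1; rewrite /adjoint_act mul1mx invmx1 mulmx1 scale1r.
Qed.
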